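(* Let $(Q,\lambda,J)$ be a contact triad, let $M=Q\times\mathbb{R}$ be equipped with the almost complex structure $\widetilde J$, and let $\dot\Sigma=\bigsqcup_{i=1}^k\dot\Sigma_i$ be a punctured Riemann surface with connected components $\dot\Sigma_1,\dots,\dot\Sigma_k$. Let $\vec\gamma^-,\vec\gamma^+$ be given collections of asymptotic closed Reeb orbits at the negative and positive punctures. Let $1\le \ell\le k$ be the number of connected components which are not cylindrical (i.e. on which the curve is not a trivial cylinder). Then the forgetful map $$\mathfrak{forget}:\ \mathcal{M}(\dot\Sigma,M,\widetilde J;\vec\gamma^-,\vec\gamma^+)\to \mathcal{M}^{\mathrm{exact}}(\dot\Sigma,Q,J;\vec\gamma^-,\vec\gamma^+),\qquad [(w,f)]\mapsto[w],$$ is a principal $\mathbb{R}^{\ell-1}$-fibration.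
   Context: Contact triad: $(Q,\xi)$ is a contact manifold, $\lambda$ a contact form with $\ker\lambda=\xi$ and Reeb vector field $R_\lambda$ ($\lambda(R_\lambda)=1$, $R_\lambda\rfloor d\lambda=0$), $\pi:TQ\to\xi$ the projection along $R_\lambda$, and $J:TQ\to TQ$ satisfies $J|_\xi^2=-\mathrm{id}$, $J(R_\lambda)=0$ and $d\lambda(Y,JY)>0$ for $0\neq Y\in\xi$. On $M=Q\times\mathbb{R}$ with $\mathbb{R}$-coordinate $s$, $\widetilde J$ is the $s$-translation invariant almost complex structure with $\widetilde J|_\xi=J|_\xi$ and $\widetilde J(\partial/\partial s)=R_\lambda$. Let $j$ be the complex structure of $\dot\Sigma$. A map $u=(w,f):\dot\Sigma\to Q\times\mathbb{R}$ is $\widetilde J$-holomorphic iff $\overline\partial^\pi w:=\frac12(\pi dw+J\,\pi dw\circ j)=0$ and $w^*\lambda\circ j=df$. A contact instanton is a map $w:\dot\Sigma\to Q$ with $\overline\partial^\pi w=0$ and $d(w^*\lambda\circ j)=0$; it is exact if $w^*\lambda\circ j=df$ for some function $f$, i.e. if $w$ arises from a $\widetilde J$-holomorphic curve $(w,f)$. Energy: with the triad metric $g=d\lambda(\cdot,J\cdot)+\lambda\otimes\lambda$, the energy is $E=E^\pi+E^\perp$, where $E^\pi(w)=\frac12\int_{\dot\Sigma}|\pi dw|^2$ and $E^\perp$ is Hofer's vertical energy built from $\sup_\varphi\int\varphi(f)\,df\circ j\wedge df$ over compactly supported $\varphi:\mathbb{R}\to\mathbb{R}_{\ge0}$ with $\int\varphi=1$.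 Moduli spaces: $\widetilde{\mathcal{M}}(\dot\Sigma,M,\widetilde J;\vec\gamma^-,\vec\gamma^+)$ is the set of finite energy $\widetilde J$-holomorphic curves $u=(u_1,\dots,u_k)$, $u_i=(w_i,f_i):\dot\Sigma_i\to Q\times\mathbb{R}$, with $w$ asymptotic at the positive (negative) punctures to the orbits $\vec\gamma^+$ ($\vec\gamma^-$). Two elements $(u_1,\dots,u_k)$ and $(u_1',\dots,u_k')$ are equivalent if there are $s_0\in\mathbb{R}$ (the same for all components) and a reparameterization $\varphi=(\varphi_1,\dots,\varphi_k)$ of $\dot\Sigma$ (automorphisms $\varphi_i$ of the punctured Riemann surfaces $\dot\Sigma_i$) with $(w_i',f_i')=(w_i\circ\varphi_i,f_i\circ\varphi_i-s_0)$ for all $i$; $\mathcal{M}(\dot\Sigma,M,\widetilde J;\vec\gamma^-,\vec\gamma^+)$ is the set of equivalence classes. $\widetilde{\mathcal{M}}^{\mathrm{exact}}(\dot\Sigma,Q,J;\vec\gamma^-,\vec\gamma^+)$ is the set of finite energy exact contact instantons $w=(w_1,\dots,w_k)$ with the same asymptotics, and $\mathcal{M}^{\mathrm{exact}}$ is its quotient by $\mathrm{Aut}(\dot\Sigma)$ acting by reparameterizations $\varphi=(\varphi_1,\dots,\varphi_k)$. A trivial cylinder is a component, biholomorphic to $\mathbb{R}\times S^1$ with coordinates $(\tau,t)$, of the form $(w,f)(\tau,t)=(\gamma(Tt),T\tau+c)$ for a closed Reeb orbit $\gamma$ of period $T$. The number $\ell$ is constant on the part of the moduli space under consideration. ''Principal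 $\mathbb{R}^{\ell-1}$-fibration'' means that $\mathbb{R}^{\ell-1}\cong\{(s_1,\dots,s_\ell)\in\mathbb{R}^\ell: s_1+\cdots+s_\ell=0\}$ acts freely and transitively on each fiber of the map, the action being by the componentwise translations $(w_i,f_i)\mapsto(w_i,f_i-s_i)$ of the non-cylindrical components. *)

(* Defs.v *)
From HB Require Import structures.
From mathcomp Require Import all_boot all_order all_algebra.
From mathcomp Require Import all_classical all_reals all_analysis.
Import Order.TTheory GRing.Theory Num.Theory numFieldNormedType.Exports.
Set Implicit Arguments.
Unset Strict Implicit.
Unset Printing Implicit Defensive.
Local Open Scope classical_set_scope.
Local Open Scope ring_scope.

(* U is meant to be open; values of f outside U are junk. *)
Fixpoint Ck_on (R : realType) (V W : normedModType R) (k : nat) (U : set V)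
    (f : V -> W) : Prop :=
  match k with
  | 0 => forall x, U x -> {for x, continuous f}
  | k'.+1 => (forall x, U x -> differentiable f x) /\
             (forall v : V, Ck_on k' U (fun x => 'D_v f x))
  end.

Definition smooth_on (R : realType) (V W : normedModType R) (U : set V)
    (f : V -> W) : Prop := forall k, Ck_on k U f.

(* A smooth manifold without boundary, modelled on V.  The atlas is indexed by
   the points, [chart p] being a chart around p (nothing forbids
   [chart p = chart q]).  Both [chart p] and its inverse [inv p] are total
   functions, meaningful on [dom p] and on [chart p @` dom p] only. *)
Record manifold (R : realType) (V : normedModType R) := Manifold {
  mcar :> topologicalType;
  mhausdorff : hausdorff_space mcar;
  msecond_countable : @second_countable mcar;
  dom : mcar -> set mcar;
  chart : mcar -> mcar -> V;
  inv : mcar -> V -> mcar;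
  dom_open : forall p, open (dom p);
  dom_self : forall p, dom p p;
  chart_img_open : forall p, open (chart p @` dom p);
  chartK : forall p x, dom p x -> inv p (chart p x) = x;
  chart_continuous : forall p x, dom p x -> {for x, continuous (chart p)};
  inv_continuous :
    forall p y, (chart p @` dom p) y -> {for y, continuous (inv p)};
  transition_smooth :
    forall p q, smooth_on (chart p @` (dom p `&` dom q)) (chart q \o inv p)
}.

Section Calculus.
Context {R : realType} {V : normedModType R}.

Definition img (M : manifold V) (p : M) : set V := chart p @` dom p.

(* The tangent space of M at x is identified with V by means of the chart
   [chart x]; accordingly a vector field is a function [M -> V] and a 1-form a
   function [M -> V -> R].
   [transition_der p q x] is the derivative at x of the change of coordinates
   from [chart p] to [chart q]. *)
Definition transition_der (M : manifold V) (p q x : M) (v : V) : V :=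
  'D_v (chart q \o inv p) (chart p x).

(* coefficients of a 1-form and of an endomorphism field in the chart
   [chart p], at the point with coordinates y *)
Definition form_in_chart (M : manifold V) (al : M -> V -> R) (p : M)
    (y v : V) : R :=
  let x := inv p y in al x (transition_der p x x v).

Definition endo_in_chart (M : manifold V) (J : M -> V -> V) (p : M)
    (y v : V) : V :=
  let x := inv p y in transition_der x p x (J x (transition_der p x x v)).

Definition smooth_form (M : manifold V) (al : M -> V -> R) : Prop :=
  forall (p : M) (v : V), smooth_on (img p) (fun y => form_in_chart al p y v).

Definition smooth_endo (M : manifold V) (J : M -> V -> V) : Prop :=
  forall (p : M) (v : V), smooth_on (img p) (fun y => endo_in_chart J p y v).

(* exterior derivative, normalised by
   d al (X, Y) = X (al Y) - Y (al X) - al [X, Y] *)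
Definition ext_der (M : manifold V) (al : M -> V -> R) (x : M) (v1 v2 : V) : R :=
  'D_v1 (fun y => form_in_chart al x y v2) (chart x x)
  - 'D_v2 (fun y => form_in_chart al x y v1) (chart x x).

Definition smooth_into (W : normedModType R) (M : manifold V) (U : set W)
    (g : W -> M) : Prop :=
  (forall x, U x -> {for x, continuous g}) /\
  (forall q : M, smooth_on (U `&` g @^-1` dom q) (chart q \o g)).

Definition der_into (W : normedModType R) (M : manifold V) (g : W -> M)
    (x v : W) : V := 'D_v (chart (g x) \o g) x.

Definition smooth_fun_on (W : normedModType R) (M : manifold V) (U : set M)
    (f : M -> W) : Prop :=
  forall p : M, smooth_on (img p `&` inv p @^-1` U) (f \o inv p).

Definition der_fun (W : normedModType R) (M : manifold V) (f : M -> W) (x : M)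
    (v : V) : W := 'D_v (f \o inv x) (chart x x).

End Calculus.

Definition smooth_map_on (R : realType) (V W : normedModType R)
    (M : manifold V) (N : manifold W) (U : set M) (w : M -> N) : Prop :=
  forall p : M, smooth_into (img p `&` inv p @^-1` U) (w \o inv p).

(* the tangent map T_xM -> T_(w x)N *)
Definition der_map (R : realType) (V W : normedModType R) (M : manifold V)
    (N : manifold W) (w : M -> N) (x : M) (v : V) : W :=
  der_into (w \o inv x) (chart x x) v.

Record contact_triad (R : realType) (n : nat)
    (Q : manifold 'rV[R]_(n.*2.+1)) := ContactTriad {
  lam : Q -> {linear 'rV[R]_(n.*2.+1) -> R^o};
  reeb : Q -> 'rV[R]_(n.*2.+1);
  cJ : Q -> {linear 'rV[R]_(n.*2.+1) -> 'rV[R]_(n.*2.+1)};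
  lam_smooth : smooth_form (fun x v => lam x v);
  lam_contact : forall x v, lam x v = 0 -> v != 0 ->
    exists2 v', lam x v' = 0 & ext_der (fun x v => lam x v) x v v' != 0;
  reeb_lam : forall x, lam x (reeb x) = 1;
  reeb_ext : forall x v, ext_der (fun x v => lam x v) x (reeb x) v = 0;
  cJ_smooth : smooth_endo (fun x v => cJ x v);
  cJ_xi : forall x v, lam x v = 0 -> lam x (cJ x v) = 0;
  cJJ : forall x v, lam x v = 0 -> cJ x (cJ x v) = - v;
  cJ_reeb : forall x, cJ x (reeb x) = 0;
  cJ_pos : forall x v, lam x v = 0 -> v != 0 ->
    0 < ext_der (fun x v => lam x v) x v (cJ x v)
}.

Section Triad.
Context {R : realType} {n : nat} {Q : manifold 'rV[R]_(n.*2.+1)}.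
Variable ct : contact_triad Q.
Implicit Types (x : Q) (v : 'rV[R]_(n.*2.+1)).

Definition dlam x v1 v2 : R := ext_der (fun x v => lam ct x v) x v1 v2.

Definition pi_xi x v : 'rV[R]_(n.*2.+1) := v - lam ct x v *: reeb ct x.

Definition triad_metric x v1 v2 : R :=
  dlam x v1 (cJ ct x v2) + lam ct x v1 * lam ct x v2.

(* On T_xQ x R, the pair (v, b) standing for v + b d/ds: J~ is J on xi, sends
   d/ds to the Reeb vector, hence sends the Reeb vector to - d/ds. *)
Definition Jtilde x (vb : 'rV[R]_(n.*2.+1) * R) : 'rV[R]_(n.*2.+1) * R :=
  (cJ ct x (pi_xi x vb.1) + vb.2 *: reeb ct x, - lam ct x vb.1).

Record closed_reeb_orbit := ClosedReebOrbit {
  orbit :> R -> Q;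
  period : R;
  period_gt0 : 0 < period;
  orbit_periodic : forall t, orbit (t + period) = orbit t;
  orbit_continuous : continuous orbit;
  orbit_reeb : forall t : R,
    is_derive t 1 (chart (orbit t) \o orbit) (reeb ct (orbit t))
}.

End Triad.

(* The complex structure of the plane: j d/dx = d/dy, j d/dy = - d/dx. *)
Definition rot (R : realType) (v : R * R) : R * R := (- v.2, v.1).

(* Transition maps of the atlas satisfy the Cauchy-Riemann equations, so that
   the complex structure j is [rot] in every chart. *)
Record riemann_surface (R : realType) := RiemannSurface {
  rs_manifold :> manifold (R * R)%type;
  transition_holomorphic : forall (p q : rs_manifold) y v,
    (chart p @` (dom p `&` dom q)) y ->
    'D_(rot v) (chart q \o inv p) y = rot ('D_v (chart q \o inv p) y)
}.

(* A closed connected Riemann surface together with finitely many distinct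
   punctures, npos positive ones and nneg negative ones. *)
Record punctured_surface (R : realType) := PuncturedSurface {
  ps_surface :> riemann_surface R;
  ps_compact : compact [set: ps_surface];
  ps_connected : connected [set: ps_surface];
  ps_nonempty : [set: ps_surface] !=set0;
  npos : nat;
  nneg : nat;
  puncture : 'I_npos + 'I_nneg -> ps_surface;
  puncture_inj : injective puncture
}.

(* The punctured surface itself.  A map on it is represented by a function on
   the closed surface whose values at the punctures are never used. *)
Definition dotted (R : realType) (S : punctured_surface R) : set S :=
  ~` range (@puncture R S).

Section Surface.
Context {R : realType} (S : punctured_surface R).

(* Cylindrical coordinates (tau, t) at a point p, z being the holomorphic chart
   at p: z - z(p) = exp (- 2 pi (tau + i t)) for tau near +oo, resp.
   z - z(p) = exp (2 pi (tau + i t)) for tau near -oo. *)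
Definition pos_end (p : S) (x : R * R) : S :=
  inv p (chart p p + expR (- (2 * pi * x.1)) *:
           ((cos (2 * pi * x.2), - sin (2 * pi * x.2)) : R * R)).

Definition neg_end (p : S) (x : R * R) : S :=
  inv p (chart p p + expR (2 * pi * x.1) *:
           ((cos (2 * pi * x.2), sin (2 * pi * x.2)) : R * R)).

Definition holomorphic_self_map (phi : S -> S) : Prop :=
  [/\ continuous phi,
      forall a, phi (puncture a) = puncture a,
      smooth_map_on (@dotted R S) phi &
      forall z v, dotted z -> der_map phi z (rot v) = rot (der_map phi z v)].

(* The punctures are labelled by orbits, so each of them is fixed. *)
Definition automorphism (phi : S -> S) : Prop :=
  exists phi' : S -> S,
    [/\ cancel phi phi', cancel phi' phi, holomorphic_self_map phi &
        holomorphic_self_map phi'].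

(* psi induces a biholomorphism from R x S^1, where S^1 = R / Z, onto the
   punctured surface; Phi is the inverse diffeomorphism, S^1 being embedded in
   the plane. *)
Definition cylinder_coordinates (psi : R * R -> S) : Prop :=
  [/\ smooth_into setT psi,
      forall x v, der_into psi x (rot v) = rot (der_into psi x v),
      forall tau t, psi (tau, t + 1) = psi (tau, t),
      range psi = @dotted R S &
      exists2 Phi : S -> R * (R * R),
        smooth_fun_on (@dotted R S) Phi &
        forall tau t,
          Phi (psi (tau, t)) = (tau, (cos (2 * pi * t), sin (2 * pi * t)))].

(* Integral over the punctured surface of a nonnegative 2-form whose
   coefficient in the chart [chart p] is [rho p]: the supremum over the finite
   families of disjoint measurable pieces contained in chart domains. *)
Definition surface_integral (rho : S -> R * R -> R) : \bar R :=
  ereal_sup [set I | exists (m : nat) (p : 'I_m -> S) (K : 'I_m -> set (R * R)),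
    [/\ forall i, measurable (K i),
        forall i, K i `<=` img (p i) `&` inv (p i) @^-1` @dotted R S,
        trivIset setT (fun i => inv (p i) @` K i) &
        I = (\sum_(i < m)
          \int[product_measure1 lebesgue_measure lebesgue_measure]_(y in K i)
             (rho (p i) y)%:E)%E]].

End Surface.

Section Curves.
Context {R : realType} {n : nat} {Q : manifold 'rV[R]_(n.*2.+1)}.
Variables (ct : contact_triad Q) (S : punctured_surface R).
Implicit Types (w : S -> Q) (f : S -> R) (z : S) (v : R * R).

Definition Jholomorphic w f : Prop := forall z v, dotted z ->
  (der_map w z (rot v), der_fun f z (rot v)) =
  Jtilde ct (w z) (der_map w z v, der_fun f z v).

Definition dbar_pi w z v : 'rV[R]_(n.*2.+1) :=
  2^-1 *: (pi_xi ct (w z) (der_map w z v) +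
           cJ ct (w z) (pi_xi ct (w z) (der_map w z (rot v)))).

(* the 1-form w^* lambda o j *)
Definition lam_j w z v : R := lam ct (w z) (der_map w z (rot v)).

Definition contact_instanton w : Prop :=
  (forall z v, dotted z -> dbar_pi w z v = 0) /\
  (forall z v1 v2, dotted z -> ext_der (lam_j w) z v1 v2 = 0).

Definition primitive w f : Prop :=
  smooth_fun_on (@dotted R S) f /\
  (forall z v, dotted z -> lam_j w z v = der_fun f z v).

(* |pi dw|^2 dA in the chart [chart p]: for every metric in the conformal class,
   this is the sum of |pi dw e|^2 over the standard basis e of the chart, times
   dx dy. *)
Definition E_pi_density w (p : S) (y : R * R) : R :=
  let x := w (inv p y) in
  let pidw (e : R * R) := pi_xi ct x (der_into (w \o inv p) y e) in
  triad_metric ct x (pidw (1, 0)) (pidw (1, 0)) +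
  triad_metric ct x (pidw (0, 1)) (pidw (0, 1)).

Definition E_pi w : \bar R :=
  ((2^-1)%:E * surface_integral (E_pi_density w))%E.

Definition test_function (phi : R -> R) : Prop :=
  [/\ continuous phi, forall s, 0 <= phi s,
      exists A : R, forall s, A < `|s| -> phi s = 0 &
      (\int[lebesgue_measure]_s (phi s)%:E = 1)%E].

(* (df o j) /\ df, evaluated on (d/dx, d/dy) in the chart [chart p] *)
Definition dfj_wedge_df f (p : S) (y : R * R) : R :=
  let df (e : R * R) : R := 'D_e (f \o inv p) y in
  df (rot (1, 0)) * df (0, 1) - df (rot (0, 1)) * df (1, 0).

Definition E_perp f : \bar R :=
  ereal_sup [set surface_integral
                   (fun (p : S) y => phi (f (inv p y)) * dfj_wedge_df f p y)
            | phi in test_function].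

Definition energy w f : \bar R := (E_pi w + E_perp f)%E.

(* The limits are locally uniform in t, hence uniform; since the orbits are
   unparameterized, they are attained up to a phase t0. *)
Definition asymptotic (gm : 'I_(nneg S) -> closed_reeb_orbit ct)
    (gp : 'I_(npos S) -> closed_reeb_orbit ct) w : Prop :=
  (forall a, exists t0 : R, forall t : R,
     w (pos_end (puncture (inl a)) x) @[x --> filter_prod +oo (nbhs t)]
       --> gp a (period (gp a) * (t + t0))) /\
  (forall a, exists t0 : R, forall t : R,
     w (neg_end (puncture (inr a)) x) @[x --> filter_prod -oo (nbhs t)]
       --> gm a (period (gm a) * (t + t0))).

Definition trivial_cylinder w f : Prop :=
  exists (psi : R * R -> S) (g : closed_reeb_orbit ct) (c : R),
    cylinder_coordinates psi /\
    forall tau t, w (psi (tau, t)) = g (period g * t) /\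
                  f (psi (tau, t)) = period g * tau + c.

End Curves.

Section Moduli.
Context {R : realType} {n : nat} {Q : manifold 'rV[R]_(n.*2.+1)}.
Variables (ct : contact_triad Q) (k : nat) (S : 'I_k -> punctured_surface R).
Variable gm : forall i, 'I_(nneg (S i)) -> closed_reeb_orbit ct.
Variable gp : forall i, 'I_(npos (S i)) -> closed_reeb_orbit ct.
Variable l : nat.

Definition qmaps := forall i, S i -> Q.
Definition curves := (qmaps * (forall i, S i -> R))%type.

Definition noncyl (u : curves) : seq 'I_k :=
  [seq i <- enum 'I_k | ~~ `[< trivial_cylinder ct (u.1 i) (u.2 i) >]].

Definition noncylQ (w : qmaps) : seq 'I_k :=
  [seq i <- enum 'I_k | ~~ `[< exists f, trivial_cylinder ct (w i) f >]].

Definition Mtilde : set curves := [set u |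
  [/\ forall i, smooth_map_on (@dotted R (S i)) (u.1 i) /\
                smooth_fun_on (@dotted R (S i)) (u.2 i),
      forall i, Jholomorphic ct (u.1 i) (u.2 i),
      (\sum_(i < k) energy ct (u.1 i) (u.2 i) < +oo)%E,
      forall i, asymptotic (@gm i) (@gp i) (u.1 i) &
      size (noncyl u) = l]].

(* The energy does not depend on the choice of the primitives. *)
Definition Mtilde_exact : set qmaps := [set w |
  [/\ forall i, smooth_map_on (@dotted R (S i)) (w i),
      forall i, contact_instanton ct (w i),
      exists f : forall i, S i -> R,
        (forall i, primitive ct (w i) (f i)) /\
        (\sum_(i < k) energy ct (w i) (f i) < +oo)%E,
      forall i, asymptotic (@gm i) (@gp i) (w i) &
      size (noncylQ w) = l]].

Definition equivalent (u u' : curves) : Prop :=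
  exists (s0 : R) (phi : forall i, S i -> S i),
    (forall i, automorphism (phi i)) /\
    (forall i (z : S i), dotted z ->
       u'.1 i z = u.1 i (phi i z) /\ u'.2 i z = u.2 i (phi i z) - s0).

Definition equivalentQ (w w' : qmaps) : Prop :=
  exists phi : forall i, S i -> S i,
    (forall i, automorphism (phi i)) /\
    (forall i (z : S i), dotted z -> w' i z = w i (phi i z)).

Definition class_of (u : curves) : set curves :=
  [set u' | Mtilde u' /\ equivalent u u'].

Definition class_ofQ (w : qmaps) : set qmaps :=
  [set w' | Mtilde_exact w' /\ equivalentQ w w'].

Definition Moduli : set (set curves) := [set class_of u | u in Mtilde].

Definition Moduli_exact : set (set qmaps) :=
  [set class_ofQ w | w in Mtilde_exact].

(* [forget [u]] = [w] for u = (w, f) *)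
Definition forget (C : set curves) : set qmaps :=
  \bigcup_(u in C) class_ofQ u.1.

(* The r-th non-cylindrical component is translated by s_r; on a cylindrical
   component the index is out of range, and nth returns 0. *)
Definition translate (s : 'rV[R]_l) (u : curves) : curves :=
  (u.1, fun i z => u.2 i z - nth 0 [seq s 0 j | j <- enum 'I_l]
                                   (index i (noncyl u))).

Definition translate_class (s : 'rV[R]_l) (C : set curves) : set curves :=
  \bigcup_(u in C) class_of (translate s u).

Definition sum_zero : set 'rV[R]_l := [set s | \sum_(j < l) s 0 j = 0].

End Moduli.

(* The subgroup G of A acts on E, and p : E -> B is onto and invariant, with G
   acting freely and transitively on each fiber. *)
Definition principal_fibration (A : zmodType) (G : set A) (X Y : Type)
    (act : A -> X -> X) (E : set X) (B : set Y) (p : X -> Y) : Prop :=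
  [/\ p @` E = B,
      (forall s x, G s -> E x -> E (act s x) /\ p (act s x) = p x),
      (forall x, E x -> act 0 x = x) /\
      (forall s t x, G s -> G t -> E x -> act (s + t) x = act s (act t x)),
      (forall s x, G s -> E x -> act s x = x -> s = 0) &
      (forall x x', E x -> E x' -> p x = p x' -> exists2 s, G s & x' = act s x)].

Arguments qmaps {R n} Q {k} S.
Arguments curves {R n} Q {k} S.

(* Main.v *)
Require Import Defs.
From HB Require Import structures.
From mathcomp Require Import all_boot all_order all_algebra.
From mathcomp Require Import all_classical all_reals all_analysis.
From mathcomp Require Import ring lra.
Import Order.TTheory GRing.Theory Num.Theory numFieldNormedType.Exports.

(* A primitive of w^* lambda o j is unique up to a constant on each component, so two
   curves over the same class of w differ by an automorphism and by constants c_i.  On a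
   cylindrical component any constant is produced by a translation of the cylinder, an
   automorphism; on the others the c_i are a common s0 plus a vector of sum zero.

   Freeness reduces to one fact: if w o phi = w and f o phi = f + c with c <> 0 for an
   automorphism phi, then (w, f) is a trivial cylinder.  Let c > 0.  As f tends to
   infinity along the orbits of phi, these cluster only at punctures, so every value of w
   lies on one of the finitely many asymptotic Reeb orbits, and therefore pi dw = 0.  Then
   d (w^* lambda) = 0, f is harmonic, and near a puncture w = gamma (h) for a harmonic
   conjugate h of f.  The asymptotics of w and the interior gradient estimate give
   d (f + i h) -> T, so that (f + i h) / T is a holomorphic coordinate E in which phi is a
   translation by some (c / T, k).  The formula phi^(-m) (E (x + m (c / T, k))) extends it
   to all of R x S^1, and its image is a basin of attraction of phi; the basins are open
   and disjoint, so there is a single one, the whole surface. *)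

Set Implicit Arguments.
Unset Strict Implicit.
Unset Printing Implicit Defensive.
Local Open Scope classical_set_scope.
Local Open Scope ring_scope.
Local Notation inv := Defs.inv.
Local Notation rot := Defs.rot.

(** * Functions of class C^k *)

(** Freeness is the obstacle. About an automorphism nothing is known beyond its being a
    biholomorphism that fixes the punctures, and at a puncture [w] is only assumed to converge
    uniformly in t, with no rate and no control of derivatives. Two facts make up for this. The
    periods of a Reeb orbit form a discrete group, so closeness of [w] to an orbit becomes closeness
    of h - T t to a single constant. And h - T t is harmonic, so its small oscillation on a square
    of fixed size bounds its gradient. Ends are parametrized by half-planes rather than punctured
    discs: half-planes are convex, so harmonic conjugates and ODE uniqueness along segments are
    available, and periodicity in t is carried along as an extra equation. Positive and negative
    punctures are treated alike, so T may a priori have either sign; the growth of f along an orbit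
    of phi is what forces T > 0. In the transitive part s0 is the mean of the constants over the l
    non-cylindrical components, which is where l >= 1 is needed. *)

Section FiniteDim.
Context {R : realType}.

(** In the chain rule the direction ['D_v f x] moves with the point, whereas [Ck_on] differentiates
    along fixed directions only. Expanding the moving direction over a finite family with continuous
    coordinates reduces one to the other. *)
Class fdim (V : normedModType R) : Prop := fdimP :
  exists m (e : 'I_m -> V) (c : 'I_m -> {linear V -> R^o}),
    (forall i, continuous (c i)) /\ forall v, v = \sum_i c i v *: e i.

Global Instance fdim_R : fdim R.
Proof.
exists 1%N, (fun _ => 1), (fun _ => idfun : {linear R^o -> R^o}).
split=> [_ x|v]; first exact: cvg_id.
by rewrite big_ord1 /= [_ *: _]mulr1.
Qed.

Global Instance fdim_rV n : fdim 'rV[R]_n.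
Proof.
pose c (j : 'I_n) (v : 'rV[R]_n) : R^o := v 0 j.
have clin j : linear (c j) by move=> a x y; rewrite /c !mxE.
pose cL j : {linear 'rV[R]_n -> R^o} :=
  HB.pack (c j) (GRing.isLinear.Build R 'rV[R]_n R^o _ (c j) (clin j)).
exists n, (fun i => delta_mx 0 i), cL; split=> [i x|v].
  exact: coord_continuous.
by rewrite {1}[v]row_sum_delta.
Qed.

Global Instance fdim_prod (V W : normedModType R) :
  fdim V -> fdim W -> fdim (V * W)%type.
Proof.
move=> [m [e [c [cc ce]]]] [n [e' [c' [cc' ce']]]].
pose e2 (i : 'I_(m + n)) : V * W :=
  match fintype.split i with inl j => (e j, 0) | inr j => (0, e' j) end.
pose c2 (i : 'I_(m + n)) (v : V * W) : R^o :=
  match fintype.split i with inl j => c j v.1 | inr j => c' j v.2 end.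
have clin i : linear (c2 i).
  by move=> a x y; rewrite /c2; case: (fintype.split i) => j /=; rewrite linearP.
pose cL i : {linear (V * W)%type -> R^o} :=
  HB.pack (c2 i) (GRing.isLinear.Build R (V * W)%type R^o _ (c2 i) (clin i)).
exists (m + n)%N, e2, cL; split=> [i x|v].
  rewrite /= /c2; case: (fintype.split i) => j.
    by apply: (continuous_comp (f := fst)); [exact: cvg_fst|exact: cc].
  by apply: (continuous_comp (f := snd)); [exact: cvg_snd|exact: cc'].
rewrite big_split_ord /= /c2 /e2.
under eq_bigr => i _ do rewrite (unsplitK (inl i)).
under [X in _ + X]eq_bigr => i _ do rewrite (unsplitK (inr i)).
have sum1 p (F : 'I_p -> V * W) : (\sum_i F i).1 = \sum_i (F i).1.
  exact: (big_morph (fun x : V * W => x.1)).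
have sum2 p (F : 'I_p -> V * W) : (\sum_i F i).2 = \sum_i (F i).2.
  exact: (big_morph (fun x : V * W => x.2)).
apply/eqP; rewrite -pair_eqE /= !sum1 !sum2 /=; apply/andP; split; apply/eqP.
  by rewrite [X in _ + X]big1 ?addr0 -?ce // => i _; rewrite scaler0.
by rewrite [X in X + _]big1 ?add0r -?ce' // => i _; rewrite scaler0.
Qed.

End FiniteDim.

Section CkCalculus.
Context {R : realType}.
Implicit Types V W Z : normedModType R.

Lemma differentiable_eps V W (f : V -> W) (L : {linear V -> W}) x :
  continuous L ->
  (forall e : R, 0 < e -> \forall h \near 0, `|f (x + h) - f x - L h| <= e * `|h|) ->
  differentiable f x /\ forall v, 'D_v f x = L v.
Proof.
move=> cL fL.
have fE : f \o shift x = cst (f x) + L +o_0 id.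
  apply/eqaddoP => e e0; near=> h => /=.
  rewrite !fctE /= opprD addrA [h + x]addrC.
  by near: h; exact: fL.
have dL := diff_unique cL fE.
have df : differentiable f x by apply/diff_locallyP; rewrite dL.
by split=> [|v]; [exact: df|rewrite (deriveE _ df) dL].
Unshelve. all: by end_near. Qed.

Lemma differentiable_epsE V W (f : V -> W) x : differentiable f x ->
  forall e : R, 0 < e ->
    \forall h \near 0, `|f (x + h) - f x - 'd f x h| <= e * `|h|.
Proof.
move=> /diff_locally /eqaddoP fE e e0; near=> h.
have : `|(f \o shift x - (cst (f x) + 'd f x)) h| <= e * `|h|.
  by near: h; exact: fE.
by rewrite !fctE /= opprD addrA [h + x]addrC.
Unshelve. all: by end_near. Qed.

Lemma near_addr0 V (P : set V) x :
  (\near x, P x) -> \forall h \near 0, P (x + h).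
Proof.
move=> nP; have : (fun h : V => x + h) @ 0 --> x.
  rewrite -[X in _ --> X](addr0 x).
  by apply: cvgD; [exact: cvg_cst|exact: cvg_id].
by apply.
Qed.

Lemma near_eq_differentiable V W (f g : V -> W) x :
  (\near x, f x = g x) -> differentiable f x -> differentiable g x.
Proof.
move=> fg df.
suff : differentiable g x /\ forall v, 'D_v g x = 'd f x v by case.
apply: differentiable_eps; first exact: diff_continuous.
have fg0 := near_addr0 fg.
move=> e e0; near=> h.
have <- : f x = g x by exact: nbhs_singleton fg.
have <- : f (x + h) = g (x + h).
  by near: h.
by near: h; exact: differentiable_epsE.
Unshelve. all: by end_near. Qed.

Lemma derive_eq_on V W (f g : V -> W) (U : set V) x v : open U -> U x ->
  (forall y, U y -> f y = g y) -> 'D_v f x = 'D_v g x.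
Proof.
move=> oU Ux fg; apply: near_eq_derive; near=> y; apply: fg.
by near: y; exact: open_nbhs_nbhs.
Unshelve. all: by end_near. Qed.

Lemma continuous_eq_on V (T : topologicalType) (f g : V -> T) (U : set V) x :
  open U -> U x -> (forall y, U y -> f y = g y) ->
  {for x, continuous f} -> {for x, continuous g}.
Proof.
move=> oU Ux fg cf; rewrite /prop_for /continuous_at -fg //.
apply: cvg_trans cf; apply: near_eq_cvg.
by near=> y; apply: fg; near: y; exact: open_nbhs_nbhs.
Unshelve. all: by end_near. Qed.

Lemma differentiable_eq_on V W (f g : V -> W) (U : set V) x : open U -> U x ->
  (forall y, U y -> f y = g y) -> differentiable f x -> differentiable g x.
Proof.
move=> oU Ux fg; apply: near_eq_differentiable; near=> y; apply: fg.
by near: y; exact: open_nbhs_nbhs.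
Unshelve. all: by end_near. Qed.

Lemma derive_comp V W Z (f : V -> W) (g : W -> Z) x v :
  differentiable f x -> differentiable g (f x) ->
  'D_v (g \o f) x = 'D_('D_v f x) g (f x).
Proof.
move=> df dg; rewrite (deriveE _ (differentiable_comp df dg)) (diff_comp df dg).
by rewrite (deriveE _ df) (deriveE _ dg).
Qed.

Lemma Ck_on_sub V W k (U U' : set V) (f : V -> W) :
  U' `<=` U -> Ck_on k U f -> Ck_on k U' f.
Proof.
move=> UU'; elim: k f => [|k IH] f /=; first by move=> H x /UU'; exact: H.
by case=> df H; split=> [x /UU'|v]; [exact: df|exact: IH].
Qed.

Lemma Ck_on_eq V W k (U : set V) (f g : V -> W) :
  open U -> (forall y, U y -> f y = g y) -> Ck_on k U f -> Ck_on k U g.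
Proof.
move=> oU; elim: k f g => [|k IH] f g fg /=.
  by move=> H x Ux; apply: (continuous_eq_on oU Ux fg); exact: H.
case=> df H; split=> [x Ux|v].
  by apply: (differentiable_eq_on oU Ux fg); exact: df.
by apply: IH (H v) => y Uy; exact: derive_eq_on Uy fg.
Qed.

Lemma Ck_on_pred V W k (U : set V) (f : V -> W) : Ck_on k.+1 U f -> Ck_on k U f.
Proof.
elim: k f => [|k IH] f /= [df H].
  by move=> x Ux; exact/differentiable_continuous/df.
by split=> // v; exact: IH.
Qed.

(** [Ck_on k U f] is a conjunction, over the points of [U], of statements about the total function
    [f] at that point; it is therefore enough that [N] contains [x]. *)
Lemma Ck_on_local V W k (U : set V) (f : V -> W) :
  (forall x, U x -> exists2 N : set V, N x & Ck_on k N f) -> Ck_on k U f.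
Proof.
elim: k f => [|k IH] f H /=.
  by move=> x /H[N Nx]; apply.
split=> [x /H[N Nx [df _]]|v]; first exact: df.
by apply: IH => x /H[N Nx [_ df]]; exists N; [|exact: df].
Qed.

Lemma Ck_on_cst V W k (U : set V) (a : W) : Ck_on k U (fun=> a).
Proof.
elim: k a => [|k IH] a /=; first by move=> x _; exact: cst_continuous.
split=> [x _|v]; first exact: differentiable_cst.
by rewrite (_ : 'D_v _ = fun=> 0) // funeqE => x; exact: derive_cst.
Qed.

Lemma Ck_on_lin V W k (U : set V) (L : {linear V -> W}) :
  continuous L -> Ck_on k U L.
Proof.
move=> cL; case: k => [|k] /=; first by move=> x _; exact: cL.
split=> [x _|v]; first exact: linear_differentiable.
rewrite (_ : 'D_v _ = fun=> L v); first exact: Ck_on_cst.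
rewrite funeqE => x; have dL := linear_differentiable x cL.
by rewrite (deriveE _ dL) diff_lin.
Qed.

Lemma Ck_on_id V k (U : set V) : Ck_on k U (@id V).
Proof. by apply: (@Ck_on_lin _ _ _ _ idfun) => x; exact: cvg_id. Qed.

Lemma Ck_onD V W k (U : set V) (f g : V -> W) :
  open U -> Ck_on k U f -> Ck_on k U g -> Ck_on k U (fun x => f x + g x).
Proof.
move=> oU; elim: k f g => [|k IH] f g /=.
  by move=> cf cg x Ux; apply: continuousD; [exact: cf|exact: cg].
case=> df Df [dg Dg]; split=> [x Ux|v].
  by apply: differentiableD; [exact: df|exact: dg].
apply: (Ck_on_eq oU _ (IH _ _ (Df v) (Dg v))) => y Uy.
by rewrite deriveD; [|exact/diff_derivable/df|exact/diff_derivable/dg].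
Qed.

Lemma Ck_on_sum V W k (U : set V) n (f : 'I_n -> V -> W) :
  open U -> (forall i, Ck_on k U (f i)) -> Ck_on k U (fun x => \sum_i f i x).
Proof.
move=> oU; elim: n f => [|n IH] f H.
  under eq_fun do rewrite big_ord0; exact: Ck_on_cst.
under eq_fun do rewrite big_ord_recl.
by apply: Ck_onD => //; exact: IH.
Qed.

Lemma Ck_on_lincomp V W Z k (U : set V) (f : V -> W) (L : {linear W -> Z}) :
  open U -> continuous L -> Ck_on k U f -> Ck_on k U (L \o f).
Proof.
move=> oU cL; elim: k f => [|k IH] f /=.
  by move=> cf x Ux; apply: continuous_comp; [exact: cf|exact: cL].
case=> df Df; split=> [x Ux|v].
  by apply: differentiable_comp; [exact: df|exact: linear_differentiable].
apply: (Ck_on_eq oU _ (IH _ (Df v))) => y Uy.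
have dL := linear_differentiable (f y) cL.
by rewrite (derive_comp _ (df _ Uy) dL) (deriveE _ dL) diff_lin.
Qed.

Lemma Ck_onN V W k (U : set V) (f : V -> W) :
  open U -> Ck_on k U f -> Ck_on k U (fun x => - f x).
Proof.
move=> oU; elim: k f => [|k IH] f /=.
  by move=> cf x Ux; apply: continuousN; exact: cf.
case=> df Df; split=> [x Ux|v]; first exact/differentiableN/df.
apply: (Ck_on_eq oU _ (IH _ (Df v))) => y Uy.
by rewrite deriveN; last exact/diff_derivable/df.
Qed.

Lemma Ck_onM V k (U : set V) (f g : V -> R) :
  open U -> Ck_on k U f -> Ck_on k U g -> Ck_on k U (fun x => f x * g x).
Proof.
move=> oU; elim: k f g => [|k IH] f g.
  by move=> cf cg x Ux; apply: continuousM; [exact: cf|exact: cg].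
move=> Hf Hg; have [df Df] := Hf; have [dg Dg] := Hg; split=> [x Ux|v].
  by apply: differentiableM; [exact: df|exact: dg].
apply: (@Ck_on_eq _ _ _ _ (fun x => f x * 'D_v g x + g x * 'D_v f x)) => //.
  move=> y Uy.
  by rewrite deriveM; [|exact/diff_derivable/df|exact/diff_derivable/dg].
by apply: Ck_onD => //; apply: IH; first [exact: Df|exact: Dg|exact: Ck_on_pred].
Qed.

Lemma Ck_onZl V W k (U : set V) (f : V -> R) (a : W) :
  open U -> Ck_on k U f -> Ck_on k U (fun x => f x *: a).
Proof.
move=> oU; elim: k f => [|k IH] f /=.
  by move=> cf x Ux; apply: cvgZr_tmp; exact: cf.
case=> df Df; split=> [x Ux|v].
  exact/differentiableZl/df.
apply: (Ck_on_eq oU _ (IH _ (Df v))) => y Uy.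
have dy := df _ Uy.
by rewrite (deriveE _ dy) (deriveE _ (differentiableZl a dy)) (diffZl a dy).
Qed.

Lemma Ck_on_coords V W k (U : set V) (f : V -> W) : fdim W -> open U ->
  (forall L : {linear W -> R^o}, continuous L -> Ck_on k U (L \o f : V -> R)) ->
  Ck_on k U f.
Proof.
move=> [n [e [c [cc ce]]]] oU H.
apply: (@Ck_on_eq _ _ _ _ (fun x => \sum_i c i (f x) *: e i)) => //.
apply: Ck_on_sum => // i; apply: Ck_onZl => //; exact: (H (c i)).
Qed.

Lemma derive_sum_coords V W n (e : 'I_n -> V) (c : 'I_n -> R) (g : V -> W) y v :
  v = \sum_i c i *: e i -> differentiable g y ->
  'D_v g y = \sum_i c i *: 'D_(e i) g y.
Proof.
move=> -> dg; rewrite (deriveE _ dg) linear_sum; apply: eq_bigr => i _.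
by rewrite linearZ (deriveE _ dg).
Qed.

(** Induction on [k] with [f] fixed and [h] varying: the derivative of the composite is a finite sum
    of products of a coordinate of ['D_v f] with ['D_(e i) h \o f]. Real values come first because
    the product rule [Ck_onM] is about scalars; [Ck_on_comp] follows coordinate by coordinate. *)
Lemma Ck_on_comp_real V W k (U : set V) (O : set W) (f : V -> W) (h : W -> R) :
  fdim W -> open U -> open O -> f @` U `<=` O ->
  Ck_on k U f -> Ck_on k O h -> Ck_on k U (h \o f).
Proof.
move=> fW oU oO fUO.
elim: k h => [|k IH] h Hf Hh.
  move=> x Ux; apply: continuous_comp; first exact: Hf.
  by apply: Hh; apply: fUO; exists x.
have [df Df] := Hf; have [dh Dh] := Hh.
have dhf y : U y -> differentiable h (f y).
  by move=> Uy; apply: dh; apply: fUO; exists y.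
split=> [x Ux|v].
  by apply: differentiable_comp; [exact: df|exact: dhf].
have [n [e [c [cc ce]]]] := fW.
pose F x := \sum_i c i ('D_v f x) * ('D_(e i) h \o f) x.
apply: (@Ck_on_eq _ _ _ _ F) => //.
  move=> y Uy; rewrite /F (derive_comp _ (df _ Uy) (dhf _ Uy)).
  by rewrite (derive_sum_coords (ce _) (dhf _ Uy)).
apply: Ck_on_sum => // i; apply: Ck_onM => //.
  by apply: (Ck_on_lincomp (L := c i)); [|exact: cc|exact: Df].
by apply: IH; [exact: Ck_on_pred|exact: Dh].
Qed.

Lemma Ck_on_comp V W Z k (U : set V) (O : set W) (f : V -> W) (g : W -> Z) :
  fdim W -> fdim Z -> open U -> open O -> f @` U `<=` O ->
  Ck_on k U f -> Ck_on k O g -> Ck_on k U (g \o f).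
Proof.
move=> fW fZ oU oO fUO Hf Hg.
apply: Ck_on_coords => // L cL; have {}Hg := Ck_on_lincomp oO cL Hg.
exact: (@Ck_on_comp_real _ _ _ _ O f (L \o g)).
Qed.

Lemma Ck_on_pair V W Z k (U : set V) (f : V -> W) (g : V -> Z) :
  open U -> Ck_on k U f -> Ck_on k U g -> Ck_on k U (fun x => (f x, g x)).
Proof.
move=> oU; elim: k f g => [|k IH] f g /=.
  by move=> cf cg x Ux; apply: cvg_pair; [exact: cf|exact: cg].
case=> df Df [dg Dg]; split=> [x Ux|v].
  by apply: differentiable_pair; [exact: df|exact: dg].
apply: (Ck_on_eq oU _ (IH _ _ (Df v) (Dg v))) => y Uy.
have dy := df _ Uy; have dy' := dg _ Uy.
rewrite (deriveE _ (differentiable_pair dy dy')) (diff_pair dy dy').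
by rewrite (deriveE _ dy) (deriveE _ dy').
Qed.

End CkCalculus.

(** * Smooth maps between manifolds *)

Lemma near_openP (T : topologicalType) (P : T -> Prop) (x : T) :
  (\near x, P x) -> exists2 N : set T, open_nbhs x N & forall y, N y -> P y.
Proof. by rewrite /prop_near1 nbhsE => -[N oN HN]; exists N. Qed.

Section SmoothAt.
Context {R : realType}.
Implicit Types V W Z : normedModType R.

(** The neighbourhood may shrink as the order grows; [smooth_onP] shows that on an open set this
    agrees with [smooth_on]. *)
Definition smooth_at V W (x : V) (f : V -> W) : Prop :=
  forall k, exists2 N : set V, open_nbhs x N & Ck_on k N f.

Lemma smooth_onP V W (U : set V) (f : V -> W) : open U ->
  smooth_on U f <-> forall x, U x -> smooth_at x f.
Proof.
move=> oU; split=> [H x Ux k|H k]; first by exists U.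
by apply: Ck_on_local => x /H/(_ k)[N [_ Nx] HN]; exists N.
Qed.

Lemma smooth_at_on V W (U : set V) (f : V -> W) x :
  open U -> U x -> smooth_on U f -> smooth_at x f.
Proof. by move=> oU Ux /(smooth_onP _ oU); apply. Qed.

Lemma smooth_at_eq V W (x : V) (f g : V -> W) :
  (\near x, f x = g x) -> smooth_at x f -> smooth_at x g.
Proof.
move=> fg H k; have [N [oN Nx] HN] := H k.
have [M [oM Mx] HM] := near_openP fg.
have oI : open (N `&` M) by exact: openI.
exists (N `&` M) => //; apply: (@Ck_on_eq _ _ _ _ _ f) => //.
  by move=> y [_ /HM].
exact: Ck_on_sub HN.
Qed.

Lemma smooth_at_eq_on V W (U : set V) (x : V) (f g : V -> W) : open U -> U x ->
  (forall y, U y -> f y = g y) -> smooth_at x f -> smooth_at x g.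
Proof.
move=> oU Ux fg; apply: smooth_at_eq; near=> y; apply: fg.
by near: y; exact: open_nbhs_nbhs.
Unshelve. all: by end_near. Qed.

Lemma smooth_at_near_diff V W (x : V) (f : V -> W) : smooth_at x f ->
  \near x, differentiable f x.
Proof.
move=> /(_ 1%N)[N oN [df _]]; near=> y; apply: df.
by near: y; exact: open_nbhs_nbhs.
Unshelve. all: by end_near. Qed.

Lemma smooth_at_diff V W (x : V) (f : V -> W) : smooth_at x f -> differentiable f x.
Proof. by move=> /smooth_at_near_diff/nbhs_singleton. Qed.

Lemma smooth_at_continuous V W (x : V) (f : V -> W) : smooth_at x f ->
  {for x, continuous f}.
Proof. by move=> /smooth_at_diff/differentiable_continuous. Qed.

Lemma smooth_at_derive V W (x : V) (f : V -> W) v : smooth_at x f ->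
  smooth_at x ('D_v f).
Proof. by move=> H k; have [N oN [_ Df]] := H k.+1; exists N; [|exact: Df]. Qed.

Lemma smooth_at_comp V W Z (x : V) (f : V -> W) (g : W -> Z) :
  fdim W -> fdim Z -> smooth_at x f -> smooth_at (f x) g -> smooth_at x (g \o f).
Proof.
move=> fW fZ Hf Hg k; have [N [oN Nx] HN] := Hf k; have [M [oM Mx] HM] := Hg k.
have nM : \near x, (N `&` f @^-1` M) x.
  near=> y; split; first by near: y; exact: open_nbhs_nbhs.
  near: y; apply: (smooth_at_continuous Hf); exact: open_nbhs_nbhs.
have [P oP PM] := near_openP nM.
exists P => //; apply: (@Ck_on_comp _ _ _ _ _ _ M) => //; first by case: oP.
  by move=> _ [y /PM[_ ?] <-].
by apply: Ck_on_sub HN => y /PM[].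
Unshelve. all: by end_near. Qed.

Lemma smooth_at_cst V W (x : V) (a : W) : smooth_at x (fun=> a).
Proof. by move=> k; exists setT; [split; [exact: openT|]|exact: Ck_on_cst]. Qed.

Lemma smooth_at_lin V W (x : V) (L : {linear V -> W}) : continuous L -> smooth_at x L.
Proof. by move=> cL k; exists setT; [split; [exact: openT|]|exact: Ck_on_lin]. Qed.

Lemma smooth_at_id V (x : V) : smooth_at x (@id V).
Proof. by move=> k; exists setT; [split; [exact: openT|]|exact: Ck_on_id]. Qed.

Lemma smooth_at_lincomp V W Z (x : V) (f : V -> W) (L : {linear W -> Z}) :
  continuous L -> smooth_at x f -> smooth_at x (L \o f).
Proof.
move=> cL H k; have [N [oN Nx] HN] := H k; exists N => //; exact: Ck_on_lincomp.
Qed.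

Lemma smooth_atD V W (x : V) (f g : V -> W) : smooth_at x f -> smooth_at x g ->
  smooth_at x (fun y => f y + g y).
Proof.
move=> Hf Hg k; have [N [oN Nx] HN] := Hf k; have [M [oM Mx] HM] := Hg k.
exists (N `&` M); first by split=> //; exact: openI.
by apply: Ck_onD; [exact: openI|exact: Ck_on_sub HN|exact: Ck_on_sub HM].
Qed.

Lemma smooth_atM V (x : V) (f g : V -> R) : smooth_at x f -> smooth_at x g ->
  smooth_at x (fun y => f y * g y).
Proof.
move=> Hf Hg k; have [N [oN Nx] HN] := Hf k; have [M [oM Mx] HM] := Hg k.
exists (N `&` M); first by split=> //; exact: openI.
by apply: Ck_onM; [exact: openI|exact: Ck_on_sub HN|exact: Ck_on_sub HM].
Qed.

Lemma smooth_atN V W (x : V) (f : V -> W) : smooth_at x f ->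
  smooth_at x (fun y => - f y).
Proof.
move=> Hf k; have [N [oN Nx] HN] := Hf k.
by exists N => //; exact: Ck_onN.
Qed.

Lemma smooth_atB V W (x : V) (f g : V -> W) : smooth_at x f -> smooth_at x g ->
  smooth_at x (fun y => f y - g y).
Proof. by move=> Hf Hg; apply: smooth_atD => //; exact: smooth_atN. Qed.

Lemma smooth_at_pair V W Z (x : V) (f : V -> W) (g : V -> Z) :
  smooth_at x f -> smooth_at x g -> smooth_at x (fun y => (f y, g y)).
Proof.
move=> Hf Hg k; have [N [oN Nx] HN] := Hf k; have [M [oM Mx] HM] := Hg k.
exists (N `&` M); first by split=> //; exact: openI.
by apply: Ck_on_pair; [exact: openI|exact: Ck_on_sub HN|exact: Ck_on_sub HM].
Qed.

Lemma smooth_at_sum V W n (x : V) (f : 'I_n -> V -> W) :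
  (forall i, smooth_at x (f i)) -> smooth_at x (fun y => \sum_i f i y).
Proof.
elim: n f => [|n IH] f H.
  under eq_fun do rewrite big_ord0; exact: smooth_at_cst.
under eq_fun do rewrite big_ord_recl.
by apply: smooth_atD => //; exact: IH.
Qed.

Lemma derive_linear_comp V W Z (L : {linear W -> Z}) (f : V -> W) x v :
  continuous L -> differentiable f x -> 'D_v (L \o f) x = L ('D_v f x).
Proof.
move=> cL df; have dL := linear_differentiable (f x) cL.
by rewrite (derive_comp _ df dL) (deriveE _ dL) diff_lin.
Qed.

Lemma derive_linear V W (L : {linear V -> W}) x v :
  continuous L -> 'D_v L x = L v.
Proof.
by move=> cL; rewrite (deriveE _ (linear_differentiable x cL)) diff_lin.
Qed.

Lemma derive_dir_linear V W (f : V -> W) x a u v : differentiable f x ->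
  'D_(a *: u + v) f x = a *: 'D_u f x + 'D_v f x.
Proof. by move=> df; rewrite !(deriveE _ df) linearP. Qed.

Lemma derive_dirN V W (f : V -> W) x v : differentiable f x ->
  'D_(- v) f x = - 'D_v f x.
Proof. by move=> df; rewrite !(deriveE _ df) linearN. Qed.

End SmoothAt.

Section ManifoldCalculus.
Context {R : realType}.
Implicit Types V W Z : normedModType R.

Lemma img_chart V (M : manifold V) (p x : M) : dom p x -> img p (chart p x).
Proof. by move=> ?; exists x. Qed.

Lemma inv_dom V (M : manifold V) (p : M) y : img p y -> dom p (inv p y).
Proof. by case=> x px <-; rewrite chartK. Qed.

Lemma chart_invK V (M : manifold V) (p : M) y : img p y -> chart p (inv p y) = y.
Proof. by case=> x px <-; rewrite chartK. Qed.

Lemma open_preimage_at (T U : topologicalType) (f : T -> U) (A : set T) (B : set U) :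
  open A -> open B -> (forall x, A x -> {for x, continuous f}) ->
  open (A `&` f @^-1` B).
Proof.
move=> oA oB cf; rewrite openE => x [Ax Bfx]; near=> y; split.
  by near: y; exact: open_nbhs_nbhs.
by near: y; apply: (cf _ Ax); exact: open_nbhs_nbhs.
Unshelve. all: by end_near. Qed.

Lemma open_img_inv V (M : manifold V) (p : M) (D : set M) : open D ->
  open (img p `&` inv p @^-1` D).
Proof.
by move=> oD; apply: open_preimage_at; [exact: chart_img_open| |exact: Defs.inv_continuous].
Qed.

Lemma overlapE V (M : manifold V) (p : M) (D : set M) :
  chart p @` (dom p `&` D) = img p `&` inv p @^-1` D.
Proof.
apply/seteqP; split=> [_ [x [px Dx] <-]|y [[x px <-]]] /=.
  by split; [exact: img_chart|rewrite /= chartK].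
by rewrite chartK // => Dx; exists x.
Qed.

Lemma transition_smooth_at V (M : manifold V) (p q : M) y :
  img p y -> dom q (inv p y) -> smooth_at y (chart q \o inv p).
Proof.
move=> py qy; apply: (smooth_at_on _ _ (transition_smooth p q)).
  by rewrite overlapE; apply: open_img_inv; exact: dom_open.
by rewrite overlapE.
Qed.

(** Pointwise forms of the smoothness predicates, testing only the charts centred at the point or at
    its image. The other charts are recovered by [chart_change_at], [sm_map_at] and [sm_fun_at]. *)
Definition sm_into W V (M : manifold V) (g : W -> M) (x : W) : Prop :=
  {for x, continuous g} /\ smooth_at x (chart (g x) \o g).

Definition sm_fun V W (M : manifold V) (f : M -> W) (z : M) : Prop :=
  smooth_at (chart z z) (f \o inv z).

Definition sm_map V W (M : manifold V) (N : manifold W) (w : M -> N) (z : M) : Prop :=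
  sm_into (w \o inv z) (chart z z).

Lemma near_dom W V (M : manifold V) (g : W -> M) (x : W) q :
  {for x, continuous g} -> dom q (g x) -> \forall y \near x, dom q (g y).
Proof.
move=> cg qx; apply: cg; apply: open_nbhs_nbhs; split=> //; exact: dom_open.
Qed.

Lemma chart_change_at W V (M : manifold V) (g : W -> M) (x : W) p q : fdim V ->
  {for x, continuous g} -> dom p (g x) -> dom q (g x) ->
  smooth_at x (chart p \o g) ->
  smooth_at x (chart q \o g) /\
  forall v, 'D_v (chart q \o g) x =
    'D_('D_v (chart p \o g) x) (chart q \o inv p) (chart p (g x)).
Proof.
move=> fV cg px qx Hp.
have Ht : smooth_at ((chart p \o g) x) (chart q \o inv p).
  by apply: transition_smooth_at; [exact: img_chart|rewrite /= chartK].
have nE : \near x, ((chart q \o inv p) \o (chart p \o g)) x = (chart q \o g) x.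
  near=> y => /=; rewrite chartK //; near: y; exact: near_dom.
split; first by apply: (smooth_at_eq nE); exact: smooth_at_comp.
move=> v; rewrite -(near_eq_derive _ nE) derive_comp //; exact: smooth_at_diff.
Unshelve. all: by end_near. Qed.

Lemma smooth_intoP W V (M : manifold V) (U : set W) (g : W -> M) :
  fdim V -> open U ->
  smooth_into U g <-> forall x, U x -> sm_into g x.
Proof.
move=> fV oU; split=> [[cg sg] x Ux|H].
  split; first exact: cg.
  apply: (smooth_at_on _ _ (sg (g x))).
    by apply: open_preimage_at; [| exact: dom_open|].
  by split=> //; exact: dom_self.
have cg x : U x -> {for x, continuous g} by move=> /H[].
split=> // q; apply/smooth_onP.
  by apply: open_preimage_at; [| exact: dom_open|].
move=> x [Ux qx]; have [_ sx] := H _ Ux.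
by apply: (chart_change_at _ (cg _ Ux) _ _ sx).1 => //; exact: dom_self.
Qed.

Lemma sm_into_eq W V (M : manifold V) (g h : W -> M) x :
  (\near x, g x = h x) -> sm_into g x -> sm_into h x.
Proof.
move=> gh [cg sg]; have ghx := nbhs_singleton gh; split.
  rewrite /prop_for /continuous_at -ghx; apply: cvg_trans cg.
  exact: near_eq_cvg.
rewrite -ghx; apply: smooth_at_eq sg; near=> y => /=; congr (chart _ _).
by near: y.
Unshelve. all: by end_near. Qed.

Lemma der_into_eq W V (M : manifold V) (g h : W -> M) x v :
  (\near x, g x = h x) -> der_into g x v = der_into h x v.
Proof.
move=> gh; rewrite /der_into (nbhs_singleton gh); apply: near_eq_derive.
by near=> y => /=; congr (chart _ _); near: y.
Unshelve. all: by end_near. Qed.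

Lemma sm_into_precomp Z W V (M : manifold V) (g : W -> M) (h : Z -> W) x :
  fdim W -> fdim V -> smooth_at x h -> sm_into g (h x) ->
  sm_into (g \o h) x /\
  forall v, der_into (g \o h) x v = der_into g (h x) ('D_v h x).
Proof.
move=> fW fV sh [cg sg]; split.
  split; last exact: (smooth_at_comp _ _ sh sg).
  by apply: continuous_comp; [exact: smooth_at_continuous|].
move=> v; rewrite /der_into -[chart _ \o (g \o h)]/((chart (g (h x)) \o g) \o h).
by rewrite derive_comp //; exact: smooth_at_diff.
Qed.

Lemma sm_map_at V W (M : manifold V) (N : manifold W) (w : M -> N) (p z : M) :
  fdim V -> fdim W -> dom p z -> sm_map w z -> sm_into (w \o inv p) (chart p z).
Proof.
move=> fV fW pz Hw.
have pc : img p (chart p z) by exact: img_chart.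
have st : smooth_at (chart p z) (chart z \o inv p).
  by apply: transition_smooth_at => //; rewrite chartK //; exact: dom_self.
have Hw' : sm_into (w \o inv z) ((chart z \o inv p) (chart p z)).
  by rewrite /= chartK.
have [H _] := sm_into_precomp fV fW st Hw'.
apply: sm_into_eq H; have cp : {for chart p z, continuous (inv p)} by exact: Defs.inv_continuous.
near=> y => /=; rewrite chartK //.
near: y; apply: cp; rewrite chartK //.
by apply: open_nbhs_nbhs; split; [exact: dom_open|exact: dom_self].
Unshelve. all: by end_near. Qed.

Lemma sm_map_continuous V W (M : manifold V) (N : manifold W) (w : M -> N) z :
  sm_map w z -> {for z, continuous w}.
Proof.
move=> [cw _]; have dz := dom_self z; apply: cvg_trans.
  apply: (@near_eq_cvg _ _ _ _ ((w \o inv z) \o chart z)); near=> y => /=.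
  by rewrite chartK //; near: y; apply: open_nbhs_nbhs; split=> //; exact: dom_open.
have : {for z, continuous ((w \o inv z) \o chart z)}.
  by apply: continuous_comp; [exact: chart_continuous|exact: cw].
by rewrite /prop_for /continuous_at /= chartK.
Unshelve. all: by end_near. Qed.

Lemma sm_fun_at V W (M : manifold V) (f : M -> W) (p z : M) :
  fdim V -> fdim W -> dom p z -> sm_fun f z -> smooth_at (chart p z) (f \o inv p).
Proof.
move=> fV fW pz Hf.
have pc : img p (chart p z) by exact: img_chart.
have st : smooth_at (chart p z) (chart z \o inv p).
  by apply: transition_smooth_at => //; rewrite chartK //; exact: dom_self.
have Hf' : smooth_at ((chart z \o inv p) (chart p z)) (f \o inv z).
  by rewrite /= chartK.
apply: smooth_at_eq (smooth_at_comp _ _ st Hf').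
have cp : {for chart p z, continuous (inv p)} by exact: Defs.inv_continuous.
near=> y => /=; rewrite chartK //.
near: y; apply: cp; rewrite chartK //.
by apply: open_nbhs_nbhs; split; [exact: dom_open|exact: dom_self].
Unshelve. all: by end_near. Qed.

Lemma sm_fun_continuous V W (M : manifold V) (f : M -> W) z :
  sm_fun f z -> {for z, continuous f}.
Proof.
move=> /smooth_at_continuous cw; have dz := dom_self z; apply: cvg_trans.
  apply: (@near_eq_cvg _ _ _ _ ((f \o inv z) \o chart z)); near=> y => /=.
  by rewrite chartK //; near: y; apply: open_nbhs_nbhs; split=> //; exact: dom_open.
have : {for z, continuous ((f \o inv z) \o chart z)}.
  by apply: continuous_comp; [exact: chart_continuous|exact: cw].
by rewrite /prop_for /continuous_at /= chartK.
Unshelve. all: by end_near. Qed.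

Lemma smooth_map_onP V W (M : manifold V) (N : manifold W) (D : set M) (w : M -> N) :
  fdim V -> fdim W -> open D ->
  smooth_map_on D w <-> forall z, D z -> sm_map w z.
Proof.
move=> fV fW oD; split=> [H z Dz|H p].
  have /smooth_intoP := H z; apply => //; first exact: open_img_inv.
  by split; [exact/img_chart/dom_self|rewrite /= chartK //; exact: dom_self].
apply/smooth_intoP => //; first exact: open_img_inv.
move=> y [py Dy]; rewrite -(chart_invK py); apply: sm_map_at => //; first exact: inv_dom.
exact: H.
Qed.

Lemma smooth_fun_onP V W (M : manifold V) (D : set M) (f : M -> W) :
  fdim V -> fdim W -> open D ->
  smooth_fun_on D f <-> forall z, D z -> sm_fun f z.
Proof.
move=> fV fW oD; split=> [H z Dz|H p].
  apply: (smooth_at_on _ _ (H z)); first exact: open_img_inv.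
  by split; [exact/img_chart/dom_self|rewrite /= chartK //; exact: dom_self].
apply/smooth_onP => //; first exact: open_img_inv.
move=> y [py Dy]; rewrite -(chart_invK py); apply: sm_fun_at => //; first exact: inv_dom.
exact: H.
Qed.

Lemma sm_into_comp Z V W (M : manifold V) (N : manifold W) (g : Z -> M) (w : M -> N) x :
  fdim V -> fdim W -> sm_into g x -> sm_map w (g x) ->
  sm_into (w \o g) x /\
  forall v, der_into (w \o g) x v = der_map w (g x) (der_into g x v).
Proof.
move=> fV fW [cg sg] Hw; have dg := dom_self (g x).
have nE : \forall y \near x, ((w \o inv (g x)) \o (chart (g x) \o g)) y = (w \o g) y.
  near=> y => /=; rewrite chartK //; near: y; exact: near_dom.
have [H1 H2] := sm_into_precomp (g := w \o inv (g x)) fV fW sg Hw.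
split; first exact: sm_into_eq nE H1.
by move=> v; rewrite -(der_into_eq _ nE) H2.
Unshelve. all: by end_near. Qed.

Lemma sm_fun_comp Z V W (M : manifold V) (g : Z -> M) (f : M -> W) x :
  fdim V -> fdim W -> sm_into g x -> sm_fun f (g x) ->
  smooth_at x (f \o g) /\
  forall v, 'D_v (f \o g) x = der_fun f (g x) (der_into g x v).
Proof.
move=> fV fW [cg sg] Hf; have dg := dom_self (g x).
have nE : \forall y \near x, ((f \o inv (g x)) \o (chart (g x) \o g)) y = (f \o g) y.
  near=> y => /=; rewrite chartK //; near: y; exact: near_dom.
split; first exact: smooth_at_eq nE (smooth_at_comp _ _ sg Hf).
move=> v; rewrite -(near_eq_derive _ nE) derive_comp //.
  exact: smooth_at_diff.
exact: smooth_at_diff.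
Unshelve. all: by end_near. Qed.

Lemma sm_map_comp V W Z (M : manifold V) (N : manifold W) (P : manifold Z)
    (g : M -> N) (w : N -> P) z :
  fdim W -> fdim Z -> sm_map g z -> sm_map w (g z) ->
  sm_map (w \o g) z /\
  forall v, der_map (w \o g) z v = der_map w (g z) (der_map g z v).
Proof.
move=> fW fZ Hg Hw; have dz := dom_self z.
have Hw' : sm_map w ((g \o inv z) (chart z z)) by rewrite /= chartK.
have [H1 H2] := sm_into_comp fW fZ Hg Hw'; split=> //.
by move=> v; rewrite /der_map H2 /= chartK.
Qed.

Lemma sm_fun_map V W Z (M : manifold V) (N : manifold W)
    (g : M -> N) (f : N -> Z) z :
  fdim W -> fdim Z -> sm_map g z -> sm_fun f (g z) ->
  sm_fun (f \o g) z /\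
  forall v, der_fun (f \o g) z v = der_fun f (g z) (der_map g z v).
Proof.
move=> fW fZ Hg Hw; have dz := dom_self z.
have Hw' : sm_fun f ((g \o inv z) (chart z z)) by rewrite /= chartK.
have [H1 H2] := sm_fun_comp fW fZ Hg Hw'; split=> //.
by move=> v; rewrite /der_fun H2 /= chartK.
Qed.

Lemma sm_inv V (M : manifold V) (p : M) y : fdim V -> img p y -> sm_into (inv p) y.
Proof.
move=> fV py; split; first exact: Defs.inv_continuous.
by apply: transition_smooth_at => //; exact: dom_self.
Qed.

Lemma sm_id V (M : manifold V) (z : M) : fdim V ->
  sm_map (@id M) z /\ forall v, der_map (@id M) z v = v.
Proof.
move=> fV; have pz := img_chart (dom_self z); split; first exact: sm_inv.
move=> v; rewrite /der_map /der_into /= chartK; last exact: dom_self.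
rewrite -[RHS](derive_id (chart z z) v); apply: derive_eq_on.
  exact: (chart_img_open z).
  exact: pz.
by move=> y zy /=; rewrite chart_invK.
Qed.

Lemma der_mapN V W (M : manifold V) (N : manifold W) (w : M -> N) z v :
  sm_map w z -> der_map w z (- v) = - der_map w z v.
Proof. by case=> _ /smooth_at_diff ?; exact: derive_dirN. Qed.

Lemma der_funN V W (M : manifold V) (f : M -> W) z v :
  sm_fun f z -> der_fun f z (- v) = - der_fun f z v.
Proof. by move=> /smooth_at_diff ?; exact: derive_dirN. Qed.

Lemma der_into_chart W V (M : manifold V) (g : W -> M) x q v : fdim V ->
  sm_into g x -> dom q (g x) ->
  'D_v (chart q \o g) x = transition_der (g x) q (g x) (der_into g x v).
Proof.
move=> fV [cg sg] qx; have dg := dom_self (g x).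
by have [_ ->] := chart_change_at fV cg dg qx sg.
Qed.

End ManifoldCalculus.

Lemma near_and (T : topologicalType) (P Q : T -> Prop) (x : T) :
  (\near x, P x) -> (\near x, Q x) -> \near x, P x /\ Q x.
Proof. exact: filterI. Qed.

(** * Mean value theorem and symmetry of second derivatives *)

Section MeanValue.
Context {R : realType}.
Implicit Types V W : normedModType R.

Lemma is_derive_line V W (f : V -> W) (x v : V) (s : R) :
  differentiable f (x + s *: v) ->
  is_derive s 1 (fun t : R => f (x + t *: v)) ('D_v f (x + s *: v)).
Proof.
move=> df; pose L (t : R) : V := x + t *: v.
have [d1 d2] := is_diff_scalel s v.
have dL : differentiable L s.
  by apply: differentiableD; [exact: differentiable_cst|exact: d1].
have DL : 'D_1 L s = v.
  rewrite deriveD; [|exact: derivable_cst|exact/diff_derivable/d1].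
  by rewrite derive_cst add0r (deriveE _ d1) d2 scale1r.
have dfL : differentiable (f \o L) s by exact: differentiable_comp.
have <- : 'D_1 (f \o L) s = 'D_v f (x + s *: v).
  by rewrite (derive_comp _ dL df) DL.
exact/derivableP/diff_derivable/dfL.
Qed.

Lemma derive_scale_dir V W (f : V -> W) x (h : R) v : differentiable f x ->
  'D_(h *: v) f x = h *: 'D_v f x.
Proof. by move=> df; rewrite !(deriveE _ df) linearZ. Qed.

Lemma mvt_dir V (f : V -> R) (x v : V) :
  (forall s : R, 0 <= s <= 1 -> differentiable f (x + s *: v)) ->
  exists2 s : R, 0 < s < 1 & f (x + v) - f x = 'D_v f (x + s *: v).
Proof.
move=> df; pose g (t : R) := f (x + t *: v).
have gd (s : R) : s \in `]0, 1[ -> is_derive s 1 g ('D_v f (x + s *: v)).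
  rewrite in_itv /= => /andP[s0 s1].
  by apply: is_derive_line; apply: df; rewrite !ltW.
have gc : {within `[0, 1], continuous g}.
  apply: derivable_within_continuous => s; rewrite in_itv /= => s01.
  by have [] := is_derive_line (df _ s01).
have [s] := MVT ltr01 gd gc.
rewrite in_itv /= /g scale1r scale0r addr0 subr0 mulr1 => s01 E.
by exists s.
Qed.

Lemma derive_translate V W (f : V -> W) (c x : V) : differentiable f (x + c) ->
  differentiable (fun y => f (y + c)) x /\
  forall v, 'D_v (fun y => f (y + c)) x = 'D_v f (x + c).
Proof.
move=> df.
have [d1 d2] := is_diff_id x; pose L (y : V) := y + c.
have dL : differentiable L x.
  by apply: differentiableD; [exact: d1|exact: differentiable_cst].
have DL v : 'D_v L x = v.
  rewrite deriveD; [|exact/diff_derivable/d1|exact: derivable_cst].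
  by rewrite derive_cst addr0 (deriveE _ d1) d2.
split; first exact: (differentiable_comp dL df).
by move=> v; rewrite -[fun y => _]/(f \o L) (derive_comp _ dL df) DL.
Qed.

(** Two applications of the mean value theorem: along [u] to the increment of [f] by [h *: v], then
    along [v] to ['D_u f]. The intermediate point is not controlled, so [P] has to contain the whole
    parallelogram. *)
Lemma second_difference V (f : V -> R) (P : set V) (x u v : V) (h : R) :
  (forall s t : R, 0 <= s <= 1 -> 0 <= t <= 1 -> P (x + s *: (h *: u) + t *: (h *: v))) ->
  (forall y, P y -> differentiable f y /\ differentiable ('D_u f) y) ->
  exists2 y, P y & f (x + h *: u + h *: v) - f (x + h *: u) - f (x + h *: v) + f x
    = h ^+ 2 * 'D_v ('D_u f) y.
Proof.
move=> HP dP; pose g y := f (y + h *: v) - f y.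
have P0 (s : R) : 0 <= s <= 1 -> P (x + s *: (h *: u)).
  by move=> s01; have := HP _ 0 s01; rewrite scale0r addr0 lexx ler01; apply.
have P1 (s : R) : 0 <= s <= 1 -> P (x + s *: (h *: u) + h *: v).
  by move=> s01; have := HP _ 1 s01; rewrite scale1r lexx ler01; apply.
have gd (s : R) : 0 <= s <= 1 -> differentiable g (x + s *: (h *: u)) /\
    'D_(h *: u) g (x + s *: (h *: u)) = h * ('D_u f (x + s *: (h *: u) + h *: v)
      - 'D_u f (x + s *: (h *: u))).
  move=> s01; have [d0 _] := dP _ (P0 _ s01); have [d1 _] := dP _ (P1 _ s01).
  have [d2 D2] := derive_translate d1.
  split; first exact: differentiableB.
  rewrite deriveB; [|exact: diff_derivable|exact: diff_derivable].
  by rewrite D2 !derive_scale_dir // mulrBr.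
have [s s01 Es] := mvt_dir (fun s H => (gd s H).1).
have {}s01 : 0 <= s <= 1 by case/andP: s01 => *; rewrite !ltW.
have [|t t01 Et] := @mvt_dir _ ('D_u f) (x + s *: (h *: u)) (h *: v).
  by move=> t t01; have [] := dP _ (HP _ _ s01 t01).
have {}t01 : 0 <= t <= 1 by case/andP: t01 => *; rewrite !ltW.
exists (x + s *: (h *: u) + t *: (h *: v)); first exact: HP.
have -> : f (x + h *: u + h *: v) - f (x + h *: u) - f (x + h *: v) + f x
    = g (x + h *: u) - g x by rewrite /g; ring.
rewrite Es (gd _ s01).2 Et derive_scale_dir; first by rewrite mulrA expr2.
by have [] := dP _ (HP _ _ s01 t01).
Qed.

(** The second difference is symmetric in [u] and [v], so the two mixed derivatives agree at two
    points of an arbitrarily small ball; their continuity carries the equality to [x]. *)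
Lemma schwarz V (f : V -> R) (x u v : V) : smooth_at x f ->
  'D_u ('D_v f) x = 'D_v ('D_u f) x.
Proof.
move=> sf.
have su := smooth_at_derive u sf; have sv := smooth_at_derive v sf.
have cA := smooth_at_continuous (smooth_at_derive u sv).
have cB := smooth_at_continuous (smooth_at_derive v su).
apply/eqP; rewrite -subr_eq0 -normr_eq0 eq_le normr_ge0 andbT.
apply/ler_addgt0Pl => e e0; rewrite addr0.
have e2 : 0 < e / 2 by rewrite divr_gt0.
have nA : \forall y \near x, `|'D_u ('D_v f) x - 'D_u ('D_v f) y| < e / 2.
  by move/cvgrPdist_lt : cA; apply.
have nB : \forall y \near x, `|'D_v ('D_u f) x - 'D_v ('D_u f) y| < e / 2.
  by move/cvgrPdist_lt : cB; apply.
have nP := near_and (near_and (smooth_at_near_diff sf) (smooth_at_near_diff su))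
  (near_and (smooth_at_near_diff sv) (near_and nA nB)).
have /nbhs_ballP[r /= r0 HP] := nP.
have [h h0 hr] : exists2 h : R, 0 < h & h * `|u| + h * `|v| < r.
  have d0 : 0 < `|u| + `|v| + 1 by rewrite ltr_wpDl // addr_ge0.
  (* The summand 1 covers the case where both directions vanish. *)
  exists (r / (2 * (`|u| + `|v| + 1))); first by rewrite divr_gt0 // mulr_gt0.
  rewrite -mulrDr mulrAC ltr_pdivrMr ?mulr_gt0 // ltr_pM2l //.
  have := normr_ge0 u; have := normr_ge0 v; lra.
have ball_in (s t : R) u' v' : h * `|u'| + h * `|v'| < r ->
    0 <= s <= 1 -> 0 <= t <= 1 ->
    ball x r (x + s *: (h *: u') + t *: (h *: v')).
  move=> {}hr /andP[s0 s1] /andP[t0 t1].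
  rewrite -ball_normE /ball_ /= -addrA opprD addrA subrr add0r normrN.
  apply: le_lt_trans (ler_normD _ _) _; rewrite !normrZ (ger0_norm s0) (ger0_norm t0) (gtr0_norm h0).
  apply: le_lt_trans hr; apply: lerD; apply: ler_piMl => //; apply: mulr_ge0 => //;
    exact: ltW.
have [||y1 Py1 E1] := @second_difference V f (ball x r) x u v h.
- by move=> s t; exact: ball_in.
- by move=> y /HP[[? ?] [? _]].
have [||y2 Py2 E2] := @second_difference V f (ball x r) x v u h.
- by move=> s t; apply: ball_in; rewrite addrC.
- by move=> y /HP[[? ?] [? _]].
have E : 'D_v ('D_u f) y1 = 'D_u ('D_v f) y2.
  have hh : h ^+ 2 != 0 by rewrite sqrf_eq0 gt_eqF.
  apply: (mulfI hh); apply: etrans (esym E1) _; apply: etrans _ E2.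
  rewrite (addrAC x (h *: v)).
  by move: (f _) (f (x + h *: u)) (f (x + _)) (f x) => a b c d; ring.
have [_ [_ [_ L1]]] := HP _ Py1; have [_ [_ [L2 _]]] := HP _ Py2.
rewrite /= E in L1; apply: ltW; move: L1 L2; clear -e0.
move: ('D_v _ x) ('D_u _ y2) ('D_u _ x) => a b c.
by rewrite !ltr_norml => /andP[? ?] /andP[? ?]; lra.
Unshelve. all: by end_near. Qed.

Lemma zero_derive_seg V (f : V -> R) (x v : V) :
  (forall s : R, 0 <= s <= 1 -> differentiable f (x + s *: v) /\
      'D_v f (x + s *: v) = 0) -> f (x + v) = f x.
Proof.
move=> H; have [s /andP[s0 s1] E] := mvt_dir (fun s h => (H s h).1).
by apply/eqP; rewrite -subr_eq0 E (H s _).2 // !ltW.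
Qed.

End MeanValue.

Lemma near_normP (R : realType) (V : normedModType R) (P : V -> Prop) (x : V) :
  (\near x, P x) <-> exists2 d : R, 0 < d & forall y, `|y - x| < d -> P y.
Proof.
split=> [/nbhs_ballP[d d0 H]|[d d0 H]].
  by exists d => // y hy; apply: H; rewrite -ball_normE /ball_ /= distrC.
apply/nbhs_ballP; exists d => // y; rewrite -ball_normE /ball_ /= distrC.
exact: H.
Qed.

Lemma near_norm_lt (R : realType) (V : normedModType R) (x : V) (e : R) : 0 < e ->
  \forall y \near x, `|y - x| < e.
Proof. by move=> e0; apply/near_normP; exists e. Qed.

(** * Holomorphic maps of the plane *)

Section ComplexPlane.
Context {R : realType}.
Local Notation C := (R * R)%type.
Implicit Types a b v w : C.

Definition cmul a v : C := (a.1 * v.1 - a.2 * v.2, a.2 * v.1 + a.1 * v.2).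
Definition cnorm2 a : R := a.1 ^+ 2 + a.2 ^+ 2.
Definition cinv a : C := (a.1 / cnorm2 a, - a.2 / cnorm2 a).

Lemma cnorm2_eq0 a : (cnorm2 a == 0) = (a == 0).
Proof.
case: a => p q; rewrite /cnorm2 /= paddr_eq0 ?sqr_ge0 // !sqrf_eq0.
by rewrite -pair_eqE.
Qed.

Lemma cmulA a b v : cmul a (cmul b v) = cmul (cmul a b) v.
Proof. by rewrite /cmul /=; congr (_, _); ring. Qed.

Lemma cmulC a b : cmul a b = cmul b a.
Proof. by rewrite /cmul /=; congr (_, _); ring. Qed.

Lemma cmul1 v : cmul (1, 0) v = v.
Proof. by case: v => p q; rewrite /cmul /=; congr (_, _); ring. Qed.

Lemma cmulV a : a != 0 -> cmul (cinv a) a = (1, 0).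
Proof.
move=> a0; have n0 : cnorm2 a != 0 by rewrite cnorm2_eq0.
rewrite /cmul /cinv /=; congr (_, _).
  by rewrite -[RHS](divff n0) {3}/cnorm2; ring.
by ring.
Qed.

Lemma cmulVK a v : a != 0 -> cmul (cinv a) (cmul a v) = v.
Proof. by move=> a0; rewrite cmulA cmulV // cmul1. Qed.

Lemma cmul_linear a : linear (cmul a).
Proof.
by move=> c x y; rewrite /cmul /=; congr (_, _); rewrite /= /GRing.scale /=; ring.
Qed.

Definition cmulL a : {linear C -> C} :=
  HB.pack (cmul a) (GRing.isLinear.Build R C C _ (cmul a) (cmul_linear a)).

Lemma cmul_rot a v : cmul a (rot v) = rot (cmul a v).
Proof. by rewrite /cmul /rot /=; congr (_, _); ring. Qed.

Lemma rot_sq v : rot (rot v) = - v.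
Proof. by case: v. Qed.

Lemma norm_fst v : `|v.1| <= `|v|.
Proof. by rewrite [leRHS]prod_normE le_max lexx. Qed.

Lemma norm_snd v : `|v.2| <= `|v|.
Proof. by rewrite [leRHS]prod_normE le_max lexx orbT. Qed.

Lemma norm_pair_le v (r : R) : `|v.1| <= r -> `|v.2| <= r -> `|v| <= r.
Proof. by move=> h1 h2; rewrite [leLHS]prod_normE ge_max h1. Qed.

(** The norm of the plane is the maximum norm, not the Euclidean one, hence the factor 2; the
    contraction constants below are chosen with this loss in mind. *)
Lemma norm_cmul a v : `|cmul a v| <= 2 * `|a| * `|v|.
Proof.
have h p q p' q' : `|p| <= `|a| -> `|q| <= `|a| -> `|p'| <= `|v| -> `|q'| <= `|v| ->
    `|p * p' + q * q'| <= 2 * `|a| * `|v|.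
  move=> *; apply: le_trans (ler_normD _ _) _; rewrite !normrM.
  by rewrite mulr_natl mulr2n mulrDl; apply: lerD; apply: ler_pM.
apply: norm_pair_le => /=; last by apply: h; rewrite ?norm_fst ?norm_snd.
by rewrite -mulNr; apply: h; rewrite ?normrN ?norm_fst ?norm_snd.
Qed.

Lemma fst_continuous : continuous (fst : C -> R).
Proof. by move=> x; exact: cvg_fst. Qed.

Lemma snd_continuous : continuous (snd : C -> R).
Proof. by move=> x; exact: cvg_snd. Qed.

Lemma cmulL_continuous a : continuous (cmulL a).
Proof.
move=> x; pose f1 (y : C) : R := a.1 * y.1 - a.2 * y.2.
pose f2 (y : C) : R := a.2 * y.1 + a.1 * y.2.
have cM (c : R) (f : C -> R) : {for x, continuous f} -> {for x, continuous (fun y => c * f y)}.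
  by move=> cf; apply: continuousM => //; exact: cst_continuous.
have c1 : {for x, continuous f1}.
  by apply: continuousB; apply: cM; [exact: fst_continuous|exact: snd_continuous].
have c2 : {for x, continuous f2}.
  by apply: continuousD; apply: cM; [exact: fst_continuous|exact: snd_continuous].
exact: (cvg_pair c1 c2).
Qed.

Lemma fst_linear : linear (fst : C -> R^o). Proof. by []. Qed.
Lemma snd_linear : linear (snd : C -> R^o). Proof. by []. Qed.

Definition fstL : {linear C -> R^o} :=
  HB.pack (fst : C -> R^o) (GRing.isLinear.Build R C R^o _ (fst : C -> R^o) fst_linear).
Definition sndL : {linear C -> R^o} :=
  HB.pack (snd : C -> R^o) (GRing.isLinear.Build R C R^o _ (snd : C -> R^o) snd_linear).

Lemma e12E v : v = v.1 *: (1, 0) + v.2 *: (0, 1).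
Proof.
by case: v => p q; congr (_, _); rewrite /= /GRing.scale /=; ring.
Qed.

Lemma conformalE (D : {linear C -> C}) v :
  (forall v, D (rot v) = rot (D v)) -> D v = cmul (D (1, 0)) v.
Proof.
move=> H; have E : (0, 1) = rot (1, 0) :> C by rewrite /rot /= oppr0.
rewrite {1}[v]e12E linearD !linearZ /= E H.
move: (D _) => [p q]; case: v => v1 v2; rewrite /cmul /rot /=.
by congr (_, _); rewrite /= /GRing.scale /=; ring.
Qed.

Lemma derive_conformalE (f : C -> C) x v : differentiable f x ->
  (forall v, 'D_(rot v) f x = rot ('D_v f x)) -> 'D_v f x = cmul ('D_(1, 0) f x) v.
Proof.
move=> df H; rewrite !(deriveE _ df); apply: conformalE => w.
by rewrite -!(deriveE _ df) H.
Qed.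

Lemma closed_ball_compact (x : C) (r : R) : compact [set y | `|y - x| <= r].
Proof.
have -> : [set y | `|y - x| <= r] =
    `[x.1 - r, x.1 + r]%classic `*` `[x.2 - r, x.2 + r]%classic.
  apply/seteqP; split=> y /=.
    move=> h; rewrite !in_itv /= -!ler_distl.
    by split; [exact: le_trans (norm_fst _) h|exact: le_trans (norm_snd _) h].
  by rewrite !in_itv /= -!ler_distl => -[h1 h2]; exact: norm_pair_le.
by apply: compact_setX; exact: segment_compact.
Qed.

End ComplexPlane.

(** * Local inversion of conformal maps *)

Section InverseFunction.
Context {R : realType}.
Local Notation C := (R * R)%type.

Lemma Ck_onV (V : normedModType R) k (U : set V) (f : V -> R) : open U -> (forall x, U x -> f x != 0) ->
  Ck_on k U f -> Ck_on k U (fun x => (f x)^-1).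
Proof.
move=> oU f0; elim: k => [|k IH] Hf.
  by move=> x Ux; apply: cvgV; [exact: f0|exact: Hf].
have [df Df] := Hf; split=> [x Ux|v]; first by apply: differentiableV; [exact: df|exact: f0].
have H := IH (Ck_on_pred Hf).
apply: (@Ck_on_eq _ _ _ _ _ (fun x => - ((f x)^-1 * (f x)^-1 * 'D_v f x))) => //.
  move=> y Uy; rewrite deriveV; [|exact: f0|exact/diff_derivable/df].
  by rewrite -mulrN -expr2 -exprVn /GRing.scale /= mulrN mulNr.
by apply: Ck_onN => //; apply: Ck_onM => //; [exact: Ck_onM|exact: Df].
Qed.

(** For the maximum norm the mean value theorem may be applied to each coordinate separately, at two
    different points of the segment, without any loss in the constant. *)
Lemma lipschitz_seg (V : normedModType R) (h : V -> C) (q : R) (x v : V) :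
  (forall s : R, 0 <= s <= 1 -> differentiable h (x + s *: v) /\
    `|'D_v h (x + s *: v)| <= q) -> `|h (x + v) - h x| <= q.
Proof.
move=> H.
have Hc (L : {linear C -> R^o}) : continuous L -> (forall w : C, `|L w| <= `|w|) ->
    `|L (h (x + v) - h x)| <= q.
  move=> cL nL; have dL (s : R) : 0 <= s <= 1 -> differentiable (L \o h : V -> R) (x + s *: v).
    move=> s01; apply: differentiable_comp; first by have [] := H _ s01.
    exact: linear_differentiable.
  have [s /andP[s0 s1] E] := mvt_dir dL.
  have s01 : 0 <= s <= 1 by rewrite !ltW.
  rewrite linearB [X in `|X|]E.
  rewrite (derive_linear_comp _ cL (H _ s01).1).
  by apply: le_trans (nL _) (H _ s01).2.
apply: norm_pair_le.
  by have := Hc fstL; apply; [exact: fst_continuous|exact: norm_fst].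
by have := Hc sndL; apply; [exact: snd_continuous|exact: norm_snd].
Qed.

(** Written with a base point and a displacement, the form in which the mean value theorem along a
    segment consumes it. *)
Definition convex_region (V : normedModType R) (U : set V) := forall x v (s : R),
  U x -> U (x + v) -> 0 <= s <= 1 -> U (x + s *: v).

Lemma convex_ball (V : normedModType R) (x0 : V) (r : R) : convex_region (ball x0 r).
Proof.
move=> x v s; rewrite -ball_normE /ball_ /= => Bx Bxv /andP[s0 s1].
have -> : x0 - (x + s *: v) = (1 - s) *: (x0 - x) + s *: (x0 - (x + v)).
  rewrite !opprD !addrA !scalerDr !scalerBl !scale1r !scalerN.
  rewrite -!addrA; congr (_ + _).
  rewrite [- (s *: x0) + _]addrCA; congr (_ + _).
  by rewrite opprK [s *: x + _]addrCA addKr addrA subrr add0r.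
apply: le_lt_trans (ler_normD _ _) _; rewrite !normrZ.
rewrite (ger0_norm s0) ger0_norm ?subr_ge0 //.
move: (`|x0 - x|) (`|x0 - (x + v)|) Bx Bxv => a b ar br.
have [->|sn1] := eqVneq s 1; first by rewrite subrr mul0r add0r mul1r.
have s1' : s < 1 by rewrite lt_neqAle sn1.
have -> : r = (1 - s) * r + s * r by ring.
by apply: ltr_leD; [rewrite ltr_pM2l // subr_gt0|apply: ler_wpM2l => //; exact: ltW].
Qed.

Fact shift_identity1 (x t t0 y x0 : C) :
  x + (y - t) - x0 = (y - t0) - ((t - x) - (t0 - x0)).
Proof.
by case: x t t0 y x0 => [? ?] [? ?] [? ?] [? ?] [? ?]; congr (_, _) => /=; ring.
Qed.

Fact shift_identity2 (x z t y : C) :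
  y - z = - ((z - (x + (y - t))) - (t - x)).
Proof.
by case: x z t y => [? ?] [? ?] [? ?] [? ?]; congr (_, _) => /=; ring.
Qed.

(* If Theta - id is a (1/2)-contraction, the point of the closed ball minimizing
   |Theta - y| can only be a zero: otherwise x + (y - Theta x) does better. *)
Lemma near_id_surj (Th : C -> C) (x0 y : C) (r : R) : 0 < r ->
  (forall x, `|x - x0| <= r -> {for x, continuous Th}) ->
  (forall x x', `|x - x0| <= r -> `|x' - x0| <= r ->
    `|(Th x - x) - (Th x' - x')| <= 2^-1 * `|x - x'|) ->
  `|y - Th x0| <= r / 2 -> exists2 x, `|x - x0| <= r & Th x = y.
Proof.
move=> r0 cTh lTh yr; pose B := [set x : C | `|x - x0| <= r].
have B0 : B x0 by rewrite /B /= subrr normr0 ltW.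
have cg : {within B, continuous (fun x => `|y - Th x|)}.
  apply: continuous_in_subspaceT => x; rewrite inE => Bx.
  apply: (continuous_comp (f := fun x => y - Th x)); last exact: norm_continuous.
  by apply: continuousB; [exact: cst_continuous|exact: cTh].
have [|x] := compact_EVT_min _ (@closed_ball_compact R x0 r) cg; first by exists x0.
rewrite inE => Bx minx; exists x => //.
apply/eqP; rewrite eq_sym -subr_eq0 -normr_eq0; apply/negPn/negP => n0.
have pos : 0 < `|y - Th x| by rewrite lt_neqAle eq_sym n0 normr_ge0.
pose x' := x + (y - Th x).
have Bx' : B x'.
  rewrite /B /=; have -> : x' - x0 = (y - Th x0) - ((Th x - x) - (Th x0 - x0)).
    exact: shift_identity1.
  apply: le_trans (ler_normB _ _) _; rewrite [leRHS](splitr r).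
  apply: lerD => //; apply: le_trans (lTh _ _ Bx B0) _.
  by rewrite mulrC ler_wpM2r ?invr_ge0.
have := minx x'; rewrite inE => /(_ Bx'); rewrite leNgt => /negP; apply.
have -> : y - Th x' = - ((Th x' - x') - (Th x - x)).
  exact: shift_identity2.
rewrite normrN; apply: le_lt_trans (lTh _ _ Bx' Bx) _.
rewrite /x' [x + _]addrC addrK; lra.
Qed.

End InverseFunction.

Section ConformalInverse.
Context {R : realType}.
Local Notation C := (R * R)%type.

Definition conformal_on (U : set C) (f : C -> C) :=
  forall x v, U x -> 'D_(rot v) f x = rot ('D_v f x).

Lemma derive_idP (V : normedModType R) (x v : V) : differentiable (@id V) x /\ 'D_v (@id V) x = v.
Proof. by have [d1 d2] := is_diff_id x; rewrite (deriveE _ d1) d2. Qed.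

Lemma cinv_neq0 (a : C) : a != 0 -> cinv a != 0.
Proof.
move=> a0; apply/negP => /eqP h; have := cmulV a0; rewrite h /cmul /= !mul0r subr0.
by move=> [] /eqP; rewrite eq_sym oner_eq0.
Qed.

Lemma cmulB1 (p w : C) : cmul p w - w = cmul (p - (1, 0)) w.
Proof. by case: p w => [? ?] [? ?]; congr (_, _) => /=; ring. Qed.

Lemma cmul0 (v : C) : cmul 0 v = 0.
Proof. by rewrite /cmul /= !mul0r subr0 addr0. Qed.

Lemma Ck_on_cinv (V : normedModType R) k (N : set V) (A : V -> C) : open N ->
  (forall x, N x -> A x != 0) -> Ck_on k N A -> Ck_on k N (cinv \o A).
Proof.
move=> oN A0 HA.
have H1 : Ck_on k N (fun y => (A y).1) by exact: (Ck_on_lincomp (L := fstL) oN fst_continuous HA).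
have H2 : Ck_on k N (fun y => (A y).2) by exact: (Ck_on_lincomp (L := sndL) oN snd_continuous HA).
have Hn : Ck_on k N (fun y => cnorm2 (A y)).
  by rewrite /cnorm2; apply: Ck_onD => //; under eq_fun do rewrite expr2; exact: Ck_onM.
have HV : Ck_on k N (fun y => (cnorm2 (A y))^-1).
  by apply: Ck_onV => // x Nx; rewrite cnorm2_eq0; exact: A0.
apply: (@Ck_on_pair _ _ _ _ _ _ (fun y => (A y).1 / cnorm2 (A y))
  (fun y => - (A y).2 / cnorm2 (A y))) => //; apply: Ck_onM => //.
exact: Ck_onN.
Qed.

Lemma Ck_on_cmulr (V : normedModType R) k (N : set V) (A : V -> C) (v : C) : open N ->
  Ck_on k N A -> Ck_on k N (fun y => cmul (A y) v).
Proof.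
move=> oN HA; have := Ck_on_lincomp (L := cmulL v) oN (@cmulL_continuous _ v) HA.
by apply: Ck_on_eq => // y Ny /=; rewrite cmulC.
Qed.

Section Local.
Variables (U : set C) (ka : C -> C) (x0 : C).
Hypothesis oU : open U.
Hypothesis Ux0 : U x0.
Hypothesis ska : smooth_on U ka.
Hypothesis cka : conformal_on U ka.
Let A x := 'D_(1, 0) ka x.
Hypothesis A0 : A x0 != 0.
Let b := cinv (A x0).

Let dka x : U x -> differentiable ka x.
Proof. by move=> Ux; apply: smooth_at_diff; exact: smooth_at_on ska. Qed.

Let DkaE x v : U x -> 'D_v ka x = cmul (A x) v.
Proof. by move=> Ux; apply: derive_conformalE; [exact: dka|move=> w; exact: cka]. Qed.

Let b0 : b != 0. Proof. exact: cinv_neq0. Qed.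

(** The threshold 1/4, doubled by [norm_cmul], makes the normalized map minus the identity a
    1/2-contraction, as [near_id_surj] asks. *)
Let small_ball : exists2 r : R, 0 < r & forall x, ball x0 r x ->
  U x /\ `|cmul b (A x) - (1, 0)| < 4^-1.
Proof.
have sA : smooth_at x0 A by apply: smooth_at_derive; exact: smooth_at_on ska.
have cA : {for x0, continuous (cmulL b \o A)}.
  by apply: continuous_comp; [exact: smooth_at_continuous|exact: cmulL_continuous].
have n1 : \forall x \near x0, `|cmul b (A x) - (1, 0)| < 4^-1.
  move/cvgrPdist_lt : cA => /(_ 4^-1); rewrite invr_gt0 ltr0n => /(_ erefl).
  have E : (cmulL b \o A) x0 = (1, 0) by rewrite /= /b cmulV.
  by rewrite E; apply: filterS => x; rewrite distrC.
have nU : \forall x \near x0, U x by exact: open_nbhs_nbhs.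
by have /nbhs_ballP[r r0 H] := near_and nU n1; exists r.
Qed.

(** Multiplying [ka] by the inverse of its derivative at [x0] gives a map [Th] close to the
    identity: [Th - id] is a 1/2-contraction on a small ball, so [Th] is bi-Lipschitz and open
    there. A conformal derivative is multiplication by a complex number, so being nonzero makes it
    invertible and [cinv] gives the derivative of the inverse. *)
Lemma conformal_local_inverse : exists (W : set C) (L : C -> C),
  [/\ open W, W x0, W `<=` U & open (ka @` W)] /\
  [/\ forall x, W x -> L (ka x) = x, smooth_on (ka @` W) L &
      conformal_on (ka @` W) L].
Proof.
have [r r0 Hr] := small_ball.
pose W := ball x0 r; have WU x : W x -> U x by move=> /Hr[].
have oW : open W by exact: ball_open.
have Wx0 : W x0 by exact: ballxx.
pose Th := cmulL b \o ka.
have dTh x : W x -> differentiable Th x.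
  move=> Wx; apply: differentiable_comp; first exact/dka/WU.
  by apply: linear_differentiable; exact: cmulL_continuous.
have DTh x v : W x -> 'D_v Th x = cmul (cmul b (A x)) v.
  move=> Wx; rewrite (derive_linear_comp _ (@cmulL_continuous _ b) (dka (WU _ Wx))).
  by rewrite (DkaE _ (WU _ Wx)) /= cmulA.
have lTh x x' : W x -> W x' ->
    `|(Th x - x) - (Th x' - x')| <= 2^-1 * `|x - x'|.
  move=> Wx Wx'.
  have := @lipschitz_seg R _ (fun y => Th y - y) (2^-1 * `|x - x'|) x' (x - x').
  rewrite [x' + _]addrC subrK; apply => s s01.
  have Ws : W (x' + s *: (x - x')).
    by apply: convex_ball => //; rewrite addrC subrK.
  have [di Di] := derive_idP (x' + s *: (x - x')) (x - x').
  split; first by apply: differentiableB; [exact: dTh|exact: di].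
  rewrite deriveB; [|exact/diff_derivable/dTh|exact/diff_derivable/di].
  rewrite Di (DTh _ _ Ws) cmulB1.
  apply: le_trans (norm_cmul _ _) _; apply: ler_wpM2r => //.
  by have [_ h] := Hr _ Ws; lra.
have bilip x x' : W x -> W x' -> `|x - x'| <= 2 * `|Th x - Th x'|.
  move=> Wx Wx'; have := lTh _ _ Wx Wx'.
  have -> : Th x - x - (Th x' - x') = (Th x - Th x') - (x - x').
    by rewrite !opprB addrACA [RHS]addrACA; congr (_ + _); rewrite addrC.
  by have := lerB_dist (x - x') (Th x - Th x'); rewrite -[`|x - x' - _|]normrN opprB; lra.
have Ax x : W x -> A x != 0.
  move=> Wx; apply/negP => /eqP h; have [_] := Hr _ Wx.
  rewrite h cmulC cmul0 sub0r normrN => h'.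
  have := le_lt_trans (norm_fst ((1, 0) : C)) h'; rewrite /= normr1; lra.
have inj x x' : W x -> W x' -> ka x = ka x' -> x = x'.
  move=> Wx Wx' E; have := bilip _ _ Wx Wx'.
  rewrite /Th /= E subrr normr0 mulr0 normr_le0 subr_eq0 => /eqP.
  exact.
have onto x rho : 0 < rho -> (forall x', `|x' - x| <= rho -> W x') ->
    forall y, `|cmul b y - Th x| <= rho / 2 -> exists2 x', W x' & ka x' = y.
  move=> rho0 Hrho y hy.
  have h1 x' : `|x' - x| <= rho -> {for x', continuous Th}.
    by move=> /Hrho Wx'; exact/differentiable_continuous/dTh.
  have h2 x' x'' : `|x' - x| <= rho -> `|x'' - x| <= rho ->
      `|(Th x' - x') - (Th x'' - x'')| <= 2^-1 * `|x' - x''|.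
    by move=> /Hrho Wx' /Hrho Wx''; exact: lTh.
  have [x' Wx' E] := near_id_surj rho0 h1 h2 hy.
  exists x'; first exact: Hrho.
  by rewrite -[LHS](cmulVK _ b0) -[RHS](cmulVK _ b0) -[cmul b (ka x')]/(Th x') E.
have oN : open (ka @` W).
  rewrite openE => _ [x Wx <-].
  have [rho rho0 Hrho] : exists2 rho : R, 0 < rho & forall x', `|x' - x| <= rho -> W x'.
    have : nbhs x W by exact: open_nbhs_nbhs.
    move=> /nbhs_ballP[rho rho0 H]; exists (rho / 2); first by rewrite divr_gt0.
    move=> x' hx'; apply: H; rewrite -ball_normE /ball_ /= distrC.
    by apply: le_lt_trans hx' _; rewrite ltr_pdivrMr // ltr_pMr // ltr1n.
  have : {for ka x, continuous (cmulL b)} by exact: cmulL_continuous.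
  move=> /cvgrPdist_lt/(_ (rho / 2)); rewrite divr_gt0 // => /(_ erefl) nb.
  rewrite /interior; apply: filterS nb => y hy.
  have [|x' Wx' E] := onto x rho rho0 Hrho y; last by exists x'.
  by rewrite distrC; exact: ltW.
pose L y := xget x0 [set x | W x /\ ka x = y].
have LP y : (ka @` W) y -> W (L y) /\ ka (L y) = y.
  by move=> [x Wx <-]; rewrite /L; case: xgetP => [x' -> //|/(_ x)]; case.
have LK x : W x -> L (ka x) = x.
  move=> Wx; have [|W1 E1] := LP (ka x); first by exists x.
  exact: inj E1.
have dL y : (ka @` W) y -> differentiable L y /\
    forall v, 'D_v L y = cmul (cinv (A (L y))) v.
  move=> Ny; have [WL kL] := LP _ Ny.
  set x := L y in WL kL *; have Ux := WU _ WL.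
  set c := cinv (A x).
  apply: (@differentiable_eps R C C L (cmulL c) y); first exact: cmulL_continuous.
  move=> e e0.
  (* [K] is a Lipschitz constant of [L]: a factor 2 from [bilip] and a factor 2 from [norm_cmul].
     [M] bounds multiplication by [c], and [e'] is chosen so that the product of the three is [e].
     Adding 1 keeps [K] and [M] positive. *)
  have [K K0 hK] : exists2 K : R, 0 < K & 4 * `|b| <= K.
    by exists (4 * `|b| + 1); rewrite ?lerDl // ltr_wpDl // mulr_ge0.
  have [M M0 hM] : exists2 M : R, 0 < M & 2 * `|c| <= M.
    by exists (2 * `|c| + 1); rewrite ?lerDl // ltr_wpDl // mulr_ge0.
  have [e' e'0 he'] : exists2 e', 0 < e' & M * (e' * K) = e.
    exists (e / (K * M)); first by rewrite divr_gt0 // mulr_gt0.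
    have := lt0r_neq0 K0; have := lt0r_neq0 M0 => M10 K10; field.
    by rewrite M10 K10.
  have /near_normP[d d0 Hd] := differentiable_epsE (dka Ux) e'0.
  have nN : \forall k \near (0 : C), (ka @` W) (y + k).
    by apply: near_addr0; exact: open_nbhs_nbhs.
  have nd : \forall k \near (0 : C), `|k| < d / K.
    have := near_norm_lt (0 : C) (divr_gt0 d0 K0).
    by apply: filterS => k; rewrite subr0.
  apply: filterS (near_and nN nd) => k [Nk dk].
  have [WL' kL'] := LP _ Nk; set x' := L (y + k) in WL' kL' *.
  have xx' : `|x' - x| <= K * `|k|.
    apply: le_trans (bilip _ _ WL' WL) _.
    rewrite /Th /= kL' kL -[cmul b (y + k)]/(cmulL b (y + k)) linearD /= addrAC.
    rewrite subrr add0r.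
    have := norm_cmul b k; have := ler_wpM2r (normr_ge0 k) hK.
    move=> h1 h2; apply: le_trans h1; apply: le_trans (ler_wpM2l _ h2) _ => //.
    by rewrite !mulrA -natrM.
  have bd : `|x' - x - 0| < d.
    rewrite subr0; apply: le_lt_trans xx' _.
    by rewrite mulrC -ltr_pdivlMr.
  have := Hd _ bd; rewrite /= [x + _]addrC subrK kL' kL -(deriveE _ (dka Ux)) (DkaE _ Ux).
  rewrite [y + k]addrC addrK => hk.
  have -> : x' - x - cmul c k = cmul c (cmul (A x) (x' - x) - k).
    rewrite -[RHS]/(cmulL c (cmul (A x) (x' - x) - k)) linearB /=.
    by congr (_ - _); rewrite /c (cmulVK (x' - x) (Ax _ WL)).
  apply: le_trans (norm_cmul _ _) _; rewrite distrC.
  have : 2 * `|c| * `|k - cmul (A x) (x' - x)| <= M * (e' * (K * `|k|)).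
    apply: ler_pM => //.
    by apply: le_trans hk _; apply: ler_wpM2l => //; exact: ltW.
  by move/le_trans; apply; rewrite [e' * _]mulrA mulrA he'.
exists W, L; split; first by split.
split=> //; last first.
  by move=> y v Ny; rewrite !(dL _ Ny).2 cmul_rot.
(* Bootstrap: the derivative of [L] is a smooth expression in [L] itself, so regularity of order k
   gives order k + 1. *)
elim=> [|k IH]; first by move=> y Ny; apply: differentiable_continuous; exact: (dL _ Ny).1.
split=> [y Ny|v]; first exact: (dL _ Ny).1.
apply: (@Ck_on_eq _ _ _ _ _ (fun y => cmul ((cinv \o (A \o L)) y) v)) => //.
  by move=> y Ny; rewrite (dL _ Ny).2.
have LU : L @` (ka @` W) `<=` U by move=> _ [y Ny <-]; apply: WU; exact: (LP _ Ny).1.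
have A0' y : (ka @` W) y -> (A \o L) y != 0 by move=> Ny; apply: Ax; exact: (LP _ Ny).1.
have HA : Ck_on k U A by have [_] := ska k.+1; exact.
exact: (Ck_on_cmulr v oN (Ck_on_cinv oN A0' (Ck_on_comp _ _ oN oU LU IH HA))).
Qed.

End Local.
End ConformalInverse.

(** * Harmonic functions *)

Section GradientEstimate.
Context {R : realType}.

Lemma second_derivative_at_max (f f1 : R -> R) (s0 d r : R) : 0 < r ->
  (forall s, `|s - s0| < r -> is_derive s 1 f (f1 s)) ->
  is_derive s0 1 f1 d -> (forall s, `|s - s0| < r -> f s <= f s0) -> d <= 0.
Proof.
move=> r0 df df1 fmax; rewrite leNgt; apply/negP => d0.
have [dd dE] := df1.
have f10 : f1 s0 = 0.
  have r2 : 0 < r / 2 by rewrite divr_gt0.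
  have hs s : s \in `]s0 - r / 2, s0 + r / 2[ -> `|s - s0| < r.
    rewrite in_itv /= => /andP[h1 h2]; rewrite ltr_norml; apply/andP; split; lra.
  have lr : s0 - r / 2 <= s0 + r / 2 by lra.
  have s0i : s0 \in `]s0 - r / 2, s0 + r / 2[.
    by rewrite in_itv /= gtrDl ltrDl oppr_lt0 r2.
  have H1 s : s \in `]s0 - r / 2, s0 + r / 2[ -> derivable f s 1.
    by move=> /hs h; have [] := df _ h.
  have H2 s : s \in `]s0 - r / 2, s0 + r / 2[ -> f s <= f s0.
    by move=> /hs h; exact: fmax.
  have [_ E1] := derive1_at_max lr H1 s0i H2.
  by have [|_ <-] := df s0; rewrite ?subrr ?normr0.
have df1' : differentiable f1 s0 by apply/derivable1_diffP.
have d2 : 0 < d / 2 by rewrite divr_gt0.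
have /near_normP[e e0 He] := differentiable_epsE df1' d2.
have [h [h0 he hr]] : exists h : R, [/\ 0 < h, h < e & h < r].
  have m0 : 0 < Num.min e r by rewrite lt_min e0.
  have h1 : Num.min e r <= e by rewrite ge_min lexx.
  have h2 : Num.min e r <= r by rewrite ge_min lexx orbT.
  by exists (Num.min e r / 2); split; [rewrite divr_gt0|lra|lra].
have posf1 s : s0 < s < s0 + h -> 0 < f1 s.
  move=> /andP[h1 h2].
  have := He (s - s0); rewrite subr0 ger0_norm; last by rewrite subr_ge0 ltW.
  have hse : s - s0 < e by apply: lt_trans he; rewrite ltrBlDl.
  move=> /(_ hse); rewrite [s0 + _]addrC subrK f10 subr0.
  have -> : 'd f1 s0 (s - s0) = (s - s0) * d.
    rewrite -[X in 'd _ _ X]mulr1 -[_ * 1]/((s - s0) *: (1 : R)) linearZ /=.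
    by rewrite -(deriveE _ df1') dE.
  rewrite ler_norml => /andP[h3 _].
  have p : 0 < (s - s0) * d by rewrite mulr_gt0 // subr_gt0.
  have q : d / 2 * (s - s0) = ((s - s0) * d) / 2 by rewrite mulrC mulrA.
  rewrite q in h3; move: ((s - s0) * d) p h3 => z; lra.
have [c] : exists2 c, c \in `]s0, s0 + h[ & f (s0 + h) - f s0 = f1 c * (s0 + h - s0).
  apply: MVT; first by rewrite ltrDl.
    move=> s; rewrite in_itv /= => /andP[h1 h2]; apply: df.
    by rewrite gtr0_norm ?subr_gt0 // ltrBlDl (lt_trans h2) // ltrD2l.
  apply: derivable_within_continuous => s; rewrite in_itv /= => /andP[h1 h2].
  have [|//] := df s; rewrite ger0_norm ?subr_ge0 // ltrBlDl (le_lt_trans h2) //.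
  by rewrite ltrD2l.
rewrite in_itv /= => /posf1 c0 E.
have := fmax (s0 + h); rewrite [s0 + h - s0]addrC addKr gtr0_norm // => /(_ hr).
by rewrite -subr_le0 E [s0 + h - s0]addrC addKr leNgt mulr_gt0.
Qed.

Lemma is_derive_subP (V : normedModType R) (f g : V -> R) x v df dg :
  is_derive x v f df -> is_derive x v g dg ->
  is_derive x v (fun y => f y - g y) (df - dg).
Proof. by move=> *; exact: is_deriveB. Qed.

Lemma is_derive_addP (V : normedModType R) (f g : V -> R) x v df dg :
  is_derive x v f df -> is_derive x v g dg ->
  is_derive x v (fun y => f y + g y) (df + dg).
Proof. by move=> *; exact: is_deriveD. Qed.

Lemma is_derive_quad (p q r s : R) :
  is_derive s 1 (fun x : R => p * x ^+ 2 + q * x + r) (2 * p * s + q).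
Proof.
have h1 : is_derive s 1 (fun x : R => p *: (x * x)) (p *: (s *: 1 + s *: 1)).
  exact: is_deriveZ.
have h2 : is_derive s 1 (fun x : R => q *: x) (q *: 1) by exact: is_deriveZ.
have h := is_derive_addP (is_derive_addP h1 h2) (is_derive_cst r s 1).
have := is_derive_eq h.
have -> : (fun y : R => p *: (y * y) + q *: y + cst r y)
    = (fun x => p * x ^+ 2 + q * x + r) by apply: funext => x.
by apply; rewrite /GRing.scale /=; ring.
Qed.

(** [a1], [a2] are the second derivatives of [b] along [e] at the two mirror points and [a3], [a4]
    those along [e']. Harmonicity at both points cancels them in the sum of the two inequalities,
    which leaves 2 ep <= 0. *)
Fact barrier_arith (M ep a1 a2 a3 a4 : R) : 0 < ep ->
  a1 - a2 - (- (4 * M) - 2 * ep) <= 0 -> a3 - a4 - 4 * M <= 0 ->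
  a1 + a3 = 0 -> a2 + a4 = 0 -> False.
Proof. lra. Qed.

Section Harmonic.
Variables (V : normedModType R) (U : set V) (x0 e e' : V).
Hypothesis oU : open U.

Let P (s t : R) := x0 + s *: e + t *: e'.

(* Maximum principle for b(s, t) - b(-s, t) against the barrier
   2 M (t^2 + 2 s - s^2) on [0, 1] x [-1, 1]. *)
Lemma harmonic_gradient_le (b : V -> R) (M : R) : smooth_on U b ->
  (forall x, U x -> 'D_e ('D_e b) x + 'D_e' ('D_e' b) x = 0) ->
  (forall s t : R, `|s| <= 1 -> `|t| <= 1 -> U (P s t) /\ `|b (P s t)| <= M) ->
  'D_e b x0 <= 2 * M.
Proof.
move=> sb hb HP.
have sbx x : U x -> smooth_at x b by move=> Ux; exact: smooth_at_on sb.
have M0 : 0 <= M.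
  by have [|| _] := HP 0 0; rewrite ?normr0 //; apply: le_trans.
have M2 : 0 <= 2 * M by rewrite mulr_ge0.
have De (s t : R) : U (P s t) -> forall f : V -> R, smooth_at (P s t) f ->
    is_derive s 1 (fun s => f (P s t)) ('D_e f (P s t)) /\
    is_derive t 1 (fun t => f (P s t)) ('D_e' f (P s t)).
  move=> Ust f sf; split; last by apply: is_derive_line; exact: smooth_at_diff.
  have E s' : P s' t = x0 + t *: e' + s' *: e by rewrite /P addrAC.
  have -> : (fun s => f (P s t)) = (fun s => f (x0 + t *: e' + s *: e)).
    by apply: funext => s'; rewrite E.
  by rewrite E; apply: is_derive_line; rewrite -E; exact: smooth_at_diff.
have Dm (s t : R) : U (P (- s) t) -> forall f : V -> R, smooth_at (P (- s) t) f ->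
    is_derive s 1 (fun s => f (P (- s) t)) (- 'D_e f (P (- s) t)) /\
    is_derive t 1 (fun t => f (P (- s) t)) ('D_e' f (P (- s) t)).
  move=> Ust f sf; split; last by apply: is_derive_line; exact: smooth_at_diff.
  have E s' : P (- s') t = x0 + t *: e' + s' *: - e.
    by rewrite /P addrAC scaleNr scalerN.
  have -> : (fun s => f (P (- s) t)) = (fun s => f (x0 + t *: e' + s *: - e)).
    by apply: funext => s'; rewrite E.
  have df : differentiable f (P (- s) t) by exact: smooth_at_diff.
  rewrite -(derive_dirN _ df) E; apply: is_derive_line.
  by rewrite -E.
pose g (s t : R) := b (P s t) - b (P (- s) t).
(* The barrier is harmonic; the added [ep * s^2] raises the Laplacian of [G] to 2 ep > 0, so that
   [G] has no interior maximum, at the price of an error [ep]. *)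
have bound (ep : R) : 0 < ep -> forall s t : R, 0 <= s <= 1 -> -1 <= t <= 1 ->
    g s t <= 2 * M * (t ^+ 2 + 2 * s - s ^+ 2) + ep.
  move=> ep0.
  pose G (x : R * R) := g x.1 x.2 - 2 * M * (x.2 ^+ 2 + 2 * x.1 - x.1 ^+ 2) + ep * x.1 ^+ 2.
  pose K := `[0, 1 : R]%classic `*` `[-1, 1 : R]%classic.
  have cK : compact K by apply: compact_setX; exact: segment_compact.
  have cG : {within K, continuous G}.
    apply: continuous_in_subspaceT => x; rewrite inE => -[/=].
    rewrite !in_itv /= => hx1 hx2.
    have nx1 : `|x.1| <= 1 by rewrite ler_norml; lra.
    have nx2 : `|x.2| <= 1 by rewrite ler_norml.
    have cP (c : R * R -> R) : {for x, continuous c} ->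
        {for x, continuous (fun y : R * R => P (c y) y.2)}.
      move=> cc; apply: continuousD; last by apply: cvgZr_tmp; exact: cvg_snd.
      by apply: continuousD; [exact: cst_continuous|apply: cvgZr_tmp; exact: cc].
    have c1 : {for x, continuous (fst : R * R -> R)} by exact: fst_continuous.
    have c2 : {for x, continuous (snd : R * R -> R)} by exact: snd_continuous.
    have b1 : {for x, continuous (fun y : R * R => b (P y.1 y.2))}.
      apply: (continuous_comp (f := fun y : R * R => P y.1 y.2)).
        exact: cP.
      by apply/smooth_at_continuous/sbx; have [] := HP _ _ nx1 nx2.
    have b2 : {for x, continuous (fun y : R * R => b (P (- y.1) y.2))}.
      apply: (continuous_comp (f := fun y : R * R => P (- y.1) y.2)).
        by apply: cP; apply: continuousN.
      by apply/smooth_at_continuous/sbx; rewrite -normrN in nx1; have [] := HP _ _ nx1 nx2.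
    have cM (p q : R * R -> R) : {for x, continuous p} -> {for x, continuous q} ->
      {for x, continuous (fun y => p y * q y)} by move=> *; exact: continuousM.
    have cc (r : R) : {for x, continuous (fun _ : R * R => r)} by exact: cst_continuous.
    have cD (p q : R * R -> R) : {for x, continuous p} -> {for x, continuous q} ->
      {for x, continuous (fun y => p y + q y)} by move=> *; exact: continuousD.
    have cB (p q : R * R -> R) : {for x, continuous p} -> {for x, continuous q} ->
      {for x, continuous (fun y => p y - q y)} by move=> *; exact: continuousB.
    exact: (cD _ _ (cB _ _ (cB _ _ b1 b2) (cM (fun=> 2 * M) _ (cc _)
      (cB _ _ (cD _ _ (cM snd snd c2 c2) (cM (fun=> 2) fst (cc _) c1)) (cM fst fst c1 c1))))
      (cM (fun=> ep) _ (cc _) (cM fst fst c1 c1))).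
  have K0 : K !=set0 by exists (0, 0); split => /=; rewrite in_itv /=; lra.
  have [c] := compact_EVT_max K0 cK cG.
  rewrite inE => -[/=]; rewrite !in_itv /= => hc1 hc2 cmax.
  have inK (s t : R) : 0 <= s <= 1 -> -1 <= t <= 1 -> (s, t) \in K.
    by move=> h1 h2; rewrite inE; split; rewrite /= in_itv.
  have nb (s t : R) : 0 <= s <= 1 -> -1 <= t <= 1 ->
      [/\ U (P s t), U (P (- s) t), b (P s t) <= M & - M <= b (P (- s) t)].
    move=> hs ht; have n1 : `|s| <= 1 by rewrite ler_norml; lra.
    have n2 : `|t| <= 1 by rewrite ler_norml.
    have [u1] := HP _ _ n1 n2; rewrite -normrN in n1; have [u2] := HP _ _ n1 n2.
    by rewrite !ler_norml => /andP[? ?] /andP[? ?].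
  suff Gc : G c <= ep.
    move=> s t hs ht; have := le_trans (cmax _ (inK _ _ hs ht)) Gc.
    rewrite /G /=; have : 0 <= ep * s ^+ 2 by rewrite mulr_ge0 ?sqr_ge0 // ltW.
    by move: (2 * M * _) (ep * _) (g s t) => p q r; lra.
  have g2 (s t : R) : 0 <= s <= 1 -> -1 <= t <= 1 -> g s t <= 2 * M.
    by move=> hs ht; have [_ _] := nb _ _ hs ht; rewrite /g; lra.
  have ep1 (s : R) : 0 <= s <= 1 -> ep * s ^+ 2 <= ep.
    by move=> /andP[s0 s1]; rewrite ler_piMr ?(ltW ep0) // expr_le1.
  case: c hc1 hc2 cmax => s t /= hs ht cmax.
  (* The sides of the rectangle: on s = 0 the function [g] vanishes by antisymmetry, and on the
     three other sides the barrier is at least 2 M, which dominates [g]. *)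
  have [s_0|sn0] := eqVneq s 0.
    rewrite /G /= s_0 /g oppr0 subrr.
    have -> : 0 - 2 * M * (t ^+ 2 + 2 * 0 - 0 ^+ 2) + ep * 0 ^+ 2 = - (2 * M * t ^+ 2).
      by ring.
    by rewrite (le_trans _ (ltW ep0)) // oppr_le0 (mulr_ge0 M2 (sqr_ge0 t)).
  have [s_1|sn1] := eqVneq s 1.
    have := g2 _ _ hs ht; have := ep1 _ hs; rewrite /G /= s_1 expr1n mulr1.
    have := mulr_ge0 M2 (sqr_ge0 t).
    have -> : 2 * M * (t ^+ 2 + 2 * 1 - 1) = 2 * M * t ^+ 2 + 2 * M by ring.
    by move: (2 * M * _) (g _ _) => p q; lra.
  have bt : t ^+ 2 = 1 -> G (s, t) <= ep.
    move=> t1; have := g2 _ _ hs ht; have := ep1 _ hs; rewrite /G /= t1.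
    have : 0 <= 2 * M * (2 * s - s ^+ 2).
      apply: (mulr_ge0 M2); rewrite subr_ge0 expr2; case/andP: hs => s0 s1.
      by rewrite ler_wpM2r // (le_trans s1) // ler1n.
    have -> : 2 * M * (1 + 2 * s - s ^+ 2) = 2 * M + 2 * M * (2 * s - s ^+ 2) by ring.
    by move: (2 * M * _) (g _ _) (ep * _) => p q r; lra.
  have [t_1|tn1] := eqVneq t 1; first by apply: bt; rewrite t_1 expr1n.
  have [t_m1|tnm1] := eqVneq t (- 1); first by apply: bt; rewrite t_m1 sqrrN expr1n.
  exfalso.
  have [r r0 Hr] : exists2 r : R, 0 < r & (forall s', `|s' - s| < r -> 0 <= s' <= 1) /\
      (forall t', `|t' - t| < r -> -1 <= t' <= 1).
    case/andP: hs => s0 s1; case/andP: ht => t0 t1.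
    pose r := Num.min (Num.min s (1 - s)) (Num.min (t + 1) (1 - t)).
    have [r1 r2 r3 r4] : [/\ r <= s, r <= 1 - s, r <= t + 1 & r <= 1 - t].
      by rewrite /r !ge_min !lexx !orbT.
    have r0 : 0 < r.
      have s0' : 0 < s by rewrite lt_neqAle eq_sym sn0.
      have s1' : s < 1 by rewrite lt_neqAle sn1.
      have t0' : -1 < t by rewrite lt_neqAle eq_sym tnm1.
      have t1' : t < 1 by rewrite lt_neqAle tn1.
      by rewrite /r !lt_min s0' !subr_gt0 s1' t1' /= -ltrBlDr sub0r t0'.
    clear -r0 r1 r2 r3 r4; by exists r => //; split=> ?; rewrite ltr_norml => /andP[? ?]; apply/andP; split; lra.
  have [u1 u2 _ _] := nb _ _ hs ht.
  have s1 := sbx _ u1; have s2 := sbx _ u2.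
  have Ds : 'D_e ('D_e b) (P s t) - 'D_e ('D_e b) (P (- s) t) - (- (4 * M) - 2 * ep) <= 0.
    pose q (x : R) := (- (2 * M) - ep) * x ^+ 2 + (4 * M) * x + 2 * M * t ^+ 2.
    apply: (@second_derivative_at_max (fun s => G (s, t))
      (fun s => 'D_e b (P s t) - - 'D_e b (P (- s) t) - (2 * (- (2 * M) - ep) * s + 4 * M)) s _ r) => //.
    - move=> s' /(Hr.1) hs'; have [u1' u2' _ _] := nb _ _ hs' ht.
      have -> : (fun s => G (s, t)) = fun s => b (P s t) - b (P (- s) t) - q s.
        by apply: funext => x; rewrite /G /g /q /=; ring.
      apply: is_derive_subP; last exact: is_derive_quad.
      apply: is_derive_subP; first exact: (De _ _ u1' b (sbx _ u1')).1.
      exact: (Dm _ _ u2' b (sbx _ u2')).1.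
    - have -> : 'D_e ('D_e b) (P s t) - 'D_e ('D_e b) (P (- s) t) - (- (4 * M) - 2 * ep)
        = 'D_e ('D_e b) (P s t) + - 'D_e ('D_e b) (P (- s) t) - (2 * 0 * s + 2 * (- (2 * M) - ep)).
        by congr (_ - _); ring.
      have -> : (fun s => 'D_e b (P s t) - - 'D_e b (P (- s) t) - (2 * (- (2 * M) - ep) * s + 4 * M))
        = (fun s => ('D_e b (P s t) + 'D_e b (P (- s) t)) -
             (0 * s ^+ 2 + (2 * (- (2 * M) - ep)) * s + 4 * M)).
        by apply: funext => x; rewrite opprK mul0r add0r.
      apply: is_derive_subP; last exact: is_derive_quad.
      apply: is_derive_addP; first exact: (De _ _ u1 _ (smooth_at_derive e s1)).1.
      exact: (Dm _ _ u2 _ (smooth_at_derive e s2)).1.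
    - by move=> s' /(Hr.1) hs'; apply: cmax; exact: inK.
  have Dt : 'D_e' ('D_e' b) (P s t) - 'D_e' ('D_e' b) (P (- s) t) - 4 * M <= 0.
    pose q (x : R) := (2 * M) * x ^+ 2 + 0 * x + (2 * M * (2 * s - s ^+ 2) - ep * s ^+ 2).
    apply: (@second_derivative_at_max (fun t => G (s, t))
      (fun t => 'D_e' b (P s t) - 'D_e' b (P (- s) t) - (2 * (2 * M) * t + 0)) t _ r) => //.
    - move=> t' /(Hr.2) ht'; have [u1' u2' _ _] := nb _ _ hs ht'.
      have -> : (fun t => G (s, t)) = fun t => b (P s t) - b (P (- s) t) - q t.
        by apply: funext => x; rewrite /G /g /q /=; ring.
      apply: is_derive_subP; last exact: is_derive_quad.
      apply: is_derive_subP; first exact: (De _ _ u1' b (sbx _ u1')).2.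
      exact: (Dm _ _ u2' b (sbx _ u2')).2.
    - have -> : 'D_e' ('D_e' b) (P s t) - 'D_e' ('D_e' b) (P (- s) t) - 4 * M
        = 'D_e' ('D_e' b) (P s t) - 'D_e' ('D_e' b) (P (- s) t) - (2 * 0 * t + 2 * (2 * M)).
        by congr (_ - _); ring.
      have -> : (fun t => 'D_e' b (P s t) - 'D_e' b (P (- s) t) - (2 * (2 * M) * t + 0))
        = (fun t => 'D_e' b (P s t) - 'D_e' b (P (- s) t) -
             (0 * t ^+ 2 + (2 * (2 * M)) * t + 0)).
        by apply: funext => x; rewrite mul0r add0r.
      apply: is_derive_subP; last exact: is_derive_quad.
      apply: is_derive_subP; first exact: (De _ _ u1 _ (smooth_at_derive e' s1)).2.
      exact: (Dm _ _ u2 _ (smooth_at_derive e' s2)).2.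
    - by move=> t' /(Hr.2) ht'; apply: cmax; exact: inK.
  exact: barrier_arith ep0 Ds Dt (hb _ u1) (hb _ u2).
(* On t = 0 the barrier is at most 4 M s, and [ep] tends to 0. The symmetric difference has
   derivative [2 * 'D_e b x0] at s = 0, which gives the bound 2 M. *)
have slope (s : R) : 0 < s <= 1 -> b (P s 0) - b (P (- s) 0) <= 4 * M * s.
  move=> /andP[s0 s1]; apply/ler_addgt0Pr => ep ep0.
  apply: le_trans (bound _ ep0 s 0 _ _) _; rewrite ?s1 ?(ltW s0) //; first by lra.
  rewrite lerD2r; have := mulr_ge0 M0 (sqr_ge0 s).
  have -> : 2 * M * (0 ^+ 2 + 2 * s - s ^+ 2) = 4 * M * s - 2 * (M * s ^+ 2) by ring.
  by move: (M * _) (4 * M * s) => p q; lra.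
have P0 : P 0 0 = x0 by rewrite /P !scale0r !addr0.
have U0 : U (P 0 0) by have [|| ] := HP 0 0; rewrite ?normr0.
have d1 := (De 0 0 U0 b (sbx _ U0)).1.
have U0' : U (P (- 0) 0) by rewrite oppr0.
have d2 := (Dm 0 0 U0' b (sbx _ U0')).1.
have [dd E] := is_derive_subP d1 d2; rewrite oppr0 opprK P0 in E.
pose h (s : R) := b (P s 0) - b (P (- s) 0).
have dh : differentiable h 0 by apply/derivable1_diffP.
suff : 'D_1 h 0 <= 4 * M by rewrite E; move: ('D_e _ _) => z; lra.
rewrite leNgt; apply/negP => hlt.
pose k := ('D_1 h 0 - 4 * M) / 2.
have k0 : 0 < k by rewrite divr_gt0 // subr_gt0.
have /near_normP[r r0 Hr] := differentiable_epsE dh k0.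
have [s [s0 s1 sr]] : exists s : R, [/\ 0 < s, s <= 1 & s < r].
  have m0 : 0 < Num.min 1 r by rewrite lt_min ltr01.
  have h1 : Num.min 1 r <= 1 by rewrite ge_min lexx.
  have h2 : Num.min 1 r <= r by rewrite ge_min lexx orbT.
  by exists (Num.min 1 r / 2); split; [rewrite divr_gt0|lra|lra].
have := Hr s; rewrite subr0 (gtr0_norm s0) => /(_ sr); rewrite add0r.
have -> : 'd h 0 s = s * 'D_1 h 0.
  rewrite -[X in 'd _ _ X]mulr1 -[_ * 1]/(s *: (1 : R)) linearZ /=.
  by rewrite -(deriveE _ dh).
have -> : h 0 = 0 by rewrite /h oppr0 subrr.
rewrite subr0 ler_norml => /andP[H1 _].
have H2 : h s <= 4 * M * s by apply: slope; rewrite s0 s1.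
have : 0 < s * k by rewrite mulr_gt0.
have E1 : s * 'D_1 h 0 = 2 * (s * k) + 4 * M * s.
  rewrite /k mulrA [2 * s]mulrC -[s * 2 * _]mulrA [2 * _]mulrC divfK ?lt0r_neq0 //.
  by rewrite mulrBr [s * (4 * M)]mulrC subrK.
move: H1; rewrite E1 [k * s]mulrC; move: (s * k) (4 * M * s) (h s) H2 => p q z; lra.
Qed.

End Harmonic.

(** The one-sided estimate applied to [b] and to [- b]. The pair of directions is arbitrary, so
    exchanging [e] and [e'] bounds the other partial derivative as well. *)
Lemma harmonic_gradient (V : normedModType R) (U : set V) (x0 e e' : V) (b : V -> R) (M : R) :
  open U -> smooth_on U b ->
  (forall x, U x -> 'D_e ('D_e b) x + 'D_e' ('D_e' b) x = 0) ->
  (forall s t : R, `|s| <= 1 -> `|t| <= 1 ->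
     U (x0 + s *: e + t *: e') /\ `|b (x0 + s *: e + t *: e')| <= M) ->
  `|'D_e b x0| <= 2 * M.
Proof.
move=> oU sb hb HP.
have U0 : U x0.
  by have [|| ] := HP 0 0; rewrite ?normr0 // !scale0r !addr0.
have sbx x : U x -> smooth_at x b by move=> Ux; exact: smooth_at_on sb.
have DN v x : U x -> 'D_v (fun y => - b y) x = - 'D_v b x.
  by move=> Ux; rewrite deriveN //; exact/diff_derivable/smooth_at_diff/sbx.
have DDN v x : U x -> 'D_v ('D_v (fun y => - b y)) x = - 'D_v ('D_v b) x.
  move=> Ux; rewrite (derive_eq_on v oU Ux (DN v)) deriveN //.
  exact/diff_derivable/smooth_at_diff/smooth_at_derive/sbx.
rewrite ler_norml; apply/andP; split; last exact: harmonic_gradient_le HP.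
have sb' : smooth_on U (fun y => - b y).
  by apply/(smooth_onP _ oU) => x Ux; exact/smooth_atN/sbx.
have hb' x : U x -> 'D_e ('D_e (fun y => - b y)) x + 'D_e' ('D_e' (fun y => - b y)) x = 0.
  by move=> Ux; rewrite (DDN e _ Ux) (DDN e' _ Ux) -opprD (hb _ Ux) oppr0.
have HP' s t : `|s| <= 1 -> `|t| <= 1 ->
    U (x0 + s *: e + t *: e') /\ `|- b (x0 + s *: e + t *: e')| <= M.
  by move=> hs ht; rewrite normrN; exact: HP.
have := harmonic_gradient_le oU sb' hb' HP'.
by rewrite (DN e _ U0) lerNl.
Qed.

End GradientEstimate.

Lemma continuous_pair (T U W : topologicalType) (f : T -> U) (g : T -> W) x :
  {for x, continuous f} -> {for x, continuous g} ->
  {for x, continuous (fun y => (f y, g y))}.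
Proof. by move=> cf cg; exact: (cvg_pair cf cg). Qed.

Section DerivativeRules.
Context {R : realType}.
Implicit Types V W : normedModType R.

Lemma is_derive_mulP V (f g : V -> R) x v df dg :
  is_derive x v f df -> is_derive x v g dg ->
  is_derive x v (fun y => f y * g y) (f x * dg + g x * df).
Proof. by move=> *; exact: is_deriveM. Qed.

Lemma is_derive_sumP V n (f : 'I_n -> V -> R) x v (df : 'I_n -> R) :
  (forall i, is_derive x v (f i) (df i)) ->
  is_derive x v (fun y => \sum_i f i y) (\sum_i df i).
Proof.
elim: n f df => [|n IH] f df H.
  rewrite big_ord0 (_ : (fun _ => _) = cst 0); first exact: is_derive_cst.
  by apply: funext => y; rewrite big_ord0.
rewrite big_ord_recl (_ : (fun _ => _) =
  (fun y => f ord0 y + \sum_(i < n) f (lift ord0 i) y)).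
  exact: (is_derive_addP (H _) (IH _ _ (fun i => H _))).
by apply: funext => y; rewrite big_ord_recl.
Qed.

Lemma is_derive_diff V W (f : V -> W) x v : differentiable f x ->
  is_derive x v f ('D_v f x).
Proof. by move=> df; exact/derivableP/diff_derivable. Qed.

Lemma is_derive_eq_on V W (U : set V) (f g : V -> W) x v d : open U -> U x ->
  (forall y, U y -> f y = g y) -> is_derive x v f d -> is_derive x v g d.
Proof.
move=> oU Ux fg; apply: near_eq_is_derive; near=> y; apply: fg.
by near: y; exact: open_nbhs_nbhs.
Unshelve. all: by end_near. Qed.

Lemma is_derive_lineP V W (f : V -> W) (x v : V) (s : R) d :
  is_derive (x + s *: v) v f d -> is_derive s 1 (fun t : R => f (x + t *: v)) d.
Proof.
have E : (fun h : R => h^-1 *: (((fun t : R => f (x + t *: v)) \o shift s) (h *: 1) - f (x + s *: v)))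
    = (fun h : R => h^-1 *: ((f \o shift (x + s *: v)) (h *: v) - f (x + s *: v))).
  apply: funext => h /=; rewrite [h *: 1]mulr1 scalerDl addrCA.
  by rewrite [x + _]addrC.
move=> [df dE]; apply: DeriveDef; first by rewrite /derivable E.
by rewrite /derive E.
Qed.

Lemma is_derive_conv V W (f : V -> W) x v d d' :
  is_derive x v f d -> d = d' -> is_derive x v f d'.
Proof. by move=> H <-. Qed.

Lemma linear_bound V (L : {linear V -> R^o}) : continuous L ->
  exists2 k : R, 0 < k & forall v, `|L v| <= k * `|v|.
Proof. by move=> cL; have [k k0 H] := linear_lipschitz cL; exists k. Qed.

End DerivativeRules.

Fact addrK2 (A : zmodType) (a b c : A) : a + b - (c + b) = a - c.
Proof. by rewrite opprD addrACA subrr addr0. Qed.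

(** * Naturality of the exterior derivative *)

Section Pullback.
Context {R : realType}.
Variables (W V : normedModType R).
Hypothesis fV : fdim V.
Variables (P : set V) (be : V -> V -> R) (ka : W -> V) (x : W).
Hypothesis oP : open P.
Hypothesis sbe : forall y v, P y -> smooth_at y (fun y => be y v).
Hypothesis lbe : forall y a u v, P y -> be y (a *: u + v) = a * be y u + be y v.
Hypothesis ska : smooth_at x ka.
Hypothesis Px : P (ka x).

Let be_sum n (c : 'I_n -> R) (e : 'I_n -> V) y : P y ->
  be y (\sum_i c i *: e i) = \sum_i c i * be y (e i).
Proof.
move=> Py; have b0 : be y 0 = 0.
  by have := lbe 1 0 0 Py; rewrite scale1r addr0 mul1r => /eqP; rewrite -subr_eq0 opprD addNKr oppr_eq0 => /eqP.
elim: n c e => [|n IH] c e; first by rewrite !big_ord0.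
by rewrite !big_ord_recl lbe // IH.
Qed.

(* d commutes with pull-back: the second derivatives of [ka] cancel by Schwarz. *)
Lemma pullback_d v1 v2 :
  'D_v1 (fun x => be (ka x) ('D_v2 ka x)) x - 'D_v2 (fun x => be (ka x) ('D_v1 ka x)) x =
  'D_('D_v1 ka x) (fun y => be y ('D_v2 ka x)) (ka x) -
  'D_('D_v2 ka x) (fun y => be y ('D_v1 ka x)) (ka x).
Proof.
have [n [e [c [cc ce]]]] := fV.
have dka : differentiable ka x := smooth_at_diff ska.
have nP : \forall x' \near x, P (ka x').
  by apply: (smooth_at_continuous ska); apply: open_nbhs_nbhs.
have D1 u1 u2 : 'D_u1 (fun x => be (ka x) ('D_u2 ka x)) x =
    \sum_i (c i ('D_u2 ka x) * 'D_('D_u1 ka x) (fun y => be y (e i)) (ka x) +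
            be (ka x) (e i) * 'D_u1 ('D_u2 (c i \o ka)) x).
  have E : \forall x' \near x, \sum_i (c i ('D_u2 ka x')) * be (ka x') (e i)
      = be (ka x') ('D_u2 ka x').
    apply: filterS nP => x' Px'; rewrite [X in be _ X]ce be_sum //.
  rewrite -(near_eq_derive _ E).
  have H : is_derive x u1 (fun x' => \sum_i (c i ('D_u2 ka x')) * be (ka x') (e i))
    (\sum_i (c i ('D_u2 ka x) * 'D_('D_u1 ka x) (fun y => be y (e i)) (ka x) +
            be (ka x) (e i) * 'D_u1 ('D_u2 (c i \o ka)) x)).
    apply: is_derive_sumP => i; apply: is_derive_mulP.
      have Ec : \forall x' \near x, 'D_u2 (c i \o ka) x' = (c i \o 'D_u2 ka) x'.
        apply: filterS (smooth_at_near_diff ska) => x' dx'.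
        by rewrite (derive_linear_comp _ (cc i) dx').
      rewrite (near_eq_derive u1 Ec).
      apply: is_derive_diff; apply: smooth_at_diff.
      by apply: smooth_at_lincomp; [exact: cc|exact: smooth_at_derive].
    have db : differentiable (fun y => be y (e i)) (ka x).
      by apply: smooth_at_diff; exact: sbe.
    rewrite -(derive_comp u1 dka db).
    exact: (is_derive_diff u1 (differentiable_comp dka db)).
  by have [_ ->] := H.
have D2 u1 u2 : 'D_u1 (fun y => be y u2) (ka x) =
    \sum_i c i u2 * 'D_u1 (fun y => be y (e i)) (ka x).
  have E y : P y -> \sum_i c i u2 * be y (e i) = be y u2.
    by move=> Py; rewrite [in RHS](ce u2) be_sum.
  rewrite -(derive_eq_on u1 oP Px E).
  have H : is_derive (ka x) u1 (fun y => \sum_i c i u2 * be y (e i))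
    (\sum_i (c i u2 * 'D_u1 (fun y => be y (e i)) (ka x) + be (ka x) (e i) * 0)).
    apply: is_derive_sumP => i; have db := smooth_at_diff (sbe (e i) Px).
    exact: (is_derive_mulP (is_derive_cst (c i u2) (ka x) u1) (is_derive_diff u1 db)).
  by have [_ ->] := H; apply: eq_bigr => i _; rewrite mulr0 addr0.
rewrite (D1 v1 v2) (D1 v2 v1) (D2 ('D_v1 ka x) ('D_v2 ka x)) (D2 ('D_v2 ka x) ('D_v1 ka x)).
rewrite -!sumrB; apply: eq_bigr => i _.
have -> : 'D_v1 ('D_v2 (c i \o ka)) x = 'D_v2 ('D_v1 (c i \o ka)) x.
  apply: (@schwarz R W (c i \o ka)); apply: smooth_at_lincomp; [exact: cc|exact: ska].
exact: addrK2.
Qed.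

End Pullback.

(** * Primitives of closed 1-forms and harmonic conjugates *)

Section Poincare.
Context {R : realType}.
Local Notation C := (R * R)%type.
Local Notation mu := (@lebesgue_measure R).

(** Derivatives are given in all directions, so the mean value theorem is used once, along the
    segment from [x] to [x + h]; continuity of [P] and [Q] then bounds the error by e / 2 for each
    coordinate of [h]. *)
Lemma partials_differentiable (U : set C) (a P Q : C -> R) (x : C) : open U -> U x ->
  convex_region U ->
  (forall y, U y -> {for y, continuous P} /\ {for y, continuous Q}) ->
  (forall y v, U y -> is_derive y v a (P y * v.1 + Q y * v.2)) ->
  differentiable a x /\ forall v, 'D_v a x = P x * v.1 + Q x * v.2.
Proof.
move=> oU Ux cU cPQ da; suff dx : differentiable a x.
  by split=> // v; have [_ ->] := da _ v Ux.
pose L (v : C) : R^o := P x * v.1 + Q x * v.2.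
have lL : linear L.
  by move=> c u v; rewrite /L /= /GRing.scale /=; ring.
pose LL : {linear C -> R^o} := HB.pack L (GRing.isLinear.Build R C R^o _ L lL).
have cL : continuous LL.
  move=> y; have cc (r : R) : {for y, continuous (fun _ : C => r)} by exact: cst_continuous.
  have h1 := continuousM (cc (P x)) (@fst_continuous R y).
  have h2 := continuousM (cc (Q x)) (@snd_continuous R y).
  exact: (continuousD h1 h2).
have [cP cQ] := cPQ _ Ux.
suff [] : differentiable a x /\ forall v, 'D_v a x = LL v by [].
apply: differentiable_eps => // e e0.
have e2 : 0 < e / 2 by rewrite divr_gt0.
have nP : \forall y \near x, `|P x - P y| < e / 2 by move/cvgrPdist_lt : cP; apply.
have nQ : \forall y \near x, `|Q x - Q y| < e / 2 by move/cvgrPdist_lt : cQ; apply.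
have nU : \forall y \near x, U y by exact: open_nbhs_nbhs.
have /near_normP[d d0 Hd] := near_and nU (near_and nP nQ).
have := near_norm_lt (0 : C) d0; apply: filterS => h; rewrite subr0 => hd.
have Hs (s : R) : 0 <= s <= 1 -> `|x + s *: h - x| < d.
  move=> /andP[s0 s1]; rewrite addrC addKr normrZ (ger0_norm s0).
  by apply: le_lt_trans hd; rewrite ler_piMl.
pose g (t : R) := a (x + t *: h).
have gd (s : R) : 0 <= s <= 1 -> is_derive s 1 g (P (x + s *: h) * h.1 + Q (x + s *: h) * h.2).
  move=> s01; apply: is_derive_lineP; apply: da; apply: (Hd _ (Hs _ s01)).1.
have gd' (s : R) : s \in `]0, 1[ -> is_derive s 1 g (P (x + s *: h) * h.1 + Q (x + s *: h) * h.2).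
  by rewrite in_itv /= => /andP[s0 s1]; apply: gd; rewrite !ltW.
have gc : {within `[0, 1], continuous g}.
  apply: derivable_within_continuous => s; rewrite in_itv /= => s01.
  by have [] := gd _ s01.
have [s] := MVT ltr01 gd' gc.
rewrite in_itv /= /g scale1r scale0r addr0 subr0 mulr1 => /andP[s0 s1] ->.
have s01 : 0 <= s <= 1 by rewrite !ltW.
have [_ [/= HP HQ]] := Hd _ (Hs _ s01); rewrite /L /=.
have -> : P (x + s *: h) * h.1 + Q (x + s *: h) * h.2 - (P x * h.1 + Q x * h.2)
  = - ((P x - P (x + s *: h)) * h.1 + (Q x - Q (x + s *: h)) * h.2) by ring.
rewrite normrN; apply: le_trans (ler_normD _ _) _; rewrite !normrM.
rewrite [X in _ <= X * _](splitr e) mulrDl; apply: lerD; apply: ler_pM => //.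
- exact: ltW.
- exact: norm_fst.
- exact: ltW.
- exact: norm_snd.
Qed.

Fact segment_variation (x0 x v : C) (h s : R) :
  x0 + s *: (x + h *: v - x0) = (x0 + s *: (x - x0)) + h *: (s *: v).
Proof.
by case: x0 x v => [? ?] [? ?] [? ?]; congr (_, _); rewrite /= /GRing.scale /=; ring.
Qed.

Section Primitive.
Variables (U : set C) (P Q : C -> R) (x0 : C).
Hypothesis oU : open U.
Hypothesis cU : convex_region U.
Hypothesis Ux0 : U x0.
Hypothesis sP : forall x, U x -> smooth_at x P.
Hypothesis sQ : forall x, U x -> smooth_at x Q.
Hypothesis closedPQ : forall x, U x -> 'D_(1, 0) Q x = 'D_(0, 1) P x.

Let DE (f : C -> R) x v : differentiable f x ->
  'D_v f x = v.1 * 'D_(1, 0) f x + v.2 * 'D_(0, 1) f x.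
Proof.
move=> df; rewrite {1}[v]e12E -[v.2 *: _]addr0.
by rewrite !(deriveE _ df) linearD !linearZ /= linearD linear0 addr0 linearZ.
Qed.

Let al (x v : C) := P x * v.1 + Q x * v.2.
Let a (x : C) : R := Rintegral mu `[0, 1]%classic (fun s => al (x0 + s *: (x - x0)) (x - x0)).

Let seg (x : C) (s : R) : U x -> 0 <= s <= 1 -> U (x0 + s *: (x - x0)).
Proof. by move=> Ux s01; apply: cU => //; rewrite addrC subrK. Qed.

(** [a] integrates the form along the segment from [x0]. Its derivative is taken under the integral
    sign, where [B h s] is the derivative of the integrand along the variation x + h v; the
    resulting integral is then evaluated by the fundamental theorem of calculus. *)
Lemma primitive_derive (x v : C) : U x -> is_derive x v a (al x v).
Proof.
move=> Ux.
have [d d0 Hd] : exists2 d : R, 0 < d & forall h : R, `|h| <= d -> U (x + h *: v).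
  have /near_normP[d d0 H] : \forall y \near x, U y by exact: open_nbhs_nbhs.
  have K0 : 0 < `|v| + 1 by rewrite ltr_wpDl.
  exists (d / 2 / (`|v| + 1)); first by rewrite !divr_gt0.
  move=> h hh; apply: H; rewrite addrC addKr normrZ.
  apply: (@le_lt_trans _ _ (d / 2)); last by rewrite ltr_pdivrMr // ltr_pMr // ltr1n.
  rewrite -[leRHS](divfK (lt0r_neq0 K0)); apply: ler_pM => //.
  by rewrite lerDl.
pose y (h : R) : C := x + h *: v - x0.
pose p (h s : R) : C := x0 + s *: y h.
have pU h s : `|h| <= d -> 0 <= s <= 1 -> U (p h s).
  by move=> hd s01; exact: (seg (Hd _ hd) s01).
pose B (h s : R) := s * ((y h).1 * 'D_v P (p h s) + (y h).2 * 'D_v Q (p h s))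
  + al (p h s) v.
pose f (h s : R) := al (p h s) (y h).
have dy1 (h : R) : is_derive h 1 (fun h => (y h).1) v.1.
  have := is_derive_quad 0 v.1 (x.1 - x0.1) h.
  rewrite mulr0 mul0r add0r; congr is_derive.
  by apply: funext => t; rewrite /y /= /GRing.scale /=; ring.
have dy2 (h : R) : is_derive h 1 (fun h => (y h).2) v.2.
  have := is_derive_quad 0 v.2 (x.2 - x0.2) h.
  rewrite mulr0 mul0r add0r; congr is_derive.
  by apply: funext => t; rewrite /y /= /GRing.scale /=; ring.
have pE h s : p h s = (x0 + s *: (x - x0)) + h *: (s *: v).
  exact: segment_variation.
have dp (g : C -> R) (h s : R) : differentiable g (p h s) ->
    is_derive h 1 (fun h => g (p h s)) (s * 'D_v g (p h s)).
  move=> dg; rewrite -[s * _]/(s *: _) -(derive_scale_dir s v dg).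
  have -> : (fun h => g (p h s)) = (fun h => g ((x0 + s *: (x - x0)) + h *: (s *: v))).
    by apply: funext => t; rewrite pE.
  by rewrite pE; apply: is_derive_line; rewrite -pE.
have df (h s : R) : `|h| <= d -> 0 <= s <= 1 -> is_derive h 1 (f^~ s) (B h s).
  move=> hd s01; have Up := pU _ _ hd s01.
  have h1 := is_derive_mulP (dp P h s (smooth_at_diff (sP Up))) (dy1 h).
  have h2 := is_derive_mulP (dp Q h s (smooth_at_diff (sQ Up))) (dy2 h).
  refine (is_derive_conv (is_derive_addP h1 h2) _).
  rewrite /B /al; move: ('D_v P _) ('D_v Q _) (P _) (Q _) => e1 e2 e3 e4; ring.
have cy (h0 : R) (s0 : R) : {for (h0, s0), continuous (fun z : C => y z.1)}.
  apply: continuousB; last exact: cst_continuous.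
  apply: continuousD; first exact: cst_continuous.
  by apply: cvgZr_tmp; exact: fst_continuous.
have cp (h0 s0 : R) : {for (h0, s0), continuous (fun z : C => p z.1 z.2)}.
  apply: continuousD; first exact: cst_continuous.
  by apply: cvgZ; [exact: snd_continuous|exact: cy].
have cg (g : C -> R) (h0 s0 : R) : {for p h0 s0, continuous g} ->
    {for (h0, s0), continuous (fun z : C => g (p z.1 z.2))}.
  by move=> gc; apply: (continuous_comp (f := fun z : C => p z.1 z.2)); [exact: cp|].
have cM (z : C) (g1 g2 : C -> R) : {for z, continuous g1} -> {for z, continuous g2} ->
    {for z, continuous (fun y => g1 y * g2 y)} by move=> *; exact: continuousM.
have cD (z : C) (g1 g2 : C -> R) : {for z, continuous g1} -> {for z, continuous g2} ->
    {for z, continuous (fun y => g1 y + g2 y)} by move=> *; exact: continuousD.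
have cc (z : C) (r : R) : {for z, continuous (fun _ : C => r)} by exact: cst_continuous.
have cy1 h0 s0 : {for (h0, s0), continuous (fun z : C => (y z.1).1)}.
  by apply: (continuous_comp (f := fun z : C => y z.1)); [exact: cy|exact: fst_continuous].
have cy2 h0 s0 : {for (h0, s0), continuous (fun z : C => (y z.1).2)}.
  by apply: (continuous_comp (f := fun z : C => y z.1)); [exact: cy|exact: snd_continuous].
have cB h0 s0 : `|h0| <= d -> 0 <= s0 <= 1 ->
    {for (h0, s0), continuous (fun z : C => B z.1 z.2)}.
  move=> hd s01; have Up := pU _ _ hd s01.
  have c1 := cg _ _ _ (smooth_at_continuous (sP Up)).
  have c2 := cg _ _ _ (smooth_at_continuous (sQ Up)).
  have c3 := cg _ _ _ (smooth_at_continuous (smooth_at_derive v (sP Up))).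
  have c4 := cg _ _ _ (smooth_at_continuous (smooth_at_derive v (sQ Up))).
  exact: (cD _ _ _ (cM _ snd _ (@snd_continuous R _)
     (cD _ _ _ (cM _ _ _ (cy1 h0 s0) c3) (cM _ _ _ (cy2 h0 s0) c4)))
     (cD _ _ _ (cM _ _ _ c1 (cc _ _)) (cM _ _ _ c2 (cc _ _)))).
have cf h0 s0 : `|h0| <= d -> 0 <= s0 <= 1 ->
    {for (h0, s0), continuous (fun z : C => f z.1 z.2)}.
  move=> hd s01; have Up := pU _ _ hd s01.
  have c1 := cg _ _ _ (smooth_at_continuous (sP Up)).
  have c2 := cg _ _ _ (smooth_at_continuous (sQ Up)).
  exact: (cD _ _ _ (cM _ _ _ c1 (cy1 h0 s0)) (cM _ _ _ c2 (cy2 h0 s0))).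
have slice (g : C -> R) h s : {for (h, s), continuous g} ->
    {for s, continuous (fun s => g (h, s))}.
  move=> gc; apply: (continuous_comp (f := fun s : R => (h, s))) => //.
  by apply: continuous_pair; [exact: cst_continuous|exact: cvg_id].
(* [B] is bounded on the compact rectangle [-d, d] x [0, 1]; the constant [K] is the dominating
   function for differentiation under the integral. *)
have [K K0 HK] : exists2 K : R, 0 <= K & forall h s, `|h| <= d -> 0 <= s <= 1 -> `|B h s| <= K.
  pose Kc := `[- d, d]%classic `*` `[0, 1 : R]%classic.
  have cK : compact Kc by apply: compact_setX; exact: segment_compact.
  have Kc0 : Kc !=set0.
    by exists (0, 0); split; rewrite /= in_itv /= ?oppr_le0 ?(ltW d0) ?lexx ?ler01.
  have cBK : {within Kc, continuous (fun z : C => `|B z.1 z.2|)}.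
    apply: continuous_in_subspaceT => -[h s]; rewrite inE => -[/=].
    rewrite !in_itv /= -ler_norml => hd s01.
    apply: (continuous_comp (f := fun z : C => B z.1 z.2)); first exact: cB.
    exact: norm_continuous.
  have [c _ Hc] := compact_EVT_max Kc0 cK cBK.
  exists `|B c.1 c.2| => // h s hd s01; apply: (Hc (h, s)).
  by rewrite inE; split; rewrite /= in_itv //= -ler_norml.
have mB : measurable (`[0, 1 : R]%classic : set (measurableTypeR R)) by exact: measurable_itv.
have Ia : `]- d, d[%classic (0 : R) by rewrite /= in_itv /= oppr_lt0 d0.
have Id h : `]- d, d[%classic h -> `|h| <= d.
  by rewrite /= in_itv /= => /andP[h1 h2]; rewrite ler_norml !ltW.
have cint (g : R -> R) : (forall s : R, 0 <= s <= 1 -> {for s, continuous g}) ->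
    {within `[0, 1]%classic, continuous g}.
  by move=> gc; apply: continuous_in_subspaceT => s; rewrite inE /= in_itv /=; exact: gc.
have intf h : `]- d, d[%classic h -> mu.-integrable `[0, 1]%classic (EFin \o f h).
  move=> /Id hd; apply: continuous_compact_integrable; first exact: segment_compact.
  by apply: cint => s s01; exact: (slice _ _ _ (cf _ _ hd s01)).
have derf h s : `]- d, d[%classic h -> `[0, 1]%classic s -> derivable (f^~ s) h 1.
  by move=> /Id hd; rewrite /= in_itv /= => s01; have [] := df _ _ hd s01.
have G0 (s : R) : 0 <= (fun _ : R => K) s by [].
have intG : mu.-integrable `[0, 1]%classic (EFin \o (fun _ : R => K)).
  apply: continuous_compact_integrable; first exact: segment_compact.
  by apply: cint => s _; exact: cst_continuous.
have p1E h s : `|h| <= d -> 0 <= s <= 1 -> partial1of2 f h s = B h s.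
  by move=> hd s01; rewrite partial1of2E; have [_ ->] := df _ _ hd s01.
have Gub h s : `]- d, d[%classic h -> `[0, 1]%classic s -> `|partial1of2 f h s| <= K.
  by move=> /Id hd; rewrite /= in_itv /= => s01; rewrite p1E //; exact: HK.
have D1 := derivable_under_integral mB Ia intf derf G0 intG Gub.
have D2 := differentiation_under_integral mB Ia intf derf G0 intG Gub.
have a0 : (fun h => a (x + h *: v)) = (fun h => Rintegral mu `[0, 1]%classic (fun s => f h s)) by [].
(* Closedness enters here: it makes [B 0 s] the derivative in s of [s * al (p 0 s) v], which goes
   from 0 to [al x v] on [0, 1]. *)
have E0 : Rintegral mu `[0, 1]%classic (fun s => B 0 s) = al x v.
  pose H (s : R) := s * al (p 0 s) v.
  have y0 : y 0 = x - x0 by rewrite /y scale0r addr0.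
  have Up s : 0 <= s <= 1 -> U (p 0 s) by apply: pU; rewrite normr0 ltW.
  have dH (s : R) : 0 <= s <= 1 -> is_derive s 1 H (B 0 s).
    move=> s01; have dg (g : C -> R) : differentiable g (p 0 s) ->
        is_derive s 1 (fun s => g (p 0 s)) ('D_(x - x0) g (p 0 s)).
      by move=> dg; rewrite -y0; apply: is_derive_line.
    have dP' := smooth_at_diff (sP (Up _ s01)); have dQ' := smooth_at_diff (sQ (Up _ s01)).
    have h1 := is_derive_mulP (dg P dP') (is_derive_cst v.1 s 1).
    have h2 := is_derive_mulP (dg Q dQ') (is_derive_cst v.2 s 1).
    refine (is_derive_conv (is_derive_mulP (is_derive_id s 1) (is_derive_addP h1 h2)) _).
    rewrite /B y0 /al.
    rewrite (DE (x - x0) dP') (DE (x - x0) dQ') (DE v dP') (DE v dQ') (closedPQ (Up _ s01)).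
    move: ('D_(1, 0) P _) ('D_(0, 1) P _) ('D_(0, 1) Q _) (P _) (Q _) (x - x0) => e1 e2 e3 e4 e5 z /=.
    by ring.
  have cBs (s : R) : 0 <= s <= 1 -> {for s, continuous (B 0)}.
    by move=> s01; apply: (slice (fun z => B z.1 z.2)); apply: cB; rewrite ?normr0 ?(ltW d0).
  have cHs (s : R) : 0 <= s <= 1 -> {for s, continuous H}.
    move=> s01; have [dHs _] := dH _ s01.
    by apply: differentiable_continuous; apply/derivable1_diffP.
  have cHat : derivable_oo_LRcontinuous H 0 1.
    split.
    - by move=> s; rewrite in_itv /= => /andP[s0 s1]; have [|] := dH s; rewrite ?(ltW s0) ?(ltW s1).
    - by apply: cvg_at_right_filter; apply: cHs; rewrite lexx ler01.
    - by apply: cvg_at_left_filter; apply: cHs; rewrite lexx ler01.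
  have DHs : {in `]0, 1[, derive1 H =1 B 0}.
    move=> s; rewrite in_itv /= => /andP[s0 s1]; rewrite derive1E.
    by have [|_ ->] := dH s; rewrite ?(ltW s0) ?(ltW s1).
  have := continuous_FTC2 ltr01 (cint _ cBs) cHat DHs.
  rewrite /Rintegral => ->; rewrite /= /H mul1r mul0r subr0 /p scale1r y0.
  by rewrite [x0 + _]addrC subrK.
have d00 : `|0 : R| <= d by rewrite normr0 ltW.
have E1 : Rintegral mu `[0, 1]%classic (fun s => partial1of2 f 0 s)
    = Rintegral mu `[0, 1]%classic (fun s => B 0 s).
  apply: eq_Rintegral => s; rewrite inE /= in_itv /= => s01; exact: p1E.
rewrite /= E1 E0 derive1E in D2.
have D : is_derive (0 : R) 1 (fun h => a (x + h *: v)) (al x v) by rewrite a0; split.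
have EE : (fun h : R => h^-1 *: ((a \o shift x) (h *: v) - a x))
   = (fun h : R => h^-1 *: (((fun h => a (x + h *: v)) \o shift 0) (h *: 1) - a (x + 0 *: v))).
  by apply: funext => h /=; rewrite [h *: 1]mulr1 addr0 scale0r addr0 [x + _]addrC.
case: D => da1 da2; apply: DeriveDef; first by rewrite /derivable EE.
by rewrite /derive EE.
Qed.

Lemma closed_form_exact : exists b : C -> R, smooth_on U b /\
  forall x v, U x -> 'D_v b x = P x * v.1 + Q x * v.2.
Proof.
exists a.
have cPQ y : U y -> {for y, continuous P} /\ {for y, continuous Q}.
  by move=> Uy; split; apply: smooth_at_continuous; [exact: sP|exact: sQ].
have da x : U x -> differentiable a x /\ forall v, 'D_v a x = P x * v.1 + Q x * v.2.
  move=> Ux; apply: (partials_differentiable oU Ux cU cPQ) => y v Uy.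
  exact: primitive_derive.
split; last by move=> x v Ux; exact: (da _ Ux).2.
case=> [|k]; first by move=> x Ux; apply: differentiable_continuous; exact: (da _ Ux).1.
split=> [x Ux|v]; first exact: (da _ Ux).1.
apply: (@Ck_on_eq _ _ _ _ _ (fun x => P x * v.1 + Q x * v.2)) => //.
  by move=> x Ux; rewrite (da _ Ux).2.
have sPk : Ck_on k U P by apply: (smooth_onP P oU).2.
have sQk : Ck_on k U Q by apply: (smooth_onP Q oU).2.
by apply: Ck_onD => //; apply: Ck_onM => //; exact: Ck_on_cst.
Qed.

End Primitive.

(** The form - dF o j is closed exactly because [F] is harmonic. The sign makes F + i a holomorphic,
    and it is the sign of the relation w^* lambda = - df o j satisfied by a holomorphic curve. *)
Lemma harmonic_conjugate (U : set C) (F : C -> R) (x0 : C) : open U -> convex_region U ->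
  U x0 -> smooth_on U F ->
  (forall x, U x -> 'D_(1, 0) ('D_(1, 0) F) x + 'D_(0, 1) ('D_(0, 1) F) x = 0) ->
  exists a : C -> R, smooth_on U a /\ forall x v, U x -> 'D_v a x = - 'D_(rot v) F x.
Proof.
move=> oU cU Ux0 sF hF.
have sFx x : U x -> smooth_at x F by move=> Ux; exact: smooth_at_on sF.
pose P x := - 'D_(0, 1) F x; pose Q := 'D_(1, 0) F.
have sP x : U x -> smooth_at x P by move=> Ux; exact/smooth_atN/smooth_at_derive/sFx.
have sQ x : U x -> smooth_at x Q by move=> Ux; exact/smooth_at_derive/sFx.
have cl x : U x -> 'D_(1, 0) Q x = 'D_(0, 1) P x.
  move=> Ux; rewrite deriveN; last exact/diff_derivable/smooth_at_diff/smooth_at_derive/sFx.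
  by apply/eqP; rewrite -addr_eq0; apply/eqP; exact: hF.
have [a [sa Da]] := closed_form_exact oU cU Ux0 sP sQ cl.
exists a; split=> // x v Ux; rewrite (Da _ _ Ux) /P /Q.
have dF := smooth_at_diff (sFx _ Ux).
rewrite [rot v]e12E !(deriveE _ dF) linearD !linearZ /= /GRing.scale /=.
by move: ('d F x _) ('d F x _) => p q; ring.
Qed.

End Poincare.

(** * The Reeb flow *)

Section SmoothBig.
Context {R : realType}.
Implicit Types V : normedModType R.

Lemma smooth_at_bigsum V (I : Type) (r : seq I) (x : V) (f : I -> V -> R) :
  (forall i, smooth_at x (f i)) -> smooth_at x (fun y => \sum_(i <- r) f i y).
Proof.
move=> H; elim: r => [|i r IH].
  under eq_fun do rewrite big_nil; exact: smooth_at_cst.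
by under eq_fun do rewrite big_cons; exact: smooth_atD.
Qed.

Lemma smooth_at_bigprod V (I : Type) (r : seq I) (x : V) (f : I -> V -> R) :
  (forall i, smooth_at x (f i)) -> smooth_at x (fun y => \prod_(i <- r) f i y).
Proof.
move=> H; elim: r => [|i r IH].
  under eq_fun do rewrite big_nil; exact: smooth_at_cst.
by under eq_fun do rewrite big_cons; exact: smooth_atM.
Qed.

Lemma smooth_at_det V n (x : V) (B : V -> 'M[R]_n) :
  (forall i j, smooth_at x (fun y => B y i j)) -> smooth_at x (fun y => \det (B y)).
Proof.
move=> H; rewrite /determinant; apply: smooth_at_bigsum => s.
by apply: smooth_atM; [exact: smooth_at_cst|exact: smooth_at_bigprod].
Qed.

Lemma smooth_at_adj V n (x : V) (B : V -> 'M[R]_n) i j :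
  (forall i j, smooth_at x (fun y => B y i j)) -> smooth_at x (fun y => (\adj (B y)) i j).
Proof.
move=> H; under eq_fun do rewrite mxE /cofactor.
apply: smooth_atM; first exact: smooth_at_cst.
apply: smooth_at_det => k l; under eq_fun do rewrite !mxE; exact: H.
Qed.

Lemma smooth_atV V (x : V) (f : V -> R) : f x != 0 -> smooth_at x f ->
  smooth_at x (fun y => (f y)^-1).
Proof.
move=> fx sf k; have [N [oN Nx] HN] := sf k.
have cf := smooth_at_continuous sf.
have n0 : \forall y \near x, f y != 0.
  have : `|f x| > 0 by rewrite normr_gt0.
  move=> fp; have : \forall y \near x, `|f x - f y| < `|f x| by move/cvgrPdist_lt : cf; apply.
  by apply: filterS => y; apply: contraTneq => ->; rewrite subr0 ltxx.
have [M [oM Mx] HM] := near_openP n0.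
exists (N `&` M); first by split=> //; exact: openI.
apply: Ck_onV; [exact: openI|by move=> y [_ /HM]|].
exact: Ck_on_sub HN.
Qed.

Lemma smooth_at_rV V n (x : V) (f : V -> 'rV[R]_n) :
  (forall j, smooth_at x (fun y => f y 0 j)) -> smooth_at x f.
Proof.
move=> H; have -> : f = fun y => \sum_j (f y 0 j) *: delta_mx 0 j.
  by apply: funext => y; rewrite {1}[f y]row_sum_delta.
apply: smooth_at_sum => j k; have [N [oN Nx] HN] := H j k.
by exists N => //; exact: Ck_onZl.
Qed.

(** The derivatives along a finite spanning family are bounded near [x], and a ball contains the
    segments between its points. This supplies the Lipschitz constant of the Reeb field for ODE
    uniqueness. *)
Lemma smooth_lipschitz V (f : V -> R) (x : V) : fdim V -> smooth_at x f ->
  exists K d : R, [/\ 0 < K, 0 < d & forall y y', `|y - x| < d -> `|y' - x| < d ->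
    `|f y - f y'| <= K * `|y - y'|].
Proof.
move=> [n [e [c [cc ce]]]] sf.
have /choice[k Hk] i : exists k, 0 < k /\ forall v, `|c i v| <= k * `|v|.
  by have [k k0 H] := linear_bound (cc i); exists k.
pose b i := `|'D_(e i) f x| + 1.
have b0 i : 0 < b i by rewrite ltr_wpDl.
have nb : \forall y \near x, forall i, `|'D_(e i) f y| <= b i.
  suff : forall i, \forall y \near x, `|'D_(e i) f y| <= b i.
    by move=> H; apply: filter_forall.
  move=> i; have ci := smooth_at_continuous (smooth_at_derive (e i) sf).
  have : \forall y \near x, `|'D_(e i) f x - 'D_(e i) f y| < 1.
    by move/cvgrPdist_lt : ci; apply.
  apply: filterS => y; rewrite distrC => h; rewrite /b -lerBlDl.
  exact: le_trans (lerB_dist _ _) (ltW h).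
have /near_normP[d d0 Hd] := near_and (smooth_at_near_diff sf) nb.
pose K := \sum_i k i * b i + 1; have K1 : 0 <= \sum_i k i * b i.
  by apply: sumr_ge0 => i _; rewrite mulr_ge0 // ltW //; have [] := Hk i.
exists K, d; split=> //; first by rewrite /K ltr_wpDl.
move=> y y' hy hy'.
have seg (s : R) : 0 <= s <= 1 -> `|y' + s *: (y - y') - x| < d.
  move=> s01; have := @convex_ball R V x d y' (y - y') s.
  rewrite -ball_normE /ball_ /= ![`|x - _|]distrC; apply => //.
  by rewrite [y' + _]addrC subrK.
have [s /andP[s0 s1]] := @mvt_dir R V f y' (y - y') (fun s h => (Hd _ (seg s h)).1).
rewrite [y' + _]addrC subrK => ->.
have s01 : 0 <= s <= 1 by rewrite !ltW.
have [ds bs] := Hd _ (seg _ s01).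
rewrite (derive_sum_coords (ce _) ds); apply: le_trans (ler_norm_sum _ _ _) _.
rewrite /K mulrDl mul1r; apply: (@le_trans _ _ ((\sum_i k i * b i) * `|y - y'|)); last by rewrite lerDl.
rewrite mulr_suml; apply: ler_sum => i _; rewrite normrZ mulrAC.
by apply: ler_pM => //; have [_] := Hk i.
Qed.

End SmoothBig.

Section PullbackForm.
Context {R : realType}.
Variables (W V : normedModType R) (M : manifold V).
Hypothesis fV : fdim V.
Variable al : M -> {linear V -> R^o}.
Hypothesis sal : smooth_form (fun x v => al x v).
Let af (x : M) (v : V) : R := al x v.

Lemma form_in_chart_linear (p : M) y a u v : img p y ->
  form_in_chart af p y (a *: u + v) = a * form_in_chart af p y u + form_in_chart af p y v.
Proof.
move=> py; rewrite /form_in_chart /af /transition_der.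
have st : smooth_at (chart p (inv p y)) (chart (inv p y) \o inv p).
  by rewrite chart_invK //; apply: transition_smooth_at => //; exact: dom_self.
by rewrite (derive_dir_linear _ _ _ (smooth_at_diff st)) linearP.
Qed.

Lemma form_in_chart_smooth (p : M) y v : img p y ->
  smooth_at y (fun y => form_in_chart af p y v).
Proof. by move=> py; apply: (smooth_at_on _ py (sal p v)); exact: chart_img_open. Qed.

Lemma form_in_chart_der (g : W -> M) (q : M) (x : W) v :
  sm_into g x -> dom q (g x) ->
  af (g x) (der_into g x v) = form_in_chart af q (chart q (g x)) ('D_v (chart q \o g) x).
Proof.
move=> [cg sg] qx; rewrite /form_in_chart chartK //; congr (al _ _).
have dg := dom_self (g x).
have [sq _] := chart_change_at fV cg dg qx sg.
by rewrite /der_into; have [_ ->] := chart_change_at fV cg qx dg sq.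
Qed.

(** [der_into] refers to the chart centred at the moving point [g y]. Near [x] all the terms are
    rewritten in the one chart centred at [g x], where [pullback_d] applies. *)
Lemma pullback_form (g : W -> M) (U : set W) (x : W) v1 v2 : open U -> U x ->
  (forall x, U x -> sm_into g x) ->
  'D_v1 (fun x => af (g x) (der_into g x v2)) x -
  'D_v2 (fun x => af (g x) (der_into g x v1)) x =
  ext_der af (g x) (der_into g x v1) (der_into g x v2).
Proof.
move=> oU Ux sg; have [cg sgx] := sg _ Ux.
pose q := g x; have dq : dom q (g x) by exact: dom_self.
have nq : \forall y \near x, U y /\ dom q (g y).
  by apply: near_and; [exact: open_nbhs_nbhs|exact: near_dom].
have E v : \forall y \near x, form_in_chart af q ((chart q \o g) y) ('D_v (chart q \o g) y)
    = af (g y) (der_into g y v).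
  by apply: filterS nq => y [Uy qy]; rewrite (form_in_chart_der v (sg _ Uy) qy).
rewrite -(near_eq_derive _ (E v2)) -(near_eq_derive _ (E v1)).
apply: (@pullback_d R W V fV (img q) (form_in_chart af q) (chart q \o g) x).
- exact: chart_img_open.
- by move=> y v py; exact: form_in_chart_smooth.
- by move=> y a u v py; exact: form_in_chart_linear.
- exact: sgx.
- exact: img_chart.
Qed.

Fact scale_diff_linear (a p1 p2 q1 q2 : R) :
  a *: (p1 : R^o) + p2 - (a *: (q1 : R^o) + q2) = a * (p1 - q1) + (p2 - q2).
Proof. by rewrite mulrBr [in RHS]addrACA -opprD. Qed.

Fact oppr_comb (a p q : R) : - (a * p + q) = a * - p + - q.
Proof. by rewrite mulrN opprD. Qed.

Lemma ext_der_linear_l (x : M) a u1 u2 v :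
  ext_der af x (a *: u1 + u2) v = a * ext_der af x u1 v + ext_der af x u2 v.
Proof.
rewrite /ext_der; have px := img_chart (dom_self x).
have sf v' := form_in_chart_smooth v' px.
rewrite (derive_dir_linear _ _ _ (smooth_at_diff (sf v))).
have E : \forall y \near chart x x, a *: form_in_chart af x y u1 + form_in_chart af x y u2 =
    form_in_chart af x y (a *: u1 + u2).
  have : \forall y \near chart x x, img x y.
    by apply: open_nbhs_nbhs; split=> //; exact: chart_img_open.
  by apply: filterS => y py; rewrite form_in_chart_linear.
rewrite -(near_eq_derive _ E) deriveD.
- rewrite deriveZ; first exact: scale_diff_linear.
  exact/diff_derivable/smooth_at_diff/sf.
- exact/derivableZ/diff_derivable/smooth_at_diff/sf.
- exact/diff_derivable/smooth_at_diff/sf.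
Qed.

Lemma ext_der_anti (x : M) u v : ext_der af x u v = - ext_der af x v u.
Proof. by rewrite /ext_der opprB. Qed.

Lemma ext_der_linear_r (x : M) a u v1 v2 :
  ext_der af x u (a *: v1 + v2) = a * ext_der af x u v1 + ext_der af x u v2.
Proof.
rewrite ext_der_anti ext_der_linear_l (ext_der_anti x u v1) (ext_der_anti x u v2).
exact: oppr_comb.
Qed.

End PullbackForm.

Section TransitionDer.
Context {R : realType} {V : normedModType R}.
Hypothesis fV : fdim V.
Variable (M : manifold V).

Lemma transition_der_comp (p q r x : M) v : dom p x -> dom q x -> dom r x ->
  transition_der q r x (transition_der p q x v) = transition_der p r x v.
Proof.
move=> px qx rx; rewrite /transition_der.
have ip := img_chart px.
have cg : {for chart p x, continuous (inv p)} by exact: Defs.inv_continuous.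
have qx' : dom q (inv p (chart p x)) by rewrite chartK.
have rx' : dom r (inv p (chart p x)) by rewrite chartK.
have sq := transition_smooth_at ip qx'.
have [_ ->] := chart_change_at fV cg qx' rx' sq.
by rewrite chartK.
Qed.

Lemma transition_der_id (p x : M) v : dom p x -> transition_der p p x v = v.
Proof.
move=> px; rewrite /transition_der -[RHS](derive_id (chart p x) v).
apply: derive_eq_on; [exact: (chart_img_open p)|exact: img_chart|].
by move=> y py /=; rewrite chart_invK.
Qed.

Lemma transition_der_linear (p q x : M) a u v : dom p x -> dom q x ->
  transition_der p q x (a *: u + v) = a *: transition_der p q x u + transition_der p q x v.
Proof.
move=> px qx; apply: derive_dir_linear; apply: smooth_at_diff.
by apply: transition_smooth_at; [exact: img_chart|rewrite chartK].
Qed.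

Lemma transition_derE (p x : M) v : dom p x ->
  transition_der p x x v = der_into (inv p) (chart p x) v.
Proof. by move=> px; rewrite /transition_der /der_into chartK. Qed.

End TransitionDer.

Fact bilinear_comb (R : realType) (a d1 d2 l l1 l2 : R) :
  a * d1 + d2 + l * (a * l1 + l2) = a * (d1 + l * l1) + (d2 + l * l2).
Proof. ring. Qed.

Section ReebField.
Context {R : realType} {n : nat}.
Local Notation m := (n.*2.+1).
Local Notation V := 'rV[R]_m.
Context {Q : manifold V}.
Variable ct : contact_triad Q.
Let la (x : Q) (v : V) : R := lam ct x v.
Let sla : smooth_form la := lam_smooth ct.
Let fV : fdim V := fdim_rV m.

(** [reeb] is given point by point, each value in the chart centred at its own point, with no
    regularity attached. The coefficients in one fixed chart are what an ODE can use, and their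
    smoothness is deduced from that of lambda. *)
Definition reeb_in_chart (p : Q) (y : V) : V :=
  transition_der (inv p y) p (inv p y) (reeb ct (inv p y)).

Section InChart.
Variable p : Q.
Let lc (y v : V) : R := form_in_chart la p y v.
Let dlc (y v1 v2 : V) : R := 'D_v1 (fun y => lc y v2) y - 'D_v2 (fun y => lc y v1) y.

Let T y v := transition_der p (inv p y) (inv p y) v.
Let S y v := transition_der (inv p y) p (inv p y) v.

Let TS y v : img p y -> T y (S y v) = v.
Proof.
move=> py; have dp := inv_dom py; have dx := dom_self (inv p y).
by rewrite /T /S (transition_der_comp fV) // transition_der_id.
Qed.

Let ST y v : img p y -> S y (T y v) = v.
Proof.
move=> py; have dp := inv_dom py; have dx := dom_self (inv p y).
by rewrite /T /S (transition_der_comp fV) // transition_der_id.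
Qed.

(** [ext_der] at a point is computed in the chart centred there; naturality of d under the
    parametrization [inv p] compares it with the derivative computed in the fixed chart [p]. *)
Let dlcE y v1 v2 : img p y -> dlc y v1 v2 = ext_der la (inv p y) (T y v1) (T y v2).
Proof.
move=> py; have dp := inv_dom py.
have E z v : img p z -> lc z v = la (inv p z) (der_into (inv p) z v).
  by move=> pz; rewrite /lc /form_in_chart transition_derE ?chart_invK //; exact: inv_dom.
have TE v : T y v = der_into (inv p) y v by rewrite /T (transition_derE v dp) chart_invK.
rewrite (TE v1) (TE v2) -(@pullback_form R V V Q fV (lam ct) sla (inv p) (img p) y v1 v2
  (chart_img_open p) py (fun z => sm_inv fV)).
have H v w : 'D_w (fun z => lc z v) y = 'D_w (fun z => la (inv p z) (der_into (inv p) z v)) y.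
  exact: (derive_eq_on w (chart_img_open p) py (fun z => E z v)).
exact: (congr2 (fun a b : R => a - b) (H v2 v1) (H v1 v2)).
Qed.

Let lc_reeb y : img p y -> lc y (reeb_in_chart p y) = 1.
Proof.
move=> py; rewrite /lc /form_in_chart -[transition_der p _ _ _]/(T y (S y (reeb ct (inv p y)))).
by rewrite TS //; exact: reeb_lam.
Qed.

Let dlc_reeb y v : img p y -> dlc y (reeb_in_chart p y) v = 0.
Proof.
by move=> py; rewrite dlcE // -[reeb_in_chart p y]/(S y (reeb ct (inv p y))) TS // reeb_ext.
Qed.

Let lc_lin y a u v : img p y -> lc y (a *: u + v) = a * lc y u + lc y v.
Proof. exact: form_in_chart_linear. Qed.

Let dlc_linl y a u1 u2 v : img p y -> dlc y (a *: u1 + u2) v = a * dlc y u1 v + dlc y u2 v.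
Proof.
move=> py; rewrite !dlcE // /T transition_der_linear; [|exact: inv_dom|exact: dom_self].
exact: ext_der_linear_l.
Qed.

Let dlc_linr y a u v1 v2 : img p y -> dlc y u (a *: v1 + v2) = a * dlc y u v1 + dlc y u v2.
Proof.
move=> py; rewrite !dlcE // /T transition_der_linear; [|exact: inv_dom|exact: dom_self].
exact: ext_der_linear_r.
Qed.

Let sum_lin (f : V -> R) : (forall a u v, f (a *: u + v) = a * f u + f v) ->
  forall v : V, f v = \sum_i v 0 i * f (delta_mx 0 i).
Proof.
move=> fl v; have f0 : f 0 = 0.
  by have := fl 1 0 0; rewrite scale1r addr0 mul1r => /eqP; rewrite -subr_eq0 opprD addNKr oppr_eq0 => /eqP.
rewrite {1}[v]row_sum_delta; elim: (index_enum _) => [|i r IH]; first by rewrite !big_nil.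
by rewrite !big_cons fl IH.
Qed.

Let B (y : V) : 'M[R]_m := \matrix_(i, j) (dlc y (delta_mx 0 i) (delta_mx 0 j)
  + lc y (delta_mx 0 i) * lc y (delta_mx 0 j)).
Let ell (y : V) : 'rV[R]_m := \row_j lc y (delta_mx 0 j).

Let mulB y (v : V) j : img p y ->
  (v *m B y) 0 j = dlc y v (delta_mx 0 j) + lc y v * lc y (delta_mx 0 j).
Proof.
move=> py; rewrite mxE.
rewrite (sum_lin (f := fun v => dlc y v (delta_mx 0 j))); last by move=> *; exact: dlc_linl.
rewrite (sum_lin (f := fun v => lc y v)); last by move=> *; exact: lc_lin.
by rewrite mulr_suml -big_split /=; apply: eq_bigr => i _; rewrite mxE mulrDr mulrA.
Qed.

Let reeb_B y : img p y -> reeb_in_chart p y *m B y = ell y.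
Proof.
move=> py; apply/rowP => j; rewrite mulB // dlc_reeb // lc_reeb // add0r mul1r.
by rewrite mxE.
Qed.

(* dlam + lam (x) lam is non-degenerate: its kernel is killed by lam (pair it with the
   Reeb vector), hence by dlam restricted to xi. *)
Let B_unit y : img p y -> B y \in unitmx.
Proof.
move=> py; rewrite -row_free_unit; apply/row_freeP; apply/row_freeP; apply/inj_row_free.
move=> v vB.
have H u : dlc y v u + lc y v * lc y u = 0.
  have Hl a u1 u2 : (fun u => dlc y v u + lc y v * lc y u) (a *: u1 + u2) =
      a * (fun u => dlc y v u + lc y v * lc y u) u1 + (fun u => dlc y v u + lc y v * lc y u) u2.
    by rewrite (dlc_linr a v u1 u2 py) (lc_lin a u1 u2 py); exact: bilinear_comb.
  rewrite (sum_lin Hl); apply: big1 => i _ /=.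
  by rewrite -mulB // vB mxE mulr0.
have lv0 : lc y v = 0.
  have := H (reeb_in_chart p y); rewrite lc_reeb // mulr1.
  have -> : dlc y v (reeb_in_chart p y) = 0.
    by apply/eqP; rewrite -oppr_eq0 /dlc opprB -/(dlc _ _ _) dlc_reeb.
  by rewrite add0r.
have [//|vn0] := eqVneq v 0.
have Tv0 : T y v != 0.
  by apply/negP => /eqP E; move: vn0; rewrite -(ST v py) E /S /transition_der derive0 eqxx.
have lT : lam ct (inv p y) (T y v) = 0 by [].
have [v' _] := lam_contact lT Tv0.
by rewrite -(TS v' py) -dlcE //; have := H (S y v'); rewrite lv0 mul0r addr0 => ->; rewrite eqxx.
Qed.

(* Cramer: the Reeb field is the inverse of dlam + lam (x) lam applied to lam. *)
Lemma reeb_in_chart_smooth y : img p y -> smooth_at y (reeb_in_chart p).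
Proof.
move=> py.
have slc z v : img p z -> smooth_at z (fun y => lc y v).
  by move=> pz; exact: form_in_chart_smooth.
have sB z i j : img p z -> smooth_at z (fun y => B y i j).
  move=> pz; under eq_fun do rewrite mxE; apply: smooth_atD.
    by apply: smooth_atB; apply: smooth_at_derive; exact: slc.
  by apply: smooth_atM; exact: slc.
have E z : img p z -> (\det (B z))^-1 *: (ell z *m \adj (B z)) = reeb_in_chart p z.
  move=> pz; have := congr1 (mulmx^~ (invmx (B z))) (reeb_B pz).
  rewrite mulmxK ?B_unit // => ->.
  by rewrite /invmx B_unit // scalemxAr.
apply: (smooth_at_eq_on (chart_img_open p) py E).
apply: smooth_at_rV => j.
under eq_fun do rewrite !mxE.
apply: smooth_atM.
  apply: smooth_atV; first by have := B_unit py; rewrite unitmxE unitfE.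
  by apply: smooth_at_det => i k; exact: sB.
apply: smooth_at_bigsum => i; apply: smooth_atM.
  by under eq_fun do rewrite mxE; exact: slc.
by apply: smooth_at_adj => k l; exact: sB.
Qed.

End InChart.
End ReebField.

(** * Uniqueness of solutions, locally and then along a segment *)

Section OdeUniqueness.
Context {R : realType}.

Lemma is_derive_lincompP (V W : normedModType R) (L : {linear V -> W}) (f : R -> V) (s : R) d :
  continuous L -> is_derive s 1 f d -> is_derive s 1 (L \o f) (L d).
Proof.
move=> cL [df dE]; have df' : differentiable f s by apply/derivable1_diffP.
have h : 'D_1 (L \o f) s = L ('D_1 f s) by exact: derive_linear_comp.
rewrite -dE -h; apply: is_derive_diff; apply: differentiable_comp; first exact: df'.
exact: linear_differentiable.
Qed.

Lemma continuous_bigsum (T : topologicalType) (I : Type) (r : seq I) (f : I -> T -> R) x :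
  (forall i, {for x, continuous (f i)}) ->
  {for x, continuous (fun y => \sum_(i <- r) f i y)}.
Proof.
move=> H; elim: r => [|i r IH].
  have -> : (fun y => \sum_(i <- [::]) f i y) = cst 0.
    by apply: funext => y; rewrite big_nil.
  exact: cst_continuous.
have -> : (fun y => \sum_(j <- i :: r) f j y) = (fun y => f i y + \sum_(j <- r) f j y).
  by apply: funext => y; rewrite big_cons.
by apply: continuousD.
Qed.

Fact half_le0 (q : R) : q <= 2^-1 * q -> q <= 0.
Proof. lra. Qed.

Lemma ode_unique_local (V : normedModType R) (X : V -> V) (al be : R -> V) (rho : R -> R)
    (r s0 : R) : fdim V ->
  smooth_at (al s0) X -> al s0 = be s0 ->
  (\forall s \near s0, is_derive (s : R) 1 al (rho s *: X (al s))) ->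
  (\forall s \near s0, is_derive (s : R) 1 be (rho s *: X (be s))) ->
  (\forall s \near s0, `|rho s| <= r) ->
  \forall s \near s0, al s = be s.
Proof.
move=> fV sX ab0 dal dbe rb.
have [n [e [c [cc ce]]]] := fV.
have r0 : 0 <= r by have := nbhs_singleton rb; apply: le_trans.
have cont (f : R -> V) : (\forall s \near s0, is_derive (s : R) 1 f (rho s *: X (f s))) ->
    \forall s \near s0, {for s, continuous f}.
  by apply: filterS => s [df _]; apply: differentiable_continuous; apply/derivable1_diffP.
have /choice[K HK] j : exists K, exists d, [/\ 0 < K, 0 < d & forall y y' : V,
    `|y - al s0| < d -> `|y' - al s0| < d ->
    `|c j (X y) - c j (X y')| <= K * `|y - y'|].
  exact: (@smooth_lipschitz R V (c j \o X) _ fV (smooth_at_lincomp (cc j) sX)).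
have /choice[d Hd] := HK.
pose KK := \sum_j K j.
have KK0 : 0 <= KK by apply: sumr_ge0 => j _; have [/ltW] := Hd j.
have KKj j : K j <= KK.
  rewrite /KK (bigD1 j) //= lerDl; apply: sumr_ge0 => k _; by have [/ltW] := Hd k.
pose C := \sum_j `|e j|.
have C0 : 0 <= C by apply: sumr_ge0.
have Cj j : `|e j| <= C.
  by rewrite /C (bigD1 j) //= lerDl; apply: sumr_ge0.
have normC v : `|v| <= C * \sum_j `|c j v|.
  rewrite {1}[v]ce; apply: le_trans (ler_norm_sum _ _ _) _.
  by rewrite mulr_sumr; apply: ler_sum => j _; rewrite normrZ mulrC; exact: ler_wpM2r.
have nd : \forall y \near al s0, forall j, `|y - al s0| < d j.
  by apply: filter_forall => j; apply: near_norm_lt; have [] := Hd j.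
have nal : \forall s \near s0, forall j, `|al s - al s0| < d j.
  have ca : {for s0, continuous al} := nbhs_singleton (cont _ dal); exact: (ca _ nd).
have nbe : \forall s \near s0, forall j, `|be s - al s0| < d j.
  have ca : {for s0, continuous be} := nbhs_singleton (cont _ dbe).
  by move: nd; rewrite ab0 => nd; exact: (ca _ nd).
have /near_normP[et et0 Het] := near_and (near_and dal dbe) (near_and rb (near_and nal nbe)).
(* Product of the constants met on the way: n coordinates, [r] for the speed, [KK] for the Lipschitz
   bounds of the field, [C] for the comparison of the norm with [g]. The summand 1 makes it
   invertible. *)
pose A := n%:R * (r * (KK * C)) + 1.
have A0 : 0 < A by rewrite ltr_wpDl // !mulr_ge0.
have [de [de0 deet deA]] : exists de : R, [/\ 0 < de, de < et & de * A <= 2^-1].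
  have m0 : 0 < Num.min et (A^-1) by rewrite lt_min et0 invr_gt0.
  have h1 : Num.min et A^-1 <= et by rewrite ge_min lexx.
  have h2 : Num.min et A^-1 <= A^-1 by rewrite ge_min lexx orbT.
  exists (Num.min et A^-1 / 2); split; [by rewrite divr_gt0| |].
    by apply: lt_le_trans h1; rewrite ltr_pdivrMr // ltr_pMr // ltr1n.
  rewrite mulrAC ler_pdivrMr // mulVf //.
  by rewrite -[leRHS](mulVf (lt0r_neq0 A0)) ler_pM2r.
pose D s := al s - be s.
pose g s := \sum_j `|c j (D s)|.
have g0 s : 0 <= g s by apply: sumr_ge0.
have inS s : s \in `[s0 - de, s0 + de] -> `|s - s0| <= de.
  by rewrite in_itv /= -ler_distl.
have inE' s : s \in `[s0 - de, s0 + de] -> `|s - s0| < et.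
  by move=> /inS h; exact: le_lt_trans h deet.
have dD j (s : R) : `|s - s0| < et ->
    is_derive s 1 (fun s => c j (D s)) (rho s * (c j (X (al s)) - c j (X (be s)))).
  move=> hs; have [[da db] _] := Het _ hs.
  refine (is_derive_conv (is_derive_lincompP (cc j) (is_deriveB da db)) _).
  by rewrite -scalerBr linearZ linearB.
have cg : {within `[s0 - de, s0 + de], continuous g}.
  apply: continuous_in_subspaceT => s /set_mem/= hs.
  apply: continuous_bigsum => j.
  apply: (continuous_comp (f := fun s => c j (D s))); last exact: norm_continuous.
  have [dj _] := dD j _ (inE' _ hs).
  by apply: differentiable_continuous; apply/derivable1_diffP.
have ne0 : `[s0 - de, s0 + de]%classic !=set0.
  by exists s0; rewrite /= in_itv /= gerBl lerDl (ltW de0).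
have [s1 /set_mem/= hs1 Hs1] := compact_EVT_max ne0 (@segment_compact _ _ _) cg.
have M0 : g s1 <= 0.
  have key j : `|c j (D s1)| <= de * (r * (KK * (C * g s1))).
    have [|s s01] := @mvt_dir R R (fun s => c j (D s)) s0 (s1 - s0).
      move=> s /andP[sa sb]; apply/derivable1_diffP.
      have [|//] := dD j (s0 + s *: (s1 - s0)).
      rewrite addrC addKr normrZ (ger0_norm sa).
      by apply: le_lt_trans (inE' _ hs1); rewrite ler_piMl.
    case/andP: s01 => sa sb.
    have -> : c j (D s0) = 0 by rewrite /D ab0 subrr linear0.
    rewrite subr0 [s0 + _]addrC subrK => ->.
    set s2 := s0 + s *: (s1 - s0).
    have hs2' : `|s2 - s0| <= de.
      rewrite /s2 addrC addKr normrZ (gtr0_norm sa); apply: le_trans (inS _ hs1).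
      by rewrite ler_piMl // ltW.
    have hs2 : `|s2 - s0| < et by exact: le_lt_trans hs2' deet.
    have [dj Ej] := dD j _ hs2; have [_ [rb2 [al2 be2]]] := Het _ hs2.
    have dj' : differentiable (fun s => c j (D s)) s2 by apply/derivable1_diffP.
    rewrite -[s1 - s0]mulr1 -[_ * 1]/((s1 - s0) *: (1 : R)) (derive_scale_dir _ _ dj') Ej.
    rewrite normrZ normrM; apply: ler_pM => //; first exact: inS.
    apply: ler_pM => //.
    have [_ _ Hj] := Hd j; apply: le_trans (Hj _ _ (al2 j) (be2 j)) _.
    apply: ler_pM => //; first by have [/ltW] := Hd j.
    apply: le_trans (normC _) _; apply: ler_wpM2l => //.
    by apply: (Hs1 s2); rewrite inE /= in_itv /= -ler_distl.
  have : g s1 <= n%:R * (de * (r * (KK * (C * g s1)))).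
    apply: le_trans (ler_sum _ (fun j _ => key j)) _.
    by rewrite sumr_const card_ord mulr_natl.
  have E : n%:R * (de * (r * (KK * (C * g s1)))) = de * (A - 1) * g s1.
    by rewrite /A addrK; ring.
  have : de * (A - 1) * g s1 <= 2^-1 * g s1.
    apply: ler_wpM2r => //; by apply: le_trans deA; rewrite ler_pM2l // gerBl.
  move=> h1 h2; rewrite E in h2; exact: half_le0 (le_trans h2 h1).
have := near_norm_lt s0 de0; apply: filterS => s hs.
have gs : g s <= 0.
  by apply: le_trans M0; apply: Hs1; rewrite inE /= in_itv /= -ler_distl ltW.
apply/eqP; rewrite -subr_eq0 -normr_eq0 eq_le normr_ge0 andbT.
apply: le_trans (normC _) _; rewrite -/(D s) -/(g s).
by rewrite mulr_ge0_le0.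
Qed.

End OdeUniqueness.

(** Continuation principle: both [P] and its negation persist near each point of [A] where they
    hold, so the set where [P] holds is open and closed in [A]. It serves for segments and for whole
    surfaces. *)
Lemma connected_all (T : topologicalType) (A : set T) (P : T -> Prop) :
  connected A -> (exists2 x, A x & P x) ->
  (forall x, A x -> P x -> \forall y \near x, P y) ->
  (forall x, A x -> ~ P x -> \forall y \near x, ~ P y) ->
  forall x, A x -> P x.
Proof.
move=> cA [x0 Ax0 Px0] oP oN x Ax.
have E : A `&` [set y | P y] = A.
  apply: cA.
  - by exists x0.
  - exists (interior [set y | P y]); first exact: open_interior.
    apply/seteqP; split=> y [Ay Py]; split=> //; last exact: interior_subset.
    exact: oP.
  - exists (~` (interior [set y | ~ P y])).
      by apply: open_closedC; exact: open_interior.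
    apply/seteqP; split=> y [Ay Py]; split=> //.
      by move/interior_subset.
    by apply: contrapT => nP; apply: Py; exact: oN.
by move: Ax; rewrite -{1}E => -[].
Qed.

Lemma hausdorff_near_neq (T U : topologicalType) (f g : T -> U) (x : T) :
  hausdorff_space U -> {for x, continuous f} -> {for x, continuous g} -> f x <> g x ->
  \forall y \near x, f y <> g y.
Proof.
move=> hU cf cg fg.
move: hU; rewrite open_hausdorff => /(_ (f x) (g x)).
have -> : f x != g x by apply/eqP.
move=> /(_ isT) [[A B] /= [fA gB] [oA oB AB]].
have nA : \forall y \near x, A (f y) by apply: cf; apply: open_nbhs_nbhs; split=> //; exact: set_mem.
have nB : \forall y \near x, B (g y) by apply: cg; apply: open_nbhs_nbhs; split=> //; exact: set_mem.
apply: filterS (near_and nA nB) => y [Ay By] E.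
have : (A `&` B) (f y) by split=> //; rewrite E.
by rewrite (eqP AB).
Qed.

Section ReebUnique.
Context {R : realType} {n : nat}.
Local Notation V := 'rV[R]_(n.*2.+1).
Context {Q : manifold V}.
Variable ct : contact_triad Q.

(** The speed [rho] varies because these paths arise by restricting a map tangent to the Reeb field
    to a segment of a half-plane. *)
Definition reeb_path (J : set R) (rho : R -> R) (al : R -> Q) :=
  forall s : R, J s -> {for s, continuous al} /\
    is_derive s 1 (chart (al s) \o al) (rho s *: reeb ct (al s)).

Lemma reeb_path_in_chart J rho al (p : Q) (s : R) : reeb_path J rho al -> J s ->
  dom p (al s) ->
  is_derive s 1 (chart p \o al) (rho s *: reeb_in_chart ct p (chart p (al s))).
Proof.
move=> H Js ps; have [ca [da Da]] := H _ Js.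
have dq := dom_self (al s).
have st : smooth_at ((chart (al s) \o al) s) (chart p \o inv (al s)).
  by apply: transition_smooth_at; [exact: img_chart|rewrite /= chartK].
have nE : \forall t \near s, ((chart p \o inv (al s)) \o (chart (al s) \o al)) t = (chart p \o al) t.
  have : \forall t \near s, dom (al s) (al t).
    by apply: ca; apply: open_nbhs_nbhs; split=> //; exact: dom_open.
  by apply: filterS => t qt /=; rewrite chartK.
apply: near_eq_is_derive nE _.
have da' : differentiable (chart (al s) \o al) s by apply/derivable1_diffP.
have E : 'D_1 ((chart p \o inv (al s)) \o (chart (al s) \o al)) s =
    rho s *: reeb_in_chart ct p (chart p (al s)).
  rewrite (derive_comp _ da' (smooth_at_diff st)) Da (derive_scale_dir _ _ (smooth_at_diff st)).
  by rewrite /reeb_in_chart chartK.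
rewrite -E; apply: is_derive_diff; apply: differentiable_comp; first exact: da'.
exact: smooth_at_diff.
Qed.

(** Coincidence is an open condition by local uniqueness in a chart around the common value, and a
    closed one because [Q] is Hausdorff. The open set [J] around [0, 1] makes derivatives at the end
    points two-sided. *)
Lemma reeb_path_unique (J : set R) (rho : R -> R) (al be : R -> Q) :
  open J -> (forall s, 0 <= s <= 1 -> J s) ->
  (forall s, J s -> {for s, continuous rho}) ->
  reeb_path J rho al -> reeb_path J rho be -> al 0 = be 0 ->
  forall s, 0 <= s <= 1 -> al s = be s.
Proof.
move=> oJ J01 crho Ha Hb ab0.
have itv01 (s : R) : `[0, 1]%classic s <-> 0 <= s <= 1 by rewrite /= in_itv.
suff H : forall s : R, `[0, 1]%classic s -> al s = be s.
  by move=> s s01; apply: H; apply/itv01.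
apply: (connected_all (@segment_connected R 0 1)).
- by exists 0 => //; apply/itv01; rewrite lexx ler01.
- move=> s /itv01/J01 Js E.
  pose p := al s; have dp : dom p (al s) by exact: dom_self.
  have nJ : \forall t \near s, J t by exact: open_nbhs_nbhs.
  have [ca _] := Ha _ Js; have [cb _] := Hb _ Js.
  have na : \forall t \near s, dom p (al t).
    by apply: ca; apply: open_nbhs_nbhs; split=> //; exact: dom_open.
  have nb : \forall t \near s, dom p (be t).
    by apply: cb; apply: open_nbhs_nbhs; split; [exact: dom_open|rewrite -E].
  have nr : \forall t \near s, `|rho t| <= `|rho s| + 1.
    have : \forall t \near s, `|rho s - rho t| < 1 by move/cvgrPdist_lt : (crho _ Js); apply.
    apply: filterS => t; rewrite distrC => h; rewrite -lerBlDl.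
    exact: le_trans (lerB_dist _ _) (ltW h).
  have sX : smooth_at ((chart p \o al) s) (reeb_in_chart ct p).
    by apply: reeb_in_chart_smooth; exact: img_chart.
  have E' : (chart p \o al) s = (chart p \o be) s by rewrite /= E.
  have da : \forall t \near s, is_derive (t : R) 1 (chart p \o al)
      (rho t *: reeb_in_chart ct p ((chart p \o al) t)).
    by apply: filterS (near_and nJ na) => t [Jt pt]; exact: reeb_path_in_chart Ha Jt pt.
  have db : \forall t \near s, is_derive (t : R) 1 (chart p \o be)
      (rho t *: reeb_in_chart ct p ((chart p \o be) t)).
    by apply: filterS (near_and nJ nb) => t [Jt pt]; exact: reeb_path_in_chart Hb Jt pt.
  have := ode_unique_local (fdim_rV _) sX E' da db nr.
  move=> nE; apply: filterS (near_and nE (near_and na nb)) => t /= [Et [pa pb]].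
  by rewrite -(chartK pa) Et chartK.
- move=> s /itv01/J01 Js; apply: hausdorff_near_neq.
  + exact: mhausdorff.
  + by have [] := Ha _ Js.
  + by have [] := Hb _ Js.
Qed.

End ReebUnique.

(** * Punctures and their ends *)

Section Polar.
Context {R : realType}.
Local Notation C := (R * R)%type.
Implicit Types (t a b : R).

Lemma circle_nat t n : cos (2 * pi * (t + n%:R)) = cos (2 * pi * t) /\
  sin (2 * pi * (t + n%:R)) = sin (2 * pi * t) :> R.
Proof.
have -> : 2 * pi * (t + n%:R) = 2 * pi * t + (pi *+ 2) *+ n.
  by rewrite mulrDr -(mulr_natr (pi *+ 2) n) -(mulr_natl pi 2).
by rewrite (periodicn (@cosD2pi R)) (periodicn (@sinD2pi R)).
Qed.

Lemma circle_int t (k : int) : cos (2 * pi * (t + k%:~R)) = cos (2 * pi * t) /\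
  sin (2 * pi * (t + k%:~R)) = sin (2 * pi * t) :> R.
Proof.
case: k => k; first exact: circle_nat.
rewrite NegzE mulrNz; have [] := circle_nat (t - k.+1%:R) k.+1.
by rewrite subrK => -> ->.
Qed.

(** The fractional part r of a - b satisfies cos (2 pi r) = 1, so sin (pi r) = 0 by the duplication
    formula, whereas sin (pi r) > 0 for 0 < r < 1. *)
Lemma circle_inj a b : cos (2 * pi * a) = cos (2 * pi * b) ->
  sin (2 * pi * a) = sin (2 * pi * b) -> exists k : int, a = b + k%:~R.
Proof.
move=> hc hs; pose d := a - b; pose k := Num.floor d; pose r := d - k%:~R.
exists k.
have cd : cos (2 * pi * r) = 1.
  have [E _] := circle_int r k; rewrite -E /r subrK /d mulrBr cosB hc hs -!expr2.
  exact: cos2Dsin2.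
have /andP[r0 r1] : 0 <= r < 1.
  have /andP[h1 h2] := floor_itv d; rewrite /r subr_ge0 h1 /= ltrBlDl.
  by move: h2; rewrite intrD addrC.
have [r_0|rn0] := eqVneq r 0.
  by move/eqP: r_0; rewrite /r subr_eq0 => /eqP <-; rewrite /d addrC subrK.
exfalso; have rp : 0 < r by rewrite lt_neqAle eq_sym rn0.
have : 0 < sin (pi * r).
  apply: sin_gt0_pi; rewrite mulr_gt0 ?pi_gt0 //=.
  by rewrite -[ltRHS]mulr1 ltr_pM2l ?pi_gt0.
have E : 2 * pi * r = (pi * r) *+ 2 by rewrite -(mulr_natl (pi * r) 2) mulrA.
move: cd; rewrite E cos_mulr2n => h.
have c1 : cos (pi * r) ^+ 2 = 1.
  by move: h; move: (cos _ ^+ 2) => z; lra.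
have : sin (pi * r) ^+ 2 = 0 by rewrite sin2cos2 c1 subrr.
by move/eqP; rewrite sqrf_eq0 => /eqP ->; rewrite ltxx.
Qed.

Lemma circle_onto (c s : R) : c ^+ 2 + s ^+ 2 = 1 ->
  exists2 t, 0 <= t <= 1 & cos (2 * pi * t) = c /\ sin (2 * pi * t) = s.
Proof.
move=> cs1; have pi0 : 0 < 2 * pi :> R by rewrite mulr_gt0 // pi_gt0.
have c1 : -1 <= c <= 1.
  rewrite -ler_norml -(@expr_le1 R 2) // real_normK ?num_real //.
  by rewrite -cs1 lerDl sqr_ge0.
have [/andP[a0 api] ca] := acos_def c1; have sa := sin_acos c1.
have s2 : 1 - c ^+ 2 = s ^+ 2 by rewrite -cs1 addrC addKr.
rewrite s2 sqrtr_sqr in sa.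
pose t := acos c / (2 * pi); have tE : 2 * pi * t = acos c.
  by rewrite /t mulrC divfK // gt_eqF.
have t0 : 0 <= t by rewrite divr_ge0 // ltW.
have t1 : t <= 1.
  rewrite ler_pdivrMr // mul1r; apply: le_trans api _.
  by rewrite ler_peMl ?pi_ge0 // ler1n.
have [s0|s0] := leP 0 s.
  by exists t; rewrite ?t0 // tE ca sa ger0_norm.
exists (1 - t); first by rewrite subr_ge0 t1 gerBl.
have -> : 2 * pi * (1 - t) = - acos c + pi *+ 2.
  by rewrite mulrBr mulr1 tE addrC -(mulr_natl pi 2).
by rewrite cosD2pi sinD2pi cosN sinN ca sa ltr0_norm // opprK.
Qed.

Lemma Ck_on_fun1 k (f df : R -> R) : (forall x : R, is_derive x 1 f (df x)) ->
  Ck_on k setT df -> Ck_on k.+1 setT f.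
Proof.
move=> Hf Hdf.
have dff x : differentiable f x by apply/derivable1_diffP; have [] := Hf x.
split=> [x _|v]; first exact: dff.
apply: (@Ck_on_eq _ _ _ _ _ (fun x => df x * v)) => //; first exact: openT.
  move=> x _; rewrite -[v in RHS]mulr1 -[v * 1]/(v *: (1 : R)).
  rewrite (derive_scale_dir v _ (dff x)) /GRing.scale /= mulrC.
  by have [_ ->] := Hf x.
by apply: Ck_onM => //; [exact: openT|exact: Ck_on_cst].
Qed.

Lemma expR_smooth (x : R) : smooth_at x (@expR R).
Proof.
suff H k : Ck_on k setT (@expR R) by move=> k; exists setT => //; split=> //; exact: openT.
elim: k => [|k IH]; last by apply: (Ck_on_fun1 (df := expR)).
by move=> y _; exact: continuous_expR.
Qed.

Lemma cos_sin_smooth (x : R) : smooth_at x (@cos R) /\ smooth_at x (@sin R).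
Proof.
suff H k : Ck_on k setT (@cos R) /\ Ck_on k setT (@sin R).
  by split=> k; have [h1 h2] := H k; exists setT => //; split=> //; exact: openT.
elim: k => [|k [IHc IHs]].
  by split=> y _; [exact: continuous_cos|exact: continuous_sin].
split; last by apply: (Ck_on_fun1 (df := cos)).
apply: (Ck_on_fun1 (df := fun x => - sin x)) => //.
by apply: Ck_onN => //; exact: openT.
Qed.

Definition polar (x : C) : C :=
  expR (- (2 * pi * x.1)) *: ((cos (2 * pi * x.2), - sin (2 * pi * x.2)) : C).

Lemma polar_cnorm2 x : cnorm2 (polar x) = expR (- (2 * pi * x.1)) ^+ 2.
Proof.
rewrite /cnorm2 /polar /= /GRing.scale /= !exprMn sqrrN -mulrDr cos2Dsin2 mulr1.
by [].
Qed.

Lemma polar_neq0 x : polar x != 0.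
Proof. by rewrite -cnorm2_eq0 polar_cnorm2 sqrf_eq0 gt_eqF // expR_gt0. Qed.

Lemma polar_period x (k : int) : polar (x.1, x.2 + k%:~R) = polar x.
Proof. by rewrite /polar /=; have [-> ->] := circle_int x.2 k. Qed.

Lemma polar_inj x y : polar x = polar y -> x.1 = y.1 /\ exists k : int, x.2 = y.2 + k%:~R.
Proof.
move=> E; have := congr1 (@cnorm2 R) E; rewrite !polar_cnorm2 => /eqP.
rewrite eqrXn2 ?expR_ge0 // => /eqP Ee.
have E1 : x.1 = y.1.
  have /expR_inj/oppr_inj := Ee; apply: mulfI.
  by rewrite gt_eqF // mulr_gt0 // pi_gt0.
split=> //; move: E; rewrite /polar Ee => -[].
rewrite /GRing.scale /= => /(mulfI (lt0r_neq0 (expR_gt0 _))) hc.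
move=> /(mulfI (lt0r_neq0 (expR_gt0 _)))/oppr_inj hs.
exact: circle_inj.
Qed.

Lemma polar_norm_le x : `|polar x| <= expR (- (2 * pi * x.1)).
Proof.
have e0 : 0 <= expR (- (2 * pi * x.1)) :> R by exact: expR_ge0.
apply: norm_pair_le; rewrite /= /GRing.scale /= normrM ger0_norm //.
  by rewrite ler_piMr // cos_max.
by rewrite ler_piMr // normrN sin_max.
Qed.

Lemma polar_onto (z : C) : z != 0 -> exists2 x : C, 0 <= x.2 <= 1 & polar x = z.
Proof.
move=> z0; have n0 : 0 < cnorm2 z.
  by rewrite lt_neqAle eq_sym cnorm2_eq0 z0 addr_ge0 // sqr_ge0.
pose r := Num.sqrt (cnorm2 z); have r0 : 0 < r by rewrite sqrtr_gt0.
have r2 : r ^+ 2 = cnorm2 z by rewrite sqr_sqrtr // ltW.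
have [|t t01 [hc hs]] := @circle_onto (z.1 / r) (- z.2 / r).
  by rewrite !expr_div_n sqrrN -mulrDl -/(cnorm2 z) r2 divff // gt_eqF.
exists (- (ln r / (2 * pi)), t) => //.
rewrite /polar /= hc hs mulrN opprK [_ * (_ / _)]mulrC divfK; last first.
  by rewrite gt_eqF // mulr_gt0 // pi_gt0.
rewrite lnK ?posrE // mulNr opprK; case: z {z0 n0 r2 hc hs} @r r0 => p q r r0.
by congr (_, _); rewrite /= /GRing.scale /= mulrC divfK // gt_eqF.
Qed.

(* z = exp (-2 pi (x.1 + i x.2)) satisfies dz = -2 pi z dx. *)
Lemma polar_derive x : smooth_at x polar /\
  forall v, 'D_v polar x = cmul (- (2 * pi) *: polar x) v.
Proof.
pose p (y : C) : R := - (2 * pi * y.1); pose q (y : C) : R := 2 * pi * y.2.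
have sp : smooth_at x p.
  apply: smooth_atN; apply: smooth_atM; first exact: smooth_at_cst.
  exact: (@smooth_at_lin R _ _ x fstL (@fst_continuous R)).
have sq : smooth_at x q.
  apply: smooth_atM; first exact: smooth_at_cst.
  exact: (@smooth_at_lin R _ _ x sndL (@snd_continuous R)).
have f1 : fdim R := fdim_R.
have se := smooth_at_comp f1 f1 sp (expR_smooth (p x)).
have sc := smooth_at_comp f1 f1 sq (cos_sin_smooth (q x)).1.
have ss := smooth_at_comp f1 f1 sq (cos_sin_smooth (q x)).2.
have E : polar = fun y => (expR (p y) * cos (q y), - (expR (p y) * sin (q y))).
  by apply: funext => y; rewrite -mulrN.
have s1 := smooth_atM se sc; have s2 := smooth_atN (smooth_atM se ss).
have sP : smooth_at x polar by rewrite E; exact: smooth_at_pair s1 s2.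
split=> // v.
have dp : 'D_v p x = - (2 * pi * v.1).
  have := is_derive_mulP (is_derive_cst (- (2 * pi)) x v)
    (is_derive_diff v (@linear_differentiable R _ _ fstL x (@fst_continuous R))).
  rewrite (@derive_linear R _ _ fstL x v (@fst_continuous R)).
  have -> : (fun y : C => cst (- (2 * pi)) y * fstL y) = p by apply: funext => y; rewrite /p /= mulNr.
  by case=> _ ->; rewrite mulr0 addr0 /= mulNr.
have dq : 'D_v q x = 2 * pi * v.2.
  have := is_derive_mulP (is_derive_cst (2 * pi) x v)
    (is_derive_diff v (@linear_differentiable R _ _ sndL x (@snd_continuous R))).
  rewrite (@derive_linear R _ _ sndL x v (@snd_continuous R)).
  have -> : (fun y : C => cst (2 * pi) y * sndL y) = q by [].
  by case=> _ ->; rewrite mulr0 addr0.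
have D1 (f : R -> R) (d : R) (u : C -> R) : differentiable u x -> is_derive (u x) 1 f d ->
    'D_v (f \o u) x = 'D_v u x * d.
  move=> du [df Df]; have df' : differentiable f (u x) by apply/derivable1_diffP.
  rewrite (derive_comp v du df') -[X in 'D_X f _]mulr1 -[_ * 1]/('D_v u x *: (1 : R)).
  by rewrite (derive_scale_dir _ _ df') Df.
have De : 'D_v (expR \o p) x = - (2 * pi * v.1) * expR (p x).
  by rewrite (D1 _ _ _ (smooth_at_diff sp) (is_derive_expR _)) dp.
have Dc : 'D_v (cos \o q) x = 2 * pi * v.2 * - sin (q x).
  by rewrite (D1 _ _ _ (smooth_at_diff sq) (is_derive_cos _)) dq.
have Ds : 'D_v (sin \o q) x = 2 * pi * v.2 * cos (q x).
  by rewrite (D1 _ _ _ (smooth_at_diff sq) (is_derive_sin _)) dq.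
have d1 := is_derive_mulP (is_derive_diff v (smooth_at_diff se)) (is_derive_diff v (smooth_at_diff sc)).
have d2 := is_derive_mulP (is_derive_diff v (smooth_at_diff se)) (is_derive_diff v (smooth_at_diff ss)).
have d3 := smooth_at_diff s1; have d4 := smooth_at_diff s2.
rewrite E (deriveE _ (differentiable_pair d3 d4)) (diff_pair d3 d4) /= -(deriveE _ d3) -(deriveE _ d4).
have [_ E1] := d1; have [dd2 E2] := d2.
rewrite /= in E1 E2; rewrite [X in (X, _)]E1 deriveN // [X in (_, - X)]E2.
rewrite De Dc Ds /cmul /= /GRing.scale /=.
by move: (expR _) (cos _) (sin _) => e c s; congr (_, _); ring.
Qed.

End Polar.

Section LocallyConstant.
Context {R : realType}.

(** [T] carries no topology: besides functions, the lemma is applied to truth values, to show that a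
    locally constant predicate is constant. *)
Lemma locally_constant_convex (V : normedModType R) (U : set V) (T : Type) (g : V -> T) :
  convex_region U -> (forall x, U x -> \forall y \near x, g y = g x) ->
  forall x y, U x -> U y -> g y = g x.
Proof.
move=> cU gU x y Ux Uy; pose l (s : R) := x + s *: (y - x).
have lU (s : R) : `[0, 1]%classic s -> U (l s).
  by rewrite /= in_itv /= => s01; apply: cU => //; rewrite addrC subrK.
have cl (s : R) : {for s, continuous l}.
  by apply: continuousD; [exact: cst_continuous|apply: cvgZr_tmp; exact: cvg_id].
have lg (s : R) : `[0, 1]%classic s -> \forall t \near s, g (l t) = g (l s).
  by move=> s01; exact: (cl s _ (gU _ (lU _ s01))).
have H : forall s : R, `[0, 1]%classic s -> g (l s) = g x.
  apply: (connected_all (@segment_connected R 0 1)).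
  - by exists 0; rewrite /= ?in_itv /= ?lexx ?ler01 // /l scale0r addr0.
  - move=> s s01 Es; have := lg s s01; rewrite Es; exact.
  - move=> s s01 nE; have := lg s s01; apply: filterS => t -> ; exact: nE.
have := H 1; rewrite /= in_itv /= lexx ler01 /l scale1r addrC subrK; exact.
Qed.

End LocallyConstant.

Section HolomorphicInto.
Context {R : realType}.
Local Notation C := (R * R)%type.
Variable S : riemann_surface R.
Let fC : fdim C := fdim_prod fdim_R fdim_R.

Lemma transition_conformal (p q : S) y v : img p y -> dom q (inv p y) ->
  'D_(rot v) (chart q \o inv p) y = rot ('D_v (chart q \o inv p) y).
Proof. by move=> py qy; apply: transition_holomorphic; rewrite overlapE. Qed.

Definition holo_at (g : C -> S) (x : C) : Prop :=
  sm_into g x /\ forall v, der_into g x (rot v) = rot (der_into g x v).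

Lemma holo_at_chart (g : C -> S) x (q : S) v : holo_at g x -> dom q (g x) ->
  'D_(rot v) (chart q \o g) x = rot ('D_v (chart q \o g) x).
Proof.
move=> [sg hg] qx; rewrite !(der_into_chart _ fC sg qx) hg.
apply: transition_conformal; first exact/img_chart/dom_self.
by rewrite chartK //; exact: dom_self.
Qed.

Lemma holo_local_inverse (g : C -> S) (U : set C) (x0 : C) : open U -> U x0 ->
  (forall x, U x -> holo_at g x) -> der_into g x0 (1, 0) != 0 ->
  exists (W : set C) (L : S -> C), [/\ open W, W x0, W `<=` U & open (g @` W)] /\
    (forall x, W x -> L (g x) = x) /\
    forall z, (g @` W) z -> sm_fun L z /\ forall v, der_fun L z (rot v) = rot (der_fun L z v).
Proof.
move=> oU Ux0 hg d0; pose q := g x0.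
have cg x : U x -> {for x, continuous g} by move=> /hg[[]].
pose U' := U `&` g @^-1` dom q.
have oU' : open U' by apply: open_preimage_at; [exact: oU|exact: dom_open|exact: cg].
have U'x0 : U' x0 by split=> //; exact: dom_self.
pose ka := chart q \o g.
have ska : smooth_on U' ka.
  apply/(smooth_onP _ oU') => x [Ux qx]; have [[cgx sgx] _] := hg _ Ux.
  exact: (chart_change_at fC cgx (dom_self (g x)) qx sgx).1.
have cka : conformal_on U' ka.
  by move=> x v [Ux qx]; apply: holo_at_chart => //; exact: hg.
have [W [l [[oW Wx0 WU' oN] [lK sl cl]]]] := conformal_local_inverse oU' U'x0 ska cka d0.
have WU : W `<=` U by move=> x /WU'[].
have Wq x : W x -> dom q (g x) by move=> /WU'[].
have imgE : g @` W = dom q `&` chart q @^-1` (ka @` W).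
  apply/seteqP; split=> [_ [x Wx <-]|z [qz [x Wx E]]].
    by split; [exact: Wq|exists x].
  exists x => //; rewrite -(chartK qz) -(chartK (Wq _ Wx)); congr (inv q _).
  exact: E.
exists W, (l \o chart q); split; first split=> //.
  rewrite imgE; apply: open_preimage_at; [exact: dom_open|exact: oN|].
  by move=> z qz; exact: chart_continuous.
split; first by move=> x Wx /=; exact: lK.
move=> _ [x Wx <-]; set z := g x.
have pz := img_chart (dom_self z).
have qz : dom q (inv z (chart z z)) by rewrite chartK; [exact: Wq|exact: dom_self].
have st := transition_smooth_at pz qz.
have Nx : (ka @` W) ((chart q \o inv z) (chart z z)).
  by exists x => //; rewrite /= chartK //; exact: dom_self.
have sl' : smooth_at ((chart q \o inv z) (chart z z)) l by exact: smooth_at_on sl.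
split; first exact: (smooth_at_comp fC fC st sl').
move=> v; rewrite /der_fun -[(l \o chart q) \o inv z]/(l \o (chart q \o inv z)).
have d1 := smooth_at_diff st; have d2 := smooth_at_diff sl'.
rewrite !(derive_comp _ d1 d2) (transition_conformal _ pz qz).
exact: cl.
Qed.

End HolomorphicInto.

Definition halfplane (R : realType) (A : R) : set (R * R) := [set x | A < x.1].

Section Ends.
Context {R : realType}.
Local Notation C := (R * R)%type.
Let fC : fdim C := fdim_prod fdim_R fdim_R.

Lemma halfplane_open (A : R) : open (halfplane A).
Proof.
have -> : halfplane A = fst @^-1` [set x | A < x] by [].
by apply: open_comp; [move=> x _; exact: fst_continuous|exact: open_gt].
Qed.

Lemma halfplane_convex (A : R) : convex_region (halfplane A).
Proof.
move=> x v s; rewrite /halfplane /= => h1 h2 /andP[s0 s1].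
rewrite /GRing.scale /=; have : 0 <= s * (x.1 + v.1 - A) by rewrite mulr_ge0 // subr_ge0 ltW.
have [->|sn1] := eqVneq s 1; first by rewrite !mul1r.
have : 0 < (1 - s) * (x.1 - A) by rewrite mulr_gt0 // subr_gt0 // lt_neqAle sn1.
move: h1 h2; lra.
Qed.

Fact expR_lt_of_ln (d s : R) : 0 < d -> - (ln d / (2 * pi)) < s -> expR (- (2 * pi * s)) < d.
Proof.
move=> d0; have pi0 : 0 < 2 * pi :> R by rewrite mulr_gt0 // pi_gt0.
rewrite -[X in _ -> _ < X](lnK d0) ltr_expR => h.
by rewrite ltrNl -ltr_pdivrMl // mulrN mulrC.
Qed.

Section OneEnd.
Variables (S : punctured_surface R) (p : S).
Local Notation E := (pos_end p).
Let c0 := chart p p.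

Lemma pos_endE (x : C) : E x = inv p (c0 + polar x).
Proof. by []. Qed.

(** Positive and negative ends parametrize the same punctured disc up to x |-> - x. From here on
    only [pos_end] is used, and a negative puncture becomes one whose limit orbit is run with a
    negative T. *)
Lemma neg_endE (x : C) : neg_end p x = E (- x).
Proof.
rewrite /neg_end /pos_end /= !mulrN opprK cosN sinN opprK.
by [].
Qed.

Lemma pos_end_period (x : C) (k : int) : E (x.1, x.2 + k%:~R) = E x.
Proof. by rewrite !pos_endE polar_period. Qed.

Lemma end_domain : exists A0 : R, forall x, halfplane A0 x -> img p (c0 + polar x).
Proof.
have : \forall y \near c0, img p y.
  apply: open_nbhs_nbhs; split; first exact: chart_img_open.
  exact/img_chart/dom_self.
move=> /near_normP[d d0 Hd]; exists (- (ln d / (2 * pi))) => x hx; apply: Hd.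
rewrite addrC addKr; apply: le_lt_trans (polar_norm_le _) _.
exact: expR_lt_of_ln d0 hx.
Qed.

Section Domain.
Variable A0 : R.
Hypothesis HA0 : forall x, halfplane A0 x -> img p (c0 + polar x).

Lemma pos_end_chart x : halfplane A0 x -> dom p (E x) /\ chart p (E x) = c0 + polar x.
Proof. by move=> /HA0 h; rewrite pos_endE chart_invK //; split=> //; exact: inv_dom. Qed.

Lemma pos_end_neq x : halfplane A0 x -> E x <> p.
Proof.
move=> /pos_end_chart[_ h] Ep; have := polar_neq0 x; rewrite Ep in h.
by rewrite -(addKr c0 (polar x)) -h addNr eqxx.
Qed.

Lemma pos_end_inj x y : halfplane A0 x -> halfplane A0 y -> E x = E y ->
  x.1 = y.1 /\ exists k : int, x.2 = y.2 + k%:~R.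
Proof.
move=> /pos_end_chart[_ hx] /pos_end_chart[_ hy] Exy; apply: polar_inj.
by apply: (addrI c0); rewrite -hx -hy Exy.
Qed.

Lemma pos_end_holo x : halfplane A0 x -> holo_at E x /\ der_into E x (1, 0) != 0.
Proof.
move=> hx; have [sp Dp] := polar_derive x.
pose f (y : C) := c0 + polar y.
have sf : smooth_at x f by apply: smooth_atD => //; exact: smooth_at_cst.
have Df v : 'D_v f x = cmul (- (2 * pi) *: polar x) v.
  rewrite -Dp /f deriveD; [|exact: derivable_cst|exact/diff_derivable/smooth_at_diff].
  by rewrite derive_cst add0r.
have si : sm_into (inv p) (f x) by apply: sm_inv; exact: HA0.
have [sE DE] := sm_into_precomp fC fC sf si.
have pz := HA0 hx.
have DEv v : der_into E x v = 'D_('D_v f x) (chart (inv p (f x)) \o inv p) (f x) by rewrite DE.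
have tc v := transition_conformal v pz (dom_self (inv p (f x))).
split.
  by split; [exact: sE|move=> v; rewrite !DEv !Df cmul_rot tc].
rewrite DEv Df; set u := cmul _ _.
have u0 : u != 0.
  rewrite /u cmulC cmul1 scaler_eq0 negb_or polar_neq0 andbT oppr_eq0 gt_eqF //.
  by rewrite mulr_gt0 // pi_gt0.
have dp : dom p (inv p (f x)) by exact: inv_dom.
have ds := dom_self (inv p (f x)).
have tE : transition_der p (inv p (f x)) (inv p (f x)) u =
   'D_u (chart (inv p (f x)) \o inv p) (f x).
  by rewrite /transition_der chart_invK.
apply/eqP; rewrite -tE => t0.
have := transition_der_comp fC u dp ds dp; rewrite t0 (transition_der_id _ dp).
rewrite /transition_der derive0 => u0'; move: u0; rewrite -u0' eqxx; exact: notF.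
Qed.

End Domain.

(** The bound on [x.2] selects a preimage in one period of t, a compact range over which limits that
    are locally uniform in t become uniform. *)
Lemma pos_end_near A : \forall z \near p, z = p \/ exists x, [/\ halfplane A x, 0 <= x.2 <= 1 & E x = z].
Proof.
have pp := dom_self p.
have nd : \forall z \near p, dom p z by apply: open_nbhs_nbhs; split=> //; exact: dom_open.
pose eA : R := expR (- (2 * pi * A)).
(* Half of [eA] pays for passing from the maximum norm to [cnorm2]: twice (eA / 2)^2 is below
   eA^2. *)
have e0 : 0 < eA / 2 by rewrite divr_gt0 // expR_gt0.
have nc : \forall z \near p, `|c0 - chart p z| < eA / 2.
  by move/cvgrPdist_lt : (chart_continuous pp); apply.
apply: filterS (near_and nd nc) => z [dz cz].
have [E0|N0] := eqVneq (chart p z - c0) 0.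
  left; move/eqP: E0; rewrite subr_eq0 => /eqP e.
  by rewrite -(chartK dz) e; exact: chartK.
right; have [x x01 Ex] := polar_onto N0; exists x; split=> //; last first.
  by rewrite pos_endE Ex addrC subrK chartK.
have : cnorm2 (polar x) < eA ^+ 2.
  rewrite Ex; rewrite distrC in cz.
  have h1 := le_lt_trans (norm_fst _) cz; have h2 := le_lt_trans (norm_snd _) cz.
  have sq (u : R) : `|u| < eA / 2 -> u ^+ 2 < (eA / 2) ^+ 2.
    by move=> hu; rewrite -(@real_normK _ u) ?num_real // ltrXn2r // ltW.
  have := ltrD (sq _ h1) (sq _ h2); rewrite /cnorm2 => /lt_le_trans; apply.
  by move: (eA) => t; have := sqr_ge0 t; rewrite !expr2; lra.
have pi0 : 0 < 2 * pi :> R by rewrite mulr_gt0 // pi_gt0.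
rewrite polar_cnorm2 ltr_pXn2r // ?nnegrE ?expR_ge0 // /eA.
by rewrite /halfplane /= ltr_expR ltrN2 ltr_pM2l.
Qed.

Lemma pos_end_cvg (P : S -> Prop) : (\near p, P p) -> exists A, forall x, halfplane A x -> P (E x).
Proof.
move=> nP.
have ci : {for c0, continuous (inv p)}.
  by apply: Defs.inv_continuous; exact/img_chart/dom_self.
have nP' : \forall z \near inv p c0, P z by rewrite chartK //; exact: dom_self.
have /near_normP[d d0 Hd] := ci _ nP'.
exists (- (ln d / (2 * pi))) => x hx; rewrite pos_endE; apply: Hd.
rewrite addrC addKr; apply: le_lt_trans (polar_norm_le _) _.
exact: expR_lt_of_ln d0 hx.
Qed.

End OneEnd.

Section Punctures.
Variable S : punctured_surface R.

Lemma finite_punctures : finite_set (range (@puncture R S)).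
Proof. exact: finite_image. Qed.

Lemma dotted_open : open (@dotted R S).
Proof.
apply: closed_openC; apply: accessible_finite_set_closed.1; last exact: finite_punctures.
exact/hausdorff_accessible/mhausdorff.
Qed.

Lemma near_dotted (z : S) : dotted z -> \forall y \near z, dotted y.
Proof. by move=> dz; apply: open_nbhs_nbhs; split=> //; exact: dotted_open. Qed.

Lemma puncture_isolated a : \forall z \near puncture a, z = puncture a \/ @dotted R S z.
Proof.
pose F := range (@puncture R S) `\ puncture a.
have oF : open (~` F).
  apply: closed_openC; apply: accessible_finite_set_closed.1; last first.
    exact: finite_setD finite_punctures.
  exact/hausdorff_accessible/mhausdorff.
have : \forall z \near puncture a, (~` F) z.
  by apply: open_nbhs_nbhs; split=> // -[_]; apply.
apply: filterS => z nz; have [->|zn] := eqVneq z (puncture a); [by left|right].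
by move=> rz; apply: nz; split=> //; exact/eqP.
Qed.

Lemma dotted_or_puncture (z : S) : dotted z \/ exists a, z = puncture a.
Proof.
have [[a _ <-]|nz] := pselect (range (@puncture R S) z); [by right; exists a|by left].
Qed.

Lemma puncture_end a : exists A0 : R, let E := pos_end (puncture a) in
  [/\ forall x, halfplane A0 x -> holo_at E x /\ der_into E x (1, 0) != 0,
      forall x, halfplane A0 x -> @dotted R S (E x) &
      forall x y, halfplane A0 x -> halfplane A0 y -> E x = E y ->
        x.1 = y.1 /\ exists k : int, x.2 = y.2 + k%:~R].
Proof.
have [A1 HA1] := end_domain (puncture a).
have [A2 HA2] := pos_end_cvg (puncture_isolated a).
exists (Num.max A1 A2) => E.
have h1 x : halfplane (Num.max A1 A2) x -> halfplane A1 x.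
  by apply: le_lt_trans; rewrite le_max lexx.
have h2 x : halfplane (Num.max A1 A2) x -> halfplane A2 x.
  by apply: le_lt_trans; rewrite le_max lexx orbT.
split=> [x /h1 hx|x hx|x y /h1 hx /h1 hy].
- exact: pos_end_holo HA1 _ hx.
- by have [/(pos_end_neq HA1 (h1 _ hx))|] := HA2 _ (h2 _ hx).
- exact: (pos_end_inj HA1 hx hy).
Qed.

(** This is the connectedness of the punctured surface, deduced from that of the closed one. The
    condition [P] also makes sense at a puncture; there a punctured neighbourhood is the image of a
    half-plane, on which [g] is constant, so either [P] or its negation holds all around. *)
Lemma locally_constant_dotted (T : Type) (g : S -> T) :
  (forall z, dotted z -> \forall y \near z, g y = g z) ->
  forall z z', dotted z -> dotted z' -> g z = g z'.
Proof.
move=> gl z z0 dz dz0.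
pose P (z : S) := \forall y \near z, dotted y -> g y = g z0.
suff : P z by move=> /nbhs_singleton; apply.
apply: (connected_all (@ps_connected R S)) => //.
- by exists z0 => //; apply: filterS (gl _ dz0) => y ->.
- by move=> x _ Px; exact: nbhs_interior Px.
- move=> x _ nPx; have [dx|[a xE]] := dotted_or_puncture x.
    have gx := gl _ dx.
    have ng : g x <> g z0.
      by move=> E; apply: nPx; apply: filterS gx => y -> _.
    apply: filterS (near_and (near_dotted dx) gx) => y [dy gy] /nbhs_singleton/(_ dy).
    by rewrite gy.
  subst x.
  have [A0 [hE dE _]] := puncture_end a; set E := pos_end _ in hE dE.
  have gE x y : halfplane A0 x -> halfplane A0 y -> g (E y) = g (E x).
    apply: (@locally_constant_convex R _ (halfplane A0) T (g \o E)) => [|u hu].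
      exact: halfplane_convex.
    have [[[cE _] _] _] := hE _ hu.
    exact: (cE _ (gl _ (dE _ hu))).
  have h0 : halfplane A0 ((A0 + 1, 0) : C) by rewrite /halfplane /= ltrDl.
  have nE := pos_end_near (puncture a) A0.
  have ng : g (E (A0 + 1, 0)) <> g z0.
    move=> Eg; apply: nPx; apply: filterS nE => y [->|[x [hx _ <-]] _].
      by move=> dp; exfalso; apply: dp; exists a.
    by rewrite (gE _ _ h0 hx).
  apply: filterS nE => y [->//|[x [hx _ <-]]] /nbhs_singleton/(_ (dE _ hx)).
  by rewrite (gE _ _ h0 hx).
Qed.

End Punctures.
End Ends.

Lemma hausdorff_separate (T : topologicalType) (x y : T) : hausdorff_space T -> x <> y ->
  exists A B, [/\ nbhs x A, nbhs y B & forall z, A z -> B z -> False].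
Proof.
rewrite open_hausdorff => /[swap] /eqP xy /(_ _ _ xy)[[A B] /= [/set_mem Ax /set_mem By]].
move=> [oA oB /eqP AB]; exists A, B; split; [exact: open_nbhs_nbhs..|].
by move=> z Az Bz; rewrite -[False]/(@set0 T z) -AB.
Qed.

(** * Asymptotics at the punctures *)

Section EpsilonDerivative.
Context {R : realType}.

Lemma is_derive_eps (f : R -> R) (x d e : R) : is_derive x 1 f d -> 0 < e ->
  \forall y \near x, `|f y - f x - (y - x) * d| <= e * `|y - x|.
Proof.
move=> df e0; have [dx Dx] := df.
have /differentiable_epsE/(_ _ e0) : differentiable f x by exact/derivable1_diffP.
move=> /near_normP[r r0 H]; apply/near_normP; exists r => // y yx.
have := H (y - x); rewrite subr0 => /(_ yx); rewrite [x + _]addrC subrK.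
suff -> : 'd f x (y - x) = (y - x) * d by [].
rewrite -[X in 'd f x X]mulr1 -[_ * 1]/((y - x) *: (1 : R)) linearZ /=.
by rewrite -deriveE ?Dx //; exact/derivable1_diffP.
Qed.

Lemma fdim_linear_continuous (V : normedModType R) (L : {linear V -> R^o}) :
  fdim V -> continuous L.
Proof.
move=> [m [e [c [cc ce]]]].
have -> : (L : V -> R) = fun v => \sum_i c i v * L (e i).
  apply/funext => v; rewrite {1}(ce v) linear_sum; apply: eq_bigr => i _.
  by rewrite linearZ.
move=> x; apply: continuous_bigsum => i.
by apply: continuousM; [exact: cc|exact: cst_continuous].
Qed.

(** The tube lemma in filter form. The segment is one period of a Reeb orbit or of an end, and the
    filter is that of a point or of +oo. *)
Lemma segment_uniform (I : Type) (F : set_system I) (P : I -> R -> Prop) : Filter F ->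
  (forall r : R, 0 <= r <= 1 -> exists A B, [/\ nbhs r A, F B & forall x i, A x -> B i -> P i x]) ->
  F (fun i => forall r : R, 0 <= r <= 1 -> P i r).
Proof.
move=> FF H; have nc := (compact_near_coveringP _).1 (@segment_compact R 0 1).
have := nc I F P FF; set G := (fun i => _ `<=` _); move=> h.
apply: (filterS _ (h _)) => [i Gi r r01|r].
  by apply: Gi; rewrite /= in_itv.
rewrite /= in_itv /= => /H[A [B [nA FB AB]]].
by exists (A, B) => // -[x i] /= [Ax Bi]; exact: AB.
Qed.

End EpsilonDerivative.

(** * Closed Reeb orbits: their periods, and curves contained in them *)

Section ReebOrbits.
Context {R : realType} {n : nat}.
Local Notation V := 'rV[R]_(n.*2.+1).
Context {Q : manifold V}.
Variable ct : contact_triad Q.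
Let fV : fdim V := fdim_rV _.

Lemma reeb_path_comp (J : set R) (rho a : R -> R) (ga : R -> Q) :
  reeb_path ct setT (fun=> 1) ga ->
  (forall s, J s -> is_derive s 1 a (rho s)) -> reeb_path ct J rho (ga \o a).
Proof.
move=> hg ha s Js; have [cg dg] := @hg (a s) I.
have [da Da] := ha s Js; have [dg1 Dg] := dg.
have ca : {for s, continuous a}.
  by apply: differentiable_continuous; exact/derivable1_diffP.
split; first exact: continuous_comp ca cg.
have d1 : differentiable a s by exact/derivable1_diffP.
have d2 : differentiable (chart (ga (a s)) \o ga) (a s) by exact/derivable1_diffP.
rewrite -[X in is_derive _ _ X]/((chart (ga (a s)) \o ga) \o a).
apply: DeriveDef; first exact/diff_derivable/differentiable_comp.
rewrite (derive_comp _ d1 d2) Da; have := derive_scale_dir (rho s) (1 : R) d2.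
by rewrite Dg scale1r /GRing.scale /= mulr1.
Qed.

Section Orbit.
Variable ga : R -> Q.
Hypothesis hg : reeb_path ct setT (fun=> 1) ga.

Let cg s : {for s, continuous ga}. Proof. exact: (@hg s I).1. Qed.

(** Any self-coincidence is a period. The paths from parameters [s] and [s'] with the same constant
    speed r - s' start at the same point, so they agree at time 1, where they have reached s + r -
    s' and r. *)
Lemma reeb_coincide s s' : ga s = ga s' -> forall r, ga (r + (s - s')) = ga r.
Proof.
move=> E r.
have dl (k s0 : R) (x : R) : setT x -> is_derive x 1 (fun y : R => s0 + y * k) k.
  move=> _; have := @is_derive_quad R 0 k s0 x.
  rewrite mulr0 mul0r add0r; apply: is_derive_eq_on (openT) I _ => y _.
  by rewrite mul0r add0r addrC mulrC.
have cc (k : R) (x : R) : setT x -> {for x, continuous (fun=> k)}.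
  by move=> _; exact: cst_continuous.
have h0 : (ga \o (fun y : R => s + y * (r - s'))) 0 = (ga \o (fun y : R => s' + y * (r - s'))) 0.
  by rewrite /= !mul0r !addr0.
have i01 (x : R) : 0 <= x <= 1 -> setT x by [].
have := reeb_path_unique openT i01 (cc (r - s')) (reeb_path_comp hg (dl _ _))
  (reeb_path_comp hg (dl _ _)) h0.
move=> /(_ 1); rewrite lexx ler01 /= !mul1r => /(_ isT).
by rewrite addrCA => ->; rewrite addrC subrK.
Qed.

Lemma reeb_functional (q : Q) : exists L : {linear V -> R^o}, continuous L /\ L (reeb ct q) = 1.
Proof. by exists (lam ct q); split; [exact: fdim_linear_continuous|exact: reeb_lam]. Qed.

(** Composed with a linear form equal to 1 on the Reeb vector, the orbit has derivative 1 at 0 in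
    the chart; a short period [p] would give |p| <= |p| / 2. *)
Lemma reeb_period_isolated : exists2 d : R, 0 < d &
  forall p, `|p| < d -> (forall s, ga (s + p) = ga s) -> p = 0.
Proof.
have [c0 d0] := @hg 0 I; rewrite scale1r in d0.
have [L [cL L1]] := reeb_functional (ga 0).
have := is_derive_eps (is_derive_lincompP cL d0) (_ : 0 < 2^-1).
rewrite invr_gt0 ltr0n => /(_ isT) /near_normP[d d1 H]; exists d => // p pd Hp.
have := H p; rewrite !subr0 => /(_ pd); rewrite /= L1 mulr1.
have -> : ga p = ga 0 by rewrite -(Hp 0) add0r.
rewrite subrr add0r normrN => h; apply/eqP; rewrite -normr_eq0.
by have := normr_ge0 p; move: h; move: (`|p|) => t h1 h2; apply/eqP; lra.
Qed.

Variable T : R.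
Hypothesis T0 : T != 0.
Hypothesis gT : forall s, ga (s + T) = ga s.

Lemma period_mulz s (k : int) : ga (s + k%:~R * T) = ga s.
Proof.
have nat_case (m : nat) r : ga (r + m%:R * T) = ga r.
  elim: m => [|m IH]; first by rewrite mul0r addr0.
  by rewrite -natr1 mulrDl mul1r addrA gT.
case: k => m; first by rewrite -[RHS](nat_case m).
rewrite NegzE -[LHS](nat_case m.+1); congr ga.
by rewrite mulrNz mulNr -addrA addNr addr0.
Qed.

Lemma period_reduce s : exists2 r, 0 <= r <= 1 & exists k : int, s = r * T + k%:~R * T.
Proof.
exists (s / T - (Num.floor (s / T))%:~R); last first.
  by exists (Num.floor (s / T)); rewrite -mulrDl subrK divfK.
rewrite subr_ge0 lerBlDl ge_floor /=; apply/ltW.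
by have /andP[_] := floor_itv (s / T); rewrite intrD addrC.
Qed.

(** Uniformity over one turn: a parameter whose value is [ga s0] differs from [s0] by a period, and
    the others have values separated from [ga s0]. All periods of [ga] have to be allowed, as [T]
    may be a multiple of a smaller one. *)
Lemma reeb_gap s0 e : 0 < e ->
  \forall q \near ga s0, forall s, ga s = q ->
    exists2 p, (forall r, ga (r + p) = ga r) & `|s - s0 - p| < e.
Proof.
move=> e0.
pose P (q : Q) (r : R) := ga (r * T) = q ->
    exists2 p, (forall x, ga (x + p) = ga x) & `|r * T - s0 - p| < e.
have cm (r : R) : {for r, continuous (fun x : R => x * T)}.
  by apply: cvgMr_tmp; exact: cvg_id.
have HP : \forall q \near ga s0, forall r, 0 <= r <= 1 -> P q r.
  apply: segment_uniform => r r01.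
  have [E|N] := pselect (ga (r * T) = ga s0).
    exists [set x | `|x * T - r * T| < e], setT; split; last first.
    - move=> x q xe _ _; exists (r * T - s0).
        by move=> y; exact: reeb_coincide.
      by rewrite opprB addrA subrK.
    - exact: filterT.
    - by have /cvgrPdist_lt/(_ _ e0) := cm r; apply: filterS => y; rewrite distrC.
  have cgr : {for r, continuous (fun x : R => ga (x * T))}.
    by apply: continuous_comp; [exact: cm|exact: cg].
  have [A [B [nA nB AB]]] := hausdorff_separate (@mhausdorff _ _ Q) N.
  exists ((fun x : R => ga (x * T)) @^-1` A), B; split.
  - exact: cgr nA.
  - exact: nB.
  - by move=> x q Ax Bq E; exfalso; apply: AB Bq; rewrite -E.
apply: filterS HP => q HP s sq; have [r r01 [k sE]] := period_reduce s.
have [|p hp pe] := HP r r01; first by rewrite -sq sE period_mulz.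
exists (p + k%:~R * T); first by move=> x; rewrite addrA period_mulz.
by move: pe; rewrite sE; congr (`|_| < _); rewrite opprD addrACA addrA addrAC; rewrite [RHS]addrC; ring.
Qed.

End Orbit.

Lemma reeb_path_near_chart (ga : R -> Q) (s0 : R) (L : {linear V -> R^o}) (e : R) :
  reeb_path ct setT (fun=> 1) ga -> continuous L -> 0 < e ->
  \forall s \near s0, `|L (chart (ga s0) (ga s)) - L (chart (ga s0) (ga s0))
     - (s - s0) * L (reeb ct (ga s0))| <= e * `|s - s0|.
Proof.
move=> hg cL e0; have [_ d0] := @hg s0 I; rewrite scale1r in d0.
exact: (is_derive_eps (is_derive_lincompP cL d0) e0).
Qed.

Fact norm_tri1 (A p e1 e2 : R) : `|A - p| <= e1 -> `|A| <= e2 -> `|p| <= e1 + e2.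
Proof.
move=> h1 h2; rewrite -(subKr A p); apply: le_trans (ler_normB _ _) _.
by rewrite addrC lerD.
Qed.

Fact norm_tri2 (A d p e1 e2 : R) : `|A - d| <= e2 -> `|A - p| <= e1 ->
  `|d| <= `|p| + e1 + e2.
Proof.
move=> h1 h2; rewrite [leRHS]addrC; apply: (norm_tri1 h1).
rewrite -(subrK p A); apply: le_trans (ler_normD _ _) _.
by rewrite addrC lerD.
Qed.

(** Here [s] is time along the curve and [t] time along the orbit; [l] and [lu] are the transverse
    and Reeb components of the velocity. The Reeb component bounds |t| by a multiple of |s|, and the
    transverse one then gives |s| |l| <= e (2 + 2 |lu|) |s|. *)
Fact transverse_arith (s t lu l e : R) : 0 < `|l| -> 0 < e -> e <= 2^-1 ->
  e * (2 + 2 * `|lu|) < `|l| ->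
  `|s * l| <= e * `|s| + e * `|t| -> `|t| <= `|s * lu| + e * `|s| + e * `|t| -> s = 0.
Proof.
rewrite !normrM; move: `|l| `|lu| (normr_ge0 s) (normr_ge0 t) (normr_ge0 lu) => a b s0 t0 b0 a0 e0 e2 ea h1 h2.
apply/eqP; rewrite -normr_eq0; apply/eqP; move: s0 t0 h1 h2; move: `|s| `|t| => x y x0 y0 h1 h2.
have y1 : e * y <= 2^-1 * y by rewrite ler_wpM2r.
have x1 : e * x <= 2^-1 * x by rewrite ler_wpM2r.
have y2 : y <= (1 + 2 * b) * x by nra.
have : x * a <= e * (2 + 2 * b) * x by nra.
nra.
Qed.

(* If u were transverse to the Reeb field, sg would leave at once each Reeb orbit
   through sg 0; by compactness of the orbits this is uniform along them. *)
Lemma reeb_tangent (I : finType) (ga : I -> R -> Q) (T : I -> R) (sg : R -> Q) (u : V) :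
  (forall i, reeb_path ct setT (fun=> 1) (ga i)) -> (forall i, T i != 0) ->
  (forall i s, ga i (s + T i) = ga i s) ->
  {for (0 : R), continuous sg} -> is_derive (0 : R) 1 (chart (sg 0) \o sg) u ->
  (\forall s \near (0 : R), exists i t, sg s = ga i t) -> pi_xi ct (sg 0) u = 0.
Proof.
move=> hg T0 gT csg dsg near_orbit; apply: contrapT => /eqP piu0.
set q := sg 0 in dsg piu0 *.
have [j /eqP] : exists j, (pi_xi ct q u) 0 j <> 0.
  apply: contrapT => h; move/eqP: piu0; apply; apply/rowP => j.
  by apply: contrapT => hj; apply: h; exists j => E; apply: hj; rewrite E mxE.
pose l : R := pi_xi ct q u 0 j; rewrite -/l => l0.
(* A coordinate of [pi_xi] that is nonzero on [u] and zero on the Reeb vector: it detects the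
   departure of [sg] from any Reeb orbit through [sg 0]. *)
pose Lf (v : V) : R^o := (pi_xi ct q v) 0 j.
have Llin : linear Lf.
  by move=> a x y; rewrite /Lf /pi_xi linearP scalerDl opprD addrACA -scalerA -scalerBr !mxE.
pose L : {linear V -> R^o} := HB.pack Lf (GRing.isLinear.Build R V R^o _ Lf Llin).
have cL : continuous L by exact: fdim_linear_continuous.
have cl : continuous (lam ct q : V -> R^o) by exact: fdim_linear_continuous.
have LR : L (reeb ct q) = 0 by rewrite /= /Lf /pi_xi reeb_lam scale1r subrr mxE.
pose lu : R := lam ct q u.
pose e := Num.min 2^-1 (`|l| / (2 * (2 + 2 * `|lu|))).
have k0 : 0 < 2 + 2 * `|lu| by rewrite ltr_pwDl // mulr_ge0.
have ln0 : 0 < `|l| by rewrite normr_gt0.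
have e0 : 0 < e by rewrite lt_min invr_gt0 ltr0n /= divr_gt0 // mulr_gt0.
have e2 : e <= 2^-1 by rewrite ge_min lexx.
have ea : e * (2 + 2 * `|lu|) < `|l|.
  rewrite -ltr_pdivlMr //; apply: (@le_lt_trans _ _ (`|l| / (2 * (2 + 2 * `|lu|)))).
    by rewrite ge_min lexx orbT.
  by rewrite invfM mulrCA mulrC ltr_pdivrMr // ltr_pMr ?divr_gt0 // ltr1n.
have H1 := is_derive_eps (is_derive_lincompP cL dsg) e0.
have H2 := is_derive_eps (is_derive_lincompP cl dsg) e0.
pose P i (s r : R) := sg s = ga i (r * T i) -> s = 0.
have HP i : \forall s \near (0 : R), forall r : R, 0 <= r <= 1 -> P i s r.
  apply: segment_uniform => r r01.
  have cm (x : R) : {for x, continuous (fun x : R => x * T i)}.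
    by apply: cvgMr_tmp; exact: cvg_id.
  have cgi (s : R) : {for s, continuous (ga i)} by exact: (@hg i s Logic.I).1.
  have [E|N] := pselect (q = ga i (r * T i)); last first.
    have [A [B [nA nB AB]]] := hausdorff_separate (@mhausdorff _ _ Q) N.
    exists ((fun x : R => ga i (x * T i)) @^-1` B), (sg @^-1` A); split.
    - have cgr : {for r, continuous (fun x : R => ga i (x * T i))}.
        by apply: continuous_comp; [exact: cm|exact: cgi].
      exact: cgr nB.
    - exact: csg nA.
    - by move=> x s Bx As Es; exfalso; apply: AB As _; rewrite Es.
  have G1 := reeb_path_near_chart (r * T i) (hg i) cL e0.
  have G2 := reeb_path_near_chart (r * T i) (hg i) cl e0.
  rewrite -E in G1 G2.
  eexists; eexists; split.
  - exact: (cm r _ (near_and G1 G2)).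
  - exact: (near_and H1 H2).
  - move=> x s [g1 g2] [h1 h2] Es; rewrite !subr0 in h1 h2.
    rewrite -Es LR mulr0 subr0 in g1; rewrite -Es reeb_lam mulr1 in g2.
    apply: (@transverse_arith s (x * T i - r * T i) lu l e) => //.
      exact: norm_tri1 h1 g1.
    exact: norm_tri2 g2 h2.
have HA : \forall s \near (0 : R), forall i, forall r : R, 0 <= r <= 1 -> P i s r.
  exact: (@filter_forall R I (fun i s => forall r : R, 0 <= r <= 1 -> P i s r) _ _ HP).
have /near_normP[d d0 Hd] := near_and near_orbit HA.
have sd : `|d / 2 - 0| < d.
  by rewrite subr0 gtr0_norm ?divr_gt0 // ltr_pdivrMr // ltr_pMr // ltr1n.
have [[i [t sE]] HAs] := Hd _ sd.
(* At s = d / 2 the point [sg s] lies on an orbit. Once its parameter is reduced to one period, the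
   uniform statement forces d / 2 = 0. *)
have [r r01 [k tE]] := period_reduce (T0 i) t.
have := HAs i r r01; rewrite /P sE tE (period_mulz (gT i)) => /(_ erefl) d20.
by move: d0; rewrite -[d](divfK (_ : 2 != 0)) ?pnatr_eq0 // d20 mul0r ltxx.
Qed.

End ReebOrbits.

Section Asymptotics.
Context {R : realType} {n : nat}.
Local Notation V := 'rV[R]_(n.*2.+1).
Local Notation C := (R * R)%type.
Context {Q : manifold V}.
Variables (ct : contact_triad Q) (S : punctured_surface R).

(** One format for both kinds of punctures: the phase is absorbed in [ga], and a negative puncture
    is recorded by a negative [T], which is why only T != 0 is asked. The limit is locally uniform
    in t. *)
Definition end_orbit (w : S -> Q) (a : 'I_(npos S) + 'I_(nneg S)) (ga : R -> Q) (T : R) :=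
  [/\ T != 0, reeb_path ct setT (fun=> 1) ga, forall s, ga (s + T) = ga s &
      forall (t : R) (P : Q -> Prop), (\forall q \near ga (T * t), P q) ->
        exists A : R, \forall t' \near t, forall tau : R, A < tau ->
          P (w (pos_end (puncture a) (tau, t')))].

Lemma orbit_reeb_path (g : closed_reeb_orbit ct) (k : R) :
  reeb_path ct setT (fun=> 1) (fun s => g (s + k)).
Proof.
have hg : reeb_path ct setT (fun=> 1) g.
  move=> s _; split; first exact: orbit_continuous.
  by rewrite scale1r; exact: orbit_reeb.
apply: (reeb_path_comp hg) => s _; have := @is_derive_quad R 0 1 k s.
rewrite mulr0 mul0r add0r; apply: is_derive_eq_on (openT) Logic.I _ => y _.
by rewrite mul0r add0r mul1r.
Qed.

Lemma end_asymptotic (gm : 'I_(nneg S) -> closed_reeb_orbit ct)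
    (gp : 'I_(npos S) -> closed_reeb_orbit ct) (w : S -> Q) a :
  asymptotic gm gp w -> exists ga T, end_orbit w a ga T.
Proof.
case: a => a [hp hn].
  have [t0 H] := hp a; pose P := period (gp a).
  exists (fun s => gp a (s + P * t0)), P; split.
  - by rewrite gt_eqF // period_gt0.
  - exact: orbit_reeb_path.
  - by move=> s; rewrite addrAC orbit_periodic.
  - move=> t A; rewrite -mulrDr => /(H t)[[A1 A2] /= [[M [_ HM]] H2] HA].
    by exists M; apply: filterS H2 => t' At' tau tM; apply: (HA (tau, t')); split=> //=; exact: HM.
have [t0 H] := hn a; pose P := period (gm a).
exists (fun s => gm a (s + P * t0)), (- P); split.
- by rewrite oppr_eq0 gt_eqF // period_gt0.
- exact: orbit_reeb_path.
- by move=> s; rewrite -[LHS]orbit_periodic -/P addrAC subrK.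
- move=> t A; rewrite mulNr -mulrN -mulrDr => /(H (- t))[[A1 A2] /= [[M [_ HM]] H2] HA].
  exists (- M); have : \forall t' \near t, A2 (- t') by exact: (opp_continuous t _ H2).
  apply: filterS => t' At' tau tM; have := HA (- tau, - t').
  rewrite /preimage /= neg_endE.
  have -> : - (- tau, - t') = (tau, t') :> C by exact: (opprK ((tau, t') : C)).
  by apply; split=> //=; apply: HM; rewrite ltrNl.
Qed.

Lemma end_uniform (P : C -> Prop) :
  (forall t : R, 0 <= t <= 1 -> exists A : R, \forall t' \near t, forall tau : R, A < tau -> P (tau, t')) ->
  exists A : R, forall x, halfplane A x -> 0 <= x.2 <= 1 -> P x.
Proof.
move=> H.
have /= [M [_ HM]] : \forall A \near +oo, forall t : R, 0 <= t <= 1 -> forall tau : R, A < tau -> P (tau, t).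
  apply: segment_uniform => t /H[A HA].
  exists [set t' | forall tau : R, A < tau -> P (tau, t')], [set B | A < B]; split=> //.
    by exists A; split=> //; exact: num_real.
  by move=> t' B /= h AB tau Bt; apply: h; exact: lt_trans AB Bt.
exists (M + 1) => -[tau t] h t01; apply: (HM (M + 1)) => //.
by rewrite ltrDl.
Qed.

Section Translated.
Variables (w : S -> Q) (f : S -> R) (phi : S -> S) (c : R).
Hypothesis c0 : 0 < c.
Hypothesis dphi : forall z, dotted z -> dotted (phi z).
Hypothesis fphi : forall z, dotted z -> f (phi z) = f z + c.
Hypothesis wphi : forall z, dotted z -> w (phi z) = w z.

Lemma iter_dotted m z : dotted z -> dotted (iter m phi z).
Proof. by move=> dz; elim: m => //= m; exact: dphi. Qed.

Lemma iter_f m z : dotted z -> f (iter m phi z) = f z + m%:R * c.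
Proof.
move=> dz; elim: m => [|m IH]; first by rewrite mul0r addr0.
by rewrite /= fphi ?IH; [rewrite -natr1 mulrDl mul1r addrA|exact: iter_dotted].
Qed.

Lemma iter_w m z : dotted z -> w (iter m phi z) = w z.
Proof. by move=> dz; elim: m => //= m IH; rewrite wphi //; exact: iter_dotted. Qed.

(** Compactness of the closed surface gives a cluster point, and continuity of [f] excludes a dotted
    one since f (phi^m z) = f z + m c. Only a cluster point is obtained: at this stage the orbit
    might visit several punctures. *)
Lemma orbit_clusters z : (forall z, dotted z -> {for z, continuous f}) -> dotted z ->
  exists a, forall N B, nbhs (puncture a) B -> exists2 m, (N <= m)%N & B (iter m phi z).
Proof.
move=> cf dz; pose F := (fun m => iter m phi z) @ \oo.
have [p _ Hp] : exists2 p : S, setT p & cluster F p.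
  have FT : F setT by exact: filterT.
  by have [p [_ cp]] := @ps_compact R S F _ FT; exists p.
have Hp' N B : nbhs p B -> exists2 m, (N <= m)%N & B (iter m phi z).
  move=> nB; have [|y [[m Nm <-] By]] := Hp [set iter m phi z | m in [set m | (N <= m)%N]] B _ nB.
    by exists N => // m Nm; exists m.
  by exists m.
have [dp|[a pa]] := dotted_or_puncture p; last by exists a; rewrite -pa.
exfalso; have nB : \forall y \near p, f y < f p + 1.
  have /cvgrPdist_lt/(_ _ ltr01) := cf _ dp; apply: filterS => y.
  by rewrite ltr_norml => /andP[h _]; move: h; move: (f y) (f p) => u v; lra.
set x := (f p + 1 - f z) / c; have [m Nm] := Hp' (Num.bound `|x|) _ nB.
rewrite iter_f // -ltrBrDl -ltr_pdivlMr // -/x => h.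
have := lt_le_trans (lt_trans h (le_lt_trans (ler_norm _) (archi_boundP (normr_ge0 _)))) (_ : _ <= m%:R).
by rewrite ler_nat => /(_ Nm); rewrite ltxx.
Qed.

(** [w] is constant along the orbit of [z]. If [w z] were not on [ga], then [w] would avoid this
    value far out in the end, uniformly over one turn, although the orbit keeps entering that
    region. *)
Lemma value_on_orbit z a ga T : dotted z -> end_orbit w a ga T ->
  (forall B, nbhs (puncture a) B -> exists m, B (iter m phi z)) ->
  exists s, w z = ga s.
Proof.
move=> dz [T0 hg gT lim] Hz; apply: contrapT => nex.
have [A HA] : exists A, forall x : C, halfplane A x -> 0 <= x.2 <= 1 -> w (pos_end (puncture a) x) <> w z.
  apply: end_uniform => t _; apply: (lim t (fun q => q <> w z)).
  have N : ga (T * t) <> w z by move=> E; apply: nex; exists (T * t).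
  have [B [B' [nB nB' BB]]] := hausdorff_separate (@mhausdorff _ _ Q) N.
  by apply: filterS nB => q Bq qE; apply: BB Bq _; rewrite qE; exact: nbhs_singleton nB'.
have [m [pE|[x [hx x01 Ex]]]] := Hz _ (pos_end_near (puncture a) A).
  by have := @iter_dotted m z dz; rewrite pE; apply; exists a.
by have := HA _ hx x01; rewrite Ex iter_w.
Qed.

End Translated.
End Asymptotics.

Section NearIdentity.
Context {R : realType}.
Local Notation C := (R * R)%type.
Variables (Th : C -> C) (B0 M : R).
Hypothesis cTh : forall x, B0 <= x.1 -> {for x, continuous Th}.
Hypothesis lTh : forall x x', B0 <= x.1 -> B0 <= x'.1 ->
  `|(Th x - x) - (Th x' - x')| <= 4^-1 * `|x - x'|.
Hypothesis mTh : forall t : R, `|Th (B0, t) - ((B0, t) : C)| <= M.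

Lemma near_id_dist x : B0 <= x.1 -> `|Th x - x| <= M + 4^-1 * (x.1 - B0).
Proof.
move=> hx; have hb : B0 <= ((B0, x.2) : C).1 by [].
rewrite -(subrK (Th (B0, x.2) - ((B0, x.2) : C)) (Th x - x)) addrC.
apply: le_trans (ler_normD _ _) _; apply: lerD; first exact: mTh.
apply: le_trans (lTh hx hb) _; rewrite ler_wpM2l //.
apply: norm_pair_le => /=; first by rewrite ger0_norm // subr_ge0.
by rewrite subrr normr0 subr_ge0.
Qed.

Lemma near_id_inj x x' : B0 <= x.1 -> B0 <= x'.1 -> Th x = Th x' -> x = x'.
Proof.
move=> hx hx' E; have := lTh hx hx'; rewrite E opprB addrC subrKA -[x' - x]opprB normrN => h; apply/eqP; rewrite -subr_eq0 -normr_eq0; apply/eqP.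
by have := normr_ge0 (x - x'); move: h; move: `|x - x'| => t; lra.
Qed.

(** [near_id_surj] on the ball around [y] that reaches exactly to the line x.1 = B0, of radius r =
    y.1 - B0. It needs |Th y - y| <= r / 2; the bound at hand is M + r / 4, so r > 4 M suffices. *)
Lemma near_id_onto y : halfplane (B0 + 4 * M) y -> exists2 x, B0 <= x.1 & Th x = y.
Proof.
rewrite /halfplane /= => hy.
have M0 : 0 <= M by exact: le_trans (normr_ge0 _) (mTh 0).
have r0 : 0 < y.1 - B0 by move: M0 hy; move: y.1 => t; lra.
have fst_ge x : `|x - y| <= y.1 - B0 -> B0 <= x.1.
  move=> /(le_trans (norm_fst _)); rewrite /= ler_norml => /andP[h _].
  by move: h; move: x.1 y.1 => p q; lra.
have [x xy Ex] : exists2 x, `|x - y| <= y.1 - B0 & Th x = y.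
  apply: near_id_surj => //.
  - by move=> x /fst_ge; exact: cTh.
  - move=> x x' /fst_ge hx /fst_ge hx'; apply: le_trans (lTh hx hx') _.
    by rewrite ler_wpM2r // lef_pV2 ?posrE ?ltr0n // ler_nat.
  - rewrite distrC; apply: le_trans (near_id_dist _) _.
      by move: r0; rewrite subr_gt0 => /ltW.
    by move: M0 hy r0; move: y.1 => t; lra.
by exists x => //; exact: fst_ge.
Qed.

Lemma near_id_fst x : B0 <= x.1 ->
  (Th x).1 - B0 <= 2 * (x.1 - B0) + M /\ x.1 - B0 <= 2 * ((Th x).1 - B0) + 2 * M.
Proof.
move=> hx; have := le_trans (norm_fst _) (near_id_dist hx); rewrite /= ler_norml.
have M0 : 0 <= M by exact: le_trans (normr_ge0 _) (mTh 0).
by move=> /andP[]; move: hx M0; move: x.1 (Th x).1 => p q; lra.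
Qed.

End NearIdentity.

Lemma segment_bounded (R : realType) (h : R -> R) : (forall t, {for t, continuous h}) ->
  exists M, forall t, 0 <= t <= 1 -> `|h t| <= M.
Proof.
move=> ch.
have /= [M [_ HM]] : \forall A \near +oo, forall t : R, 0 <= t <= 1 -> `|h t| <= A.
  apply: segment_uniform => t _; exists [set t' | `|h t - h t'| < 1], [set B | `|h t| + 1 < B]; split.
  - by have /cvgrPdist_lt/(_ _ ltr01) := ch t.
  - by exists (`|h t| + 1); split=> //; exact: num_real.
  - move=> t' B /= h1 /ltW; apply: le_trans.
    rewrite -(subKr (h t) (h t')); apply: le_trans (ler_normB _ _) _.
    by rewrite lerD2l ltW.
by exists (M + 1) => t; apply: HM; rewrite ltrDl.
Qed.

Section NormFacts.
Context {R : realType}.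
Fact norm_shift (A s t p e : R) : `|A - s - p| < e / 2 -> `|s - t| < e / 2 -> `|A - t - p| < e.
Proof. rewrite !ltr_norml => /andP[h1 h2] /andP[h3 h4]; apply/andP; split; lra. Qed.

Fact norm_far1 (u q p e d : R) : `|u - q| < e -> d <= `|q - p| -> 4 * e <= d -> e <= `|u - p|.
Proof.
move=> h1 h2 h3; rewrite leNgt; apply/negP => h4; move: h2; rewrite leNgt => /negP; apply.
by move: h1 h4; rewrite !ltr_norml => /andP[h1 h4] /andP[h5 h6]; apply/andP; split; lra.
Qed.

Fact norm_far2 (u t q p e d : R) : `|u - t| < e -> `|u - q| < e -> d <= `|q - p| -> 4 * e <= d ->
  e <= `|t - p|.
Proof.
move=> h0 h1 h2 h3; rewrite leNgt; apply/negP => h4; move: h2; rewrite leNgt => /negP; apply.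
move: h0 h1 h4; rewrite !ltr_norml => /andP[h1 h4] /andP[h5 h6] /andP[h7 h8].
by apply/andP; split; lra.
Qed.

Fact norm_close (u v p e : R) : `|u - p| < e -> `|v - p| < e -> `|u - v| < 2 * e.
Proof. rewrite !ltr_norml => /andP[h1 h2] /andP[h3 h4]; apply/andP; split; lra. Qed.
End NormFacts.

(** * The holomorphic coordinate (F + i a) / T on an end *)

Section HalfPlane.
Context {R : realType} {n : nat}.
Local Notation V := 'rV[R]_(n.*2.+1).
Local Notation C := (R * R)%type.
Let fC : fdim C := fdim_prod fdim_R fdim_R.
Context {Q : manifold V}.
Variables (ct : contact_triad Q) (ga : R -> Q) (T : R) (W : C -> Q) (F a : C -> R) (A0 : R).
Hypothesis T0 : T != 0.
Hypothesis hg : reeb_path ct setT (fun=> 1) ga.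
Hypothesis gT : forall s, ga (s + T) = ga s.
Hypothesis lim : forall (t : R) (P : Q -> Prop), (\forall q \near ga (T * t), P q) ->
  exists A : R, \forall t' \near t, forall tau : R, A < tau -> P (W (tau, t')).
Hypothesis perW : forall x (k : int), W (x.1, x.2 + k%:~R) = W x.
Hypothesis perF : forall x (k : int), F (x.1, x.2 + k%:~R) = F x.
Hypothesis WE : forall x, halfplane A0 x -> W x = ga (a x).
Hypothesis sF : smooth_on (halfplane A0) F.
Hypothesis sa : smooth_on (halfplane A0) a.
Hypothesis CR : forall x v, halfplane A0 x -> 'D_v a x = - 'D_(rot v) F x.

(** The angle of [W] along the orbit, minus its expected linear growth. It is not yet known to be
    1-periodic in t: [shift_period] only gives this up to a period of [ga]. *)
Let b (x : C) := a x - T * x.2.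
Let per p := forall r, ga (r + p) = ga r.

Let sFx x : halfplane A0 x -> smooth_at x F. Proof. by move=> hx; exact: (smooth_at_on (@halfplane_open R A0) hx sF). Qed.
Let sax x : halfplane A0 x -> smooth_at x a. Proof. by move=> hx; exact: (smooth_at_on (@halfplane_open R A0) hx sa). Qed.

Let snd_smooth (x : C) : smooth_at x (fun x : C => T * x.2).
Proof.
apply: smooth_atM; first exact: smooth_at_cst.
exact: (@smooth_at_lin R _ _ x sndL (@snd_continuous R)).
Qed.

Let sb x : halfplane A0 x -> smooth_at x b.
Proof. by move=> hx; apply: smooth_atB; [exact: sax|exact: snd_smooth]. Qed.

Let cb x : halfplane A0 x -> {for x, continuous b}.
Proof. by move=> /sb; exact: smooth_at_continuous. Qed.

Let perN p : per p -> per (- p).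
Proof. by move=> hp r; rewrite -(hp (r - p)) subrK. Qed.

Let perD p q : per p -> per q -> per (p + q).
Proof. by move=> hp hq r; rewrite addrA hq hp. Qed.

Let perT k : per (k%:~R * T).
Proof. by move=> r; exact: period_mulz. Qed.

Lemma shift_period x (k : int) : halfplane A0 x ->
  per (b (x.1, x.2 + k%:~R) - b x).
Proof.
move=> hx; have hy : halfplane A0 ((x.1, x.2 + k%:~R) : C) by [].
have Ega : ga (a (x.1, x.2 + k%:~R)) = ga (a x) by rewrite -!WE // perW.
have -> : b (x.1, x.2 + k%:~R) - b x = (a (x.1, x.2 + k%:~R) - a x) - k%:~R * T.
  by rewrite /b /=; move: (a (x.1, x.2 + k%:~R)) (a x) => p q; ring.
by apply: perD; [exact: reeb_coincide hg _ _ Ega|exact/perN/perT].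
Qed.

(** [reeb_gap] at the limit points [ga (T * t)], uniformly for t in [0, 1]; other values of t are
    reached by integer shifts, each of which changes [b] by a period. *)
Lemma conjugate_near_period e : 0 < e -> exists2 B, A0 <= B &
  forall x, halfplane B x -> exists2 p, per p & `|b x - p| < e.
Proof.
move=> e0; have e2 : 0 < e / 2 by rewrite divr_gt0.
have [A HA] : exists A, forall x : C, halfplane A x -> 0 <= x.2 <= 1 ->
    halfplane A0 x -> exists2 p, per p & `|b x - p| < e.
  apply: end_uniform => t _.
  have [A HA] := lim (reeb_gap hg T0 gT (T * t) e2); exists A.
  have ct' : \forall t' \near t, `|T * t - T * t'| < e / 2.
    have cm : {for t, continuous (fun x : R => T * x)} by apply: cvgMl_tmp; exact: cvg_id.
    by have /cvgrPdist_lt/(_ _ e2) := cm.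
  apply: filterS (near_and HA ct') => t' [h1 h2] tau Atau hx.
  have [p hp pe] := h1 _ Atau _ (esym (WE hx)); exists p => //.
  exact: norm_shift pe h2.
exists (Num.max A A0); first by rewrite le_max lexx orbT.
move=> x; rewrite /halfplane /= gt_max => /andP[xA xA0].
pose k := Num.floor x.2; pose y : C := (x.1, x.2 + (- k)%:~R).
have y01 : 0 <= y.2 <= 1.
  have /andP[h1 h2] := floor_itv x.2; rewrite -/k in h1 h2.
  rewrite /y /= mulrNz subr_ge0 h1 /=; apply/ltW; rewrite ltrBlDl.
  by move: h2; rewrite intrD.
have [p hp pe] := HA y xA y01 xA0; exists (p - (b y - b x)).
  by apply: perD => //; apply: perN; exact: shift_period.
by rewrite opprB addrA addrAC; move: pe; congr (`|_| < e); move: (b x) (b y) => u v; ring.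
Qed.

(* b stays close to the periods of ga, which form a discrete group; being continuous,
   it stays close to a single one. *)
Lemma conjugate_oscillation e : 0 < e -> exists2 B, A0 <= B &
  forall x y, halfplane B x -> halfplane B y -> `|b x - b y| < e.
Proof.
move=> e0; have [d d0 Hd] := reeb_period_isolated hg.
(* 4 e1 <= d keeps the e1-balls around distinct periods apart, even after moving the point by e1; 2
   e1 <= e yields the required oscillation. *)
pose e1 := Num.min e d / 4.
have e10 : 0 < e1 by rewrite divr_gt0 // lt_min e0.
have e1e : 2 * e1 <= e.
  have : Num.min e d <= e by rewrite ge_min lexx.
  by rewrite /e1; move: e0 e10; rewrite /e1; move: (Num.min e d) => m; lra.
have e1d : 4 * e1 <= d.
  have : Num.min e d <= d by rewrite ge_min lexx orbT.
  by rewrite /e1; move: (Num.min e d) => m; lra.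
have [B AB HB] := conjugate_near_period e10; exists B => // x y hx hy.
have hA z : halfplane B z -> halfplane A0 z by exact: le_lt_trans.
have [p hp pe] := HB _ hx.
have H z : halfplane B z -> (`|b z - p| < e1) = (`|b x - p| < e1).
  move=> hz; apply/esym; apply: (@locally_constant_convex R _ (halfplane B) _ (fun z => `|b z - p| < e1)) => //.
    exact: halfplane_convex.
  move=> u hu; have /cvgrPdist_lt/(_ _ e10) := cb (hA _ hu); rewrite /=.
  have [q hq qe] := HB _ hu; have [E|N] := eqVneq q p.
    have nb : \forall t \near u, `|b t - p| < e1.
      have co : open [set t : R | `|t - p| < e1].
        have -> : [set t : R | `|t - p| < e1] = ball p e1.
          by apply/seteqP; split=> t; rewrite /ball /= distrC.
        exact: ball_open.
      have nr : \forall r \near b u, `|r - p| < e1.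
        by apply: open_nbhs_nbhs; split; [exact: co|rewrite /= -E].
      exact: (cb (hA _ hu) nr).
    by move=> _; apply: filterS nb => t ->; rewrite -E qe.
  have dq : d <= `|q - p|.
    rewrite leNgt; apply/negP => /Hd h; move/eqP: N; apply; apply/eqP; rewrite -subr_eq0.
    by apply/eqP; apply: h; exact/perD/perN.
  apply: filterS => t ht.
  have f1 : e1 <= `|b u - p| by exact: norm_far1 qe dq e1d.
  have f2 : e1 <= `|b t - p| by exact: norm_far2 ht qe dq e1d.
  by rewrite !ltNge f1 f2.
have := H _ hy; rewrite pe => ye.
by apply: lt_le_trans (norm_close pe ye) e1e.
Qed.

Let e1 : C := (1, 0).
Let e2 : C := (0, 1).

Let Dlin x v : is_derive x v (fun x : C => T * x.2) (T * v.2).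
Proof.
have ds : is_derive x v (fun x : C => x.2) v.2.
  refine (is_derive_conv (is_derive_diff v (@linear_differentiable R _ _ sndL x (@snd_continuous R))) _).
  exact: (@derive_linear R _ _ sndL x v (@snd_continuous R)).
refine (is_derive_conv (is_derive_mulP (is_derive_cst T x v) ds) _).
by rewrite mulr0 addr0.
Qed.

Let Db k x v : halfplane A0 x -> 'D_v (fun y => b y - k) x = 'D_v a x - T * v.2.
Proof.
move=> hx; have da := is_derive_diff v (smooth_at_diff (sax hx)).
have H := is_derive_subP (is_derive_subP da (Dlin x v)) (is_derive_cst k x v).
by have [_ ->] := H; rewrite subr0.
Qed.

Let DDb k x v : halfplane A0 x -> 'D_v ('D_v (fun y => b y - k)) x = 'D_v ('D_v a) x.
Proof.
move=> hx; rewrite -[LHS](derive_eq_on v (@halfplane_open R A0) hx (fun y hy => esym (Db k v hy))).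
have da := is_derive_diff v (smooth_at_diff (smooth_at_derive v (sax hx))).
by have [_ ->] := is_derive_subP da (is_derive_cst (T * v.2) x v); rewrite subr0.
Qed.

Let rot1 : rot e1 = e2. Proof. by congr pair; rewrite /= ?oppr0. Qed.
Let rot2 : rot e2 = - e1. Proof. by congr pair; rewrite /= ?oppr0. Qed.

Let Da1 x : halfplane A0 x -> 'D_e1 a x = - 'D_e2 F x.
Proof. by move=> hx; rewrite (CR e1 hx) rot1. Qed.

Let Da2 x : halfplane A0 x -> 'D_e2 a x = 'D_e1 F x.
Proof.
by move=> hx; rewrite (CR e2 hx) rot2 (derive_dirN _ (smooth_at_diff (sFx hx))) opprK.
Qed.

Let laplace_a x : halfplane A0 x -> 'D_e1 ('D_e1 a) x + 'D_e2 ('D_e2 a) x = 0.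
Proof.
move=> hx; rewrite (derive_eq_on e2 (@halfplane_open R A0) hx Da2).
rewrite (derive_eq_on e1 (@halfplane_open R A0) hx Da1) deriveN; last first.
  exact/diff_derivable/smooth_at_diff/smooth_at_derive/sFx.
by rewrite (schwarz e1 e2 (sFx hx)) addNr.
Qed.

(** The partial derivatives of [b] are - F_2 and F_1 - T. Since [b] is harmonic with oscillation
    below e / 2 on the square around [x], the gradient estimate, which costs a factor 2, bounds both
    by e; the shift B + 1 makes room for the square. *)
Lemma end_gradient e : 0 < e -> exists2 B, A0 <= B &
  forall x, halfplane B x -> `|'D_e1 F x - T| <= e /\ `|'D_e2 F x| <= e.
Proof.
move=> e0; have e20 : 0 < e / 2 by rewrite divr_gt0.
have [B AB HB] := conjugate_oscillation e20; exists (B + 1).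
  by apply: le_trans AB _; rewrite lerDl.
move=> x hx.
have hA y : halfplane B y -> halfplane A0 y by exact: le_lt_trans.
have hxB : halfplane B x by apply: lt_trans hx; rewrite ltrDl.
have sb' : smooth_on (halfplane B) (fun y => b y - b x).
  apply/(smooth_onP _ (@halfplane_open R B)) => y hy.
  by apply: smooth_atB; [exact/sb/hA|exact: smooth_at_cst].
have near_x (s t : R) : `|s| <= 1 -> `|t| <= 1 -> halfplane B (x + s *: e1 + t *: e2).
  rewrite ler_norml => /andP[s1 _] _; rewrite /halfplane /= /GRing.scale /= mulr0 addr0 mulr1.
  by move: hx; rewrite /halfplane /=; move: s1; move: x.1 => u; lra.
have near_b (s t : R) : `|s| <= 1 -> `|t| <= 1 ->
    halfplane B (x + s *: e1 + t *: e2) /\ `|b (x + s *: e1 + t *: e2) - b x| <= e / 2.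
  by move=> s1 t1; have h := near_x _ _ s1 t1; split=> //; apply/ltW/HB.
have L k y : halfplane B y -> 'D_e1 ('D_e1 (fun y => b y - k)) y + 'D_e2 ('D_e2 (fun y => b y - k)) y = 0.
  by move=> /hA hy; rewrite (DDb k e1 hy) (DDb k e2 hy) laplace_a.
have := harmonic_gradient (@halfplane_open R B) sb' (L (b x)) near_b.
rewrite (Db _ _ (hA _ hxB)) mulr0 subr0 (Da1 (hA _ hxB)) normrN => g1.
have := @harmonic_gradient R _ (halfplane B) x e2 e1 _ (e / 2) (@halfplane_open R B) sb'.
rewrite (Db _ _ (hA _ hxB)) mulr1 (Da2 (hA _ hxB)) => g2.
rewrite mulrCA divff ?pnatr_eq0 // mulr1 in g1 g2.
split; last exact: g1.
apply: g2 => [y hy|s t s1 t1]; first by rewrite addrC L.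
by rewrite addrAC; exact: near_b.
Qed.

Let DF_e1 x h : halfplane A0 x -> 'D_(h *: e1) F x = h * 'D_e1 F x.
Proof. by move=> hx; rewrite derive_scale_dir //; exact/smooth_at_diff/sFx. Qed.

(** If T < 0, then F_1 <= T / 2 < 0 far out, so F decreases along horizontal rays and stays below
    its maximum on one vertical period, against the assumed growth. *)
Lemma growth_pos : (forall K B, exists x, [/\ halfplane B x, 0 <= x.2 <= 1 & K < F x]) -> 0 < T.
Proof.
move=> grow; rewrite lt_neqAle eq_sym T0 /= leNgt; apply/negP => Tneg.
have e0 : 0 < - T / 2 by rewrite divr_gt0 // oppr_gt0.
have [B AB HB] := end_gradient e0.
have hA x : B < x.1 -> halfplane A0 x by exact: le_lt_trans.
pose h (t : R) := F (B + 1, t).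
have ch t : {for t, continuous h}.
  have hx : halfplane A0 ((B + 1, t) : C) by apply: hA; rewrite /= ltrDl.
  have cF := smooth_at_continuous (sFx hx).
  have cp : {for t, continuous (fun t : R => ((B + 1, t) : C))}.
    by apply: continuous_pair; [exact: cst_continuous|exact: cvg_id].
  exact: (continuous_comp cp cF).
have [M HM] := segment_bounded ch.
have [x [hx x01]] := grow M (B + 1); rewrite ltNge => /negP; apply.
apply: le_trans (le_trans (ler_norm _) (HM _ x01)); rewrite /h.
have xE : x = ((B + 1, x.2) : C) + (x.1 - (B + 1)) *: e1.
  by rewrite /e1 {1}[x]surjective_pairing; congr pair;
     rewrite /= /GRing.scale /= ?mulr0 ?addr0 ?mulr1 // addrC subrK.
have d0 : 0 <= x.1 - (B + 1) by rewrite subr_ge0 ltW.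
have inB (s : R) : 0 <= s -> B < (((B + 1, x.2) : C) + s *: ((x.1 - (B + 1)) *: e1)).1.
  move=> s0; rewrite /= /GRing.scale /= mulr1 -addrA ltrDl ltr_pwDl //.
  exact: mulr_ge0.
have [s /andP[s0 _]|s s01] := @mvt_dir R C F ((B + 1, x.2) : C) ((x.1 - (B + 1)) *: e1).
  exact/smooth_at_diff/sFx/hA/inB.
have s0 : 0 <= s by case/andP: s01 => /ltW.
rewrite -xE (DF_e1 _ (hA _ (inB _ s0))) => E.
rewrite -subr_le0 E; apply: mulr_ge0_le0 => //.
have [+ _] := HB _ (inB _ s0); rewrite ler_norml => /andP[_].
by move: Tneg; move: ('D_e1 F _) => p; lra.
Qed.

Section Model.
Hypothesis Tpos : 0 < T.

Definition model_map (x : C) : C := (T^-1 * F x, T^-1 * a x).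
Local Notation Th := model_map.

Let iT0 : 0 < T^-1. Proof. by rewrite invr_gt0. Qed.

Let sTh x : halfplane A0 x -> smooth_at x Th.
Proof.
move=> hx; apply: smooth_at_pair; apply: smooth_atM; [exact: smooth_at_cst|exact: sFx|exact: smooth_at_cst|exact: sax].
Qed.

Let DTh x v : halfplane A0 x -> 'D_v Th x = (T^-1 * 'D_v F x, T^-1 * 'D_v a x).
Proof.
move=> hx; have dTh := smooth_at_diff (sTh hx).
have H (g : C -> R) : smooth_at x g -> 'D_v (fun y => T^-1 * g y) x = T^-1 * 'D_v g x.
  move=> sg; have [_ ->] := is_derive_mulP (is_derive_cst T^-1 x v) (is_derive_diff v (smooth_at_diff sg)).
  by rewrite mulr0 addr0.
rewrite [LHS]surjective_pairing; congr pair.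
  rewrite -(H _ (sFx hx)); have := @derive_linear_comp R _ _ _ (@fstL R) Th x v (@fst_continuous R) dTh.
  exact: esym.
rewrite -(H _ (sax hx)); have := @derive_linear_comp R _ _ _ (@sndL R) Th x v (@snd_continuous R) dTh.
exact: esym.
Qed.

Let conformal_Th : conformal_on (halfplane A0) Th.
Proof.
move=> x v hx; rewrite !DTh // !CR // rot_sq (derive_dirN _ (smooth_at_diff (sFx hx))) opprK.
by congr pair; rewrite /= mulrN ?opprK.
Qed.

Fact model_arith (t P1 P2 v1 v2 r e : R) : 0 < t -> t * e <= 8^-1 ->
  `|P1| <= e -> `|P2| <= e -> `|v1| <= r -> `|v2| <= r ->
  `|t * (v1 * P1 + v2 * P2)| <= 4^-1 * r.
Proof.
move=> t0 te h1 h2 h3 h4; rewrite normrM (gtr0_norm t0).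
have r0 : 0 <= r by exact: le_trans h3.
have e0 : 0 <= e by exact: le_trans h1.
have h : `|v1 * P1 + v2 * P2| <= 2 * (r * e).
  apply: le_trans (ler_normD _ _) _; rewrite !normrM mulr_natl mulr2n.
  by apply: lerD; exact: ler_pM.
have : t * (2 * (r * e)) <= 4^-1 * r.
  have : r * (t * e) <= r * 8^-1 by rewrite ler_wpM2l.
  by move: (t * e) (mulrCA t r e) => u; lra.
by apply: le_trans; rewrite ler_pM2l.
Qed.

(** By [end_gradient] the derivative of [Th] tends to the identity, so [Th - id] is a contraction on
    a closed half-plane. The bound [M] is found for t in [0, 1] and extends to all t by the exact
    compatibility of [Th] with integer shifts. *)
Lemma model_near_id : exists B M, [/\ A0 < B,
  forall x x', B <= x.1 -> B <= x'.1 -> `|(Th x - x) - (Th x' - x')| <= 4^-1 * `|x - x'|,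
  forall t : R, `|Th (B, t) - ((B, t) : C)| <= M,
  forall x, B <= x.1 -> 'D_e1 F x != 0 &
  forall x (k : int), B <= x.1 -> Th (x.1, x.2 + k%:~R) = ((Th x).1, (Th x).2 + k%:~R)].
Proof.
(* After division by T each of the two partial derivatives contributes 1/8, which makes the
   Lipschitz constant 1/4. *)
have e0 : 0 < T / 8 by rewrite divr_gt0.
have [B1 AB1 HB1] := end_gradient e0.
have [d d0 Hd] := reeb_period_isolated hg.
have [B2 AB2 HB2] := conjugate_oscillation d0.
pose B := Num.max B1 B2 + 1.
have hB1 x : B <= x.1 -> halfplane B1 x.
  by apply: lt_le_trans; rewrite /B ltr_pwDr // le_max lexx.
have hB2 x : B <= x.1 -> halfplane B2 x.
  by apply: lt_le_trans; rewrite /B ltr_pwDr // le_max lexx orbT.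
have hA x : B <= x.1 -> halfplane A0 x by move=> /hB1; exact: le_lt_trans.
have Tne : T != 0 by [].
(* A shift by [k] changes [b] by a period of [ga], and by less than the distance [d] from 0 to the
   other periods; so it does not change [b] at all. *)
have pera x (k : int) : B <= x.1 -> a (x.1, x.2 + k%:~R) = a x + T * k%:~R.
  move=> hx; have := shift_period k (hA _ hx).
  have hy : B <= ((x.1, x.2 + k%:~R) : C).1 by [].
  move=> /(Hd _ (HB2 _ _ (hB2 _ hy) (hB2 _ hx))); rewrite /b /=.
  by move: (a (_, _)) (a x) => p q; lra.
have perTh x (k : int) : B <= x.1 -> Th (x.1, x.2 + k%:~R) = ((Th x).1, (Th x).2 + k%:~R).
  by move=> hx; rewrite /Th /model_map perF pera // mulrDr mulKf.
have c1 (t : R) : {for t, continuous (fun t : R => Th (B, t) - ((B, t) : C))}.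
  have hx : B <= ((B, t) : C).1 by [].
  have cp : {for t, continuous (fun t : R => ((B, t) : C))}.
    by apply: continuous_pair; [exact: cst_continuous|exact: cvg_id].
  have cT : {for ((B, t) : C), continuous Th} by exact/smooth_at_continuous/sTh/hA.
  exact: (continuousB (continuous_comp cp cT) cp).
have cn (t : R) : {for t, continuous (fun t : R => `|Th (B, t) - ((B, t) : C)|)}.
  exact: (continuous_comp (c1 t) (@norm_continuous _ _ _)).
have [M HM] := segment_bounded cn.
exists B, M; split; last exact: perTh.
- by apply: le_lt_trans AB1 _; rewrite /B ltr_pwDr // le_max lexx.
- move=> x x' hx hx'.
  have := @lipschitz_seg R C (fun y => Th y - y) (4^-1 * `|x - x'|) x' (x - x').
  rewrite (_ : x' + (x - x') = x); last by rewrite addrC subrK.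
  apply=> s s01.
  set y := x' + _; have hy : B <= y.1.
    rewrite /y /= /GRing.scale /=; case/andP: s01 => s0 s1.
    have : 0 <= s * (x.1 - B) by rewrite mulr_ge0 // subr_ge0.
    have : 0 <= (1 - s) * (x'.1 - B) by rewrite mulr_ge0 // subr_ge0.
    by move: x.1 x'.1 => u v; lra.
  have dT := smooth_at_diff (sTh (hA _ hy)); have [di Di] := derive_idP y (x - x').
  split; first exact: differentiableB.
  rewrite deriveB; [|exact: diff_derivable|exact: diff_derivable].
  rewrite Di (DTh _ (hA _ hy)); move: (x - x') => v.
  have [g1 g2] := HB1 _ (hB1 _ hy).
  have dF := smooth_at_diff (sFx (hA _ hy)); have da := smooth_at_diff (sax (hA _ hy)).
  have E (f : C -> R) : differentiable f y -> 'D_v f y = v.1 * 'D_e1 f y + v.2 * 'D_e2 f y.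
    by move=> df; rewrite {1}[v]e12E derive_dir_linear // derive_scale_dir.
  have te : T^-1 * (T / 8) <= 8^-1 by rewrite mulKf.
  have n1 := norm_fst v; have n2 := norm_snd v.
  rewrite (E _ dF) (E _ da) (Da1 (hA _ hy)) (Da2 (hA _ hy)).
  apply: norm_pair_le => /=.
    have -> : T^-1 * (v.1 * 'D_e1 F y + v.2 * 'D_e2 F y) - v.1 =
        T^-1 * (v.1 * ('D_e1 F y - T) + v.2 * 'D_e2 F y).
      by move: ('D_e1 F y) ('D_e2 F y) => p q; field.
    exact: model_arith te g1 g2 n1 n2.
  have -> : T^-1 * (v.1 * - 'D_e2 F y + v.2 * 'D_e1 F y) - v.2 =
      T^-1 * (v.1 * - 'D_e2 F y + v.2 * ('D_e1 F y - T)).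
    by move: ('D_e1 F y) ('D_e2 F y) => p q; field.
  apply: model_arith te _ g1 n1 n2 => //; by rewrite normrN.
- move=> t; pose k := Num.floor t; have /andP[h1 h2] := floor_itv t.
  rewrite -/k intrD in h1 h2.
  have := HM (t - k%:~R); rewrite subr_ge0 h1 /= lerBlDl (ltW h2) => /(_ isT).
  have hb : B <= ((B, t) : C).1 by [].
  have := perTh (B, t) (- k) hb; rewrite /= mulrNz => ->.
  rewrite normr_id; have -> // : (T^-1 * F (B, t), T^-1 * a (B, t) - k%:~R) - ((B, t - k%:~R) : C) =
    Th (B, t) - ((B, t) : C).
  by congr pair; rewrite /= opprB addrA subrK.
- move=> x /hB1/HB1[+ _]; rewrite ler_norml; move: ('D_e1 F x) => p /andP[h _].
  by apply: lt0r_neq0; move: Tpos h; lra.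
Qed.

(** [G] is the inverse of [Th]: global bijectivity comes from the contraction, smoothness from the
    local inversion of conformal maps. The last two clauses say that [Th] and [G] both respect the
    direction +oo, which is needed to carry neighbourhoods of the puncture from one coordinate to
    the other. *)
Lemma model_inverse : exists (G : C -> C) (A : R),
  [/\ forall y, halfplane A y -> [/\ halfplane A0 (G y), F (G y) = T * y.1, a (G y) = T * y.2,
        smooth_at y G & forall v, 'D_(rot v) G y = rot ('D_v G y)],
      forall y (k : int), halfplane A y -> G (y.1, y.2 + k%:~R) = ((G y).1, (G y).2 + k%:~R),
      forall K, exists K', forall x, halfplane K' x ->
        exists y, [/\ halfplane A y, halfplane K y & G y = x] &
      forall K, exists K', forall y, halfplane K' y -> halfplane A y -> halfplane K (G y)].
Proof.
have [B [M [AB lT mT nz pT]]] := model_near_id.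
have hA x : B <= x.1 -> halfplane A0 x by exact: lt_le_trans.
have cT x : B <= x.1 -> {for x, continuous Th} by move=> /hA/sTh; exact: smooth_at_continuous.
have M0 : 0 <= M by exact: le_trans (normr_ge0 _) (mT 0).
pose A := B + 4 * M + 1.
have /choice[G HG] y : exists x, halfplane A y -> B < x.1 /\ Th x = y.
  have [hy|] := pselect (halfplane A y); last by move=> nh; exists 0.
  have hy' : halfplane (B + 4 * M) y by apply: lt_trans hy; rewrite /A ltrDl.
  have [x Bx Ex] := near_id_onto cT lT mT hy'; exists x => _; split=> //.
  have [+ _] := near_id_fst lT mT Bx; rewrite Ex; move: hy; rewrite /halfplane /A /=.
  by move: M0; move: x.1 y.1 => p q; lra.
have HB y : halfplane A y -> B <= (G y).1 by move=> /HG[/ltW].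
have ThG y : halfplane A y -> Th (G y) = y by move=> /HG[].
have GTh x : B <= x.1 -> halfplane A (Th x) -> G (Th x) = x.
  by move=> hx hT; apply: (near_id_inj lT (HB _ hT) hx); rewrite ThG.
have FG y : halfplane A y -> F (G y) = T * y.1.
  by move=> hy; rewrite -{2}(ThG _ hy) /= mulVKf.
have aG y : halfplane A y -> a (G y) = T * y.2.
  by move=> hy; rewrite -{2}(ThG _ hy) /= mulVKf.
exists G, A; split.
- move=> y hy; have hx := hA _ (HB _ hy); have Bx : halfplane B (G y) by have [] := HG _ hy.
  have sBA : halfplane B `<=` halfplane A0 by move=> z /ltW/hA.
  have sT : smooth_on (halfplane B) Th.
    by apply/(smooth_onP _ (@halfplane_open R B)) => z /sBA; exact: sTh.
  have kT : conformal_on (halfplane B) Th by move=> z v /sBA; exact: conformal_Th.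
  have d0 : 'D_(1, 0) Th (G y) != 0.
    rewrite -/e1 (DTh _ hx); apply/eqP => /(congr1 fst) /= /eqP.
    by rewrite mulf_eq0 (negbTE (nz _ (HB _ hy))) orbF gt_eqF.
  have [X [L [[oO Ox OB oTO] [LK sL cL]]]] := conformal_local_inverse (@halfplane_open R B) Bx sT kT d0.
  have Ty : (Th @` X) y by exists (G y) => //; exact: ThG.
  pose N := (Th @` X) `&` halfplane A.
  have oN : open N by apply: openI => //; exact: halfplane_open.
  have Ny : N y by split.
  have GL z : N z -> L z = G z.
    by move=> [[x Wx' <-] hz]; rewrite LK //; apply/esym/GTh => //; apply/ltW/OB.
  split=> //; first exact: FG; first exact: aG.
    apply: (smooth_at_eq_on oN Ny GL); exact: (smooth_at_on oTO Ty sL).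
  by move=> v; rewrite -!(derive_eq_on _ oN Ny GL); exact: cL.
- move=> y k hy; have hyk : halfplane A ((y.1, y.2 + k%:~R) : C) by [].
  have hB : B <= (((G y).1, (G y).2 + k%:~R) : C).1 by exact: HB.
  apply: (near_id_inj lT (HB _ hyk) hB); rewrite (ThG _ hyk) (pT _ _ (HB _ hy)) (ThG _ hy).
  by [].
- move=> K; exists (Num.max A K + Num.max A K - B + 2 * M + B + `|B|) => x hx.
  have h : B <= x.1 /\ Num.max A K < (Th x).1.
    have AK : B <= Num.max A K.
      by rewrite le_max; apply/orP; left; move: M0; rewrite /A; lra.
    have Bx : B <= x.1.
      have := ler_norm (- B); rewrite normrN; move: hx AK M0; rewrite /halfplane /=.
      by move: (Num.max A K) x.1 `|B| => p q r; lra.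
    split=> //; have [_] := near_id_fst lT mT Bx; move: hx AK M0 (ler_norm (- B)).
    by rewrite normrN /halfplane /=; move: (Num.max A K) x.1 (Th x).1 `|B| => p q r s; lra.
  case: h => Bx; rewrite gt_max => /andP[hTA hTK].
  by exists (Th x); split=> //; exact: GTh.
- move=> K; exists (B + M + 2 * `|K - B|) => y hy hAy.
  have [+ _] := near_id_fst lT mT (HB _ hAy); rewrite (ThG _ hAy).
  move: hy (ler_norm (K - B)); rewrite /halfplane /=; move: y.1 (G y).1 `|K - B| => p q r.
  lra.
Qed.

End Model.

End HalfPlane.

(** * From a translated holomorphic curve to coordinates at a puncture *)

Section Curve.
Context {R : realType} {n : nat}.
Local Notation V := 'rV[R]_(n.*2.+1).
Local Notation C := (R * R)%type.
Context {Q : manifold V}.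
Variables (ct : contact_triad Q) (S : punctured_surface R) (w : S -> Q) (f : S -> R).
Let fC : fdim C := fdim_prod fdim_R fdim_R.
Let fV : fdim V := fdim_rV _.
Hypothesis sw : forall z, dotted z -> sm_map w z.
Hypothesis sf : forall z, dotted z -> sm_fun f z.
Hypothesis hJ : Jholomorphic ct w f.

Lemma der_fun_rot z v : dotted z ->
  der_fun f z (rot v) = - lam ct (w z) (der_map w z v).
Proof. by move=> dz; have [_ ->] := hJ v dz. Qed.

Lemma lam_der_rot z v : dotted z ->
  lam ct (w z) (der_map w z (rot v)) = der_fun f z v.
Proof.
move=> dz; have := der_fun_rot (rot v) dz; rewrite rot_sq (der_funN _ (sf dz)).
by move=> /oppr_inj.
Qed.

Lemma orbit_tangent phi c : 0 < c ->
  (forall z, dotted z -> dotted (phi z)) ->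
  (forall z, dotted z -> f (phi z) = f z + c) ->
  (forall z, dotted z -> w (phi z) = w z) ->
  (forall a, exists ga T, end_orbit ct w a ga T) ->
  forall z v, dotted z -> pi_xi ct (w z) (der_map w z v) = 0.
Proof.
move=> c0 dphi fphi wphi ends z v dz.
have [ga /choice[T HT]] := choice ends.
pose l (s : R) : C := chart z z + s *: v.
have l0 : l 0 = chart z z by rewrite /l scale0r addr0.
pose sg := w \o inv z \o l.
have sg0 : sg 0 = w z by rewrite /sg /= l0 chartK //; exact: dom_self.
have [cw sw0] := sw dz.
have cl : {for (0 : R), continuous l}.
  by apply: continuousD; [exact: cst_continuous|apply: cvgZr_tmp; exact: cvg_id].
have csg : {for (0 : R), continuous sg}.
  by apply: continuous_comp; [exact: cl|rewrite l0; exact: cw].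
rewrite -sg0; apply: (@reeb_tangent R n Q ct _ ga T sg) => //.
- by move=> i; have [] := HT i.
- by move=> i; have [] := HT i.
- by move=> i; have [] := HT i.
- rewrite sg0; have wz : (w \o inv z) (chart z z) = w z by rewrite -[RHS]sg0 /sg /= l0.
  have H : is_derive (l 0) v (chart (w z) \o (w \o inv z)) (der_map w z v).
    rewrite l0; have := is_derive_diff v (smooth_at_diff sw0).
    by rewrite /der_map /der_into wz; exact.
  exact: (is_derive_lineP H).
- have ci : {for chart z z, continuous (inv z)}.
    by apply: Defs.inv_continuous; exact/img_chart/dom_self.
  have nd : \forall y \near inv z (chart z z), dotted y.
    by apply: near_dotted; rewrite chartK //; exact: dom_self.
  have : \forall s \near (0 : R), dotted (inv z (l s)).
    have cil : {for (0 : R), continuous (inv z \o l)}.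
      by apply: continuous_comp; [exact: cl|rewrite l0].
    by apply: (cil (@dotted R S)); rewrite /= l0.
  apply: filterS => s ds.
  have cf y : dotted y -> {for y, continuous f} by move=> /sf; exact: sm_fun_continuous.
  have [i Hi] := orbit_clusters c0 dphi fphi cf ds; exists i.
  apply: (value_on_orbit dphi wphi ds (HT i)) => B /(Hi 0%N)[m _ Bm].
  by exists m.
Qed.

Section End.
Variables (a : 'I_(npos S) + 'I_(nneg S)) (A0 : R).
Local Notation E := (pos_end (puncture a)).
Hypothesis hE : forall x, halfplane A0 x -> holo_at E x /\ der_into E x (1, 0) != 0.
Hypothesis dE : forall x, halfplane A0 x -> @dotted R S (E x).
Hypothesis tan : forall z v, dotted z -> pi_xi ct (w z) (der_map w z v) = 0.

Let W := w \o E.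
Let F := f \o E.
Let al (x v : C) : R := lam ct (W x) (der_into W x v).

Let sW x : halfplane A0 x -> sm_into W x /\
  forall v, der_into W x v = der_map w (E x) (der_into E x v).
Proof. by move=> hx; have [[sE _] _] := hE hx; exact: (sm_into_comp fC fV sE (sw (dE hx))). Qed.

Let sF x : halfplane A0 x -> smooth_at x F /\
  forall v, 'D_v F x = der_fun f (E x) (der_into E x v).
Proof.
by move=> hx; have [[sE _] _] := hE hx; exact: (sm_fun_comp fC fdim_R sE (sf (dE hx))).
Qed.

Let alE x v : halfplane A0 x -> al x v = - 'D_(rot v) F x.
Proof.
move=> hx; have [_ ->] := sF hx; have [[_ ->] _] := hE hx.
by rewrite (der_fun_rot _ (dE hx)) opprK /al; have [_ ->] := sW hx.
Qed.

Let DWr x v : halfplane A0 x -> der_into W x v = al x v *: reeb ct (W x).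
Proof.
move=> hx; rewrite /al; have [_ ->] := sW hx.
by apply/eqP; rewrite -subr_eq0; apply/eqP; exact: tan (dE hx).
Qed.

Let ext_reeb (q : Q) (c : R) (v : V) : dlam ct q (c *: reeb ct q) v = 0.
Proof.
have -> : c *: reeb ct q = (c - 1) *: reeb ct q + reeb ct q by rewrite scalerBl scale1r subrK.
by rewrite /dlam (ext_der_linear_l (lam_smooth ct)) !reeb_ext mulr0 addr0.
Qed.

Let sFo : smooth_on (halfplane A0) F.
Proof. by apply/(smooth_onP _ (@halfplane_open R A0)) => x /sF[]. Qed.

Lemma end_harmonic x : halfplane A0 x ->
  'D_(1, 0) ('D_(1, 0) F) x + 'D_(0, 1) ('D_(0, 1) F) x = 0.
Proof.
move=> hx; have sx := smooth_at_diff (sF hx).1.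
have E1 y : halfplane A0 y -> 'D_(1, 0) F y = al y (0, 1).
  move=> hy; rewrite alE //; have -> : rot (0, 1) = - (1, 0) :> C.
    by congr pair; rewrite /= ?oppr0.
  by rewrite (derive_dirN _ (smooth_at_diff (sF hy).1)) opprK.
have E2 y : halfplane A0 y -> 'D_(0, 1) F y = - al y (1, 0).
  move=> hy; rewrite alE // opprK; congr ('D_ _ _ _).
  by congr pair; rewrite /= ?oppr0.
have sa1 : smooth_at x (fun y => al y (1, 0)).
  apply: (smooth_at_eq_on (@halfplane_open R A0) hx) => [y hy|].
    by rewrite -[RHS]opprK -(E2 _ hy).
  exact/smooth_atN/smooth_at_derive/(sF hx).1.
rewrite (derive_eq_on _ (@halfplane_open R A0) hx E1) (derive_eq_on _ (@halfplane_open R A0) hx E2).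
rewrite deriveN; last exact/diff_derivable/smooth_at_diff.
have sWx y : halfplane A0 y -> sm_into W y by move=> /sW[].
have := pullback_form fV (lam_smooth ct) ((1, 0) : C) ((0, 1) : C) (@halfplane_open R A0) hx sWx.
rewrite /= (DWr (1, 0) hx); move: (ext_reeb (W x) (al x (1, 0)) (der_into W x (0, 1))).
by rewrite /dlam => ->.
Qed.

(** [h] is the conjugate of [F] normalized by h x0 = s0. Along the segment from [x0] to [x], both
    [W] and [ga \o h] follow the Reeb field with speed ['D_v h] and start at the same point, so ODE
    uniqueness identifies them. *)
Lemma end_conjugate ga x0 s0 : reeb_path ct setT (fun=> 1) ga ->
  halfplane A0 x0 -> W x0 = ga s0 -> exists h : C -> R,
  [/\ smooth_on (halfplane A0) h,
      forall x v, halfplane A0 x -> 'D_v h x = - 'D_(rot v) F x &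
      forall x, halfplane A0 x -> W x = ga (h x)].
Proof.
move=> hg hx0 Wx0.
have [h0 [sh0 Dh0]] := harmonic_conjugate (@halfplane_open R A0) (@halfplane_convex R A0) hx0 sFo end_harmonic.
pose h x := h0 x + (s0 - h0 x0).
have sh x : halfplane A0 x -> smooth_at x h.
  move=> hx; apply: smooth_atD; last exact: smooth_at_cst.
  exact: (smooth_at_on (@halfplane_open R A0) hx sh0).
have Dh x v : halfplane A0 x -> 'D_v h x = - 'D_(rot v) F x.
  move=> hx; have d := is_derive_diff v (smooth_at_diff (smooth_at_on (@halfplane_open R A0) hx sh0)).
  by have [_ ->] := is_derive_addP d (is_derive_cst (s0 - h0 x0) x v); rewrite addr0 Dh0.
exists h; split; [by apply/(smooth_onP _ (@halfplane_open R A0))|exact: Dh|move=> x hx].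
pose v := x - x0; pose l (s : R) : C := x0 + s *: v.
pose J := [set s | halfplane A0 (l s)].
have cl (s : R) : {for s, continuous l}.
  by apply: continuousD; [exact: cst_continuous|apply: cvgZr_tmp; exact: cvg_id].
have oJ : open J by apply: open_comp; [move=> s _; exact: cl|exact: halfplane_open].
have J01 (s : R) : 0 <= s <= 1 -> J s.
  by move=> s01; apply: halfplane_convex => //; rewrite /v addrC subrK.
pose rho s := 'D_v h (l s).
have crho s : J s -> {for s, continuous rho}.
  move=> Js; have c1 := smooth_at_continuous (smooth_at_derive v (sh _ Js)).
  exact: (continuous_comp (cl s) c1).
have p1 : reeb_path ct J rho (W \o l).
  move=> s Js; have [cW sWs] := (sW Js).1.
  split; first exact: (continuous_comp (cl s) cW).
  have <- : der_into W (l s) v = rho s *: reeb ct ((W \o l) s).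
    by rewrite (DWr _ Js) (alE _ Js) /rho Dh.
  exact: (is_derive_lineP (is_derive_diff v (smooth_at_diff sWs))).
have p2 : reeb_path ct J rho (ga \o (h \o l)).
  apply: reeb_path_comp => // s Js.
  exact: (is_derive_lineP (is_derive_diff v (smooth_at_diff (sh _ Js)))).
have l0 : l 0 = x0 by rewrite /l scale0r addr0.
have l1 : l 1 = x by rewrite /l scale1r addrC subrK.
have E0 : (W \o l) 0 = (ga \o (h \o l)) 0.
  by rewrite /= l0 Wx0 /h addrC subrK.
have := reeb_path_unique oJ J01 crho p1 p2 E0; move=> /(_ 1).
by rewrite lexx ler01 /= l1; exact.
Qed.

End End.

(* The coordinates (f, h) / T near a puncture, where h is the angle of w along
   the Reeb orbit ga. *)
Definition end_coordinates (a : 'I_(npos S) + 'I_(nneg S)) (ga : R -> Q) (T : R)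
    (E : C -> S) (A : R) :=
  [/\ forall x, halfplane A x ->
        [/\ holo_at E x, @dotted R S (E x), f (E x) = T * x.1 & w (E x) = ga (T * x.2)],
      forall x (k : int), halfplane A x -> E (x.1, x.2 + k%:~R) = E x,
      forall x y, halfplane A x -> halfplane A y -> E x = E y ->
        x.1 = y.1 /\ exists k : int, x.2 = y.2 + k%:~R,
      forall K, \forall z \near puncture a, z = puncture a \/
        exists x, [/\ halfplane A x, halfplane K x & E x = z] &
      forall P : S -> Prop, (\forall z \near puncture a, P z) ->
        exists K, forall x, halfplane K x -> halfplane A x -> P (E x)].

(** The orbit of [z] is used twice: it provides the point of the end where [W] meets [ga], and it
    makes [f] unbounded above over one period strip of the end, whence T > 0. *)
Lemma end_model phi c z : 0 < c ->
  (forall z, dotted z -> dotted (phi z)) ->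
  (forall z, dotted z -> f (phi z) = f z + c) ->
  (forall z, dotted z -> w (phi z) = w z) ->
  (forall a, exists ga T, end_orbit ct w a ga T) -> dotted z ->
  exists a ga T E A, [/\ 0 < T, reeb_path ct setT (fun=> 1) ga, forall s, ga (s + T) = ga s,
    end_coordinates a ga T E A &
    forall B, nbhs (puncture a) B -> exists m, B (iter m phi z)].
Proof.
move=> c0 dphi fphi wphi ends dz.
have tan := orbit_tangent c0 dphi fphi wphi ends.
have cf y : dotted y -> {for y, continuous f} by move=> /sf; exact: sm_fun_continuous.
have [a Ha] := orbit_clusters c0 dphi fphi cf dz.
have [ga [T hend]] := ends a; have [T0 hg gT lim] := hend.
have [A0 [hE dE iE]] := puncture_end a; set E := pos_end _ in hE dE iE.
have enter N B : exists m x, [/\ (N <= m)%N, halfplane B x, 0 <= x.2 <= 1 & E x = iter m phi z].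
  have [m Nm [pE|[x [hx x01 Ex]]]] := Ha N _ (pos_end_near (puncture a) B).
    by have := @iter_dotted R S phi dphi m z dz; rewrite pE => dp; exfalso; apply: dp; exists a.
  by exists m, x.
have [s0 ws0] : exists s, w z = ga s.
  by apply: (value_on_orbit dphi wphi dz hend) => B /(Ha 0%N)[m _ Bm]; exists m.
have [m0 [x0 [_ hx0 _ Ex0]]] := enter 0%N A0.
have wx0 : (w \o E) x0 = ga s0 by rewrite /= Ex0 (iter_w dphi wphi).
have [h [sh CRh Wh]] := end_conjugate hE dE tan hg hx0 wx0.
have sFo : smooth_on (halfplane A0) (f \o E).
  apply/(smooth_onP _ (@halfplane_open R A0)) => x hx; have [[sE _] _] := hE _ hx.
  by have [] := sm_fun_comp fC (@fdim_R R) sE (sf (dE _ hx)).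
have perE x (k : int) : E (x.1, x.2 + k%:~R) = E x by exact: pos_end_period.
have perW x (k : int) : (w \o E) (x.1, x.2 + k%:~R) = (w \o E) x by rewrite /= perE.
have perF x (k : int) : (f \o E) (x.1, x.2 + k%:~R) = (f \o E) x by rewrite /= perE.
have grow K B : exists x, [/\ halfplane B x, 0 <= x.2 <= 1 & K < (f \o E) x].
  have [m [x [Nm hx x01 Ex]]] := enter (Num.bound `|(K - f z) / c|) B; exists x; split=> //.
  rewrite /= Ex (iter_f dphi fphi) // -ltrBlDl -ltr_pdivrMr //.
  apply: le_lt_trans (ler_norm _) _; apply: lt_le_trans (archi_boundP (normr_ge0 _)) _.
  by rewrite ler_nat.
have Tpos := growth_pos T0 hg gT lim perW Wh sFo sh CRh grow.
have [G [A [hG pG onG farG]]] := model_inverse T0 hg gT lim perW perF Wh sFo sh CRh Tpos.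
exists a, ga, T, (E \o G), A; split=> //; last by move=> B /(Ha 0%N)[m _ Bm]; exists m.
split.
- move=> x hx; have [hGx FG aG sG cG] := hG _ hx; have [[sE rE] _] := hE _ hGx.
  have [sEG DEG] := sm_into_precomp fC fC sG sE.
  split; [|exact: dE|exact: FG|by rewrite /= -aG; exact: Wh].
  by split; [exact: sEG|move=> v; rewrite !DEG cG rE].
- by move=> x k hx; rewrite /= pG // perE.
- move=> x y hx hy /= Exy; have [hGx FGx aGx _ _] := hG _ hx; have [hGy FGy aGy _ _] := hG _ hy.
  have [E1 [k E2]] := iE _ _ hGx hGy Exy.
  have hyk : halfplane A ((y.1, y.2 + k%:~R) : C) by [].
  have EG : G x = G (y.1, y.2 + k%:~R) by rewrite pG // [G x]surjective_pairing E1 E2.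
  have [_ FGk aGk _ _] := hG _ hyk; rewrite -EG /= in FGk aGk.
  have Tn : T != 0 by rewrite gt_eqF.
  by split; [apply: (mulfI Tn); rewrite -FGx|exists k; apply: (mulfI Tn); rewrite -aGx].
- move=> K; have [K' HK'] := onG K; apply: filterS (pos_end_near (puncture a) K') => y.
  move=> [->|[x [hx _ <-]]]; [by left|right].
  by have [y' [h1 h2 E']] := HK' _ hx; exists y'; split=> //=; rewrite E'.
- move=> P /pos_end_cvg[K HK]; have [K' HK'] := farG K; exists K' => x hx hAx.
  exact/HK/HK'.
Qed.

End Curve.

(** * Curves invariant under a translation are trivial cylinders *)

Section Cylinder.
Context {R : realType} {n : nat}.
Local Notation V := 'rV[R]_(n.*2.+1).
Local Notation C := (R * R)%type.
Context {Q : manifold V}.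
Variables (ct : contact_triad Q) (S : punctured_surface R) (w : S -> Q) (f : S -> R).
Let fC : fdim C := fdim_prod fdim_R fdim_R.
Let fV : fdim V := fdim_rV _.
Hypothesis sw : forall z, dotted z -> sm_map w z.
Hypothesis sf : forall z, dotted z -> sm_fun f z.
Hypothesis hJ : Jholomorphic ct w f.
Hypothesis ends : forall a, exists ga T, end_orbit ct w a ga T.

(** In these coordinates [f] is T times the first one, so df takes the value T != 0 on the image of
    (1, 0), which therefore cannot vanish. *)
Lemma immersion_of_height (g : C -> S) (U : set C) (T : R) x : open U -> U x -> T != 0 ->
  sm_into g x -> dotted (g x) -> (forall y, U y -> f (g y) = T * y.1) ->
  der_into g x (1, 0) != 0.
Proof.
move=> oU Ux T0 sg dg fg; have [sfg Dfg] := sm_fun_comp fC (@fdim_R R) sg (sf dg).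
pose e1 : C := (1, 0).
have ds : is_derive x e1 (fun x : C => x.1) 1.
  refine (is_derive_conv (is_derive_diff e1 (@linear_differentiable R _ _ fstL x (@fst_continuous R))) _).
  exact: (@derive_linear R _ _ fstL x e1 (@fst_continuous R)).
have := Dfg e1; rewrite (derive_eq_on e1 oU Ux fg).
have [_ ->] := is_derive_mulP (is_derive_cst T x e1) ds.
rewrite mulr1 mulr0 addr0 => TE; apply/eqP => d0; move: TE.
by rewrite /e1 d0 /der_fun derive0 => /eqP; rewrite (negbTE T0).
Qed.

Section Iterate.
Variables (phi : S -> S).
Hypothesis hphi : holomorphic_self_map phi.
Hypothesis dphi : forall z, dotted z -> dotted (phi z).

Lemma self_map_smooth z : dotted z -> sm_map phi z.
Proof.
have [_ _ sphi _] := hphi; exact: (smooth_map_onP _ fC fC (@dotted_open R S)).1.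
Qed.

Lemma iter_self_map m z : dotted z -> sm_map (iter m phi) z /\
  forall v, der_map (iter m phi) z (rot v) = rot (der_map (iter m phi) z v).
Proof.
move=> dz; elim: m => [|m [sm rm]].
  by have [si di] := sm_id z fC; split=> // v; rewrite !di.
have dm : dotted (iter m phi z) by exact: iter_dotted.
have [sc dc] := sm_map_comp fC fC sm (self_map_smooth dm); split; first exact: sc.
by have [_ _ _ rp] := hphi; move=> v; rewrite -[iter m.+1 phi]/(phi \o iter m phi) !dc rm rp.
Qed.

Lemma iter_self_map_continuous m z : {for z, continuous (iter m phi)}.
Proof.
have [cphi _ _ _] := hphi; elim: m => [|m IH]; first exact: cvg_id.
by apply: (continuous_comp IH); exact: cphi.
Qed.

End Iterate.

Variables (phi phi' : S -> S) (c : R).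
Hypothesis phiK : cancel phi phi'.
Hypothesis phiK' : cancel phi' phi.
Hypothesis hphi : holomorphic_self_map phi.
Hypothesis hphi' : holomorphic_self_map phi'.
Hypothesis c0 : 0 < c.
Hypothesis fphi : forall z, dotted z -> f (phi z) = f z + c.
Hypothesis wphi : forall z, dotted z -> w (phi z) = w z.

Let dphi z : dotted z -> dotted (phi z).
Proof.
have [_ pp _ _] := hphi'; move=> dz [a _ E]; apply: dz; exists a => //.
by rewrite -[LHS]pp E phiK.
Qed.

Let dphi' z : dotted z -> dotted (phi' z).
Proof.
have [_ pp _ _] := hphi; move=> dz [a _ E]; apply: dz; exists a => //.
by rewrite -[LHS]pp E phiK'.
Qed.

Let fphi' z : dotted z -> f (phi' z) = f z + - c.
Proof. by move=> dz; rewrite -{2}(phiK' z) fphi ?addrK //; exact: dphi'. Qed.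

Let wphi' z : dotted z -> w (phi' z) = w z.
Proof. by move=> dz; rewrite -{2}(phiK' z) wphi //; exact: dphi'. Qed.

Let iterK m z : iter m phi' (iter m phi z) = z.
Proof. by elim: m z => // m IH z; rewrite (iterS m phi) (iterSr m phi') phiK IH. Qed.

Let iterK' m z : iter m phi (iter m phi' z) = z.
Proof. by elim: m z => // m IH z; rewrite (iterS m phi') (iterSr m phi) phiK' IH. Qed.

Section Model.
Variables (a : 'I_(npos S) + 'I_(nneg S)) (ga : R -> Q) (T : R) (E : C -> S) (A : R).
Hypothesis T0 : 0 < T.
Hypothesis hg : reeb_path ct setT (fun=> 1) ga.
Hypothesis gT : forall s, ga (s + T) = ga s.
Hypothesis hE : end_coordinates w f a ga T E A.

Let Tn : T != 0. Proof. by rewrite gt_eqF. Qed.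

Let E_immersion x : halfplane A x -> der_into E x (1, 0) != 0.
Proof.
have [h _ _ _ _] := hE; move=> hx; have [[sE _] dE _ _] := h _ hx.
by apply: (immersion_of_height (@halfplane_open R A) hx Tn sE dE) => y /h[].
Qed.

(* phi preserves the Reeb orbit and shifts f by c, so it is a translation in the
   coordinates E up to a period of ga, which is locally constant. *)
Lemma end_shift : exists A' k, [/\ A <= A', (forall r, ga (r + T * k) = ga r) &
  forall x, halfplane A' x -> phi (E x) = E (x + (c / T, k))].
Proof.
have [h pE iE onE cvE] := hE; have [cphi pphi _ _] := hphi.
(* [phi] is continuous and fixes the puncture, so it maps the far part of the end back into the
   end. *)
have nphi : \forall z \near puncture a, phi z = puncture a \/
    exists x, [/\ halfplane A x, halfplane A x & E x = phi z].
  by have := onE A; rewrite -{1}(pphi a) => /(cphi (puncture a)).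
have [K HK] := cvE _ nphi; pose A' := Num.max A K.
have hA x : halfplane A' x -> halfplane A x by apply: le_lt_trans; rewrite le_max lexx.
have step x : halfplane A' x -> exists y, [/\ halfplane A y, E y = phi (E x),
    y.1 = x.1 + c / T & forall r, ga (r + (T * y.2 - T * x.2)) = ga r].
  move=> hx; have hAx := hA _ hx; have hKx : halfplane K x.
    by apply: le_lt_trans hx; rewrite le_max lexx orbT.
  have [_ dE fE wE] := h _ hAx.
  have [pE'|[y [hy _ Ey]]] := HK _ hKx hAx.
    by exfalso; apply: (dphi dE); exists a.
  have [_ _ fEy wEy] := h _ hy; exists y; split=> //.
    by apply: (mulfI Tn); rewrite -fEy Ey fphi // fE mulrDr [T * (c / T)]mulrC divfK.
  by apply: reeb_coincide hg _ _ _; rewrite -wEy Ey wphi // wE.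
have hx0 : halfplane A' ((A' + 1, 0) : C) by rewrite /halfplane /= ltrDl.
have [y0 [hy0 Ey0 y01 py0]] := step _ hx0.
pose k := y0.2; exists A', k.
have perk r : ga (r + T * k) = ga r by have := py0 r; rewrite /= mulr0 subr0.
split=> //; first by rewrite le_max lexx.
pose P x := phi (E x) = E (x + (c / T, k)).
have cT : 0 < c / T by rewrite divr_gt0.
have hsh x : halfplane A' x -> halfplane A' (x + (c / T, k)).
  by move=> hx; apply: lt_trans hx _; rewrite /= ltrDl.
have P0 : P (A' + 1, 0).
  rewrite /P -Ey0; congr E; rewrite [LHS]surjective_pairing y01; congr pair.
  by rewrite /= add0r.
suff lc x : halfplane A' x -> \forall y \near x, P y = P x.
  move=> x hx; rewrite -/(P x).
  by rewrite (@locally_constant_convex R _ _ _ P (@halfplane_convex R A') lc _ _ hx0 hx).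
move=> hx; have [[[cE _] _] dE fE wE] := h _ (hA _ hx).
have [[[cE' _] _] dE' fE' wE'] := h _ (hA _ (hsh _ hx)).
have cpE : {for x, continuous (phi \o E)} by apply: (continuous_comp cE); exact: cphi.
have csh : {for x, continuous (fun y : C => y + (c / T, k))}.
  by apply: cvgD; [exact: cvg_id|exact: cst_continuous].
have cEs : {for x, continuous (E \o (fun y : C => y + (c / T, k)))} by exact: (continuous_comp csh cE').
have [Px|nP] := pselect (P x); last first.
  have := hausdorff_near_neq (@mhausdorff _ _ S) cpE cEs nP.
  by apply: filterS => y ny; rewrite propeqE; split.
have [d d0 Hd] := reeb_period_isolated hg.
(* The defect T (y.2 - t.2 - k) is a period of [ga]. Two errors of size d / (2 T), one for [y] and
   one for [t], keep it below [d] in absolute value, hence zero. *)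
have e0 : 0 < d / (2 * T) by rewrite divr_gt0 // mulr_gt0.
pose y' := x + (c / T, k); pose U : set C := halfplane A `&` [set y | `|y' - y| < d / (2 * T)].
have oU : open U.
  apply: openI; first exact: halfplane_open.
  have -> : [set y : C | `|y' - y| < d / (2 * T)] = ball (y' : C) (d / (2 * T)).
    by rewrite -ball_normE.
  exact: ball_open.
have Uy' : U y' by split; [exact/hA/hsh|rewrite /= subrr normr0].
have hU y : U y -> holo_at E y by move=> [/h[]].
have [W [L [[oW Wy WU oEW] _]]] := holo_local_inverse oU Uy' hU (E_immersion (hA _ (hsh _ hx))).
have nW : \forall t \near x, (E @` W) (phi (E t)).
  apply: (cpE (E @` W)); apply: open_nbhs_nbhs; split; first exact: oEW.
  by exists y' => //; exact: esym Px.
have nd : \forall t \near x, `|x - t| < d / (2 * T).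
  by have /cvgrPdist_lt/(_ _ e0) := @cvg_id _ (nbhs x).
have nh : \forall t \near x, halfplane A' t.
  by apply: open_nbhs_nbhs; split=> //; exact: halfplane_open.
apply: filterS (near_and nW (near_and nd nh)) => t [[y Wy' Ey] [xt ht]].
have Pt : P t; last by rewrite propeqE; split.
have [hAy yd] := WU _ Wy'.
have [_ dEt fEt wEt] := h _ (hA _ ht); have [_ _ fEy wEy] := h _ hAy.
have y1 : y.1 = t.1 + c / T.
  by apply: (mulfI Tn); rewrite -fEy Ey fphi // fEt mulrDr [T * (c / T)]mulrC divfK.
have py : forall r, ga (r + (T * y.2 - T * t.2)) = ga r.
  by apply: reeb_coincide hg _ _ _; rewrite -wEy Ey wphi // wEt.
have y2 : y.2 = t.2 + k.
  have z0 : T * y.2 - T * t.2 - T * k = 0.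
    apply: Hd => [|r]; last by rewrite -(perk (r + _)) addrA subrK py.
    have n1 := le_lt_trans (norm_snd _) yd; have n2 := le_lt_trans (norm_snd _) xt.
    rewrite /= in n1 n2; rewrite -mulrBr -mulrBr normrM gtr0_norm // mulrC -ltr_pdivlMr //.
    have -> : d / T = d / (2 * T) + d / (2 * T) by field.
    rewrite (_ : y.2 - t.2 - k = (x.2 - t.2) - (x.2 + k - y.2)); last by ring.
    by apply: le_lt_trans (ler_normB _ _) _; exact: ltrD.
  by apply: (mulfI Tn); rewrite mulrDr; move: z0; move: (T * y.2) (T * t.2) (T * k) => p q r; lra.
by rewrite /P -Ey; congr E; rewrite [LHS]surjective_pairing y1 y2.
Qed.

Section Shift.
Variables (B k : R).
Hypothesis AB : A <= B.
Hypothesis perk : forall r, ga (r + T * k) = ga r.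
Hypothesis shE : forall x, halfplane B x -> phi (E x) = E (x + (c / T, k)).
Let hAB x : halfplane B x -> halfplane A x. Proof. exact: le_lt_trans. Qed.
Let cT : 0 < c / T. Proof. by rewrite divr_gt0. Qed.

Definition shift_by (m : nat) (x : C) : C := x + ((m%:R * (c / T), m%:R * k) : C).

Let shiftS m x : shift_by m.+1 x = shift_by m x + (c / T, k).
Proof.
by rewrite /shift_by -addrA; congr (x + _); congr pair; rewrite /= -natr1 mulrDl mul1r.
Qed.

Let shift_half K m x : halfplane K x -> halfplane K (shift_by m x).
Proof. by move=> hx; apply: (lt_le_trans hx); rewrite /= lerDl mulr_ge0 // ltW. Qed.

Let shift_far K x : exists N, forall m, (N <= m)%N -> halfplane K (shift_by m x).
Proof.
exists (Num.bound `|(K - x.1) / (c / T)|) => m Nm; rewrite /halfplane /shift_by /=.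
rewrite -ltrBlDl -ltr_pdivrMr //.
apply: le_lt_trans (ler_norm _) _; apply: lt_le_trans (archi_boundP (normr_ge0 _)) _.
by rewrite ler_nat.
Qed.

Let iterE m x : halfplane B x -> iter m phi (E x) = E (shift_by m x).
Proof.
move=> hx; elim: m => [|m IH]; first by rewrite /shift_by !mul0r (_ : x + (0, 0) = x) //; exact: addr0.
by rewrite /= IH shE ?shiftS //; exact: shift_half.
Qed.

Definition attracted b z := forall P : S -> Prop, (\forall y \near puncture b, P y) ->
  exists N, forall m, (N <= m)%N -> P (iter m phi z).

(** A single visit to the region where [phi] acts as a translation is enough: from then on each step
    adds c / T > 0 to the first coordinate. Clustering at the puncture is thereby upgraded to
    convergence. *)
Lemma end_attracted j z x : halfplane B x -> iter j phi z = E x -> attracted a z.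
Proof.
have [_ _ _ _ cvE] := hE; move=> hx zx P /cvE[K HK]; have [N HN] := shift_far K x.
exists (N + j)%N => m Nm; have jm : (j <= m)%N by apply: leq_trans Nm; rewrite leq_addl.
rewrite -(subnK jm) iterD zx iterE //; apply: HK; last exact/shift_half/hAB.
by apply: HN; rewrite leq_subRL // addnC.
Qed.

Lemma basin_open j z x : halfplane B x -> dotted z -> iter j phi z = E x ->
  \forall y \near z, exists2 x, halfplane B x & iter j phi y = E x.
Proof.
have [h _ _ _ _] := hE; move=> hx dz zx.
have hB y : halfplane B y -> holo_at E y by move=> /hAB/h[].
have [W [L [[oW Wx WB oEW] _]]] := holo_local_inverse (@halfplane_open R B) hx hB (E_immersion (hAB hx)).
have : \forall y \near z, (E @` W) (iter j phi y).
  have nb : nbhs (iter j phi z) (E @` W).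
    by apply: open_nbhs_nbhs; split=> //; rewrite zx; exists x.
  exact: (iter_self_map_continuous hphi nb).
by apply: filterS => y [x' Wx' <-]; exists x' => //; exact: WB.
Qed.

Section Coordinates.
Hypothesis hbasin : forall z, dotted z -> exists m x, halfplane B x /\ iter m phi z = E x.

Let depth x : nat := xget 0%N [set m | halfplane B (shift_by m x)].
Let depthP x : halfplane B (shift_by (depth x) x).
Proof.
have [N HN] := shift_far B x.
exact: (xgetPex 0%N (ex_intro [set m | halfplane B (shift_by m x)] N (HN N (leqnn N)))).
Qed.

(* The end coordinates are extended to R x S^1 by conjugation with phi. *)
Definition cylinder_map (x : C) : S := iter (depth x) phi' (E (shift_by (depth x) x)).
Local Notation psi := cylinder_map.

(** Every sufficiently large number of steps gives the same point, by the translation law. So [m]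
    can be frozen near a point, which gives smoothness, and two points can be compared with a common
    [m]. *)
Let psiE m x : halfplane B (shift_by m x) -> psi x = iter m phi' (E (shift_by m x)).
Proof.
have key i j : (i <= j)%N -> halfplane B (shift_by i x) ->
    iter i phi' (E (shift_by i x)) = iter j phi' (E (shift_by j x)).
  move=> ij hi; have -> : shift_by j x = shift_by (j - i) (shift_by i x).
    rewrite /shift_by -addrA; congr (x + _).
    by congr pair; rewrite /= -mulrDl -natrD subnKC.
  rewrite -(iterE (j - i) hi) -{1}(iterK (j - i) (E (shift_by i x))) -iterD subnKC //.
move=> hm; rewrite /psi; have [le|/ltnW le] := leqP (depth x) m.
  exact: key le (depthP x).
by apply/esym; exact: key le hm.
Qed.

Let psi_props x : [/\ holo_at psi x, dotted (psi x), f (psi x) = T * x.1 & w (psi x) = ga (T * x.2)].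
Proof.
have [h _ _ _ _] := hE; set m := depth x.
have hm : halfplane B (shift_by m x) by exact: depthP.
have [hEx dE fE wE] := h _ (hAB hm).
rewrite (psiE hm); split.
- pose g := E \o shift_by m.
  have sS : smooth_at x (shift_by m) by apply: smooth_atD; [exact: smooth_at_id|exact: smooth_at_cst].
  have DS v : 'D_v (shift_by m) x = v.
    have [_ ->] := derive_translate (@derive_idP R C (x + ((m%:R * (c / T), m%:R * k) : C)) v).1.
    by have [_ ->] := @derive_idP R C (x + ((m%:R * (c / T), m%:R * k) : C)) v.
  have [sE rE] := hEx; have [sg Dg] := sm_into_precomp fC fC sS sE.
  have [si ri] := iter_self_map hphi' dphi' m dE.
  have [sp Dp] := sm_into_comp fC fC sg si.
  have near_eq : \forall y \near x, (iter m phi' \o g) y = psi y.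
    have : \forall y \near x, halfplane B (shift_by m y).
      apply: (smooth_at_continuous sS); apply: open_nbhs_nbhs; split=> //; exact: halfplane_open.
    by apply: filterS => y hy; rewrite (psiE hy).
  split; first exact: sm_into_eq near_eq sp.
  by move=> v; rewrite -!(der_into_eq _ near_eq) !Dp !Dg !DS rE ri.
- exact: (@iter_dotted R S phi' dphi' m (E (shift_by m x))).
- rewrite (iter_f dphi' fphi') // fE /shift_by /= mulrDr mulrCA [T * (c / T)]mulrC divfK //.
  by rewrite mulrN addrK.
- rewrite (iter_w dphi' wphi') // wE /shift_by /= mulrDr mulrCA.
  elim: (m) => [|i IH]; first by rewrite mul0r addr0.
  by rewrite -natr1 mulrDl mul1r addrA perk.
Qed.

Let psi_period tau t : psi (tau, t + 1) = psi (tau, t).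
Proof.
have [_ pE _ _ _] := hE; set m := depth (tau, t).
have hm : halfplane B (shift_by m (tau, t)) by exact: depthP.
have hm' : halfplane B (shift_by m (tau, t + 1)) by [].
rewrite (psiE hm) (psiE hm'); congr (iter m phi' _).
by rewrite -(pE _ 1 (hAB hm)); congr E; congr pair; rewrite /= addrAC.
Qed.

Let psi_inj x y : psi x = psi y -> x.1 = y.1 /\ exists j : int, x.2 = y.2 + j%:~R.
Proof.
have [_ _ iE _ _] := hE; move=> Exy.
have [N1 H1] := shift_far B x; have [N2 H2] := shift_far B y; pose m := maxn N1 N2.
have hx : halfplane B (shift_by m x) by apply: H1; rewrite leq_maxl.
have hy : halfplane B (shift_by m y) by apply: H2; rewrite leq_maxr.
have := congr1 (iter m phi) Exy; rewrite (psiE hx) (psiE hy) !iterK'.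
move=> /(iE _ _ (hAB hx) (hAB hy)); rewrite /shift_by /= => -[/addIr e1 [j e2]]; split=> //.
by exists j; move: e2; rewrite addrAC => /addIr.
Qed.

Let psi_range : range psi = @dotted R S.
Proof.
apply/seteqP; split=> [_ [x _ <-]|z dz]; first by have [] := psi_props x.
have [m [x [hx Ex]]] := hbasin dz.
exists (x - ((m%:R * (c / T), m%:R * k) : C)) => //.
have sx : shift_by m (x - ((m%:R * (c / T), m%:R * k) : C)) = x by rewrite /shift_by subrK.
by rewrite (psiE (m := m)) ?sx // -Ex iterK.
Qed.

Let circle (x : C) : R * C := (x.1, (cos (2 * pi * x.2), sin (2 * pi * x.2))).

Let circle_smooth x : smooth_at x circle.
Proof.
have s2 : smooth_at x (fun x : C => 2 * pi * x.2).
  apply: smooth_atM; first exact: smooth_at_cst.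
  exact: (@smooth_at_lin R _ _ x sndL (@snd_continuous R)).
have [sc ss] := cos_sin_smooth (2 * pi * x.2).
apply: smooth_at_pair; first exact: (@smooth_at_lin R _ _ x fstL (@fst_continuous R)).
by apply: smooth_at_pair; [exact: (smooth_at_comp _ _ s2 sc)|exact: (smooth_at_comp _ _ s2 ss)].
Qed.

(** The inverse diffeomorphism is [circle] applied to an arbitrary choice of preimages: preimages
    differ by integers in t, which [circle] forgets. Near each point the choice can thus be replaced
    by a holomorphic local inverse, which exists because [psi] is immersive. *)
Lemma cylinder_map_coordinates : cylinder_coordinates psi.
Proof.
split.
- by apply/(smooth_intoP _ fC openT) => x _; have [[]] := psi_props x.
- by move=> x; have [[]] := psi_props x.
- exact: psi_period.
- exact: psi_range.
have /choice[X HX] z : exists x, dotted z -> psi x = z.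
  have [dz|nd] := pselect (dotted z); last by exists 0.
  by have [x _ <-] : range psi z; [rewrite psi_range|exists x].
have Xpsi x : circle (X (psi x)) = circle x.
  have dx : dotted (psi x) by have [] := psi_props x.
  have [e1 [j e2]] := psi_inj (HX _ dx); have [ec es] := circle_int x.2 j.
  by rewrite /circle e1 e2 ec es.
exists (circle \o X); last by move=> tau t; rewrite /= Xpsi.
apply/(smooth_fun_onP _ fC _ (@dotted_open R S)) => z; rewrite -psi_range => -[x _ <-].
have hpsi y : setT y -> holo_at psi y by have [] := psi_props y.
have d0 : der_into psi x (1, 0) != 0.
  have [[sp _] dx _ _] := psi_props x.
  by apply: (immersion_of_height openT I Tn sp dx) => y _; have [] := psi_props y.
have [W [L [[oW Wx _ oN] [LK HL]]]] := holo_local_inverse openT I hpsi d0.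
have Nx : (psi @` W) (psi x) by exists x.
have [sL _] := HL _ Nx; set z0 := psi x in Nx sL *.
have sLc : smooth_at (L z0) circle by exact: circle_smooth.
have zK : inv z0 (chart z0 z0) = z0 by rewrite chartK //; exact: dom_self.
have sc : smooth_at (chart z0 z0) (circle \o (L \o inv z0)).
  by apply: (smooth_at_comp _ _ sL); rewrite /= zK.
apply: smooth_at_eq sc.
have ci : {for chart z0 z0, continuous (inv z0)}.
  by apply: Defs.inv_continuous; exact/img_chart/dom_self.
have : \forall y \near chart z0 z0, (psi @` W) (inv z0 y).
  have nb : nbhs (inv z0 (chart z0 z0)) (psi @` W).
    by rewrite zK; apply: open_nbhs_nbhs; split.
  exact: (ci _ nb).
by apply: filterS => y /= [u Wu <-]; rewrite LK // Xpsi.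
Qed.

Lemma cylinder_map_trivial : trivial_cylinder ct w f.
Proof.
have og (t : R) : is_derive t 1 (chart (ga t) \o ga) (reeb ct (ga t)).
  by have [_] := @hg t I; rewrite scale1r.
have cg : continuous ga by move=> t; exact: (@hg t I).1.
exists psi, (ClosedReebOrbit T0 gT cg og), 0; split; first exact: cylinder_map_coordinates.
by move=> tau t; have [_ _ -> ->] := psi_props (tau, t); rewrite addr0.
Qed.

End Coordinates.
End Shift.
End Model.

Let model z (dz : dotted z) := end_model sw sf hJ c0 dphi fphi wphi ends dz.

Lemma attracted_unique a b z : attracted a z -> attracted b z -> a = b.
Proof.
move=> ha hb; apply: contrapT => ab.
have N : puncture a <> puncture b by move=> /(@puncture_inj R S).
have [U [U' [nU nU' UU]]] := hausdorff_separate (@mhausdorff _ _ S) N.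
have [N1 H1] := ha _ nU; have [N2 H2] := hb _ nU'.
by apply: (UU (iter (maxn N1 N2) phi z)); [apply: H1; rewrite leq_maxl|apply: H2; rewrite leq_maxr].
Qed.

Lemma locally_attracted z : dotted z -> exists b, \forall y \near z, attracted b y.
Proof.
move=> dz; have [a [ga [T [E [A [T0 hg gT hE Hc]]]]]] := model dz.
have [B [k [AB perk shE]]] := end_shift T0 hg hE.
have [_ _ _ onE _] := hE; exists a.
have [m [pE|[x [_ hx Ex]]]] := Hc _ (onE B).
  by have := @iter_dotted R S phi dphi m z dz; rewrite pE => dp; exfalso; apply: dp; exists a.
have := basin_open T0 hE AB hx dz (esym Ex); apply: filterS => y [x' hx' Ex'].
exact: (end_attracted T0 hE AB shE hx' Ex').
Qed.

Lemma dotted_nonempty : exists z, @dotted R S z.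
Proof.
have [p _] := @ps_nonempty R S; have [dp|[a _]] := dotted_or_puncture p; first by exists p.
have [A0 [_ dE _]] := puncture_end a; exists (pos_end (puncture a) (A0 + 1, 0)).
by apply: dE; rewrite /halfplane /= ltrDl.
Qed.

Lemma translated_trivial : trivial_cylinder ct w f.
Proof.
have [z0 dz0] := dotted_nonempty.
have [a [ga [T [E [A [T0 hg gT hE Hc]]]]]] := model dz0.
have [B [k [AB perk shE]]] := end_shift T0 hg hE.
have [_ _ _ onE _] := hE.
have enter z : dotted z -> forall m, (iter m phi z = puncture a \/
    exists x, [/\ halfplane A x, halfplane B x & E x = iter m phi z]) ->
    exists m x, halfplane B x /\ iter m phi z = E x.
  move=> dz m [pE|[x [_ hx Ex]]]; last by exists m, x.
  by have := @iter_dotted R S phi dphi m z dz; rewrite pE => dp; exfalso; apply: dp; exists a.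
have az0 : attracted a z0.
  have [m /(enter _ dz0)[j [x [hx Ex]]]] := Hc _ (onE B).
  exact: (end_attracted T0 hE AB shE hx Ex).
have same z : dotted z -> attracted a z = attracted a z0.
  move=> dz; apply: (locally_constant_dotted _ dz dz0) => {dz}z dz.
  have [b Hb] := locally_attracted dz; have bz := nbhs_singleton Hb.
  have [ab|nab] := pselect (a = b).
    by rewrite -ab in Hb bz; apply: filterS Hb => y Hy; rewrite propeqE; split.
  by apply: filterS Hb => y Hy; rewrite propeqE; split=> h; exfalso; apply: nab;
    [exact: attracted_unique h Hy|exact: attracted_unique h bz].
apply: (cylinder_map_trivial T0 hg gT hE AB perk shE) => z dz.
have : attracted a z by rewrite same.
by move=> /(_ _ (onE B))[m /(_ m (leqnn m))/(enter _ dz)].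
Qed.

End Cylinder.

(** If c < 0, the inverse automorphism translates [f] by - c > 0 and still preserves [w]. *)
Lemma translated_trivial_cylinder (R : realType) (n : nat) (Q : manifold 'rV[R]_(n.*2.+1))
    (ct : contact_triad Q) (S : punctured_surface R) (w : S -> Q) (f : S -> R)
    (gm : 'I_(nneg S) -> closed_reeb_orbit ct) (gp : 'I_(npos S) -> closed_reeb_orbit ct)
    (phi : S -> S) (c : R) :
  smooth_map_on (@dotted R S) w -> smooth_fun_on (@dotted R S) f -> Jholomorphic ct w f ->
  asymptotic gm gp w -> automorphism phi ->
  (forall z, dotted z -> w (phi z) = w z) -> (forall z, dotted z -> f (phi z) = f z + c) ->
  c != 0 -> trivial_cylinder ct w f.
Proof.
move=> sw sf hJ has [phi' [phiK phiK' hphi hphi']] wphi fphi cn.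
have fC : fdim (R * R)%type := fdim_prod fdim_R fdim_R.
have swz := (smooth_map_onP _ fC (fdim_rV _) (@dotted_open R S)).1 sw.
have sfz := (smooth_fun_onP _ fC fdim_R (@dotted_open R S)).1 sf.
have ends a := end_asymptotic a has.
have [c0|c0] : 0 < c \/ 0 < - c.
  by rewrite oppr_gt0; apply/orP; rewrite orbC -neq_lt.
  exact: (translated_trivial swz sfz hJ ends phiK phiK' hphi hphi' c0 fphi wphi).
have dphi' z : dotted z -> dotted (phi' z).
  have [_ pp _ _] := hphi; move=> dz [a _ E]; apply: dz; exists a => //.
  by rewrite -[LHS]pp E phiK'.
apply: (translated_trivial swz sfz hJ ends phiK' phiK hphi' hphi c0) => z dz.
  by rewrite -{2}(phiK' z) fphi ?addrK //; exact: dphi'.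
by rewrite -{2}(phiK' z) wphi //; exact: dphi'.
Qed.

(** * Automorphisms and cylinders *)

Section Automorphisms.
Context {R : realType}.
Local Notation C := (R * R)%type.
Let fC : fdim C := fdim_prod fdim_R fdim_R.
Variable S : punctured_surface R.

Lemma holomorphic_self_mapP (phi : S -> S) : continuous phi ->
  (forall a, phi (puncture a) = puncture a) ->
  (forall z, dotted z -> sm_map phi z /\
     forall v, der_map phi z (rot v) = rot (der_map phi z v)) ->
  holomorphic_self_map phi.
Proof.
move=> cphi pphi H; split=> //.
  by apply/(smooth_map_onP _ fC fC (@dotted_open R S)) => z /H[].
by move=> z v /H[].
Qed.

Lemma holomorphic_id : @holomorphic_self_map R S id.
Proof.
apply: holomorphic_self_mapP => // [z|z dz]; first exact: cvg_id.
by have [si di] := sm_id z fC; split=> // v; rewrite !di.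
Qed.

Lemma holomorphic_comp (phi phi2 : S -> S) :
  holomorphic_self_map phi -> holomorphic_self_map phi2 ->
  (forall z, dotted z -> dotted (phi z)) -> holomorphic_self_map (phi2 \o phi).
Proof.
move=> h h2 dphi; have [cphi pphi _ rp] := h; have [cphi2 pphi2 _ rp2] := h2.
apply: holomorphic_self_mapP => [z|a|z dz].
- by apply: (continuous_comp (cphi z)); exact: cphi2.
- by rewrite /= pphi pphi2.
- have [s d] := sm_map_comp fC fC (self_map_smooth h dz) (self_map_smooth h2 (dphi _ dz)).
  by split; [exact: s|move=> v; rewrite !d rp // rp2 //; exact: dphi].
Qed.

Lemma automorphism_dotted (phi : S -> S) z : automorphism phi -> dotted z -> dotted (phi z).
Proof.
move=> [phi' [K _ _ [_ pp _ _]]] dz [a _ E]; apply: dz; exists a => //.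
by rewrite -[LHS]pp E K.
Qed.

Lemma automorphism_id : @automorphism R S id.
Proof. by exists id; split=> //; exact: holomorphic_id. Qed.

Lemma automorphism_inverse (phi : S -> S) : automorphism phi ->
  exists2 phi', automorphism phi' & cancel phi phi' /\ cancel phi' phi.
Proof. by move=> [phi' [K K' h h']]; exists phi' => //; exists phi. Qed.

Lemma automorphism_comp (phi phi2 : S -> S) :
  automorphism phi -> automorphism phi2 -> automorphism (phi2 \o phi).
Proof.
move=> a a2; have d := automorphism_dotted a; have d2 := automorphism_dotted a2.
have [phi' a' [K K']] := automorphism_inverse a; have [phi2' a2' [K2 K2']] := automorphism_inverse a2.
have [_ [_ _ h _]] := a; have [_ [_ _ h2 _]] := a2; have [_ [_ _ h' _]] := a'; have [_ [_ _ h2' _]] := a2'.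
exists (phi' \o phi2'); split.
- exact: can_comp.
- exact: can_comp.
- exact: holomorphic_comp h h2 d.
- by apply: (holomorphic_comp h2' h') => z; exact: automorphism_dotted.
Qed.

Lemma sm_fun_eq_dotted (W : normedModType R) (g h : S -> W) z : dotted z ->
  (forall y, dotted y -> g y = h y) -> sm_fun g z -> sm_fun h z.
Proof.
move=> dz E; apply: smooth_at_eq.
have ci : {for chart z z, continuous (inv z)}.
  by apply: Defs.inv_continuous; exact/img_chart/dom_self.
have nd : \forall y \near inv z (chart z z), dotted y.
  by apply: near_dotted; rewrite chartK //; exact: dom_self.
have : \forall y \near chart z z, dotted (inv z y) by exact: (ci _ nd).
by apply: filterS => y /E.
Qed.

Lemma cylinder_coordinates_auto (psi : C -> S) (phi : S -> S) :
  automorphism phi -> cylinder_coordinates psi -> cylinder_coordinates (phi \o psi).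
Proof.
move=> au [spsi rpsi ppsi range_psi [Phi sPhi PhiE]].
have [phi' au' [K K']] := automorphism_inverse au; have [_ [_ _ h _]] := au.
have [_ [_ _ h' _]] := au'; have [_ _ _ rphi] := h.
have dpsi x : dotted (psi x) by rewrite -range_psi; exists x.
have spx x : sm_into psi x by apply: (smooth_intoP _ fC openT).1 => //; exact: spsi.
have SD x := sm_into_comp fC fC (spx x) (self_map_smooth h (dpsi x)).
split.
- by apply/(smooth_intoP _ fC openT) => x _; have [] := SD x.
- by move=> x v; have [_ D] := SD x; rewrite !D rpsi rphi.
- by move=> tau t; rewrite /= ppsi.
- apply/seteqP; split=> [_ [x _ <-]|z dz]; first exact: automorphism_dotted.
  have : dotted (phi' z) by exact: automorphism_dotted.
  by rewrite -range_psi => -[x _ Ex]; exists x => //=; rewrite Ex K'.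
- exists (Phi \o phi'); last by move=> tau t; rewrite /= K PhiE.
  have fW : fdim (R * C)%type by exact: fdim_prod fdim_R fC.
  apply/(smooth_fun_onP _ fC fW (@dotted_open R S)) => z dz.
  have d' : dotted (phi' z) by exact: automorphism_dotted.
  have sP := (smooth_fun_onP _ fC fW (@dotted_open R S)).1 sPhi _ d'.
  by have [] := sm_fun_map fC fW (self_map_smooth h' dz) sP.
Qed.

Lemma primitive_difference (f1 f2 : S -> R) :
  (forall z, dotted z -> sm_fun f1 z) -> (forall z, dotted z -> sm_fun f2 z) ->
  (forall z v, dotted z -> der_fun f1 z v = der_fun f2 z v) ->
  exists c : R, forall z, dotted z -> f1 z = f2 z - c.
Proof.
move=> s1 s2 E.
suff H : forall z z', dotted z -> dotted z' -> f1 z - f2 z = f1 z' - f2 z'.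
  have [z0 dz0] := dotted_nonempty S; exists (f2 z0 - f1 z0) => z dz.
  by move: (H _ _ dz dz0); move: (f1 z) (f2 z) (f1 z0) (f2 z0) => p q r t; lra.
apply: locally_constant_dotted => z dz.
have pz := img_chart (dom_self z).
have ci : {for chart z z, continuous (inv z)} by exact: Defs.inv_continuous.
have nd : \forall y \near inv z (chart z z), dotted y.
  by apply: near_dotted; rewrite chartK //; exact: dom_self.
have nd' : \forall y \near chart z z, dotted (inv z y) by exact: (ci _ nd).
have ni : \forall y \near chart z z, img z y.
  by apply: open_nbhs_nbhs; split=> //; exact: chart_img_open.
have /near_normP[d d0 Hd] := near_and nd' ni.
pose g y := f1 (inv z y) - f2 (inv z y).
have Dg y : `|y - chart z z| < d -> differentiable g y /\ forall v, 'D_v g y = 0.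
  move=> /Hd[dy iy]; have si := sm_inv fC iy.
  have [c1 D1] := sm_fun_comp fC (@fdim_R R) si (s1 _ dy).
  have [c2 D2] := sm_fun_comp fC (@fdim_R R) si (s2 _ dy).
  have e1 := smooth_at_diff c1; have e2 := smooth_at_diff c2.
  split; first exact: differentiableB.
  move=> v; have [_ ->] := is_derive_subP (is_derive_diff v e1) (is_derive_diff v e2).
  by rewrite D1 D2 E // subrr.
have cc := chart_continuous (dom_self z).
have nc : \forall y \near z, `|chart z y - chart z z| < d.
  by move/cvgrPdist_lt : cc => /(_ _ d0); apply: filterS => y; rewrite distrC.
have ndm : \forall y \near z, dom z y.
  by apply: open_nbhs_nbhs; split; [exact: dom_open|exact: dom_self].
apply: filterS (near_and nc ndm) => y [yd yz].
have := @zero_derive_seg R C g (chart z z) (chart z y - chart z z).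
rewrite /g (_ : chart z z + (chart z y - chart z z) = chart z y); last by rewrite addrC subrK.
rewrite !chartK //; last exact: dom_self.
apply=> s /andP[s0 s1'].
have hs : `|chart z z + s *: (chart z y - chart z z) - chart z z| < d.
  rewrite addrC addKr normrZ ger0_norm //; apply: le_lt_trans yd.
  by rewrite ler_piMl.
by have [dg D0] := Dg _ hs; split; [exact: dg|exact: D0].
Qed.

Section Translation.
Variable psi : C -> S.
Hypothesis hpsi : cylinder_coordinates psi.
Variable b : R.

Let be : C := (b, 0).

Let psi_dotted x : dotted (psi x).
Proof. by have [_ _ _ <- _] := hpsi; exists x. Qed.

Let psi_holo x : holo_at psi x.
Proof.
have [s r _ _ _] := hpsi; split; last exact: r.
by apply: (smooth_intoP _ fC openT).1.
Qed.

Let psi_int tau t (k : int) : psi (tau, t + k%:~R) = psi (tau, t).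
Proof.
have [_ _ p _ _] := hpsi.
have nat_case (m : nat) r : psi (tau, r + m%:R) = psi (tau, r).
  by elim: m => [|m IH]; rewrite ?addr0 // -natr1 addrA p.
case: k => m; first exact: nat_case.
by rewrite NegzE mulrNz -[LHS](nat_case m.+1) subrK.
Qed.

Let coordinates : exists Y : S -> C, [/\ forall z, dotted z -> psi (Y z) = z,
  forall z, dotted z -> sm_fun (fun z => (Y z).1) z, (forall x, (Y (psi x)).1 = x.1) &
  forall x y, psi x = psi y -> x.1 = y.1 /\ exists k : int, x.2 = y.2 + k%:~R].
Proof.
have [_ _ _ rpsi [Phi sPhi PhiE]] := hpsi.
have inj x y : psi x = psi y -> x.1 = y.1 /\ exists k : int, x.2 = y.2 + k%:~R.
  case: x y => [x1 x2] [y1 y2] /(congr1 Phi); rewrite !PhiE => -[-> c s]; split=> //.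
  exact: circle_inj c s.
have /choice[Y HY] z : exists x, dotted z -> psi x = z.
  have [dz|nd] := pselect (dotted z); last by exists 0.
  by have [x _ <-] : range psi z; [rewrite rpsi|exists x].
have Y1 x : (Y (psi x)).1 = x.1 by have [] := inj _ _ (HY _ (@psi_dotted x)).
exists Y; split=> // z dz.
have fW : fdim (R * C)%type by exact: fdim_prod fdim_R fC.
have sP := (smooth_fun_onP _ fC fW (@dotted_open R S)).1 sPhi _ dz.
pose fst1 (q : R * C) : R^o := q.1.
have fl : linear fst1 by [].
pose L : {linear (R * C)%type -> R^o} := HB.pack fst1 (GRing.isLinear.Build R (R * C)%type R^o _ fst1 fl).
have cL : continuous L by move=> q; exact: cvg_fst.
have sLP : sm_fun (fun y => (Phi y).1) z by exact: (smooth_at_lincomp cL sP).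
apply: (sm_fun_eq_dotted dz _ sLP) => y dy.
by rewrite -{1}(HY _ dy) [Y y]surjective_pairing PhiE.
Qed.

(* Near a puncture |tau| is large, whereas it is bounded on the frontier D of a small
   neighbourhood N1 of the puncture; so the path s |-> psi (x + s be) does not leave N1. *)
Lemma cylinder_translation : exists2 th : S -> S,
  forall x, th (psi x) = psi (x + be) & holomorphic_self_map th /\ (forall a, th (puncture a) = puncture a).
Proof.
have [Y [YK sY Y1 inj]] := coordinates.
(* Translation in the cylinder coordinates, extended by the identity at the punctures; periodicity
   of [psi] removes the dependence on the choice of [Y]. *)
pose th z := if pselect (dotted z) then psi (Y z + be) else z.
have thp a : th (puncture a) = puncture a.
  by rewrite /th; case: pselect => // dp; exfalso; apply: dp; exists a.
have thE x : th (psi x) = psi (x + be).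
  rewrite /th; case: pselect => [d|nd]; last by exfalso; apply: nd.
  have [e1 [k e2]] := inj _ _ (YK _ d).
  rewrite [Y _]surjective_pairing e1 e2 [x in RHS]surjective_pairing.
  by rewrite -[RHS](psi_int _ _ k); congr psi; congr pair; rewrite /= !addr0.
have hol z : dotted z -> sm_map th z /\ forall v, der_map th z (rot v) = rot (der_map th z v).
  move=> dz; have [x0 zE] : exists x, psi x = z by exists (Y z); exact: YK.
  rewrite -zE; move: (x0) => x {dz zE x0}.
  have d0 : der_into psi x (1, 0) != 0.
    have [sp _] := psi_holo x.
    apply: (immersion_of_height (U := setT) (T := 1) sY openT I (oner_neq0 _) sp (@psi_dotted x)).
    by move=> y _; rewrite Y1 mul1r.
  have hall y : setT y -> holo_at psi y by [].
  have [W [L [[oW Wx _ oN] [LK HL]]]] := holo_local_inverse openT I hall d0.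
  have Nx : (psi @` W) (psi x) by exists x.
  have [sL rL] := HL _ Nx; set z0 := psi x in Nx sL rL *.
  have zK : inv z0 (chart z0 z0) = z0 by rewrite chartK //; exact: dom_self.
  pose l y := (L \o inv z0) y + be.
  have sl : smooth_at (chart z0 z0) l by apply: smooth_atD; [exact: sL|exact: smooth_at_cst].
  have Dl v : 'D_v l (chart z0 z0) = der_fun L z0 v.
    rewrite /l /der_fun deriveD; [|exact/diff_derivable/smooth_at_diff|exact: derivable_cst].
    by rewrite derive_cst addr0.
  have [sp rp] := psi_holo (l (chart z0 z0)).
  have [sc Dc] := sm_into_precomp fC fC sl sp.
  have ci : {for chart z0 z0, continuous (inv z0)}.
    by apply: Defs.inv_continuous; exact/img_chart/dom_self.
  have nb : nbhs (inv z0 (chart z0 z0)) (psi @` W).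
    by rewrite zK; apply: open_nbhs_nbhs; split.
  have near_eq : \forall y \near chart z0 z0, (psi \o l) y = (th \o inv z0) y.
    have : \forall y \near chart z0 z0, (psi @` W) (inv z0 y) by exact: (ci _ nb).
    by apply: filterS => y [u Wu Eu]; rewrite /l /= -Eu LK // thE.
  split; first exact: sm_into_eq near_eq sc.
  by move=> v; rewrite /der_map -!(der_into_eq _ near_eq) !Dc !Dl rL rp.
exists th => //; split=> //; apply: holomorphic_self_mapP => // z.
have [dz|[a ->]] := dotted_or_puncture z.
  by apply: sm_map_continuous; have [] := hol _ dz.
move=> N; rewrite thp => nN.
pose F := range (@puncture R S) `\ puncture a.
have cF : closed F.
  apply: accessible_finite_set_closed.1; last exact: finite_setD (finite_punctures S).
  exact/hausdorff_accessible/mhausdorff.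
have nN' : nbhs (puncture a) (N `&` ~` F).
  apply: filterI => //; apply: open_nbhs_nbhs; split; first exact: closed_openC.
  by move=> [_]; apply.
(* A compact Hausdorff surface is regular, so [N] may be shrunk to an open [N1] whose closure lies
   in [N] and contains no other puncture. The frontier of [N1] is then a compact subset of the
   punctured surface, where tau is bounded by some [K]. *)
have [B nB BN] := compact_regular (@mhausdorff _ _ S) (@ps_compact R S) filterT nN'.
pose N1 := B^°.
have oN1 : open N1 by exact: open_interior.
have N1a : N1 (puncture a) by exact: nbhs_singleton (nbhs_interior nB).
have cN1 : closure N1 `<=` N `&` ~` F.
  by apply: subset_trans BN; apply: closure_subset; exact: interior_subset.
pose D := closure N1 `&` ~` N1.
have dD z0 : D z0 -> dotted z0.
  move=> [/cN1[_ nF] nN1] [a' _ az]; have [aa|naa] := eqVneq a' a.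
    by apply: nN1; rewrite -az aa.
  apply: nF; split; first by exists a'.
  by move=> E; move/eqP: naa; apply; apply: (@puncture_inj R S); rewrite az.
have cD : compact D.
  apply: (subclosed_compact _ (@ps_compact R S)) => //.
  by apply: closedI; [exact: closed_closure|exact: open_closedC].
have cY z0 : dotted z0 -> {for z0, continuous (fun z => (Y z).1)}.
  by move=> /sY; exact: sm_fun_continuous.
have [K HK] : exists K : R, forall z0, D z0 -> `|(Y z0).1| < K.
  have nc := (compact_near_coveringP _).1 cD.
  have := nc R +oo (fun K z0 => `|(Y z0).1| < K) _.
  move=> [z0 Dz0|M [_ HM]]; last by exists (M + 1) => z0; apply: HM; rewrite ltrDl.
  exists ([set z | `|(Y z0).1 - (Y z).1| < 1], [set K | `|(Y z0).1| + 1 < K]) => /=.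
    split; first by have /cvgrPdist_lt/(_ _ ltr01) := cY _ (dD _ Dz0).
    by exists (`|(Y z0).1| + 1); split=> //; exact: num_real.
  move=> [y K] /= [h1 h2]; apply: le_lt_trans h2.
  rewrite -[X in `|X| <= _](subKr (Y z0).1); apply: le_trans (ler_normB _ _) _.
  by rewrite lerD2l ltW.
(* The path moves tau by at most |b|, so a start with |tau| > K + |b| keeps |tau| >= K and avoids
   the frontier. Such starts fill a neighbourhood of the puncture, since the band |tau| <= M is
   compact and misses the puncture. *)
pose M := K + `|b|.
pose band := [set psi x | x in [set x : C | `|x.1| <= M /\ 0 <= x.2 <= 1]].
have bandP x : `|x.1| <= M -> band (psi x).
  move=> hx; have /andP[h1 h2] := floor_itv x.2; rewrite intrD in h2.
  exists (x.1, x.2 + (- Num.floor x.2)%:~R).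
    by rewrite /= mulrNz subr_ge0 h1 lerBlDl (ltW h2).
  by rewrite psi_int -surjective_pairing.
have cband : closed band.
  apply: compact_closed; first exact: mhausdorff.
  apply: continuous_compact.
    apply: continuous_in_subspaceT => x _; have [[cx _] _] := psi_holo x; exact: cx.
  have -> : [set x : C | `|x.1| <= M /\ 0 <= x.2 <= 1] = `[- M, M]%classic `*` `[0, 1]%classic.
    by apply/seteqP; split=> x /=; rewrite !in_itv /= ler_norml.
  by apply: compact_setX; exact: segment_compact.
have nband : \forall z \near puncture a, ~ band z.
  apply: open_nbhs_nbhs; split; first exact: closed_openC.
  by move=> [x _ E]; apply: (@psi_dotted x); exists a.
have nN1 : \forall z \near puncture a, N1 z by exact: open_nbhs_nbhs.
apply: filterS (near_and nband nN1) => z0 [zb zN1].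
have [dz0|[a' za]] := dotted_or_puncture z0; last first.
  by rewrite /= za thp -za; have [] := cN1 _ (subset_closure zN1).
pose x := Y z0; have zE : psi x = z0 by exact: YK.
have xM : M < `|x.1| by rewrite ltNge; apply/negP => /bandP; rewrite zE.
pose sg (s : R) := psi (x + s *: be).
have csg s : {for s, continuous sg}.
  have cl : {for s, continuous (fun s : R => x + s *: be)}.
    by apply: continuousD; [exact: cst_continuous|apply: cvgZr_tmp; exact: cvg_id].
  by apply: (continuous_comp cl); have [[]] := psi_holo (x + s *: be).
have sgD s : 0 <= s <= 1 -> ~ D (sg s).
  move=> /andP[s0 s1] /HK; rewrite Y1 /= /GRing.scale /=; apply/negP; rewrite -leNgt.
  have sb : `|s * b| <= `|b| by rewrite normrM ger0_norm // ler_piMl.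
  have : `|x.1| <= `|x.1 + s * b| + `|s * b|.
    by rewrite -{1}(addrK (s * b) x.1); exact: ler_normB.
  by move: xM sb; rewrite /M; move: `|x.1| `|b| `|s * b| `|_ + _| => p q r t; lra.
have H : forall s : R, `[0, 1]%classic s -> N1 (sg s).
  apply: (connected_all (@segment_connected R 0 1)).
  - by exists 0; rewrite /= ?in_itv /= ?lexx ?ler01 // /sg scale0r addr0 zE.
  - by move=> s _ Ns; apply: (csg s N1); exact: open_nbhs_nbhs.
  - move=> s; rewrite /= in_itv /= => s01 nNs.
    have nc : ~ closure N1 (sg s) by move=> cs; apply: (sgD s s01); split.
    have : nbhs (sg s) (~` closure N1).
      by apply: open_nbhs_nbhs; split=> //; exact/closed_openC/closed_closure.
    move=> nb; have nt : \forall t \near s, ~ closure N1 (sg t) by exact: (csg s _ nb).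
    by apply: filterS nt => t nt Nt; apply: nt; exact: subset_closure.
have : N1 (th z0).
  by rewrite -zE thE; have := H 1; rewrite /= in_itv /= lexx ler01 /sg scale1r; exact.
by move=> /subset_closure/cN1[].
Qed.

End Translation.

End Automorphisms.

Lemma derive_subcst (R : realType) (V W : normedModType R) (g : V -> W) (c : W) x v :
  'D_v (fun y => g y - c) x = 'D_v g x.
Proof.
rewrite /derive; set q1 := (fun h : R => _); set q2 := (fun h : R => _ *: (_ - g x)).
suff -> : q1 = q2 by [].
by apply/funext => h; rewrite /q1 /q2 /= opprB addrA subrK.
Qed.

(** * Invariance of the energy under translation *)

Section EnergyTranslation.
Context {R : realType}.
Local Notation mu := (@lebesgue_measure R).

Lemma integral_translate (G : R -> R) (c : R) : continuous G -> (forall x, 0 <= G x) ->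
  (\int[mu]_x (G (x - c))%:E = \int[mu]_x (G x)%:E)%E.
Proof.
move=> cG G0; pose F (x : R) := x - c.
have dF (x : R) : is_derive x 1 F 1.
  have := @is_derive_quad R 0 1 (- c) x; rewrite mulr0 mul0r add0r.
  by apply: is_derive_eq_on (openT) Logic.I _ => y _; rewrite mul0r add0r mul1r.
have F' : derive1 F = cst 1.
  by apply/funext => x; rewrite derive1E; have [_ ->] := dF x.
rewrite (@increasing_ge0_integration_by_substitutionT R F G) //.
- apply: eq_integral => x _; rewrite F'; congr (_%:E).
  by rewrite /= [RHS]mulr1.
- by move=> x y xy; rewrite ltrD2r.
- by rewrite F'; exact: cst_continuous.
- by rewrite F'; exact: is_cvg_cst.
- by rewrite F'; exact: is_cvg_cst.
- apply/cvgrNyPle => A; exists (A + c); split; first exact: num_real.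
  by move=> x /ltW; rewrite lerBlDr.
- apply/cvgryPge => A; exists (A + c); split; first exact: num_real.
  by move=> x /ltW; rewrite lerBrDr.
Qed.

Lemma test_function_translate (phi : R -> R) (c : R) : test_function phi ->
  test_function (fun s => phi (s - c)).
Proof.
move=> [cphi phi0 [A HA] iphi]; split=> //.
- move=> x; have cs : {for x, continuous (fun s : R => s - c)}.
    by apply: cvgD; [exact: cvg_id|exact: cst_continuous].
  by apply: (continuous_comp cs); exact: cphi.
- exists (A + `|c|) => s hs; apply: HA.
  have : `|s| <= `|s - c| + `|c| by rewrite -{1}(subrK c s); exact: ler_normD.
  by move: hs; move: `|s| `|s - c| `|c| => p q r; lra.
- by rewrite integral_translate.
Qed.

Variable S : punctured_surface R.

(** Translating [f] amounts to translating the test function, which preserves its integral. This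
    gives one inequality for all [f] and [c]; applying it again with [- c] gives the other. *)
Lemma E_perp_translate (f : S -> R) (c : R) : E_perp (fun z => f z - c) = E_perp f.
Proof.
have le (g : S -> R) d : (E_perp (fun z => (g z - d)%R) <= E_perp g)%E.
  apply: ge_ereal_sup => _ [phi tphi <-]; apply: ereal_sup_ubound.
  exists (fun s => phi (s - d)); first exact: test_function_translate.
  congr surface_integral; apply/funext => p; apply/funext => y; congr (_ * _).
  have D (e : R * R) : 'D_e ((fun z => g z - d) \o inv p) y = 'D_e (g \o inv p) y.
    exact: derive_subcst.
  by rewrite /dfj_wedge_df !D.
apply: le_anti; apply/andP; split; first exact: le.
have E : (fun z => (f z - c) - (- c)) = f by apply/funext => z; rewrite opprK subrK.
have := le (fun z => f z - c) (- c); rewrite E; exact.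
Qed.

End EnergyTranslation.

(** * Exact contact instantons and holomorphic curves *)

Section Instantons.
Context {R : realType} {n : nat}.
Local Notation V := 'rV[R]_(n.*2.+1).
Local Notation C := (R * R)%type.
Context {Q : manifold V}.
Variables (ct : contact_triad Q) (S : punctured_surface R) (w : S -> Q) (f : S -> R).
Let fC : fdim C := fdim_prod fdim_R fdim_R.
Let fV : fdim V := fdim_rV _.
Hypothesis sw : smooth_map_on (@dotted R S) w.
Hypothesis sf : smooth_fun_on (@dotted R S) f.

Let swz z : dotted z -> sm_map w z.
Proof. exact: (smooth_map_onP _ fC fV (@dotted_open R S)).1. Qed.
Let sfz z : dotted z -> sm_fun f z.
Proof. exact: (smooth_fun_onP _ fC (@fdim_R R) (@dotted_open R S)).1. Qed.

Lemma lam_reeb (q : Q) (a : R) : lam ct q (a *: reeb ct q) = a.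
Proof. by rewrite linearZ /= reeb_lam /GRing.scale /= mulr1. Qed.

Lemma pi_lam (q : Q) (v : V) : lam ct q (pi_xi ct q v) = 0.
Proof. by rewrite /pi_xi linearB /= lam_reeb subrr. Qed.

Lemma pi_xi_decomp (q : Q) (v : V) : v = pi_xi ct q v + lam ct q v *: reeb ct q.
Proof. by rewrite /pi_xi subrK. Qed.

Lemma Jholomorphic_primitive : Jholomorphic ct w f -> primitive ct w f.
Proof. by move=> hJ; split=> // z v dz; rewrite /lam_j (lam_der_rot sfz hJ). Qed.

Lemma dbar_of_Jtilde (q : Q) (d e : V) (c : R) : e = cJ ct q (pi_xi ct q d) + c *: reeb ct q ->
  pi_xi ct q d + cJ ct q (pi_xi ct q e) = 0.
Proof.
move=> ->; have d0 := pi_lam q d; have J0 := cJ_xi d0; have JJ := cJJ d0.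
move: (pi_xi ct q d) J0 JJ {d0} => x J0 JJ.
have -> : pi_xi ct q (cJ ct q x + c *: reeb ct q) = cJ ct q x.
  by rewrite /pi_xi linearD /= J0 add0r lam_reeb addrK.
by rewrite JJ subrr.
Qed.

Lemma Jholomorphic_dbar : Jholomorphic ct w f ->
  forall z v, dotted z -> dbar_pi ct w z v = 0.
Proof.
move=> hJ z v dz; have [E _] := hJ z v dz.
exact: (etrans (congr1 (fun x => 2^-1 *: x) (dbar_of_Jtilde E)) (scaler0 _ _)).
Qed.

Lemma der_fun_chart (p : S) y v : img p y -> dotted (inv p y) ->
  'D_v (f \o inv p) y = der_fun f (inv p y) (transition_der p (inv p y) (inv p y) v).
Proof.
move=> py dy; have [_ ->] := sm_fun_comp fC (@fdim_R R) (sm_inv fC py) (sfz dy).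
by rewrite (transition_derE v (inv_dom py)) (chart_invK py).
Qed.

Lemma Jholomorphic_closed : Jholomorphic ct w f ->
  forall z v1 v2, dotted z -> ext_der (lam_j ct w) z v1 v2 = 0.
Proof.
move=> hJ z v1 v2 dz; have pz := img_chart (dom_self z).
pose U := img z `&` inv z @^-1` (@dotted R S).
have oU : open U by apply: open_img_inv; exact: dotted_open.
have Uz : U (chart z z) by split=> //; rewrite /= chartK //; exact: dom_self.
have E v y : U y -> form_in_chart (lam_j ct w) z y v = 'D_v (f \o inv z) y.
  by move=> [py dy]; rewrite /form_in_chart /lam_j (lam_der_rot sfz hJ) // der_fun_chart.
have E1 := derive_eq_on v1 oU Uz (E v2); have E2 := derive_eq_on v2 oU Uz (E v1).
apply/eqP; rewrite subr_eq0; apply/eqP.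
exact: (etrans E1 (etrans (schwarz v1 v2 (sfz dz)) (esym E2))).
Qed.

Lemma instanton_Jholomorphic : contact_instanton ct w -> primitive ct w f ->
  Jholomorphic ct w f.
Proof.
move=> [hd _] [_ hp] z v dz; rewrite /Jtilde /=.
have swd := swz dz.
have e2 : der_fun f z (rot v) = - lam ct (w z) (der_map w z v).
  by rewrite -hp // /lam_j rot_sq (der_mapN _ swd) linearN.
congr pair; last exact: e2.
rewrite [LHS](pi_xi_decomp (w z)) -[lam ct (w z) _]/(lam_j ct w z v) hp //; congr (_ + _).
have := hd z v dz; rewrite /dbar_pi => /eqP; rewrite scaler_eq0 invr_eq0 pnatr_eq0 /= => /eqP E.
have := congr1 (cJ ct (w z)) E; rewrite linearD linear0 cJJ ?pi_lam // => /eqP.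
by rewrite subr_eq0 => /eqP ->.
Qed.

(** In cylinder coordinates [w] alone determines df, namely the period times d tau, so [f] differs
    from the period times tau by a constant. Hence being a trivial cylinder does not depend on the
    primitive, and [noncylQ], which sees only [w], agrees with [noncyl]. *)
Lemma trivial_cylinder_primitive f0 : Jholomorphic ct w f ->
  trivial_cylinder ct w f0 -> trivial_cylinder ct w f.
Proof.
move=> hJ [psi [g [c0 [hpsi wf]]]]; have [spsi rpsi _ range_psi _] := hpsi.
have spx x : sm_into psi x by apply: (smooth_intoP _ fC openT).1 => //; exact: spsi.
have dpsi x : dotted (psi x) by rewrite -range_psi; exists x.
pose P := period g.
pose G (x : C) := f (psi x) - P * x.1.
have ds x v : is_derive x v (fun x : C => P * x.1) (P * v.1).
  have ds1 : is_derive x v (fun x : C => x.1) v.1.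
    refine (is_derive_conv (is_derive_diff v (@linear_differentiable R _ _ fstL x (@fst_continuous R))) _).
    exact: (@derive_linear R _ _ fstL x v (@fst_continuous R)).
  refine (is_derive_conv (is_derive_mulP (is_derive_cst P x v) ds1) _).
  by rewrite mulr0 addr0.
have s1 (x : C) : smooth_at x (fun x : C => P * x.1).
  apply: smooth_atM; first exact: smooth_at_cst.
  exact: (@smooth_at_lin R _ _ x fstL (@fst_continuous R)).
have s2 (x : C) : smooth_at x (fun x : C => P * x.2).
  apply: smooth_atM; first exact: smooth_at_cst.
  exact: (@smooth_at_lin R _ _ x sndL (@snd_continuous R)).
have ds2 x v : 'D_v (fun x : C => P * x.2) x = P * v.2.
  have ds1 : is_derive x v (fun x : C => x.2) v.2.
    refine (is_derive_conv (is_derive_diff v (@linear_differentiable R _ _ sndL x (@snd_continuous R))) _).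
    exact: (@derive_linear R _ _ sndL x v (@snd_continuous R)).
  have [_ ->] := is_derive_mulP (is_derive_cst P x v) ds1.
  by rewrite mulr0 addr0.
have wpsi x : w (psi x) = g (P * x.2) by case: x => x1 x2; have [] := wf x1 x2.
have Dw x v : der_map w (psi x) (der_into psi x v) = (P * v.2) *: reeb ct (w (psi x)).
  have [_ <-] := sm_into_comp fC fV (spx x) (swz (dpsi x)).
  have wE : w \o psi = g \o (fun x : C => P * x.2) by apply/funext => y; exact: wpsi.
  rewrite wE wpsi /der_into; have [dg Dg] := orbit_reeb g (P * x.2).
  have d2 : differentiable (chart (g (P * x.2)) \o g) (P * x.2) by exact/derivable1_diffP.
  have := derive_comp v (smooth_at_diff (s2 x)) d2; rewrite ds2 => ->.
  have := derive_scale_dir (P * v.2) (1 : R) d2.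
  by rewrite Dg /GRing.scale /= mulr1.
have DG x v : differentiable G x /\ 'D_v G x = 0.
  have [sF DF] := sm_fun_comp fC (@fdim_R R) (spx x) (sfz (dpsi x)).
  split; first by apply: differentiableB; exact: smooth_at_diff.
  have [_ ->] := is_derive_subP (is_derive_diff v (smooth_at_diff sF)) (ds x v).
  rewrite DF -(lam_der_rot sfz hJ _ (dpsi x)) -rpsi Dw lam_reeb.
  by rewrite subrr.
have Gc x : G x = G 0.
  by have := @zero_derive_seg R C G 0 x (fun s _ => DG _ _); rewrite add0r.
exists psi, g, (G 0); split=> // tau t; split; first by have [] := wf tau t.
by have := Gc (tau, t); rewrite /G /= => /eqP; rewrite subr_eq addrC => /eqP.
Qed.

End Instantons.

Section TrivialCylinders.
Context {R : realType} {n : nat} {Q : manifold 'rV[R]_(n.*2.+1)}.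
Variables (ct : contact_triad Q) (S : punctured_surface R).
Implicit Types (w : S -> Q) (f : S -> R).

Lemma trivial_cylinder_auto w f w' f' (phi : S -> S) s : automorphism phi ->
  (forall z, dotted z -> w' z = w (phi z) /\ f' z = f (phi z) - s) ->
  trivial_cylinder ct w f -> trivial_cylinder ct w' f'.
Proof.
move=> au E [psi [g [c [hpsi wf]]]].
have [phi' au' [K K']] := automorphism_inverse au.
exists (phi' \o psi), g, (c - s); split; first exact: cylinder_coordinates_auto.
have [_ _ _ range_psi _] := hpsi.
move=> tau t; have dp : dotted (psi (tau, t)) by rewrite -range_psi; exists (tau, t).
have [-> ->] := E _ (automorphism_dotted au' dp); have [ew ef] := wf tau t.
by rewrite /= K' ew ef addrA.
Qed.

(** On a trivial cylinder f = period * tau + c, so shifting tau by b / period adds [b] to [f] and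
    leaves [w] unchanged. Cylindrical components absorb their constants in this way. *)
Lemma trivial_cylinder_translation w f b : trivial_cylinder ct w f ->
  exists th, automorphism th /\ forall z, dotted z -> w (th z) = w z /\ f (th z) = f z + b.
Proof.
move=> [psi [g [c [hpsi wf]]]]; have [_ _ _ range_psi _] := hpsi.
pose be : R * R := (b / period g, 0).
have [th thE [hth thp]] := cylinder_translation hpsi (b / period g).
have [th' thE' [hth' thp']] := cylinder_translation hpsi (- (b / period g)).
have P0 : period g != 0 by rewrite gt_eqF // period_gt0.
have onto z : dotted z -> exists x, psi x = z by rewrite -range_psi => -[x _ <-]; exists x.
have addK x : (x + (b / period g, 0)) + (- (b / period g), 0) = x :> R * R.
  by rewrite -addrA [X in x + X](_ : _ = 0) ?addr0 //; congr pair; rewrite /= ?subrr ?addr0.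
have addK' x : (x + (- (b / period g), 0)) + (b / period g, 0) = x :> R * R.
  by rewrite -addrA [X in x + X](_ : _ = 0) ?addr0 //; congr pair; rewrite /= ?addNr ?addr0.
exists th; split.
  exists th'; split=> // z; have [/onto[x <-]|[a ->]] := dotted_or_puncture z.
  - by rewrite thE thE' addK.
  - by rewrite thp thp'.
  - by rewrite thE' thE addK'.
  - by rewrite thp' thp.
move=> _ /onto[[tau t] <-]; rewrite thE.
have -> : (tau, t) + (b / period g, 0) = (tau + b / period g, t) :> R * R.
  by congr pair; rewrite /= addr0.
have [-> ->] := wf tau t; have [-> ->] := wf (tau + b / period g) t; split=> //.
by rewrite mulrDr mulrCA divff // mulr1 addrAC.
Qed.

End TrivialCylinders.

(** * The moduli spaces *)

Section ModuliSpaces.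
Context {R : realType} {n : nat} {Q : manifold 'rV[R]_(n.*2.+1)}.
Variables (ct : contact_triad Q) (k : nat) (S : 'I_k -> punctured_surface R).
Variable gm : forall i, 'I_(nneg (S i)) -> closed_reeb_orbit ct.
Variable gp : forall i, 'I_(npos (S i)) -> closed_reeb_orbit ct.
Variable l : nat.
Local Notation curves := (curves Q S).
Local Notation qmaps := (qmaps Q S).
Implicit Types (u v : curves) (w : qmaps).
Local Notation Mt := (Mtilde gm gp l).
Local Notation Me := (Mtilde_exact gm gp l).
Local Notation class := (class_of gm gp l).
Local Notation classQ := (class_ofQ gm gp l).

Lemma automorphisms_inverse (phi : forall i, S i -> S i) : (forall i, automorphism (phi i)) ->
  exists phi' : forall i, S i -> S i,
    (forall i, automorphism (phi' i)) /\ forall i, cancel (phi i) (phi' i) /\ cancel (phi' i) (phi i).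
Proof.
move=> au; have H i := cid2 (automorphism_inverse (au i)).
by exists (fun i => s2val (H i)); split=> i; [exact: (s2valP (H i))|exact: (s2valP' (H i))].
Qed.

Lemma equivalent_refl u : equivalent u u.
Proof.
exists 0, (fun i => id); split=> [i|i z _]; first exact: automorphism_id.
by rewrite subr0.
Qed.

Lemma equivalent_sym u v : equivalent u v -> equivalent v u.
Proof.
move=> [s0 [phi [au E]]]; have [phi' [au' K]] := automorphisms_inverse au.
exists (- s0), phi'; split=> // i z dz; have [K1 K2] := K i.
have [-> ->] := E i _ (automorphism_dotted (au' i) dz).
by rewrite K2 opprK subrK.
Qed.

Lemma equivalent_trans u v x : equivalent u v -> equivalent v x -> equivalent u x.
Proof.
move=> [s0 [phi [au E]]] [s1 [phi1 [au1 E1]]].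
exists (s0 + s1), (fun i => phi i \o phi1 i); split=> [i|i z dz].
  exact: automorphism_comp.
have [-> ->] := E1 i z dz; have [-> ->] := E i _ (automorphism_dotted (au1 i) dz).
by rewrite opprD addrA.
Qed.

Lemma equivalentQ_refl w : equivalentQ w w.
Proof. by exists (fun i => id); split=> // i; exact: automorphism_id. Qed.

Lemma equivalentQ_sym w w' : equivalentQ w w' -> equivalentQ w' w.
Proof.
move=> [phi [au E]]; have [phi' [au' K]] := automorphisms_inverse au.
exists phi'; split=> // i z dz; have [K1 K2] := K i.
by rewrite (E i _ (automorphism_dotted (au' i) dz)) K2.
Qed.

Lemma equivalentQ_trans w w' w2 : equivalentQ w w' -> equivalentQ w' w2 -> equivalentQ w w2.
Proof.
move=> [phi [au E]] [phi1 [au1 E1]].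
exists (fun i => phi i \o phi1 i); split=> [i|i z dz]; first exact: automorphism_comp.
by rewrite (E1 i z dz) (E i _ (automorphism_dotted (au1 i) dz)).
Qed.

Lemma equivalent_forget u v : equivalent u v -> equivalentQ u.1 v.1.
Proof. by move=> [s0 [phi [au E]]]; exists phi; split=> // i z dz; have [] := E i z dz. Qed.

Lemma class_eq u v : equivalent u v -> class u = class v.
Proof.
move=> uv; apply/seteqP; split=> x [Mx e]; split=> //.
  exact: equivalent_trans (equivalent_sym uv) e.
exact: equivalent_trans uv e.
Qed.

Lemma classQ_eq w w' : equivalentQ w w' -> classQ w = classQ w'.
Proof.
move=> ww; apply/seteqP; split=> x [Mx e]; split=> //.
  exact: equivalentQ_trans (equivalentQ_sym ww) e.
exact: equivalentQ_trans ww e.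
Qed.

Lemma class_self u : Mt u -> class u u.
Proof. by move=> Mu; split=> //; exact: equivalent_refl. Qed.

Lemma classQ_self w : Me w -> classQ w w.
Proof. by move=> Mw; split=> //; exact: equivalentQ_refl. Qed.

(** The action numbers the non-cylindrical components by their rank in this list, so it descends to
    equivalence classes only if equivalent curves have the same list. *)
Lemma noncyl_equivalent u v : equivalent u v -> noncyl ct u = noncyl ct v.
Proof.
move=> [s0 [phi [au E]]]; apply: eq_filter => i; congr (~~ _); apply: asbool_equiv_eq.
split; first by apply: trivial_cylinder_auto (au i) _ => z dz; exact: E.
have [phi' au' [K K']] := automorphism_inverse (au i).
apply: (trivial_cylinder_auto (s := - s0) au') => z dz.
have [-> ->] := E i _ (automorphism_dotted au' dz).
by rewrite K' opprK subrK.
Qed.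

Lemma trivial_cylinder_constant (T : punctured_surface R) (w : T -> Q) (f : T -> R) c :
  trivial_cylinder ct w f -> trivial_cylinder ct w (fun z => f z - c).
Proof. exact: (trivial_cylinder_auto (@automorphism_id R T)). Qed.

Lemma noncyl_translate (s : 'rV[R]_l) u : noncyl ct (translate ct s u) = noncyl ct u.
Proof.
apply: eq_filter => i; congr (~~ _); apply: asbool_equiv_eq; split=> /=.
  set c := nth _ _ _ => /(@trivial_cylinder_constant _ _ _ (- c)).
  by under eq_fun do rewrite opprK subrK.
exact: trivial_cylinder_constant.
Qed.

Lemma translate_equivalent (s : 'rV[R]_l) u v : equivalent u v ->
  equivalent (translate ct s u) (translate ct s v).
Proof.
move=> uv; have N := noncyl_equivalent uv; move: uv => [s0 [phi [au E]]].
exists s0, phi; split=> // i z dz; rewrite /translate /= -N.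
by have [-> ->] := E i z dz; split=> //; rewrite addrAC.
Qed.

Lemma Jholomorphic_translate (T : punctured_surface R) (w : T -> Q) (f : T -> R) c :
  Jholomorphic ct w f -> Jholomorphic ct w (fun z => f z - c).
Proof.
move=> hJ z v dz; have D (x : R * R) : der_fun (fun z => f z - c) z x = der_fun f z x.
  exact: derive_subcst.
by rewrite !D; exact: hJ.
Qed.

Lemma Mtilde_translate (s : 'rV[R]_l) u : Mt u -> Mt (translate ct s u).
Proof.
move=> [sm hJ en asy sz]; split=> /=.
- move=> i; have [sw sf] := sm i; split=> // p j.
  have fC : fdim (R * R)%type := fdim_prod fdim_R fdim_R.
  have := (smooth_fun_onP _ fC (@fdim_R R) (@dotted_open R (S i))).1 sf.
  move=> sfz; apply: (smooth_fun_onP _ fC (@fdim_R R) (@dotted_open R (S i))).2 => z dz.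
  by apply: smooth_atB; [exact: sfz|exact: smooth_at_cst].
- by move=> i; apply: Jholomorphic_translate; exact: hJ.
- move: en; under [in X in _ -> X]eq_bigr => i _ do rewrite /energy E_perp_translate.
  exact.
- exact: asy.
- by rewrite noncyl_translate.
Qed.

Lemma noncyl_noncylQ u : (forall i, smooth_map_on (@dotted R (S i)) (u.1 i) /\
    smooth_fun_on (@dotted R (S i)) (u.2 i)) ->
  (forall i, Jholomorphic ct (u.1 i) (u.2 i)) -> noncylQ ct u.1 = noncyl ct u.
Proof.
move=> sm hJ; apply: eq_filter => i; congr (~~ _); apply: asbool_equiv_eq.
have [sw sf] := sm i; split=> [[f0]|h]; last by exists (u.2 i).
exact: (trivial_cylinder_primitive sw sf (hJ i)).
Qed.

Lemma Mtilde_forget u : Mt u -> Me u.1.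
Proof.
move=> [sm hJ en asy sz]; split.
- by move=> i; have [] := sm i.
- move=> i; have [sw sf] := sm i; split=> z.
    by move=> v; exact: (Jholomorphic_dbar (hJ i)).
  by move=> v1 v2; exact: (Jholomorphic_closed sf (hJ i)).
- exists u.2; split=> // i; have [sw sf] := sm i.
  exact: (Jholomorphic_primitive sf (hJ i)).
- exact: asy.
- by rewrite noncyl_noncylQ.
Qed.

Lemma Mtilde_lift w : Me w -> exists2 u, Mt u & u.1 = w.
Proof.
move=> [sw hc [f [hp en]] asy sz]; exists (w, f) => //.
have sm i : smooth_map_on (@dotted R (S i)) (w i) /\ smooth_fun_on (@dotted R (S i)) (f i).
  by split; [exact: sw|have [] := hp i].
have hJ i : Jholomorphic ct (w i) (f i).
  by have [s1 s2] := sm i; exact: (instanton_Jholomorphic s1 (hc i) (hp i)).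
split=> //; by rewrite -(@noncyl_noncylQ (w, f)).
Qed.

Lemma forget_class u : Mt u -> forget gm gp l (class u) = classQ u.1.
Proof.
move=> Mu; apply/seteqP; split=> [w [v [Mv uv] vw]|w uw].
  by rewrite (classQ_eq (equivalent_forget uv)).
by exists u => //; exact: class_self.
Qed.

Lemma translate_class_class (s : 'rV[R]_l) u : Mt u ->
  translate_class gm gp s (class u) = class (translate ct s u).
Proof.
move=> Mu; apply/seteqP; split=> [x [v [Mv uv] vx]|x ux].
  by rewrite (class_eq (translate_equivalent s uv)).
by exists u => //; exact: class_self.
Qed.

Lemma translate0 u : translate ct (0 : 'rV[R]_l) u = u.
Proof.
case: u => w f; rewrite /translate /=; congr pair; apply: functional_extensionality_dep => i.
apply/funext => z; set x := index _ _.
have -> : nth 0 [seq (0 : 'rV[R]_l) 0 j | j <- enum 'I_l] x = 0; last by rewrite subr0.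
have [xl|lx] := ltnP x l; last by rewrite nth_default // size_map size_enum_ord.
by rewrite (nth_map (Ordinal xl)) ?size_enum_ord // mxE.
Qed.

Lemma nth_translation (s : 'rV[R]_l) (x : nat) (xl : (x < l)%N) :
  nth 0 [seq s 0 j | j <- enum 'I_l] x = s 0 (Ordinal xl).
Proof.
rewrite (nth_map (Ordinal xl)) ?size_enum_ord //; congr (s 0 _).
by apply: val_inj; rewrite /= nth_enum_ord.
Qed.

Lemma translateD (s t : 'rV[R]_l) u :
  translate ct (s + t) u = translate ct s (translate ct t u).
Proof.
rewrite [RHS]/translate noncyl_translate /translate /=; congr pair.
apply: functional_extensionality_dep => i; apply/funext => z; set x := index _ _.
rewrite -addrA -opprD; congr (_ - _).
have D (r : 'rV[R]_l) : (l <= x)%N -> nth 0 [seq r 0 j | j <- enum 'I_l] x = 0.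
  by move=> lx; rewrite nth_default // size_map size_enum_ord.
have [xl|lx] := ltnP x l; last by rewrite !D // addr0.
by rewrite !(nth_translation _ xl) mxE addrC.
Qed.

(** On the j-th non-cylindrical component the equivalence reads w o phi = w and f o phi = f + (s0 -
    s_j). Such a component is not a trivial cylinder, so s_j = s0 for every j; the zero sum then
    gives l s0 = 0. *)
Lemma translate_free (s : 'rV[R]_l) u : (0 < l)%N -> Mt u -> sum_zero s ->
  equivalent u (translate ct s u) -> s = 0.
Proof.
move=> l0 [sm hJ _ asy sz] hs [s0 [phi [au E]]].
have H (j : 'I_l) : s 0 j = s0.
  have [i0 _] : exists i : 'I_k, i \in noncyl ct u.
    by move: sz l0; case: (noncyl ct u) => [|i t] /= <- // _; exists i; rewrite inE eqxx.
  set i := nth i0 (noncyl ct u) j.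
  have jz : (j < size (noncyl ct u))%N by rewrite sz.
  have iu : i \in noncyl ct u by exact: mem_nth.
  have un : uniq (noncyl ct u) by apply: filter_uniq; exact: enum_uniq.
  have ix : index i (noncyl ct u) = j by rewrite /i index_uniq.
  have nc : ~ trivial_cylinder ct (u.1 i) (u.2 i).
    by move: iu; rewrite mem_filter => /andP[/negP h _]; apply: contra_not h => h; exact/asboolP.
  have [sw sf] := sm i.
  have [//|ne] := eqVneq (s 0 j) s0; exfalso; apply: nc.
  have cn : s0 - s 0 j != 0 by rewrite subr_eq0 eq_sym.
  apply: (translated_trivial_cylinder sw sf (hJ i) (asy i) (au i) _ _ cn) => z dz.
    by have [/esym] := E i z dz.
  have [_] := E i z dz; rewrite /translate /= ix (nth_translation s (ltn_ord j)).
  rewrite (_ : Ordinal _ = j); last exact: val_inj.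
  by move: (u.2 i (phi i z)) (u.2 i z) (s 0 j) => p q r; lra.
have : \sum_(j < l) s 0 j = 0 by exact: hs.
rewrite (eq_bigr (fun=> s0)) // sumr_const card_ord => /eqP; rewrite mulrn_eq0.
rewrite eqn0Ngt l0 /= => /eqP s00; apply/rowP => j.
by rewrite H s00 mxE.
Qed.

(** Let c_i be the constant by which the heights differ on component i. On the non-cylindrical
    components these are split as their mean [s0] plus a vector of sum zero, the required [s]; on
    the cylindrical ones the discrepancy between c_i and [s0] is moved into the automorphism. *)
Lemma translate_transitive u v : (0 < l)%N -> Mt u -> Mt v -> equivalentQ u.1 v.1 ->
  exists2 s : 'rV[R]_l, sum_zero s & equivalent (translate ct s u) v.
Proof.
move=> l0 Mu Mv [phi [au E]]; have [sm hJ _ _ sz] := Mu; have [smv hJv _ _ szv] := Mv.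
have fC : fdim (R * R)%type := fdim_prod fdim_R fdim_R.
(* Both [v.2 i] and [u.2 i \o phi i] have differential w^* lambda o j for the same map v.1 i, so
   they differ by a constant on the connected punctured surface. *)
have /= cst i : exists c : R, forall z, dotted z -> v.2 i z = u.2 i (phi i z) - c.
  have [sw sf] := sm i; have [swv sfv] := smv i.
  have sfz := (smooth_fun_onP _ fC (@fdim_R R) (@dotted_open R (S i))).1 sf.
  have sfvz := (smooth_fun_onP _ fC (@fdim_R R) (@dotted_open R (S i))).1 sfv.
  have swz := (smooth_map_onP _ fC (fdim_rV _) (@dotted_open R (S i))).1 sw.
  have [_ [_ _ h _]] := au i; have [_ _ _ rphi] := h.
  have dphi z := automorphism_dotted (z := z) (au i).
  have SD z (dz : dotted z) := sm_fun_map fC (@fdim_R R) (self_map_smooth h dz) (sfz _ (dphi z dz)).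
  apply: (primitive_difference sfvz (f2 := u.2 i \o phi i)) => [z dz|z x dz].
    by have [] := SD z dz.
  have [_ ->] := SD z dz.
  rewrite -(lam_der_rot sfvz (hJv i) x dz).
  rewrite -(lam_der_rot sfz (hJ i) (der_map (phi i) z x) (dphi z dz)) -(rphi z x dz).
  have [_ <-] := sm_map_comp fC (fdim_rV _) (self_map_smooth h dz) (swz _ (dphi z dz)).
  have ci : {for chart z z, continuous (inv z)}.
    by apply: Defs.inv_continuous; exact/img_chart/dom_self.
  have nd : \forall y \near inv z (chart z z), dotted y.
    by apply: near_dotted; rewrite chartK //; exact: dom_self.
  have near_eq : \forall y \near chart z z, (v.1 i \o inv z) y = ((u.1 i \o phi i) \o inv z) y.
    have : \forall y \near chart z z, dotted (inv z y) by exact: (ci _ nd).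
    by apply: filterS => y dy; rewrite /= E.
  by rewrite /der_map (der_into_eq _ near_eq) E.
have [c Hc] := choice cst.
have [i0 _] : exists i : 'I_k, i \in noncyl ct u.
  by move: sz l0; case: (noncyl ct u) => [|i t] /= <- // _; exists i; rewrite inE eqxx.
pose r (j : 'I_l) := c (nth i0 (noncyl ct u) j).
pose s0 := (\sum_j r j) / l%:R.
have ln : l%:R != 0 :> R by rewrite pnatr_eq0 -lt0n.
pose s : 'rV[R]_l := \row_j (r j - s0).
exists s.
  rewrite /sum_zero /= (eq_bigr (fun j => r j - s0)) => [|j _]; last by rewrite mxE.
  by rewrite sumrB sumr_const card_ord -[s0 *+ l]mulr_natr /s0 divfK // subrr.
have th i : exists th : S i -> S i, automorphism th /\ forall z, dotted z ->
    v.1 i z = u.1 i (th z) /\ v.2 i z = (translate ct s u).2 i (th z) - s0.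
  have dphi z := automorphism_dotted (z := z) (au i).
  have [iu|ni] := boolP (i \in noncyl ct u).
    exists (phi i); split; first exact: au.
    move=> z dz; rewrite (E i z dz) (Hc i z dz); split=> //.
    have xl : (index i (noncyl ct u) < l)%N by rewrite -sz index_mem.
    rewrite /translate /= nth_translation mxE /r /= nth_index //.
    by move: (u.2 i _) (c i) => p q; lra.
  have tc : trivial_cylinder ct (u.1 i) (u.2 i).
    by move: ni; rewrite mem_filter mem_enum andbT negbK => /asboolP.
  (* The extra automorphism raises the height by s0 - c_i, so that the common shift by - s0 leaves
     exactly - c_i. *)
  have [t [at_ Et]] := trivial_cylinder_translation (s0 - c i) tc.
  exists (t \o phi i); split; first exact: (automorphism_comp (au i) at_).
  move=> z dz; have [e1 e2] := Et _ (dphi z dz); rewrite (E i z dz) (Hc i z dz).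
  split; first by rewrite -e1.
  (* A cylindrical component is absent from the list, its index is the length [l], and [nth] returns
     the default 0: the action does not move it. *)
  rewrite /translate /= e2 nth_default; last first.
    by rewrite size_map size_enum_ord -sz leqNgt index_mem.
  by move: (u.2 i _) (c i) => p q; lra.
have H i := cid (th i).
by exists s0, (fun i => sval (H i)); split=> i; have [] := svalP (H i).
Qed.

End ModuliSpaces.

Unset Implicit Arguments.
Set Strict Implicit.
Set Printing Implicit Defensive.

(** [forget] and [translate_class] are unions over the members of a class, defined for arbitrary
    sets of curves. The first two clauses identify them with the maps induced on classes by (w, f)
    |-> w and by [translate], so that the last clause speaks of the intended map and action. *)
Theorem proposition1p27 (R : realType) (n : nat)
    (Q : manifold 'rV[R]_(n.*2.+1)) (ct : contact_triad Q)
    (k : nat) (S : 'I_k -> punctured_surface R)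
    (gm : forall i, 'I_(nneg (S i)) -> closed_reeb_orbit ct)
    (gp : forall i, 'I_(npos (S i)) -> closed_reeb_orbit ct)
    (l : nat) (hl : (1 <= l <= k)%N) :
  [/\ (forall u : curves Q S, Mtilde gm gp l u ->
         forget gm gp l (class_of gm gp l u) = class_ofQ gm gp l u.1),
      (forall (s : 'rV[R]_l) (u : curves Q S), sum_zero s -> Mtilde gm gp l u ->
         translate_class gm gp s (class_of gm gp l u) =
         class_of gm gp l (translate ct s u)) &
      principal_fibration (@sum_zero R l) (translate_class gm gp (l:=l))
        (Moduli gm gp l) (Moduli_exact gm gp l) (forget gm gp l)].
Proof.
have l0 : (0 < l)%N by case/andP: hl.
split; [by move=> u; exact: forget_class|by move=> s u _; exact: translate_class_class|split].
- apply/seteqP; split=> [_ [_ [u Mu <-] <-]|_ [w Mw <-]].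
    by rewrite forget_class //; exists u.1 => //; exact: Mtilde_forget.
  have [u Mu uw] := Mtilde_lift Mw; exists (class_of gm gp l u); first by exists u.
  by rewrite forget_class // uw.
- move=> s _ _ [u Mu <-]; rewrite translate_class_class //.
  have Ms := Mtilde_translate s Mu; split; first by exists (translate ct s u).
  by rewrite !forget_class.
- split=> [_ [u Mu <-]|s t _ _ _ [u Mu <-]].
    by rewrite translate_class_class // translate0.
  have Ms := Mtilde_translate t Mu.
  by rewrite !translate_class_class // translateD.
- move=> s _ hs [u Mu <-]; rewrite translate_class_class // => E.
  apply: (translate_free l0 Mu hs).
  have : class_of gm gp l (translate ct s u) (translate ct s u).
    exact/class_self/Mtilde_translate.
  by rewrite E => -[].
- move=> _ _ [u Mu <-] [v Mv <-]; rewrite !forget_class // => E.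
  have uv : equivalentQ u.1 v.1.
    by have : class_ofQ gm gp l u.1 v.1; [rewrite E; exact/classQ_self/Mtilde_forget|case].
  have [s hs sv] := translate_transitive l0 Mu Mv uv; exists s => //.
  by rewrite translate_class_class //; apply/esym/class_eq.
Qed.
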